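(* Let $(\Sigma,j)$ be a Riemann surface, $E\to\Sigma$ a complex vector bundle of class $C^1$, and $\mathbf{D}$ a linear Cauchy–Riemann type operator on $E$ of class $L^p$ for some $p\in(2,\infty]$. Suppose $\eta:\Sigma\to E$ is a continuous section that is a weak solution to the equation $\mathbf{D}\eta=0$, with $\eta(z_0)=0$ for some point $z_0\in\Sigma$. Then there exists a continuous local complex trivialization of $E$ near $z_0$ that identifies $\eta$ with a holomorphic function. Moreover, if $\mathbf{D}$ is smooth and complex linear, then the local trivialization near $z_0$ can be arranged to be smooth.
   Context: $\mathbb{D}\subset\mathbb{C}$ is the closed unit disk with coordinate $z=s+it$. A vector bundle is of class $C^k$ if it has an atlas of local trivializations with $C^k$ transition maps. Let $F:=\overline{\operatorname{Hom}}_{\mathbb{C}}(T\Sigma,E)$ be the bundle of complex-antilinear maps $T\Sigma\to E$. Given a holomorphic coordinate $z=s+it$ identifying an open set $\mathcal{U}\subset\Sigma$ with $\mathbb{D}$ and a complex trivialization of $E|_{\mathcal{U}}$ (in the atlas), there is an induced trivialization of $F|_{\mathcal{U}}$ in which a function $f:\mathbb{D}\to\mathbb{C}^n$ representing $\eta\in\Gamma(E|_{\mathcal{U}})$ also represents the section $X\mapsto d\bar z(X)\,\eta$ of $F$. A linear Cauchy–Riemann type operator of class $L^p$ is a first-order real-linear partial differential operator $\mathbf{D}$ from $E$ to $F$ which, in all such local coordinates and trivializations, takes the form $\partial_s+i\partial_t+A$ for some $A\in L^p(\mathbb{D},\operatorname{End}_{\mathbb{R}}(\mathbb{C}^n))$;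 equivalently it satisfies $\mathbf{D}(f\eta)=(\bar\partial f)\eta+f\mathbf{D}\eta$ for real-valued functions $f$, with $\bar\partial f:=df+i\,df\circ j$, and has zeroth-order part of class $L^p$. It is smooth if $E$ and all the functions $A$ are smooth. It need not be complex linear in general. *)

(* Defs.v *)
From HB Require Import structures.
From mathcomp Require Import all_boot all_order all_algebra.
From mathcomp Require Import complex.
From mathcomp Require Import all_classical all_reals all_analysis.

Set Implicit Arguments.
Unset Strict Implicit.
Unset Printing Implicit Defensive.

Import Order.TTheory GRing.Theory Num.Theory.
Import numFieldNormedType.Exports.

Local Open Scope classical_set_scope.
Local Open Scope ring_scope.
Local Open Scope complex_scope.

(* R[i] as a normed space over itself, exactly as [numFieldNormedType] does it
   for an abstract [numClosedFieldType].  In particular [derivable f z 1], for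
   f : R[i] -> V, is complex differentiability of f at z. *)
Section complex_normed.
Variable R : realType.
HB.instance Definition _ := GRing.ComAlgebra.copy R[i] R[i]^o.
HB.instance Definition _ := Vector.copy R[i] R[i]^o.
HB.instance Definition _ := NormedModule.copy R[i] R[i]^o.
HB.instance Definition _ := Num.ClosedField.on R[i].
End complex_normed.

Section plane.
Variable R : realType.
Local Notation C := R[i].

Definition disk : set C := [set z | `|z| <= 1].
Definition open_disk : set C := [set z | `|z| < 1].

Definition holomorphic_on (O : set C) (f : C -> C) : Prop :=
  forall z, O z -> derivable f z 1.

(* The restrictions of u to the horizontal and vertical lines through z = s + it,
   parametrized by s and by t. *)
Definition hline (u : C -> R) (z : C) : R -> R := fun s => u (s +i* complex.Im z).
Definition vline (u : C -> R) (z : C) : R -> R := fun t => u (complex.Re z +i* t).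

Definition pds (u : C -> R) (z : C) : R := 'D_1 (hline u z) (complex.Re z).
Definition pdt (u : C -> R) (z : C) : R := 'D_1 (vline u z) (complex.Im z).

(* All partial derivatives of order at most m exist and are continuous on the
   open set O. *)
Fixpoint Cn_on (m : nat) (O : set C) (u : C -> R) : Prop :=
  (forall z, O z -> {for z, continuous u}) /\
  (if m is m'.+1 then
     [/\ forall z, O z -> derivable (hline u z) (complex.Re z) 1,
         forall z, O z -> derivable (vline u z) (complex.Im z) 1,
         Cn_on m' O (pds u) & Cn_on m' O (pdt u)]
   else True).

(* Regularity classes: [Some m] is C^m and [None] is C^infinity. *)
Definition Ck_on (k : option nat) (O : set C) (u : C -> R) : Prop :=
  if k is Some m then Cn_on m O u else forall m, Cn_on m O u.

Definition CkC_on (k : option nat) (O : set C) (g : C -> C) : Prop :=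
  Ck_on k O (fun z => complex.Re (g z)) /\ Ck_on k O (fun z => complex.Im (g z)).

Definition Ckmx_on (k : option nat) (m n : nat) (O : set C)
    (g : C -> 'M[C]_(m, n)) : Prop :=
  forall i j, CkC_on k O (fun z => g z i j).

(* dbar = d_s + i d_t, without the factor 1/2. *)
Definition dbar (g : C -> C) (z : C) : C :=
  (pds (fun w => complex.Re (g w)) z +i* pds (fun w => complex.Im (g w)) z) +
  'i * (pdt (fun w => complex.Re (g w)) z +i* pdt (fun w => complex.Im (g w)) z).

Definition dbarv (n : nat) (f : C -> 'cV[C]_n) (z : C) : 'cV[C]_n :=
  \col_k dbar (fun w => f w k 0) z.

Definition toC (q : R * R) : C := q.1 +i* q.2.

Definition lebesgue2 :
    {measure set (measurableTypeR R * measurableTypeR R) -> \bar R} :=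
  (@lebesgue_measure R \x @lebesgue_measure R)%E.

Definition Cintegral (D : set C) (g : C -> C) : C :=
  (\int[lebesgue2]_(q in toC @^-1` D) complex.Re (g (toC q)))%R +i*
  (\int[lebesgue2]_(q in toC @^-1` D) complex.Im (g (toC q)))%R.

Definition Lp_disk (p : \bar R) (u : C -> R) : Prop :=
  ((fun q => u (toC q)) \_ (toC @^-1` disk)) \in Lfun lebesgue2 p.

(* Compactness of the support is automatic: it is closed and bounded. *)
Definition test_function (phi : C -> C) : Prop :=
  CkC_on None setT phi /\ closure [set z | phi z != 0] `<=` open_disk.

Section endomorphisms.
Variable n : nat.

Definition real_endo (A : C -> 'cV[C]_n -> 'cV[C]_n) : Prop :=
  forall z (a : R) v w, A z (a%:C *: v + w) = a%:C *: A z v + A z w.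

(* A function with values in the real endomorphisms of C^n is of some
   regularity when all the real coordinates of z |-> A z v are, for every fixed
   vector v; it is enough to let v range over a real basis of C^n, which gives
   the entries of the real (2n x 2n)-matrix of A. *)
Definition Lp_endo (p : \bar R) (A : C -> 'cV[C]_n -> 'cV[C]_n) : Prop :=
  forall v k, Lp_disk p (fun z => complex.Re (A z v k 0)) /\
              Lp_disk p (fun z => complex.Im (A z v k 0)).

(* Smoothness on the closed disk means smoothness on a neighborhood of it. *)
Definition smooth_endo (A : C -> 'cV[C]_n -> 'cV[C]_n) : Prop :=
  exists O : set C, [/\ open O, disk `<=` O &
    forall v, Ckmx_on None O (fun z => A z v)].

End endomorphisms.
End plane.

Section surface.
Variable R : realType.
Local Notation C := R[i].

(* A homeomorphism between an open subset of T and an open subset of C. *)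
Record chart (T : topologicalType) := Chart {
  cdom : set T;
  ccod : set C;
  cfwd : T -> C;
  cbwd : C -> T;
  open_cdom : open cdom;
  open_ccod : open ccod;
  cfwd_cod : forall x, cdom x -> ccod (cfwd x);
  cbwd_dom : forall z, ccod z -> cdom (cbwd z);
  cfwdK : forall x, cdom x -> cbwd (cfwd x) = x;
  cbwdK : forall z, ccod z -> cfwd (cbwd z) = z;
  cfwd_continuous : forall x, cdom x -> {for x, continuous cfwd};
  cbwd_continuous : forall z, ccod z -> {for z, continuous cbwd} }.

Definition chart_compat (T : topologicalType) (c d : chart T) : Prop :=
  holomorphic_on (ccod c `&` cbwd c @^-1` cdom d) (cfwd d \o cbwd c).

(* The complex structure j is multiplication by i in the charts. *)
Record riemann_surface := RiemannSurface {
  surf_space :> topologicalType;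
  surf_hausdorff : hausdorff_space surf_space;
  surf_second_countable : @second_countable surf_space;
  surf_atlas : set (chart surf_space);
  surf_cover : forall x, exists2 c, surf_atlas c & cdom c x;
  surf_compat : forall c d, surf_atlas c -> surf_atlas d -> chart_compat c d }.

Definition hol_coord (X : riemann_surface) (c : chart X) : Prop :=
  forall d, surf_atlas d -> chart_compat c d /\ chart_compat d c.

Definition hol_coord_at (X : riemann_surface) (x : X) (c : chart X) : Prop :=
  hol_coord c /\ cdom c x.

(* A tangent vector at x is the family of its coordinates dz(v), indexed by the
   holomorphic coordinates z around x and transforming by the chain rule; it is
   extended by 0 to the other charts. *)
Definition is_tangent (X : riemann_surface) (x : X) : pred (chart X -> C) :=
  fun v => `[< (forall c, ~ hol_coord_at x c -> v c = 0) /\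
    (forall c d, hol_coord_at x c -> hol_coord_at x d ->
       v d = 'D_1 (cfwd d \o cbwd c) (cfwd c x) * v c) >].

Lemma is_tangent_submod (X : riemann_surface) (x : X) :
  submod_closed (is_tangent x).
Proof.
split=> [|a u v].
  by apply/asboolP; split=> // c d _ _; rewrite mulr0.
move=> /asboolP[u0 uE] /asboolP[v0 vE]; apply/asboolP; split=> [c nc|c d hc hd].
  by rewrite !fctE u0 // v0 // scaler0 addr0.
by rewrite !fctE (uE c d) // (vE c d) // mulrDr scalerAr.
Qed.

HB.instance Definition _ (X : riemann_surface) (x : X) :=
  GRing.isSubmodClosed.Build C (chart X -> C) (is_tangent x)
    (is_tangent_submod x).

Record tangent (X : riemann_surface) (x : X) := Tangent {
  tangent_coord :> chart X -> C;
  tangentP : tangent_coord \in is_tangent x }.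

HB.instance Definition _ (X : riemann_surface) (x : X) :=
  [isSub of tangent x for @tangent_coord X x].
HB.instance Definition _ (X : riemann_surface) (x : X) :=
  [Choice of tangent x by <:].
HB.instance Definition _ (X : riemann_surface) (x : X) :=
  [SubChoice_isSubLmodule of tangent x by <:].

Definition Ck_surface (k : option nat) (X : riemann_surface) (m n : nat)
    (V : set X) (g : X -> 'M[C]_(m, n)) : Prop :=
  forall c, surf_atlas c ->
    Ckmx_on k (ccod c `&` cbwd c @^-1` V) (g \o cbwd c).

(* Almost everywhere with respect to the Lebesgue measure class. *)
Definition ae_surface (X : riemann_surface) (P : X -> Prop) : Prop :=
  forall c : chart X, hol_coord c ->
    {ae @lebesgue2 R, forall q, ccod c (toC q) -> P (cbwd c (toC q))}.

End surface.

Section bundle.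
Variables (R : realType) (X : riemann_surface R) (n : nat).
Local Notation C := R[i].

(* A local trivialization of a family of complex vector spaces, over an open
   set; outside of this set the linear maps are irrelevant. *)
Record local_triv (E : X -> lmodType C) := LocalTriv {
  tdom : set X;
  tmap : forall x, {linear E x -> 'cV[C]_n};
  open_tdom : open tdom;
  tmap_bij : forall x, tdom x -> bijective (tmap x) }.

Definition transition_class (k : option nat) (E : X -> lmodType C)
    (tau sigma : local_triv E) : Prop :=
  exists g : X -> 'M[C]_n,
    (forall x v, tdom tau x -> tdom sigma x ->
       tmap sigma x v = g x *m tmap tau x v) /\
    Ck_surface k (tdom tau `&` tdom sigma) g.

(* The topology of the total space is the one determined by the local
   trivializations. *)
Record vbundle := VBundle {
  fiber :> X -> lmodType C;
  triv_atlas : set (local_triv fiber);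
  triv_cover : forall x, exists2 tau, triv_atlas tau & tdom tau x;
  triv_compat : forall tau sigma, triv_atlas tau -> triv_atlas sigma ->
    transition_class (Some 0%N) tau sigma }.

Definition bundle_class (k : option nat) (E : vbundle) : Prop :=
  forall tau sigma : local_triv E, triv_atlas tau -> triv_atlas sigma ->
    transition_class k tau sigma.

Definition triv_class (k : option nat) (E : vbundle) (Phi : local_triv E) :
    Prop :=
  forall tau : local_triv E, triv_atlas tau ->
    transition_class k tau Phi /\ transition_class k Phi tau.

Definition section (E : vbundle) := forall x, E x.

Definition section_class (k : option nat) (E : vbundle) (eta : section E) :
    Prop :=
  forall tau : local_triv E, triv_atlas tau ->
    Ck_surface k (tdom tau) (fun x => tmap tau x (eta x)).

Definition local_rep (E : vbundle) (c : chart R X) (tau : local_triv E)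
    (eta : section E) (z : C) : 'cV[C]_n :=
  tmap tau (cbwd c z) (eta (cbwd c z)).

Definition Hombar (E : vbundle) (x : X) :=
  {linear tangent x -> E x | Num.conj \; *:%R}.

(* A holomorphic coordinate identifying some subset of X with the closed disk,
   and a trivialization from the atlas over that subset. *)
Definition disk_coord (E : vbundle) (c : chart R X) (tau : local_triv E) :
    Prop :=
  [/\ hol_coord c, triv_atlas tau, @disk R `<=` ccod c &
      forall z, disk z -> tdom tau (cbwd c z)].

(* Operators are applied to C^1 sections only, and their values matter only
   almost everywhere. *)
Definition operator (E : vbundle) := section E -> forall x, Hombar E x.

Definition additive_scaling (E : vbundle) (D : operator E) (a : C) : Prop :=
  forall eta zeta : section E,
    section_class (Some 1%N) eta -> section_class (Some 1%N) zeta ->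
    ae_surface (fun x => forall v : tangent x,
      D (fun y => a *: eta y + zeta y) x v = a *: D eta x v + D zeta x v).

Definition real_linear_op (E : vbundle) (D : operator E) : Prop :=
  forall a : R, additive_scaling D a%:C.

Definition complex_linear_op (E : vbundle) (D : operator E) : Prop :=
  forall a : C, additive_scaling D a.

(* In the coordinate c and the trivialization tau, D is d_s + i d_t + A on the
   disk.  Since dz(v) is [v c], a function g represents the element
   v |-> conj(dz(v)) g of the fiber of Hombar. *)
Definition local_form (E : vbundle) (D : operator E) (c : chart R X)
    (tau : local_triv E) (A : C -> 'cV[C]_n -> 'cV[C]_n) : Prop :=
  forall eta : section E, section_class (Some 1%N) eta ->
  {ae @lebesgue2 R, forall q, disk (toC q) ->
    let z := toC q in let f := local_rep c tau eta in
    forall v : tangent (cbwd c z),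
      tmap tau (cbwd c z) (D eta (cbwd c z) v) =
      Num.conj (v c) *: (dbarv f z + A z (f z))}.

Definition CR_operator (p : \bar R) (E : vbundle) (D : operator E) : Prop :=
  real_linear_op D /\
  forall (c : chart R X) (tau : local_triv E), disk_coord c tau ->
    exists A, [/\ real_endo A, Lp_endo p A & local_form D c tau A].

Definition smooth_CR_operator (E : vbundle) (D : operator E) : Prop :=
  bundle_class None E /\
  forall (c : chart R X) (tau : local_triv E), disk_coord c tau ->
    exists A, [/\ real_endo A, smooth_endo A & local_form D c tau A].

(* D eta = 0 in the sense of distributions.  The coefficient A is determined
   almost everywhere on the disk by D. *)
Definition weak_solution (p : \bar R) (E : vbundle) (D : operator E)
    (eta : section E) : Prop :=
  forall (c : chart R X) (tau : local_triv E) A, disk_coord c tau ->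
  real_endo A -> Lp_endo p A -> local_form D c tau A ->
  forall phi : C -> C, test_function phi -> forall k : 'I_n,
    let f := local_rep c tau eta in
    Cintegral (@disk R) (fun z =>
      - dbar phi z * f z k 0 + phi z * A z (f z) k 0) = 0.

Definition holomorphic_in (E : vbundle) (Phi : local_triv E)
    (eta : section E) : Prop :=
  forall c : chart R X, surf_atlas c -> forall k : 'I_n,
    holomorphic_on (ccod c `&` cbwd c @^-1` tdom Phi)
      (fun z => local_rep c Phi eta z k 0).

End bundle.

(* Main.v *)
Require Import Defs.
From HB Require Import structures.
From mathcomp Require Import all_boot all_order all_algebra.
From mathcomp Require Import complex.
From mathcomp Require Import all_classical all_reals all_analysis.
From mathcomp Require Import ring lra measurable_realfun ess_sup_inf.

(* The kernel 1 / (z - w) inverts d_s + i d_t: with the Cauchy transform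
     T u (z) = kappa^-1 int u(w) / (z - w) dw
   a cut-off weak solution of (d_s + i d_t) f + A f = 0 satisfies f = T m near z0, where
   m = -A f there; this is Weyl's lemma, tested against chi(w) / (w - z) regularized at w = z.
   Next A f = P f for a complex-linear P dominated by |A|: in general P v = <v, f> / |f|^2 A f,
   and P = A when D is complex linear.  On a small disk T is a contraction, so Picard iteration
   solves Psi = 1 + T (Psi P), with Psi close to 1 and hence invertible.  The product formula
   (T u) (T m) = T (u T m + m T u) gives Psi f = T (m + Psi P f + (Psi - 1) m), whose density
   vanishes near z0; so Psi f is holomorphic there, and Psi changes the trivialization.  If P is
   smooth, so is Psi, because the derivatives of Psi solve equations of the same form.
   An L^p bound with p > 2 enters only through the integrals int |A(w)| |z - w|^-(1 + th) dw,
   0 < th, being bounded in z. *)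

Set Implicit Arguments.
Unset Strict Implicit.
Unset Printing Implicit Defensive.

Import Order.TTheory GRing.Theory Num.Theory.
Import numFieldNormedType.Exports.

Local Open Scope classical_set_scope.
Local Open Scope ring_scope.
Local Open Scope complex_scope.

(** * The complex plane and complex derivatives *)

(** The zeroth-order part of D is only real linear, while the equation solved by Psi involves
    complex matrices multiplied from the left, for which a real-linear coefficient has no meaning.
    This forces a complex-linear P, and in general it has to be built from f itself; near the zeros
    of f it is merely measurable, so only continuity of Psi can be expected. If D is complex linear,
    P does not involve f and no regularity is lost. A Cauchy transform of a density that is only
    majorized need not be differentiable, so there is no Leibniz rule for Psi f. The product
    formula, which is Fubini combined with partial fractions, takes its place, and the whole
    argument stays at the level of densities. In the definitions a holomorphic function is one that
    is complex differentiable at each point. That coordinate changes are smooth must therefore be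
    derived: Goursat's bisection supplies the weak equation with zero coefficient, and the same Weyl
    lemma that treats eta then represents such a function as a Cauchy transform whose density
    vanishes near the point. *)

Section modulus.
Variable R : realType.
Local Notation C := R[i].
Implicit Types z w : C.

Definition cabs z : R := complex.Re `|z|.

Lemma normc_cabs z : `|z| = (cabs z)%:C.
Proof. by rewrite /cabs normc_def. Qed.

Lemma cabsE z : cabs z = Num.sqrt (complex.Re z ^+ 2 + complex.Im z ^+ 2).
Proof. by rewrite /cabs normc_def. Qed.

Lemma cabs_ge0 z : 0 <= cabs z. Proof. by rewrite cabsE sqrtr_ge0. Qed.

Lemma sqr_cabs z : cabs z ^+ 2 = complex.Re z ^+ 2 + complex.Im z ^+ 2.
Proof. by rewrite cabsE sqr_sqrtr// addr_ge0// sqr_ge0. Qed.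

Lemma cabs0 : cabs 0 = 0. Proof. by rewrite /cabs normr0. Qed.
Lemma cabs1 : cabs 1 = 1. Proof. by rewrite /cabs normr1. Qed.

Lemma cabs_eq0 z : (cabs z == 0) = (z == 0).
Proof. by rewrite -(normr_eq0 z) normc_cabs eq_complex /= eqxx andbT. Qed.

Lemma cabs_gt0 z : (0 < cabs z) = (z != 0).
Proof. by rewrite lt_def cabs_eq0 cabs_ge0 andbT. Qed.

Lemma cabsN z : cabs (- z) = cabs z. Proof. by rewrite /cabs normrN. Qed.

Lemma cabsBC z w : cabs (z - w) = cabs (w - z).
Proof. by rewrite -cabsN opprB. Qed.

Lemma cabsM z w : cabs (z * w) = cabs z * cabs w.
Proof.
by apply: (@complexI R); rewrite rmorphM -!normc_cabs normrM.
Qed.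

Lemma cabsV z : cabs z^-1 = (cabs z)^-1.
Proof.
by apply: (@complexI R); rewrite fmorphV -!normc_cabs normfV.
Qed.

Lemma cabsD z w : cabs (z + w) <= cabs z + cabs w.
Proof. by rewrite -lecR rmorphD -!normc_cabs ler_normD. Qed.

Lemma cabs_real (x : R) : cabs x%:C = `|x|.
Proof. by rewrite cabsE/= expr0n/= addr0 sqrtr_sqr. Qed.

Lemma cabsB z w : cabs (z - w) <= cabs z + cabs w.
Proof. by rewrite -(cabsN w) cabsD. Qed.

Lemma Re_le_cabs z : `|complex.Re z| <= cabs z.
Proof.
by rewrite -[leLHS]sqrtr_sqr cabsE ler_sqrt ?lerDl ?sqr_ge0// addr_ge0 ?sqr_ge0.
Qed.

Lemma Im_le_cabs z : `|complex.Im z| <= cabs z.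
Proof.
by rewrite -[leLHS]sqrtr_sqr cabsE ler_sqrt ?lerDr ?sqr_ge0// addr_ge0 ?sqr_ge0.
Qed.

Lemma cabs_le z : cabs z <= `|complex.Re z| + `|complex.Im z|.
Proof.
rewrite -(@ler_pXn2r _ 2) ?nnegrE ?cabs_ge0 ?addr_ge0// sqr_cabs.
by rewrite sqrrD !real_normK ?num_real// lerD2r lerDl mulrn_wge0// mulr_ge0.
Qed.

Lemma cabs_sum (I : Type) (s : seq I) (P : pred I) (F : I -> C) :
  cabs (\sum_(i <- s | P i) F i) <= \sum_(i <- s | P i) cabs (F i).
Proof.
elim/big_ind2 : _ => //; first by rewrite cabs0.
by move=> x1 x2 y1 y2 h1 h2; apply: le_trans (cabsD _ _) _; rewrite lerD.
Qed.

Lemma cRe0 : complex.Re (0 : C) = 0. Proof. by []. Qed.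
Lemma cIm0 : complex.Im (0 : C) = 0. Proof. by []. Qed.
Lemma cReD z w : complex.Re (z + w) = complex.Re z + complex.Re w.
Proof. by case: z w => [? ?] [? ?]. Qed.
Lemma cImD z w : complex.Im (z + w) = complex.Im z + complex.Im w.
Proof. by case: z w => [? ?] [? ?]. Qed.
Lemma cReN z : complex.Re (- z) = - complex.Re z. Proof. by case: z. Qed.
Lemma cImN z : complex.Im (- z) = - complex.Im z. Proof. by case: z. Qed.
Lemma cReM z w : complex.Re (z * w) =
  complex.Re z * complex.Re w - complex.Im z * complex.Im w.
Proof. by case: z w => [? ?] [? ?]. Qed.
Lemma cImM z w : complex.Im (z * w) =
  complex.Re z * complex.Im w + complex.Im z * complex.Re w.
Proof. by case: z w => [? ?] [? ?]. Qed.
Lemma cReV z : complex.Re z^-1 = complex.Re z / cabs z ^+ 2.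
Proof. by rewrite sqr_cabs; case: z. Qed.
Lemma cImV z : complex.Im z^-1 = - complex.Im z / cabs z ^+ 2.
Proof. by rewrite sqr_cabs; case: z => a b /=; rewrite mulNr. Qed.

Definition reimE := (cRe0, cIm0, cReD, cImD, cReN, cImN, cReM, cImM).

Lemma ReIm z : complex.Re z +i* complex.Im z = z. Proof. by case: z. Qed.

Lemma complex_ext z w : complex.Re z = complex.Re w ->
  complex.Im z = complex.Im w -> z = w.
Proof. by case: z w => [? ?] [? ?] /= -> ->. Qed.

Lemma nbhs_cabsP z (A : set C) :
  nbhs z A <-> exists2 e : R, 0 < e & forall w, cabs (w - z) < e -> A w.
Proof.
split=> [/(@nbhs_normP _ C z A)[e /= e0 h]|[e e0 h]].
  have ee : e = (complex.Re e)%:C by rewrite RRe_real// gtr0_real.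
  exists (complex.Re e); first by rewrite -ltcR -ee.
  by move=> w wz; apply: h; rewrite /= normc_cabs ee ltcR cabsBC.
apply: (iffRL (@nbhs_normP _ C z A)); exists e%:C => /=; first by rewrite ltcR.
by move=> w /=; rewrite normc_cabs ltcR cabsBC => /h.
Qed.

Lemma cts_cabsP (u : C -> R) z : {for z, continuous u} <->
  forall e : R, 0 < e -> exists2 d : R, 0 < d &
    forall w, cabs (w - z) < d -> `|u w - u z| < e.
Proof.
split=> [/cvgrPdist_lt h e /h h'|h]; first have /nbhs_cabsP[d d0 hd] := h'.
  by exists d => // w /hd; rewrite distrC.
apply/(@cvgrPdist_lt _ R^o _ (nbhs z)) => e /h[d d0 hd]; apply/nbhs_cabsP; exists d => // w /hd.
by rewrite distrC.
Qed.

Lemma cvgC_cabsP (T : topologicalType) (f : T -> C) (t : T) :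
  {for t, continuous f} <->
  forall e : R, 0 < e -> \forall s \near t, cabs (f s - f t) < e.
Proof.
split=> [/cvgrPdist_lt h e e0|h].
  have /h : 0 < e%:C by rewrite ltcR.
  by apply: filterS => s; rewrite normc_cabs ltcR cabsBC.
apply/cvgrPdist_lt => e e0.
have ee : e = (complex.Re e)%:C by rewrite RRe_real// gtr0_real.
have /h : 0 < complex.Re e by rewrite -ltcR -ee.
by apply: filterS => s; rewrite normc_cabs ee ltcR cabsBC.
Qed.

Lemma openP_cabs (O : set C) : open O <-> forall z, O z ->
  exists2 e : R, 0 < e & forall w, cabs (w - z) < e -> O w.
Proof.
rewrite openE; split=> h z Oz; first by apply/nbhs_cabsP; exact: h.
by rewrite /interior; apply/nbhs_cabsP; exact: h.
Qed.

Lemma open_cball (a : C) (r : R) : open [set z | cabs (z - a) < r].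
Proof.
apply/openP_cabs => z /= zr; exists (r - cabs (z - a)); first by rewrite subr_gt0.
move=> w wz; have -> : w - a = (w - z) + (z - a) by ring.
by rewrite (le_lt_trans (cabsD _ _))// -ltrBrDr.
Qed.

Lemma disk_cabs z : disk z <-> cabs z <= 1.
Proof. by rewrite /disk /= normc_cabs -(lecR (cabs z) 1). Qed.

Lemma open_disk_cabs z : open_disk z <-> cabs z < 1.
Proof. by rewrite /open_disk /= normc_cabs -(ltcR (cabs z) 1). Qed.

(** Multiplied out instead of a difference quotient, and with a real modulus: h = 0 is no exception,
    and all estimates are inequalities between real numbers. *)
Definition cderiv (f : C -> C) z l := forall e : R, 0 < e ->
  exists2 d : R, 0 < d & forall h, cabs h < d ->
    cabs (f (z + h) - f z - l * h) <= e * cabs h.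

Lemma scalC1 z : z%:A = z. Proof. exact: mulr1. Qed.

Definition cquot f z (h : C) : C := h^-1 * (f (z + h) - f z).

Lemma cquotE f z : (fun h : C => h^-1 *: ((f \o shift z) (h *: (1 : C)) - f z)) = cquot f z.
Proof. apply/funext => h; rewrite /= /cquot (addrC z h) (scalC1 h); exact: erefl. Qed.

Lemma cderiv_cvg f z l : cquot f z h @[h --> 0^'] --> l <-> cderiv f z l.
Proof.
have E h : h != 0 -> cabs (l - cquot f z h) * cabs h = cabs (f (z + h) - f z - l * h).
  move=> h0; rewrite -cabsM -cabsN /cquot; congr cabs.
  by rewrite mulrBl mulrAC mulVf// mul1r opprB.
split=> [/cvgrPdist_le H e e0|hl].
  have /H : 0 < e%:C by rewrite ltcR.
  rewrite near_withinE => /nbhs_cabsP[d d0 hd]; exists d => // h hh.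
  have [->|h0] := eqVneq h 0; first by rewrite addr0 subrr mulr0 subr0 !cabs0 mulr0.
  have := hd h; rewrite subr0 => /(_ hh h0).
  by rewrite normc_cabs lecR -E// => le1; rewrite ler_wpM2r ?cabs_ge0.
apply/cvgrPdist_le => e e0.
have ee : e = (complex.Re e)%:C by rewrite RRe_real// gtr0_real.
have /hl[d d0 hd] : 0 < complex.Re e by rewrite -ltcR -ee.
rewrite near_withinE; apply/nbhs_cabsP; exists d => // h; rewrite subr0 => hh h0.
by rewrite ee normc_cabs lecR -(@ler_pM2r _ (cabs h)) ?cabs_gt0// E// hd.
Qed.

Lemma cderivP f z : derivable f z 1 <-> exists l, cderiv f z l.
Proof.
rewrite /derivable cquotE; split=> [H|[l /cderiv_cvg hl]]; last by apply/cvg_ex; exists l.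
by exists (lim (cquot f z h @[h --> 0^'])); apply/cderiv_cvg.
Qed.

Lemma derive_cderiv f z l : cderiv f z l -> 'D_1 f z = l.
Proof. by move=> /cderiv_cvg hl; rewrite /derive cquotE; exact/cvg_lim. Qed.

Lemma derivable_cderiv f z : derivable f z 1 -> cderiv f z ('D_1 f z).
Proof. by move=> /cderivP[l hl]; rewrite (derive_cderiv hl). Qed.

Lemma cderiv_continuous f z l : cderiv f z l -> {for z, continuous f}.
Proof.
move=> hl; apply/cvgC_cabsP => e e0; have [d d0 hd] := hl 1 ltr01.
apply/nbhs_cabsP; exists (Num.min d (e / (cabs l + 1))).
  by rewrite lt_min d0/= divr_gt0// ltr_wpDl// cabs_ge0.
move=> w; rewrite lt_min => /andP[wd we].
have := hd (w - z) wd; rewrite subrKC mul1r => h1.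
have -> : f w - f z = (f w - f z - l * (w - z)) + l * (w - z) by ring.
rewrite (le_lt_trans (cabsD _ _))// cabsM.
move: we; rewrite ltr_pdivlMr; last by rewrite ltr_wpDl// cabs_ge0.
lra.
Qed.

Lemma cderiv_comp f g z l m : cderiv f z l -> cderiv g (f z) m ->
  cderiv (g \o f) z (m * l).
Proof.
move=> hl hm e e0.
(* Capping the remainder of f at |h| bounds its increment by M |h|. The weights 1/M and 1/N then
   make the remainder of g and the remainder of f, the latter multiplied by m, each contribute at
   most (e/2) |h|. *)
pose M := cabs l + 1; pose N := cabs m + 1.
have M0 : 0 < M by rewrite ltr_wpDl// cabs_ge0.
have N0 : 0 < N by rewrite ltr_wpDl// cabs_ge0.
have [d1 d10 h1] := hm (e / 2 / M) (divr_gt0 (divr_gt0 e0 (ltr0Sn _ 1)) M0).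
have [d2 d20 h2] := hl (Num.min 1 (e / 2 / N))
   ltac:(by rewrite lt_min ltr01 !divr_gt0).
exists (Num.min d2 (d1 / M)); first by rewrite lt_min d20 divr_gt0.
move=> h; rewrite lt_min ltr_pdivlMr// => /andP[/h2 hd2 hM].
have [hd21 hd22] : cabs (f (z + h) - f z - l * h) <= cabs h /\
   cabs (f (z + h) - f z - l * h) <= e / 2 / N * cabs h.
  split; apply: (le_trans hd2).
    by rewrite -[leRHS]mul1r ler_wpM2r ?cabs_ge0// ge_min lexx.
  by rewrite ler_wpM2r ?cabs_ge0// ge_min lexx orbT.
pose k := f (z + h) - f z.
have kM : cabs k <= M * cabs h.
  have -> : k = (f (z + h) - f z - l * h) + l * h by rewrite /k; ring.
  by rewrite (le_trans (cabsD _ _))// cabsM /M mulrDl mul1r addrC lerD2l.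
have kd : cabs k < d1 by rewrite (le_lt_trans kM)// mulrC.
have := h1 k kd.
rewrite /k subrKC => h3 /=.
have -> : g (f (z + h)) - g (f z) - m * l * h =
  (g (f (z + h)) - g (f z) - m * k) + m * (f (z + h) - f z - l * h).
  by rewrite /k; ring.
rewrite (le_trans (cabsD _ _))// cabsM.
have t1 : cabs (g (f (z + h)) - g (f z) - m * k) <= e / 2 * cabs h.
  apply: (le_trans h3); rewrite -mulrA ler_wpM2l//; first by rewrite ltW// divr_gt0.
  by rewrite mulrC ler_pdivrMr// mulrC.
have t2 : cabs m * cabs (f (z + h) - f z - l * h) <= e / 2 * cabs h.
  apply: (@le_trans _ _ (N * (e / 2 / N * cabs h))).
    by rewrite ler_pM ?cabs_ge0// /N lerDl.
  by rewrite mulrA mulrCA mulfV ?gt_eqF// mulr1.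
lra.
Qed.

Lemma cderiv_near f g z l : (\forall w \near z, f w = g w) ->
  cderiv f z l -> cderiv g z l.
Proof.
move=> /nbhs_cabsP[d d0 hd] hl e e0; have [c c0 hc] := hl _ e0.
exists (Num.min d c); first by rewrite lt_min d0.
move=> h; rewrite lt_min => /andP[hhd hhc].
rewrite -(hd (z + h)) ?[z + h]addrC ?addrK// -(hd z) ?subrr ?cabs0//.
by rewrite addrC; exact: hc.
Qed.

(** Differentiation under the integral sign produces a quadratic remainder of this kind. *)
Lemma cderivM_bound f z l (K d : R) : 0 < d ->
  (forall h, cabs h < d -> cabs (f (z + h) - f z - l * h) <= K * cabs h ^+ 2) ->
  cderiv f z l.
Proof.
move=> d0 H e e0; pose K' := `|K| + 1.
have K0 : 0 < K' by rewrite ltr_wpDl.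
exists (Num.min d (e / K')); first by rewrite lt_min d0 divr_gt0.
move=> h; rewrite lt_min ltr_pdivlMr// => /andP[hd he].
apply: (le_trans (H _ hd)); rewrite expr2 mulrA ler_wpM2r ?cabs_ge0//.
rewrite (le_trans _ (ltW he))// mulrC ler_wpM2l ?cabs_ge0//.
by rewrite (le_trans (ler_norm _))// /K' lerDl.
Qed.

End modulus.

(** * Partial derivatives and smooth cut-offs *)

Section partial_derivatives.
Variable R : realType.
Local Notation C := R[i].
Implicit Types (u v : C -> R) (O : set C) (z : C) (b : bool).

(** The boolean selects the direction, [true] for s and [false] for t, so that one proof serves both
    partial derivatives. *)
Definition pline b u z : R -> R := if b then hline u z else Defs.vline u z.
Definition pcoord b z : R := if b then complex.Re z else complex.Im z.
Definition pd b u z : R := 'D_1 (pline b u z) (pcoord b z).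
Definition pdir b : C := if b then 1 else 'i.
Definition isd b u z (l : R) := is_derive (pcoord b z) (1 : R) (pline b u z) l.

Lemma plineE b u z : pline b u z (pcoord b z) = u z.
Proof. by case: b => /=; rewrite /hline /Defs.vline ReIm. Qed.

Lemma pline_shift b u z (h : R) :
  pline b u z (h + pcoord b z) = u (z + h%:C * pdir b).
Proof.
case: b => /=; rewrite /hline /Defs.vline; congr u; apply: complex_ext;
  rewrite !reimE /=; ring.
Qed.

Lemma cvg_at0P (g : R -> R) (l : R) : g h @[h --> 0^'] --> l <->
  forall e : R, 0 < e -> exists2 d : R, 0 < d &
    forall h, `|h| < d -> h != 0 -> `|l - g h| <= e.
Proof.
split=> [/cvgrPdist_le H e /H|H].
  rewrite near_withinE => /(@nbhs_normP _ R^o)[d /= d0 hd]; exists d => // h hh.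
  by apply: hd => /=; rewrite sub0r normrN.
apply/cvgrPdist_le => e /H[d d0 hd]; rewrite near_withinE.
apply: (iffRL (@nbhs_normP _ R^o 0 _)); exists d => // h hh; apply: hd; by move: hh; rewrite /ball_ /= sub0r normrN.
Qed.

Lemma isdP b u z l : isd b u z l <-> forall e : R, 0 < e ->
  exists2 d : R, 0 < d & forall h : R, `|h| < d ->
    `|u (z + h%:C * pdir b) - u z - l * h| <= e * `|h|.
Proof.
pose g (h : R) := h^-1 * (u (z + h%:C * pdir b) - u z).
have gE : (fun h : R => h^-1 *: ((pline b u z \o shift (pcoord b z)) (h *: (1 : R))
      - pline b u z (pcoord b z))) = g.
  by apply/funext => h; rewrite /g /= plineE [_%:A]mulr1 pline_shift.
have E h : h != 0 -> `|l - g h| * `|h| = `|u (z + h%:C * pdir b) - u z - l * h|.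
  move=> h0; rewrite -normrM -normrN /g; congr `|_|.
  by rewrite mulrBl mulrAC mulVf// mul1r opprB.
have E0 : u (z + (0 : R)%:C * pdir b) - u z - l * 0 = 0.
  by rewrite rmorph0 mul0r addr0 subrr mulr0 subr0.
split=> [[dv <-] e e0|H].
  have : g h @[h --> 0^'] --> 'D_1 (pline b u z) (pcoord b z).
    by move: dv; rewrite /derivable /derive gE => /cvg_ex[m hm]; rewrite (cvg_lim _ hm).
  rewrite -/(pd _ _ _); move=> /cvg_at0P/(_ _ e0)[d d0 hd]; exists d => // h hh.
  have [->|h0] := eqVneq h 0.
    by rewrite rmorph0 mul0r addr0 subrr mulr0 subr0 !normr0 mulr0.
  have := hd h hh h0; rewrite -(@ler_pM2r _ `|h|) ?normr_gt0// => /(le_trans _); apply.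
  rewrite -normrM -normrN /g le_eqVlt; apply/orP; left; apply/eqP; congr `|_|.
  by rewrite mulrBl mulrAC mulVf// mul1r opprB.
have gl : g h @[h --> 0^'] --> l.
  apply/cvg_at0P => e /H[d d0 hd]; exists d => // h hh h0.
  by rewrite -(@ler_pM2r _ `|h|) ?normr_gt0// E// hd.
split; first by rewrite /derivable gE; apply/cvg_ex; exists l.
by rewrite /derive gE; exact/cvg_lim.
Qed.

Lemma isd_pd b u z l : isd b u z l -> pd b u z = l.
Proof. by move=> [_]. Qed.

Lemma isd_near b u v z l : (\forall w \near z, u w = v w) ->
  isd b u z l -> isd b v z l.
Proof.
move=> /nbhs_cabsP[d d0 hd] /isdP hl; apply/isdP => e e0; have [c c0 hc] := hl _ e0.
exists (Num.min d c); first by rewrite lt_min d0.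
move=> h; rewrite lt_min => /andP[hhd hhc].
rewrite -(hd (z + h%:C * pdir b)); last first.
  rewrite [z + _]addrC addrK cabsM cabs_real; case: b {hl hc} => /=;
  rewrite ?cabs1 ?mulr1// cabsE/= expr0n/= expr1n add0r sqrtr1 mulr1//.
by rewrite -(hd z) ?subrr ?cabs0//; exact: hc.
Qed.

Lemma isd_cst b (k : R) z : isd b (fun=> k) z 0.
Proof. by case: b; exact: is_derive_cst. Qed.

Lemma isd_coord b c z : isd b (pcoord c) z (b == c)%:R.
Proof. by case: b c => -[]/=; [exact: is_derive_id|exact: is_derive_cst|
  exact: is_derive_cst|exact: is_derive_id]. Qed.

Lemma isdD b u v z l m : isd b u z l -> isd b v z m ->
  isd b (fun w => u w + v w) z (l + m).
Proof.
move=> hu hv; rewrite /isd.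
suff -> : pline b (fun w => u w + v w) z = pline b u z + pline b v z.
  exact: is_deriveD hu hv.
by case: b {hu hv}.
Qed.

Lemma isdN b u z l : isd b u z l -> isd b (fun w => - u w) z (- l).
Proof.
move=> hu; rewrite /isd.
suff -> : pline b (fun w => - u w) z = - pline b u z by exact: is_deriveN hu.
by case: b {hu}.
Qed.

Lemma isdM b u v z l m : isd b u z l -> isd b v z m ->
  isd b (fun w => u w * v w) z (u z * m + v z * l).
Proof.
move=> hu hv; rewrite /isd.
suff -> : pline b (fun w => u w * v w) z = pline b u z * pline b v z.
  by have := is_deriveM hu hv; rewrite !plineE.
by case: b {hu hv}.
Qed.

Lemma isd_comp b u z l (F : R -> R) m : isd b u z l -> is_derive (u z) (1 : R) F m ->
  isd b (fun w => F (u w)) z (m * l).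
Proof.
move=> hu hF; rewrite -(plineE b u z) in hF; rewrite /isd.
suff -> : pline b (fun w => F (u w)) z = F \o pline b u z by exact: is_derive1_comp hF hu.
by case: b {hu hF}.
Qed.

Lemma isdV b u z l : u z != 0 -> isd b u z l ->
  isd b (fun w => (u w)^-1) z (- (u z)^-1 ^+ 2 * l).
Proof.
move=> u0 hu; apply: (isd_comp (F := GRing.inv)) => //.
have := @is_deriveV _ (@id R) (u z) 1 1 u0 (is_derive_id _ _).
by rewrite exprVn [_ *: _]mulr1.
Qed.

Lemma Cn_onS m O u : Cn_on m.+1 O u <->
  (forall z, O z -> {for z, continuous u}) /\
  forall b, (forall z, O z -> isd b u z (pd b u z)) /\ Cn_on m O (pd b u).
Proof.
split=> /= [[cu [ds dt cs ct]]|[cu H]]; split=> //.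
  by case; split=> // z Oz; split=> //; [exact: ds|exact: dt].
have [Hs cs] := H true; have [Ht ct] := H false.
by split=> // z Oz; [case: (Hs z Oz)|case: (Ht z Oz)].
Qed.

Lemma Cn_on_cts m O u z : Cn_on m O u -> O z -> {for z, continuous u}.
Proof. by case: m => [|m] [cu _] /cu. Qed.

Lemma Cn_on_isd m O u b z : Cn_on m.+1 O u -> O z -> isd b u z (pd b u z).
Proof. by move=> /Cn_onS[_ /(_ b)[h _]]; exact: h. Qed.

Lemma Cn_on_pd m O u b : Cn_on m.+1 O u -> Cn_on m O (pd b u).
Proof. by move=> /Cn_onS[_ /(_ b)[]]. Qed.

Lemma Cn_on_pred m O u : Cn_on m.+1 O u -> Cn_on m O u.
Proof.
elim: m u => [|m IH] u /Cn_onS[cu H]; first by split.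
by apply/Cn_onS; split=> // b; have [hb /IH cb] := H b.
Qed.

Lemma Cn_on_le m k O u : (k <= m)%N -> Cn_on m O u -> Cn_on k O u.
Proof.
move=> /subnK <-; elim: (m - k)%N => [//|i IH]; rewrite addSn => /Cn_on_pred; exact: IH.
Qed.

Lemma Cn_on_sub m O O' u : O' `<=` O -> Cn_on m O u -> Cn_on m O' u.
Proof.
move=> OO'; elim: m u => [|m IH] u.
  by move=> [cu _]; split=> // z /OO'/cu.
move=> /Cn_onS[cu H]; apply/Cn_onS; split=> [z /OO'/cu//|b].
by have [hb /IH cb] := H b; split=> // z /OO'/hb.
Qed.

Lemma near_cts u v z : (\forall w \near z, u w = v w) ->
  {for z, continuous u} -> {for z, continuous v}.
Proof.
move=> uv /cts_cabsP cu; apply/cts_cabsP => e /cu[d d0 hd].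
have /nbhs_cabsP[c c0 hc] := uv; exists (Num.min d c); first by rewrite lt_min d0.
move=> w; rewrite lt_min => /andP[wd wc].
by rewrite -(hc w)// -(hc z) ?subrr ?cabs0//; exact: hd.
Qed.

Lemma open_near O z : open O -> O z -> \forall w \near z, O w.
Proof. by move=> oO Oz; exact: open_nbhs_nbhs. Qed.

Lemma Cn_on_eq m O u v : open O -> (forall z, O z -> u z = v z) ->
  Cn_on m O u -> Cn_on m O v.
Proof.
move=> oO; elim: m u v => [|m IH] u v uv.
  move=> [cu _]; split=> // z Oz; apply: (near_cts _ (cu z Oz)).
  by apply: filterS (open_near oO Oz).
move=> /Cn_onS[cu H]; apply/Cn_onS.
have uvn z : O z -> \forall w \near z, u w = v w.
  by move=> Oz; apply: filterS (open_near oO Oz).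
split=> [z Oz|b]; first exact: (near_cts (uvn _ Oz) (cu z Oz)).
have [hb cb] := H b.
have hv z : O z -> isd b v z (pd b u z).
  by move=> Oz; apply: isd_near (hb z Oz); exact: uvn.
split=> [z Oz|]; first by rewrite (isd_pd (hv z Oz)); exact: hv.
by apply: IH cb => z Oz; rewrite (isd_pd (hv z Oz)).
Qed.

Lemma Cn_on_local m O u :
  (forall z, O z -> exists U, [/\ open U, U z & Cn_on m U u]) -> Cn_on m O u.
Proof.
elim: m u => [|m IH] u H.
  by split=> // z Oz; have [U [oU Uz [cu _]]] := H z Oz; exact: cu.
apply/Cn_onS; split=> [z Oz|b].
  by have [U [oU Uz /Cn_on_cts cu]] := H z Oz; exact: cu.
split=> [z Oz|]; first by have [U [oU Uz /Cn_on_isd cu]] := H z Oz; exact: cu.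
by apply: IH => z Oz; have [U [oU Uz /Cn_on_pd cu]] := H z Oz; exists U; split.
Qed.

Lemma cts_cst (k : R) z : {for z, continuous (fun=> k : R)}.
Proof. by apply/cts_cabsP => e e0; exists 1 => // w _; rewrite subrr normr0. Qed.

Lemma cts_coord b z : {for z, continuous (pcoord b)}.
Proof.
apply/cts_cabsP => e e0; exists e => // w; apply: le_lt_trans.
by case: b; rewrite /= -?cReN -?cReD -?cImN -?cImD; [exact: Re_le_cabs|exact: Im_le_cabs].
Qed.

Lemma Cn_on_cst m O (k : R) : open O -> Cn_on m O (fun=> k).
Proof.
move=> oO; elim: m k => [|m IH] k; first by split=> // z _; exact: cts_cst.
apply/Cn_onS; split=> [z _|b]; first exact: cts_cst.
have E z : pd b (fun=> k) z = 0 by apply: isd_pd; exact: isd_cst.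
by split=> [z _|]; [rewrite E; exact: isd_cst|apply: Cn_on_eq (IH 0)].
Qed.

Lemma Cn_on_coord m O b : open O -> Cn_on m O (pcoord b).
Proof.
move=> oO; case: m => [|m]; first by split=> // z _; exact: cts_coord.
apply/Cn_onS; split=> [z _|c]; first exact: cts_coord.
have E z : pd c (pcoord b) z = (c == b)%:R by apply: isd_pd; exact: isd_coord.
by split=> [z _|]; [rewrite E; exact: isd_coord|apply: Cn_on_eq (Cn_on_cst m (c == b)%:R oO)].
Qed.

Lemma ctsD u v z : {for z, continuous u} -> {for z, continuous v} ->
  {for z, continuous (fun w => u w + v w)}.
Proof.
move=> /cts_cabsP cu /cts_cabsP cv; apply/cts_cabsP => e e0.
have [d d0 hd] := cu _ (divr_gt0 e0 (ltr0Sn _ 1)).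
have [c c0 hc] := cv _ (divr_gt0 e0 (ltr0Sn _ 1)).
exists (Num.min d c); first by rewrite lt_min d0.
move=> w; rewrite lt_min => /andP[/hd h1 /hc h2].
by rewrite opprD addrACA (le_lt_trans (ler_normD _ _))// [ltRHS]splitr ltrD.
Qed.

Lemma ctsM u v z : {for z, continuous u} -> {for z, continuous v} ->
  {for z, continuous (fun w => u w * v w)}.
Proof. by move=> cu cv; apply: (@cvgM R C (nbhs z) _ u v _ _ cu cv). Qed.

Lemma Cn_onD m O u v : open O -> Cn_on m O u -> Cn_on m O v ->
  Cn_on m O (fun z => u z + v z).
Proof.
move=> oO; elim: m u v => [|m IH] u v.
  by move=> [cu _] [cv _]; split=> // z Oz; apply: ctsD; [exact: cu|exact: cv].
move=> /Cn_onS[cu Hu] /Cn_onS[cv Hv]; apply/Cn_onS; split=> [z Oz|b].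
  by apply: ctsD; [exact: cu|exact: cv].
have [du cdu] := Hu b; have [dv cdv] := Hv b.
have E z : O z -> isd b (fun z => u z + v z) z (pd b u z + pd b v z).
  by move=> Oz; apply: isdD; [exact: du|exact: dv].
split=> [z Oz|]; first by rewrite (isd_pd (E z Oz)); exact: E.
by apply: (Cn_on_eq oO _ (IH _ _ cdu cdv)) => z Oz; rewrite (isd_pd (E z Oz)).
Qed.

Lemma Cn_onM m O u v : open O -> Cn_on m O u -> Cn_on m O v ->
  Cn_on m O (fun z => u z * v z).
Proof.
move=> oO; elim: m u v => [|m IH] u v.
  by move=> [cu _] [cv _]; split=> // z Oz; apply: ctsM; [exact: cu|exact: cv].
move=> Hu0 Hv0; have Hu1 := Cn_on_pred Hu0; have Hv1 := Cn_on_pred Hv0.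
move: Hu0 Hv0 => /Cn_onS[cu Hu] /Cn_onS[cv Hv]; apply/Cn_onS; split=> [z Oz|b].
  by apply: ctsM; [exact: cu|exact: cv].
have [du cdu] := Hu b; have [dv cdv] := Hv b.
have E z : O z -> isd b (fun z => u z * v z) z (u z * pd b v z + v z * pd b u z).
  by move=> Oz; apply: isdM; [exact: du|exact: dv].
split=> [z Oz|]; first by rewrite (isd_pd (E z Oz)); exact: E.
have := Cn_onD oO (IH _ _ Hu1 cdv) (IH _ _ Hv1 cdu).
by apply: Cn_on_eq => // z Oz; rewrite (isd_pd (E z Oz)).
Qed.

Lemma Cn_onN m O u : open O -> Cn_on m O u -> Cn_on m O (fun z => - u z).
Proof.
move=> oO hu; have := Cn_onM oO (Cn_on_cst m (-1) oO) hu.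
by apply: Cn_on_eq => // z _; rewrite mulN1r.
Qed.

Lemma Cn_onB m O u v : open O -> Cn_on m O u -> Cn_on m O v ->
  Cn_on m O (fun z => u z - v z).
Proof. by move=> oO hu hv; apply: Cn_onD => //; exact: Cn_onN. Qed.

(* The chain rule for a family of functions of one variable that is stable under
   differentiation, with derivative [F' k = c k * F (s k) + d k * F (t k)]. *)
Lemma Cn_on_family (I : Type) (F : I -> R -> R) (s t : I -> I) (c d : I -> R)
    (D : set R) m O u k : open O ->
  (forall k x, D x -> is_derive x (1 : R) (F k) (c k * F (s k) x + d k * F (t k) x)) ->
  (forall z, O z -> D (u z)) ->
  Cn_on m O u -> Cn_on m O (fun z => F k (u z)).
Proof.
move=> oO dF Du; elim: m k => [|m IH] k.
  move=> [cu _]; split=> // z Oz; apply: (@continuous_comp _ _ _ u (F k)); first exact: cu.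
  apply/differentiable_continuous/derivable1_diffP.
  by case: (dF k _ (Du _ Oz)).
move=> Hu0; have Hu1 := Cn_on_pred Hu0; move: Hu0 => /Cn_onS[cu Hu].
have E b z : O z -> isd b (fun z => F k (u z)) z
    ((c k * F (s k) (u z) + d k * F (t k) (u z)) * pd b u z).
  move=> Oz; have [du _] := Hu b; apply: isd_comp; [exact: du|exact/dF/Du].
apply/Cn_onS; split=> [z Oz|b].
  apply: (@continuous_comp _ _ _ u (F k)); first exact: cu.
  apply/differentiable_continuous/derivable1_diffP.
  by case: (dF k _ (Du _ Oz)).
split=> [z Oz|]; first by rewrite (isd_pd (E b z Oz)); exact: E.
have [_ cdu] := Hu b.
have h1 : Cn_on m O (fun z => c k * F (s k) (u z) + d k * F (t k) (u z)).
  by apply: Cn_onD => //; apply: Cn_onM => //; [exact: Cn_on_cst|exact: IH|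
    exact: Cn_on_cst|exact: IH].
have := Cn_onM oO h1 cdu.
by apply: Cn_on_eq => // z Oz; rewrite (isd_pd (E b z Oz)).
Qed.

Lemma Cn_onV m O u : open O -> (forall z, O z -> u z != 0) -> Cn_on m O u ->
  Cn_on m O (fun z => (u z)^-1).
Proof.
move=> oO u0 hu.
(* The powers x^-(k+1) are closed under differentiation up to the constants -(k+1). *)
have := @Cn_on_family nat (fun k x => x^-1 ^+ k.+1) S S (fun k => - k.+1%:R) (fun=> 0)
  [set x | x != 0] m O u 0%N oO.
apply => //= k x x0.
have h := @is_deriveV _ (@id R) x 1 1 x0 (is_derive_id _ _).
have hX := is_deriveX k.+1 h; rewrite mul0r addr0.
have -> : (fun y : R => y^-1 ^+ k.+1) = (fun y : R => y^-1) ^+ k.+1.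
  by apply/funext => y; rewrite exprfctE.
apply: (is_derive_eq hX); rewrite -[_ *: _]/(_ * _) -[(- x ^- 2) *: _]/(_ * _) mulr1 /=.
by rewrite -exprVn mulrN mulNr -mulrA -exprD addn2.
Qed.

End partial_derivatives.

Section chain_rule.
Variable R : realType.
Local Notation C := R[i].
Implicit Types (u v : C -> R) (O : set C) (z : C) (b : bool).

Lemma cabs_pdir (h : R) b : cabs (h%:C * pdir R b) = `|h|.
Proof.
rewrite cabsM cabs_real; case: b => /=; first by rewrite cabs1 mulr1.
by rewrite cabsE/= expr0n/= expr1n add0r sqrtr1 mulr1.
Qed.

Lemma pline_line b u z (t : R) :
  pline b u (z + t%:C * pdir R b) = pline b u z.
Proof.
by case: b => /=; apply/funext => s; rewrite /hline /Defs.vline; congr u;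
  apply: complex_ext; rewrite ?reimE/=; ring.
Qed.

Lemma pcoord_line b z (t : R) : pcoord b (z + t%:C * pdir R b) = t + pcoord b z.
Proof. by case: b; rewrite /= !reimE/=; ring. Qed.

(** The mean value theorem on a coordinate line, for steps of either sign. It yields total
    differentiability from continuous partials, and later uniform difference quotients. *)
Lemma pd_mean_value b u z (h L e : R) :
  (forall t : R, `|t| <= `|h| -> let w := z + t%:C * pdir R b in
     isd b u w (pd b u w) /\ `|pd b u w - L| <= e) ->
  `|u (z + h%:C * pdir R b) - u z - L * h| <= e * `|h|.
Proof.
move=> H.
pose F := pline b u z; pose x := pcoord b z.
have dF (s : R) : `|s - x| <= `|h| ->
    exists2 l, is_derive s (1 : R) F l & `|l - L| <= e.
  move=> /H /= []; rewrite /isd pline_line pcoord_line -/x subrK => h1 h2.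
  by exists (pd b u (z + (s - x)%:C * pdir R b)).
have Fh : u (z + h%:C * pdir R b) = F (x + h) by rewrite [x + h]addrC /F pline_shift.
have F0 : u z = F x by rewrite /F plineE.
(* The mean value theorem wants the derivative as a function; off the segment, where none need
   exist, [dl] may take its default value 0. *)
pose dl s := xget 0 [set l | is_derive s (1 : R) F l /\ `|l - L| <= e].
have dlP (s : R) : `|s - x| <= `|h| -> is_derive s (1 : R) F (dl s) /\ `|dl s - L| <= e.
  by move=> /dF[l l1 l2]; rewrite /dl; case: xgetP => [y _ []//|/(_ l)/(_ (conj l1 l2))].
rewrite Fh F0.
have bnd (c : R) : `|c - x| <= `|h| -> `|dl c * h - L * h| <= e * `|h|.
  by move=> /dlP[_ hc]; rewrite -mulrBl normrM ler_wpM2r.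
have [h0|h0] := leP 0 h.
  have [|||c] := @MVT_segment R F dl x (x + h); first by rewrite lerDl.
  - move=> s; rewrite in_itv/= => /andP[xs sx].
    have /dlP[]// : `|s - x| <= `|h|.
    by rewrite (ger0_norm h0) gtr0_norm ?subr_gt0// lerBlDl ltW.
  - apply: derivable_within_continuous => s; rewrite in_itv/= => /andP[xs sx].
    have /dlP[[]]// : `|s - x| <= `|h|.
    by rewrite !ger0_norm ?subr_ge0// lerBlDl.
  rewrite in_itv/= => /andP[xs sx] ->; rewrite addrAC subrr add0r; apply: bnd.
  by rewrite !ger0_norm ?subr_ge0// lerBlDl.
have [|||c] := @MVT_segment R F dl (x + h) x; first by rewrite gerDl ltW.
- move=> s; rewrite in_itv/= => /andP[xs sx].
  have /dlP[]// : `|s - x| <= `|h|.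
  by rewrite distrC gtr0_norm ?subr_gt0// ltr0_norm//; lra.
- apply: derivable_within_continuous => s; rewrite in_itv/= => /andP[xs sx].
  have /dlP[[]]// : `|s - x| <= `|h|.
  by rewrite distrC ger0_norm ?subr_ge0// ltr0_norm//; lra.
rewrite in_itv/= => /andP[xs sx] E.
have -> : F (x + h) - F x = dl c * h by rewrite -opprB E; ring.
apply: bnd.
by rewrite distrC ger0_norm ?subr_ge0// ltr0_norm//; lra.
Qed.

Definition frechet u z (a b : R) := forall e : R, 0 < e ->
  exists2 d : R, 0 < d & forall h, cabs h < d ->
    `|u (z + h) - u z - (a * complex.Re h + b * complex.Im h)| <= e * cabs h.

(** The displacement is split into a horizontal and a vertical leg, and the mean value estimate is
    applied to each; continuity of the partials keeps them close to their values at z along both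
    legs. *)
Lemma Cn_on_frechet m O u z : open O -> O z -> Cn_on m.+1 O u ->
  frechet u z (pd true u z) (pd false u z).
Proof.
move=> oO Oz hu e e0.
have /cts_cabsP hs := Cn_on_cts (Cn_on_pd true hu) Oz.
have /cts_cabsP ht := Cn_on_cts (Cn_on_pd false hu) Oz.
have e2 : 0 < e / 2 by rewrite divr_gt0.
have [d1 d10 hd1] := hs _ e2; have [d2 d20 hd2] := ht _ e2.
have /openP_cabs/(_ _ Oz)[d3 d30 hd3] := oO.
exists (Num.min d1 (Num.min d2 d3)); first by rewrite !lt_min d10 d20 d30.
move=> h; rewrite !lt_min => /andP[hh1 /andP[hh2 hh3]].
pose k := z + (complex.Re h)%:C * pdir R true.
have -> : z + h = k + (complex.Im h)%:C * pdir R false.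
  by rewrite /k/=; apply: complex_ext; rewrite !reimE/=; ring.
have s1 : `|u k - u z - pd true u z * complex.Re h| <= e / 2 * `|complex.Re h|.
  apply: pd_mean_value => t th w.
  have wz : cabs (w - z) <= cabs h.
    by rewrite /w [z + _]addrC addrK cabs_pdir (le_trans th)// Re_le_cabs.
  split; last by rewrite ltW// hd1// (le_lt_trans wz).
  by apply: Cn_on_isd hu _; apply: hd3; rewrite (le_lt_trans wz).
have s2 : `|u (k + (complex.Im h)%:C * pdir R false) - u k - pd false u z * complex.Im h|
    <= e / 2 * `|complex.Im h|.
  apply: pd_mean_value => t th w.
  have wz : cabs (w - z) <= cabs h.
    have -> : w - z = complex.Re h +i* t.
      by rewrite /w /k/=; apply: complex_ext; rewrite !reimE/=; ring.
    by rewrite !cabsE/= ler_sqrt ?addr_ge0 ?sqr_ge0// lerD2l -[t ^+ 2]real_normK ?num_real// -[complex.Im h ^+ 2]real_normK ?num_real// lerXn2r ?nnegrE.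
  split; last by rewrite ltW// hd2// (le_lt_trans wz).
  by apply: Cn_on_isd hu _; apply: hd3; rewrite (le_lt_trans wz).
set A := u _ in s2 *.
have -> : A - u z - (pd true u z * complex.Re h + pd false u z * complex.Im h) =
  (A - u k - pd false u z * complex.Im h) + (u k - u z - pd true u z * complex.Re h).
  by ring.
apply: (le_trans (ler_normD _ _)); apply: (le_trans (lerD s2 s1)).
have := Re_le_cabs h; have := Im_le_cabs h => i1 i2.
have -> : e * cabs h = e / 2 * cabs h + e / 2 * cabs h by field.
by rewrite lerD// ler_wpM2l// ltW.
Qed.

(** Even along one coordinate line g moves in both real directions, so u has to be totally
    differentiable and not merely have partials. *)
Lemma frechet_isd u b (g : C -> C) z (a c l m : R) : frechet u (g z) a c ->
  isd b (fun w => complex.Re (g w)) z l -> isd b (fun w => complex.Im (g w)) z m ->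
  isd b (fun w => u (g w)) z (a * l + c * m).
Proof.
move=> hu /isdP h1 /isdP h2; apply/isdP => e e0.
pose M := `|l| + `|m| + 2; have M0 : 0 < M by rewrite /M ltr_wpDl// addr_ge0.
pose N := `|a| + `|c| + 1; have N0 : 0 < N by rewrite /N ltr_wpDl// addr_ge0.
pose e1 := e / 2 / M; have e10 : 0 < e1 by rewrite !divr_gt0.
pose e2 := Num.min 1 (e / 2 / N); have e20 : 0 < e2 by rewrite lt_min ltr01 !divr_gt0.
have e2N : e2 * N <= e / 2 by rewrite -ler_pdivlMr// /e2 ge_min lexx orbT.
have e21 : e2 <= 1 by rewrite /e2 ge_min lexx.
have [d0 d00 hd0] := hu _ e10.
have [d1 d10 hd1] := h1 _ e20; have [d2 d20 hd2] := h2 _ e20.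
exists (Num.min (d0 / M) (Num.min d1 d2)); first by rewrite !lt_min d10 d20 divr_gt0.
move=> h; rewrite !lt_min => /andP[hh0 /andP[/hd1 hh1 /hd2 hh2]].
set w := z + _ in hh1 hh2 *.
pose k := g w - g z.
have kR : complex.Re k = complex.Re (g w) - complex.Re (g z) by rewrite /k !reimE.
have kI : complex.Im k = complex.Im (g w) - complex.Im (g z) by rewrite /k !reimE.
rewrite -kR in hh1; rewrite -kI in hh2.
have kM : cabs k <= M * `|h|.
  apply: (le_trans (cabs_le _)).
  have t1 : `|complex.Re k| <= `|complex.Re k - l * h| + `|l| * `|h|.
    by rewrite -normrM (le_trans _ (ler_normD _ _))// subrK.
  have t2 : `|complex.Im k| <= `|complex.Im k - m * h| + `|m| * `|h|.
    by rewrite -normrM (le_trans _ (ler_normD _ _))// subrK.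
  have : e2 * `|h| <= `|h| by rewrite -[leRHS]mul1r ler_wpM2r.
  rewrite /M; lra.
have kd : cabs k < d0 by rewrite (le_lt_trans kM)// mulrC -ltr_pdivlMr.
have := hd0 k kd; rewrite /k subrKC -/k => h3.
set A := u (g w) in h3 *.
have -> : A - u (g z) - (a * l + c * m) * h =
  (A - u (g z) - (a * complex.Re k + c * complex.Im k)) +
  (a * (complex.Re k - l * h) + c * (complex.Im k - m * h)) by ring.
apply: (le_trans (ler_normD _ _)).
have t1 : e1 * cabs k <= e / 2 * `|h|.
  apply: (@le_trans _ _ (e1 * (M * `|h|))); first by rewrite ler_wpM2l// ltW.
  by rewrite mulrA /e1 divfK// gt_eqF.
have t2 : `|a * (complex.Re k - l * h) + c * (complex.Im k - m * h)| <= e / 2 * `|h|.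
  apply: (le_trans (ler_normD _ _)); rewrite !normrM.
  apply: (@le_trans _ _ (`|a| * (e2 * `|h|) + `|c| * (e2 * `|h|))).
    by rewrite lerD// ler_wpM2l.
  rewrite -mulrDl mulrA ler_wpM2r// (le_trans _ e2N)// mulrC ler_wpM2l//.
    exact: ltW.
  by rewrite /N lerDl.
by have := lerD h3 (le_trans t2 (lexx _)); lra.
Qed.

Lemma Cn_on_comp m O U u (g : C -> C) : open O -> open U ->
  (forall z, O z -> U (g z)) -> CkC_on (Some m) O g -> Cn_on m U u ->
  Cn_on m O (fun z => u (g z)).
Proof.
move=> oO oU OU; elim: m u => [|m IH] u [hR hI] hu.
all: have cu z : O z -> {for z, continuous (fun z => u (g z))}.
all: try (move=> Oz; have /cts_cabsP c1 := Cn_on_cts hR Oz;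
  have /cts_cabsP c2 := Cn_on_cts hI Oz; have /cts_cabsP c3 := Cn_on_cts hu (OU _ Oz);
  apply/cts_cabsP => e e0; have [d d0 hd] := c3 _ e0;
  have [d1 d10 hd1] := c1 _ (divr_gt0 d0 (ltr0Sn _ 1));
  have [d2 d20 hd2] := c2 _ (divr_gt0 d0 (ltr0Sn _ 1));
  exists (Num.min d1 d2); [by rewrite lt_min d10|];
  move=> w; rewrite lt_min => /andP[/hd1 k1 /hd2 k2]; apply: hd;
  rewrite (le_lt_trans (cabs_le _))// !reimE [ltRHS]splitr ltrD//).
  by split.
have E b z : O z -> isd b (fun z => u (g z)) z
   (pd true u (g z) * pd b (fun w => complex.Re (g w)) z +
    pd false u (g z) * pd b (fun w => complex.Im (g w)) z).
  move=> Oz; apply: frechet_isd; last 2 first.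
  - exact: Cn_on_isd hR Oz.
  - exact: Cn_on_isd hI Oz.
  - exact: (Cn_on_frechet oU (OU _ Oz) hu).
apply/Cn_onS; split=> [//|b]; split=> [z Oz|]; first by rewrite (isd_pd (E b z Oz)); exact: E.
have hg : CkC_on (Some m) O g by split; exact: Cn_on_pred.
have := Cn_onD oO (Cn_onM oO (IH _ hg (Cn_on_pd true hu)) (Cn_on_pd b hR))
  (Cn_onM oO (IH _ hg (Cn_on_pd false hu)) (Cn_on_pd b hI)).
by apply: Cn_on_eq => // z Oz; rewrite (isd_pd (E b z Oz)).
Qed.

End chain_rule.

Section bump.
Variable R : realType.
Local Notation C := R[i].

(** The classical function exp(-1/x), flat at 0, together with its products with x^-k:
    differentiation of one member gives a combination of others. *)
Definition flat (k : nat) (x : R) : R :=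
  if 0 < x then x^-1 ^+ k * expR (- x^-1) else 0.

Lemma is_deriveP (g : R -> R) (x l : R) : is_derive x (1 : R) g l <->
  forall e : R, 0 < e -> exists2 d : R, 0 < d & forall h : R, `|h| < d ->
    `|g (x + h) - g x - l * h| <= e * `|h|.
Proof.
(* A function of one variable is read as a function of Re w, so the criterion on horizontal lines
   applies. *)
have := isdP true (fun w => g (complex.Re w)) (x +i* 0) l.
rewrite /isd /= /hline /= => ->.
have E h : x + (h * 1 - 0 * 0) = x + h by ring.
by split=> H e /H[d d0 hd]; exists d => // h /hd; rewrite E.
Qed.

Lemma is_derive_near (f g : R -> R) (x l d : R) : 0 < d ->
  (forall y, `|y - x| < d -> f y = g y) ->
  is_derive x (1 : R) f l -> is_derive x (1 : R) g l.
Proof.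
move=> d0 fg /is_deriveP H; apply/is_deriveP => e /H[c c0 hc].
exists (Num.min d c); first by rewrite lt_min d0.
move=> h; rewrite lt_min => /andP[hd hhc]; rewrite -!fg ?subrr ?normr0//; first exact: hc.
by rewrite addrAC subrr add0r.
Qed.

(** With y = 1/x the exponential series gives y^(k+2) / (k+2)! <= exp y. Quadratic decay at 0 is
    exactly what makes the derivative there vanish. *)
Lemma flat_le k (x : R) : `|flat k x| <= k.+2`!%:R * x ^+ 2.
Proof.
rewrite /flat; case: ifPn => x0; last by rewrite normr0 mulr_ge0// sqr_ge0.
have [y y0 ->] : exists2 y : R, 0 < y & x = y^-1.
  by exists x^-1; rewrite ?invr_gt0 ?invrK.
rewrite invrK ger0_norm ?mulr_ge0 ?exprn_ge0 ?expR_ge0 ?(ltW y0)//.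
have h : y ^+ k.+2 / k.+2`!%:R <= expR y.
  by rewrite (le_trans _ (expR_ge1Dxn k.+1 (ltW y0)))// lerDr.
have f0 : (0 : R) < k.+2`!%:R by rewrite ltr0n fact_gt0.
rewrite expRN ler_pdivrMr ?expR_gt0//.
rewrite ler_pdivrMr// in h.
have -> : y ^+ k = y ^- 2 * y ^+ k.+2.
  by rewrite -(addn2 k) exprD mulrCA mulVf ?mulr1// expf_neq0// gt_eqF.
by rewrite -mulrA exprVn [leRHS]mulrCA ler_wpM2l ?invr_ge0 ?exprn_ge0 ?(ltW y0)// mulrC.
Qed.

Lemma is_derive_flat k (x : R) :
  is_derive x (1 : R) (flat k) (- k%:R * flat k.+1 x + 1 * flat k.+2 x).
Proof.
have [x0|x0|->] := ltgtP x 0.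
- have E0 j y : y < 0 -> flat j y = 0 by move=> y0; rewrite /flat ltNge (ltW y0).
  rewrite !E0// !mulr0 addr0; apply/is_deriveP => e e0.
  exists (- x) => [|h]; first by rewrite oppr_gt0.
  rewrite ltr_norml => /andP[_ hx]; rewrite !E0//; last by rewrite addrC -ltrBrDr sub0r.
  by rewrite subrr mul0r subr0 normr0 mulr_ge0// ltW.
- apply: (@is_derive_near (fun y => y^-1 ^+ k * expR (- y^-1)) _ x _ x) => //.
    move=> y; rewrite ltr_norml => /andP[]; rewrite ltrBrDr addNr => y0 _.
    by rewrite /flat y0.
  have xn0 : x != 0 by rewrite gt_eqF.
  have h1 := @is_deriveV _ (@id R) x 1 1 xn0 (is_derive_id _ _).
  have h2 := is_deriveX k h1.
  have h3 := is_deriveN h1.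
  have h4 := @is_derive1_comp R expR (- (fun y : R => y^-1)) x _ _ (is_derive_expR (- x^-1)) h3.
  have := is_deriveM h2 h4.
  have -> : (fun y : R => y^-1 ^+ k * expR (- y^-1)) =
     ((fun y : R => y^-1) ^+ k) * (expR \o (- (fun y : R => y^-1))).
    by apply/funext => y; rewrite fctE exprfctE.
  move=> h5; apply: (is_derive_eq h5).
  rewrite /flat x0 /= exprfctE -![_ *: _]/(_ * _) /=.
  case: k {h2 h5} => [|k] /=; rewrite -?exprVn ?exprS ?expr0 /=; ring.
- rewrite /flat ltxx !mulr0 addr0; apply/is_deriveP => e e0.
  have f0 : (0 : R) < k.+2`!%:R by rewrite ltr0n fact_gt0.
  exists (e / k.+2`!%:R); first by rewrite divr_gt0.
  move=> h hh; rewrite add0r ltxx subr0 mul0r subr0 -/(flat k h).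
  apply: (le_trans (flat_le k h)); rewrite -real_normK ?num_real// expr2 mulrA.
  by rewrite ler_wpM2r// mulrC -ler_pdivlMr// ltW.
Qed.

Lemma flat0_gt0 (x : R) : 0 < x -> 0 < flat 0 x.
Proof. by rewrite /flat => ->; rewrite mul1r expR_gt0. Qed.

Lemma flat0_le0 (x : R) : x <= 0 -> flat 0 x = 0.
Proof. by rewrite /flat ltNge => ->. Qed.

Lemma flat0_ge0 (x : R) : 0 <= flat 0 x.
Proof. by rewrite /flat; case: ifP => // _; rewrite mul1r expR_ge0. Qed.

Lemma Cn_on_flat m O k (u : C -> R) : open O -> Cn_on m O u ->
  Cn_on m O (fun z => flat k (u z)).
Proof.
move=> oO; apply: (@Cn_on_family _ nat flat S (fun k => k.+2) (fun k => - k%:R)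
  (fun=> 1) setT) => //.
by move=> ? ? _; exact: is_derive_flat.
Qed.

Lemma Cn_on_sqdist m O (a : C) : open O -> Cn_on m O (fun z => cabs (z - a) ^+ 2).
Proof.
move=> oO.
have h b : Cn_on m O (fun z => pcoord b z - pcoord b a).
  by apply: Cn_onB => //; [exact: Cn_on_coord|exact: Cn_on_cst].
have := Cn_onD oO (Cn_onM oO (h true) (h true)) (Cn_onM oO (h false) (h false)).
by apply: Cn_on_eq => // z _; rewrite sqr_cabs !reimE /= !expr2.
Qed.

Lemma bump_exists (a : C) (r1 r2 : R) : 0 <= r1 -> r1 < r2 ->
  exists chi : C -> R, [/\ forall m, Cn_on m setT chi,
    forall z, cabs (z - a) <= r1 -> chi z = 1,
    forall z, r2 <= cabs (z - a) -> chi z = 0 & forall z, 0 <= chi z <= 1].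
Proof.
move=> r10 r12.
have r20 : 0 <= r2 by rewrite (le_trans r10)// ltW.
(* p is positive precisely inside the large disk and q precisely outside the closed small one, so p
   + q has no zero and p / (p + q) is the cut-off. *)
pose p z := flat 0 (r2 ^+ 2 - cabs (z - a) ^+ 2).
pose q z := flat 0 (cabs (z - a) ^+ 2 - r1 ^+ 2).
have pq0 z : 0 < p z + q z.
  have [h|h] := ltP (cabs (z - a)) r2.
    rewrite ltr_wpDr ?flat0_ge0// flat0_gt0// subr_gt0 ltrXn2r ?nnegrE ?cabs_ge0//.
  rewrite ltr_wpDl ?flat0_ge0// flat0_gt0// subr_gt0 ltrXn2r ?nnegrE ?cabs_ge0//.
  exact: lt_le_trans h.
exists (fun z => p z / (p z + q z)); split.
- move=> m; have oT := @openT C.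
  have hs := Cn_on_sqdist m a oT.
  have hp : Cn_on m setT p by apply: Cn_on_flat => //; apply: Cn_onB => //; exact: Cn_on_cst.
  have hq : Cn_on m setT q by apply: Cn_on_flat => //; apply: Cn_onB => //; exact: Cn_on_cst.
  apply: Cn_onM => //; apply: Cn_onV => //; last exact: Cn_onD.
  by move=> z _; rewrite gt_eqF.
- move=> z h; have q0 : q z = 0.
    by rewrite /q flat0_le0// subr_le0 lerXn2r ?nnegrE ?cabs_ge0.
  by have := pq0 z; rewrite q0 addr0 => p0; rewrite divff// gt_eqF.
- move=> z h; rewrite /p flat0_le0 ?mul0r// subr_le0 lerXn2r ?nnegrE ?cabs_ge0//.
- move=> z; rewrite divr_ge0 ?addr_ge0 ?flat0_ge0//= ler_pdivrMr ?pq0// mul1r.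
  by rewrite lerDl flat0_ge0.
Qed.

End bump.

(** * Integration over the plane *)

Section complex_measurable.
Context d (T : measurableType d) (R : realType).
Local Notation C := R[i].
Implicit Types (f g : T -> C) (u v : T -> R).

Lemma measurable_funV u : measurable_fun setT u -> measurable_fun setT (fun x => (u x)^-1).
Proof.
(* The inverse becomes a real power of a nonnegative function, whose measurability is known. At a
   zero of u both sides are 0. *)
move=> mu; have -> : (fun x => (u x)^-1) = (fun x => u x * (u x ^+ 2) `^ (-1)).
  apply/funext => x; rewrite powR_inv1 ?sqr_ge0//.
  by have [->|u0] := eqVneq (u x) 0; rewrite ?invr0 ?mul0r// expr2 invfM mulrA mulfV// mul1r.
apply: measurable_funM => //.
have h := measurableT_comp (@measurable_powR R (-1)) (measurable_funX 2 mu).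
exact: h.
Qed.

Definition cmf f := measurable_fun setT (fun x => complex.Re (f x)) /\
  measurable_fun setT (fun x => complex.Im (f x)).

Lemma cmf_cst (c : C) : cmf (fun=> c).
Proof. by split; exact: measurable_cst. Qed.

Lemma cmfD f g : cmf f -> cmf g -> cmf (fun x => f x + g x).
Proof.
move=> [f1 f2] [g1 g2]; split.
  by under eq_fun do rewrite cReD; exact: measurable_funD.
by under eq_fun do rewrite cImD; exact: measurable_funD.
Qed.

Lemma cmfN f : cmf f -> cmf (fun x => - f x).
Proof.
move=> [f1 f2]; split.
  by under eq_fun do rewrite cReN; exact: measurable_funN.
by under eq_fun do rewrite cImN; exact: measurable_funN.
Qed.

Lemma cmfB f g : cmf f -> cmf g -> cmf (fun x => f x - g x).
Proof. by move=> mf mg; apply: cmfD => //; exact: cmfN. Qed.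

Lemma cmfM f g : cmf f -> cmf g -> cmf (fun x => f x * g x).
Proof.
move=> [f1 f2] [g1 g2]; split.
  by under eq_fun do rewrite cReM; apply: measurable_funB; exact: measurable_funM.
by under eq_fun do rewrite cImM; apply: measurable_funD; exact: measurable_funM.
Qed.

Lemma cmf_sum (I : Type) (s : seq I) (P : pred I) (F : I -> T -> C) :
  (forall i, cmf (F i)) -> cmf (fun x => \sum_(i <- s | P i) F i x).
Proof.
move=> mF; elim: s => [|i s IH].
  by under eq_fun do rewrite big_nil; exact: cmf_cst.
under eq_fun do rewrite big_cons; case: (P i) => //; exact: cmfD.
Qed.

Lemma measurable_sqr_cabs f : cmf f -> measurable_fun setT (fun x => cabs (f x) ^+ 2).
Proof.
move=> [f1 f2]; under eq_fun do rewrite sqr_cabs.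
by apply: measurable_funD; exact: measurable_funX.
Qed.

Lemma measurable_cabs f : cmf f -> measurable_fun setT (fun x => cabs (f x)).
Proof.
move=> mf; have -> : (fun x => cabs (f x)) = (fun x => (cabs (f x) ^+ 2) `^ 2^-1).
  by apply/funext => x; rewrite powR12_sqrt ?sqr_ge0// sqrtr_sqr ger0_norm ?cabs_ge0.
exact: (@measurableT_comp _ _ _ _ _ _ _ _ (fun x => cabs (f x) ^+ 2) (@measurable_powR R 2^-1) (measurable_sqr_cabs mf)).
Qed.

Lemma cmfV f : cmf f -> cmf (fun x => (f x)^-1).
Proof.
move=> mf; have m2 := measurable_funV (measurable_sqr_cabs mf); case: mf => f1 f2; split.
  by under eq_fun do rewrite cReV; exact: measurable_funM.
by under eq_fun do rewrite cImV; apply: measurable_funM => //; exact: measurable_funN.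
Qed.

Lemma cmf_div f g : cmf f -> cmf g -> cmf (fun x => f x / g x).
Proof. by move=> mf mg; apply: cmfM => //; exact: cmfV. Qed.

Lemma cmf_real u : measurable_fun setT u -> cmf (fun x => (u x)%:C).
Proof. by move=> mu; split => //=; exact: measurable_cst. Qed.

End complex_measurable.

Section plane_measure.
Variable R : realType.
Local Notation C := R[i].
Local Notation P := (measurableTypeR R * measurableTypeR R)%type.

Lemma lebesgue2X (A B : set (measurableTypeR R)) : measurable A -> measurable B ->
  lebesgue2 R (A `*` B) = (lebesgue_measure A * lebesgue_measure B)%E.
Proof. exact: product_measure1E. Qed.

Lemma lebesgue2_sigma_finite : sigma_finite setT (lebesgue2 R).
Proof.
have /sigma_finiteP[F [TF ndF Foo]] := sigma_finiteT (@lebesgue_measure R).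
exists (fun n => F n `*` F n).
  rewrite -setXTT TF predeqE => -[x y]; split.
    move=> [/= [n _ Fnx] [k _ Gky]]; exists (maxn n k) => //; split.
    - by move: x Fnx; exact/subsetPset/ndF/leq_maxl.
    - by move: y Gky; exact/subsetPset/ndF/leq_maxr.
  by move=> [n _ []/= ? ?]; split; exists n.
move=> k; have [? ?] := Foo k.
split; first exact: measurableX.
by rewrite lebesgue2X// lte_mul_pinfty// ge0_fin_numE.
Qed.

(** A named copy of [lebesgue2], to which the sigma-finiteness needed for Fubini can be attached as
    an instance. *)
Definition mu2 : set P -> \bar R := lebesgue2 R.
HB.instance Definition _ := Measure.copy mu2 (lebesgue2 R).
HB.instance Definition _ := Measure_isSigmaFinite.Build _ _ _ mu2 lebesgue2_sigma_finite.

Lemma mu2X (A B : set (measurableTypeR R)) : measurable A -> measurable B ->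
  mu2 (A `*` B) = (lebesgue_measure A * lebesgue_measure B)%E.
Proof. exact: lebesgue2X. Qed.

(** An open set is the union of the rational open squares that it contains, and there are countably
    many of them; squares belong to the product sigma-algebra. *)
Lemma measurable_openC (O : set C) : open O -> measurable ((@toC R) @^-1` O : set P).
Proof.
move=> /openP_cabs oO.
pose S (a b c : rat) : set P := (`]ratr a - ratr c, ratr a + ratr c[%classic `*`
  `]ratr b - ratr c, ratr b + ratr c[%classic).
have -> : (@toC R) @^-1` O = \bigcup_a \bigcup_b \bigcup_c
    (if `[< S a b c `<=` (@toC R) @^-1` O >] then S a b c else set0).
  apply/seteqP; split=> [[x y] /= Oxy|q [a _ [b _ [c _]]]]; last first.
    by case: asboolP => // h /h.
  have [d d0 hd] := oO _ Oxy.
  have /rat_in_itvoo[c] : 0 < d / 4 by rewrite divr_gt0.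
  rewrite in_itv/= => /andP[c0 cd].
  have /rat_in_itvoo[a] : x - ratr c < x + ratr c by lra.
  have /rat_in_itvoo[b] : y - ratr c < y + ratr c by lra.
  rewrite !in_itv/= => /andP[b1 b2] /andP[a1 a2].
  exists a => //; exists b => //; exists c => //.
  have h : S a b c `<=` (@toC R) @^-1` O.
    move=> [s t] [] /=; rewrite !in_itv/= => /andP[s1 s2] /andP[t1 t2].
    apply: hd; apply: (le_lt_trans (cabs_le _)); rewrite !reimE /=.
    have : `|s - x| < d / 2 by rewrite ltr_norml; apply/andP; split; lra.
    have : `|t - y| < d / 2 by rewrite ltr_norml; apply/andP; split; lra.
    lra.
  case: asboolP => // _; split=> /=; rewrite in_itv/=; apply/andP; split; lra.
apply: bigcupT_measurable_rat => a; apply: bigcupT_measurable_rat => b.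
apply: bigcupT_measurable_rat => c; case: ifP => // _.
by apply: measurableX; exact: measurable_itv.
Qed.

Definition rmeas (u : C -> R) := measurable_fun setT (fun q : P => u (toC q)).
Definition cmeas (g : C -> C) := cmf (fun q : P => g (toC q)).

Lemma cts_on_measurable (O : set C) (u : C -> R) : open O ->
  (forall z, O z -> {for z, continuous u}) -> rmeas (fun z => \1_O z * u z).
Proof.
move=> oO cu.
pose O' := (@toC R) @^-1` O : set P.
have mO' : measurable O' by exact: measurable_openC.
have m1 : measurable_fun O' (fun q : P => u (toC q)).
  apply: (measurability _ (RGenOpens.measurableE R)).
  move=> _ [_ [a [b ->] <-]].
  rewrite (_ : _ `&` _ = (@toC R) @^-1` (O `&` u @^-1` `]a, b[%classic))//.
  apply: measurable_openC; apply/openP_cabs => z [Oz /= zab].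
  have /openP_cabs/(_ _ Oz)[d d0 hd] := oO.
  have /cts_cabsP cz := cu z Oz; move: zab; rewrite in_itv/= => /andP[az zb].
  have [c c0 hc] := cz (Num.min (u z - a) (b - u z))
    ltac:(by rewrite lt_min !subr_gt0 az zb).
  exists (Num.min d c); first by rewrite lt_min d0.
  move=> w; rewrite lt_min => /andP[/hd Ow /hc]; rewrite lt_min => /andP[h1 h2].
  split=> //=; rewrite in_itv/=; move: h1 h2.
  rewrite !ltr_norml => /andP[h1 h2] /andP[h3 h4]; apply/andP; split; lra.
have m2 := (measurable_restrictT (fun q : P => u (toC q)) mO').1 m1.
apply: (eq_measurable_fun _ _ m2) => q _; rewrite /patch indicE.
rewrite [q \in O'](_ : _ = (toC q \in O)); last by apply/idP/idP; rewrite !inE.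
by case: ifP; rewrite ?mul1r ?mul0r.
Qed.

Lemma cts_measurable (u : C -> R) : (forall z, {for z, continuous u}) -> rmeas u.
Proof.
move=> cu; have := @cts_on_measurable setT u openT (fun z _ => cu z).
by rewrite /rmeas; under eq_fun do rewrite indicT mul1r.
Qed.

Definition affine_map (a : C) (c : R) (q : P) : P :=
  (complex.Re a + c * q.1, complex.Im a + c * q.2).

Lemma toC_affine a c q : toC (affine_map a c q) = a + c%:C * toC q.
Proof. by rewrite /toC /affine_map; apply: complex_ext; rewrite !reimE /=; ring. Qed.

Lemma measurable_affine1 (a c : R) :
  measurable_fun setT (fun x : measurableTypeR R => (a + c * x : measurableTypeR R)).
Proof. by apply: measurable_funD; [exact: measurable_cst|exact: measurable_funM]. Qed.

Lemma measurable_affine a c : measurable_fun setT (affine_map a c).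
Proof.
apply: measurable_fun_pair.
  exact: (measurableT_comp (measurable_affine1 (complex.Re a) c) measurable_fst).
exact: (measurableT_comp (measurable_affine1 (complex.Im a) c) measurable_snd).
Qed.

(** Uniqueness of Lebesgue measure: the scaled pushforward agrees with it on half-open intervals.
    The planar version uses rectangles in the same way. *)
Lemma lebesgue_affine (a c : R) (c0 : 0 < c) (A : set (measurableTypeR R)) :
  measurable A ->
  lebesgue_measure A = (c%:E * lebesgue_measure ((fun x => a + c * x)%R @^-1` A))%E.
Proof.
move=> mA.
pose m1 := @measure_function_pushforward__canonical__measure_function_Measure
  _ _ _ _ _ (@lebesgue_measure R) _ (measurable_affine1 a c).
rewrite (@lebesgue_measure_unique R (mscale (NngNum (ltW c0)) m1))// => X [[x y]] _ <-.
change (lebesgue_measure (`]x, y]%classic : set R) =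
  c%:E * lebesgue_measure ((fun z => (a + c * z)%R) @^-1` (`]x, y]%classic : set R)))%E.
rewrite (_ : _ @^-1` _ = `](x - a) / c, (y - a) / c]%classic); last first.
  by apply/seteqP; split=> z /=; rewrite !in_itv/= ltr_pdivrMr// ler_pdivlMr// =>
    /andP[h1 h2]; apply/andP; split; lra.
rewrite !lebesgue_measure_itv/= !lte_fin ltr_pM2r ?invr_gt0// ltrD2r.
case: ifP => _; last by rewrite mule0.
by rewrite -!EFinB -EFinM; congr EFin; field; rewrite gt_eqF.
Qed.

Lemma mu2_affine (a : C) (c : R) (c0 : 0 < c) (A : set P) : measurable A ->
  mu2 A = ((c ^+ 2)%:E * mu2 (affine_map a c @^-1` A))%E.
Proof.
move=> mA.
pose m1 := @measure_function_pushforward__canonical__measure_function_Measure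
  _ _ _ _ _ mu2 _ (measurable_affine a c).
have c2 : 0 <= c ^+ 2 by rewrite sqr_ge0.
rewrite [LHS](@product_measure_unique _ _ _ _ _ lebesgue_measure lebesgue_measure
  (mscale (NngNum c2) m1))// => X Y mX mY.
change ((c ^+ 2)%:E * mu2 (affine_map a c @^-1` (X `*` Y)) =
  lebesgue_measure X * lebesgue_measure Y)%E.
have -> : affine_map a c @^-1` (X `*` Y) =
  ((fun x => complex.Re a + c * x) @^-1` X) `*` ((fun x => complex.Im a + c * x) @^-1` Y).
  by [].
rewrite mu2X; last 2 first.
- by rewrite -[X in measurable X]setTI; exact: measurable_affine1.
- by rewrite -[X in measurable X]setTI; exact: measurable_affine1.
rewrite (lebesgue_affine (complex.Re a) c0 mX) (lebesgue_affine (complex.Im a) c0 mY).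
by rewrite expr2 EFinM muleACA.
Qed.

Lemma ge0_integral_affine (a : C) (c : R) (u : C -> R) : 0 < c -> rmeas u ->
  (forall z, 0 <= u z) ->
  (\int[mu2]_q (u (toC q))%:E =
   (c ^+ 2)%:E * \int[mu2]_q (u (a + c%:C * toC q))%:E)%E.
Proof.
move=> c0 mu u0.
have c2 : 0 <= c ^+ 2 by rewrite sqr_ge0.
pose m1 := @measure_function_pushforward__canonical__measure_function_Measure
  _ _ _ _ _ mu2 _ (measurable_affine a c).
transitivity (\int[mscale (NngNum c2) m1]_q (u (toC q))%:E)%E.
  apply: eq_measure_integral => A mA _; exact: (mu2_affine a c0 mA).
have mE : measurable_fun setT (fun q : P => (u (toC q))%:E) by exact/measurable_EFinP.
have E0 (q : P) : (0 <= (u (toC q))%:E)%E by rewrite lee_fin.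
have E1 : (\int[m1]_q (u (toC q))%:E = \int[mu2]_q (u (a + c%:C * toC q))%:E)%E; last first.
  by rewrite -E1 (ge0_integral_mscale m1 measurableT (NngNum c2) mE (fun q _ => E0 q)).
rewrite (@ge0_integral_pushforward _ _ _ _ _ _ (measurable_affine a c) mu2 _ _
  measurableT mE (fun q _ => E0 q)).
by rewrite preimage_setT; apply: eq_integral => q _ /=; rewrite toC_affine.
Qed.

End plane_measure.

Section complex_integral.
Context d (T : measurableType d) (R : realType).
Variable mu : {measure set T -> \bar R}.
Local Notation C := R[i].
Implicit Types (f g : T -> C) (u v b : T -> R).

Definition rintegrable u := mu.-integrable setT (EFin \o u).
Definition cintegrable f := rintegrable (fun x => complex.Re (f x)) /\
  rintegrable (fun x => complex.Im (f x)).
Definition cintg f : C := (\int[mu]_x complex.Re (f x))%R +i* (\int[mu]_x complex.Im (f x))%R.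

Lemma eq_cintg f g : f =1 g -> cintg f = cintg g.
Proof. by move=> /funext ->. Qed.

Lemma rintegrable_le u b : measurable_fun setT u -> rintegrable b ->
  (forall x, `|u x| <= b x) -> rintegrable u.
Proof.
move=> mu' ib ub; apply: le_integrable ib => //; first exact/measurable_EFinP.
move=> x _ /=; rewrite lee_fin (le_trans (ub x))// ler_norm//.
Qed.

Lemma rintegrableD u v : rintegrable u -> rintegrable v ->
  rintegrable (fun x => u x + v x).
Proof. by move=> iu iv; have := integrableD measurableT iu iv. Qed.

Lemma rintegrableZ (k : R) u : rintegrable u -> rintegrable (fun x => k * u x).
Proof. by move=> iu; have := integrableZl measurableT k iu. Qed.

Lemma rintegrableN u : rintegrable u -> rintegrable (fun x => - u x).
Proof. by move=> iu; have := integrableN iu. Qed.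

Lemma rintegrable_measurable u : rintegrable u -> measurable_fun setT u.
Proof. by move=> /measurable_int/measurable_EFinP. Qed.

Lemma cintegrable_le f b : cmf f -> rintegrable b ->
  (forall x, cabs (f x) <= b x) -> cintegrable f.
Proof.
move=> [f1 f2] ib fb; split; apply: (rintegrable_le _ ib) => // x.
  exact: (le_trans (Re_le_cabs _)).
exact: (le_trans (Im_le_cabs _)).
Qed.

Lemma cintegrableD f g : cintegrable f -> cintegrable g ->
  cintegrable (fun x => f x + g x).
Proof.
move=> [f1 f2] [g1 g2]; split.
  by under eq_fun do rewrite cReD; exact: rintegrableD.
by under eq_fun do rewrite cImD; exact: rintegrableD.
Qed.

Lemma cintegrableN f : cintegrable f -> cintegrable (fun x => - f x).
Proof.
move=> [f1 f2]; split.
  by under eq_fun do rewrite cReN; exact: rintegrableN.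
by under eq_fun do rewrite cImN; exact: rintegrableN.
Qed.

Lemma cintegrableB f g : cintegrable f -> cintegrable g ->
  cintegrable (fun x => f x - g x).
Proof. by move=> h1 h2; apply: cintegrableD => //; exact: cintegrableN. Qed.

Lemma cintegrableZ (c : C) f : cintegrable f -> cintegrable (fun x => c * f x).
Proof.
move=> [f1 f2]; split.
  under eq_fun do rewrite cReM.
  by apply: rintegrableD; [|apply: rintegrableN]; exact: rintegrableZ.
by under eq_fun do rewrite cImM; apply: rintegrableD; exact: rintegrableZ.
Qed.

Lemma cintgD f g : cintegrable f -> cintegrable g ->
  cintg (fun x => f x + g x) = cintg f + cintg g.
Proof.
move=> [f1 f2] [g1 g2]; apply: complex_ext; rewrite !reimE /=.
  by under eq_Rintegral do rewrite cReD; rewrite RintegralD.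
by under eq_Rintegral do rewrite cImD; rewrite RintegralD.
Qed.

Lemma cintgZ (c : C) f : cintegrable f -> cintg (fun x => c * f x) = c * cintg f.
Proof.
move=> [f1 f2]; apply: complex_ext; rewrite !reimE /=.
  under eq_Rintegral do rewrite cReM.
  by rewrite RintegralB//; [rewrite !RintegralZl|exact: rintegrableZ|exact: rintegrableZ].
under eq_Rintegral do rewrite cImM.
by rewrite RintegralD//; [rewrite !RintegralZl|exact: rintegrableZ|exact: rintegrableZ].
Qed.

Lemma cintgN f : cintegrable f -> cintg (fun x => - f x) = - cintg f.
Proof.
by move=> fi; rewrite -mulN1r -cintgZ//; apply: eq_cintg => x; rewrite mulN1r.
Qed.

Lemma cintgB f g : cintegrable f -> cintegrable g ->
  cintg (fun x => f x - g x) = cintg f - cintg g.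
Proof. by move=> h1 h2; rewrite cintgD ?cintgN//; exact: cintegrableN. Qed.

(* The constant 2 could be 1, but comparing real and imaginary parts separately
   is enough. *)
Lemma cintg_le f b (B : R) : cmf f -> rintegrable b -> (forall x, cabs (f x) <= b x) ->
  (\int[mu]_x (b x)%:E <= B%:E)%E -> cabs (cintg f) <= 2 * B.
Proof.
move=> mf ib fb bB.
have [i1 i2] := cintegrable_le mf ib fb; have [m1 m2] := mf.
have bB' : \int[mu]_x b x <= B.
  rewrite -lee_fin /Rintegral fineK//; exact: integrable_fin_num.
have h (u : T -> R) : rintegrable u -> (forall x, `|u x| <= b x) ->
    `|\int[mu]_x u x| <= B.
  move=> iu ub; apply: (le_trans (le_normr_Rintegral measurableT iu)).
  apply: le_trans bB'; apply: le_Rintegral => //.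
  exact: integrable_norm.
rewrite (le_trans (cabs_le _))// mulr2n mulrDl mul1r lerD//=; apply: h => // x.
  exact: (le_trans (Re_le_cabs _)).
exact: (le_trans (Im_le_cabs _)).
Qed.

Lemma eq_cintg_ae f g : cmf f -> cmf g -> {ae mu, forall x, f x = g x} ->
  cintg f = cintg g.
Proof.
move=> [f1 f2] [g1 g2] fg; apply: complex_ext; rewrite /= /Rintegral; congr fine.
all: apply: ae_eq_integral => //; try exact/measurable_EFinP.
all: by apply: filterS fg => x -> _.
Qed.

End complex_integral.

Section fubini.
Context d1 d2 (T1 : measurableType d1) (T2 : measurableType d2) (R : realType).
Variable m1 : {sigma_finite_measure set T1 -> \bar R}.
Variable m2 : {sigma_finite_measure set T2 -> \bar R}.
Local Notation C := R[i].

Lemma real_fubini (f : T1 * T2 -> R) : (m1 \x m2)%E.-integrable setT (EFin \o f) ->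
  \int[m1]_x (\int[m2]_y f (x, y))%R = \int[m2]_y (\int[m1]_x f (x, y))%R.
Proof.
move=> fi; rewrite /Rintegral.
have iF := integrable_fubini_F fi.
have mf : measurable_fun setT (EFin \o f) := measurable_int _ fi.
have mG := measurable_fubini_G fi.
have iG : m2.-integrable setT (fubini_G m1 (EFin \o f)).
  apply/integrableP; split=> //; apply: le_lt_trans ((integrable21ltyP m1 m2 mf).1 fi).
  apply: ge0_le_integral => //.
  - exact: measurableT_comp.
  - have a0 q : (0 <= (abse \o (EFin \o f)) q)%E by rewrite /= lee_fin.
    have ma : measurable_fun setT (abse \o (EFin \o f)) by exact: measurableT_comp.
    exact: (measurable_fun_fubini_tonelli_G (m1 := m1) _ ma).
  - move=> y _; apply: le_abse_integral => //; exact: measurableT_comp.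
(* Inner integrals may be infinite on a null set, where [fine] replaces them by 0; the outer
   integral does not notice. *)
have h (d : measure_display) (T : measurableType d) (m : {measure set T -> \bar R}) (F : T -> \bar R) :
    m.-integrable setT F -> (\int[m]_x (fine (F x))%:E = \int[m]_x F x)%E.
  move=> Fi; have mF := measurable_int _ Fi; apply: ae_eq_integral => //.
    by apply/measurable_EFinP; apply: (measurableT_comp _ mF); exact: fine_measurable.
  have := integrable_ae measurableT Fi; apply: filterS => x /(_ I) xf _.
  by rewrite fineK.
by rewrite (h _ _ _ _ iF) (h _ _ _ _ iG); congr fine; exact: Fubini fi.
Qed.

(** Absolute integrability is verified in the order in which a bound is at hand: the majorant b is
    integrated over x first and leaves at most c, which is integrable. Tonelli turns this into
    integrability for the product measure. *)
Lemma complex_fubini (K : T1 -> T2 -> C) (b : T1 -> T2 -> R) (c : T2 -> R) :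
  cmf (fun q : T1 * T2 => K q.1 q.2) ->
  measurable_fun setT (fun q : T1 * T2 => b q.1 q.2) ->
  (forall x y, cabs (K x y) <= b x y) ->
  measurable_fun setT c ->
  (forall y, \int[m1]_x (b x y)%:E <= (c y)%:E)%E ->
  (\int[m2]_y (c y)%:E < +oo)%E ->
  cintg m1 (fun x => cintg m2 (K x)) = cintg m2 (fun y => cintg m1 (K^~ y)).
Proof.
move=> [K1 K2] mb Kb mc bc cfin.
have b0 x y : 0 <= b x y := le_trans (cabs_ge0 _) (Kb x y).
have bfin : (\int[m2]_y \int[m1]_x (b x y)%:E < +oo)%E.
  apply: le_lt_trans cfin; apply: ge0_le_integral => //.
  - by move=> y _; apply: integral_ge0 => x _; rewrite lee_fin.
  - apply: (measurable_fun_fubini_tonelli_G (m1 := m1) (fun q => (b q.1 q.2)%:E)).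
      exact/measurable_EFinP.
    by move=> q; rewrite lee_fin.
  - exact/measurable_EFinP.
have bi : (m1 \x m2)%E.-integrable setT (EFin \o (fun q => b q.1 q.2)).
  apply/(@integrable21ltyP _ _ _ _ _ m1 m2); first exact/measurable_EFinP.
  under eq_integral => y _.
    under eq_integral => x _ do
      rewrite /= ger0_norm//.
    over.
  exact: bfin.
have h (u : T1 * T2 -> R) : measurable_fun setT u -> (forall q : T1 * T2, `|u q| <= b q.1 q.2) ->
  (m1 \x m2)%E.-integrable setT (EFin \o u).
  move=> mu ub; exact: (rintegrable_le mu bi).
apply: complex_ext => /=.
  apply: (real_fubini (f := fun q => complex.Re (K q.1 q.2))); apply: h => // q.
  exact: (le_trans (Re_le_cabs _)).
apply: (real_fubini (f := fun q => complex.Im (K q.1 q.2))); apply: h => // q.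
exact: (le_trans (Im_le_cabs _)).
Qed.

End fubini.

Section plane_integral.
Variable R : realType.
Local Notation C := R[i].
Local Notation P := (measurableTypeR R * measurableTypeR R)%type.
Implicit Types (u : C -> R) (g : C -> C).

Definition RI u : \bar R := (\int[@mu2 R]_q (u (toC q))%:E)%E.
Definition CI g : C := cintg (@mu2 R) (fun q => g (toC q)).
Definition rint u := rintegrable (@mu2 R) (fun q => u (toC q)).
Definition cint g := cintegrable (@mu2 R) (fun q => g (toC q)).

Lemma rint_ge0 u : rmeas u -> (forall z, 0 <= u z) -> (RI u < +oo)%E -> rint u.
Proof.
move=> mu u0 ufin; apply/integrableP; split; first exact/measurable_EFinP.
rewrite (_ : (\int[_]_(x in _) _)%E = RI u)//; apply: eq_integral => q _ /=.
by rewrite ger0_norm.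
Qed.

Lemma RI_le u v : (forall z, 0 <= u z) -> rmeas u -> rmeas v ->
  (forall z, u z <= v z) -> (RI u <= RI v)%E.
Proof.
move=> u0 mu mv uv; apply: ge0_le_integral => //; try exact/measurable_EFinP.
all: by move=> q _; rewrite lee_fin.
Qed.

Lemma RID u v : (forall z, 0 <= u z) -> (forall z, 0 <= v z) -> rmeas u -> rmeas v ->
  RI (fun z => u z + v z) = (RI u + RI v)%E.
Proof.
move=> u0 v0 mu mv; rewrite /RI; under eq_integral do rewrite EFinD.
rewrite ge0_integralD//; try exact/measurable_EFinP.
all: by move=> q _; rewrite lee_fin.
Qed.

Lemma RIZ (k : R) u : 0 <= k -> (forall z, 0 <= u z) -> rmeas u ->
  RI (fun z => k * u z) = (k%:E * RI u)%E.
Proof.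
move=> k0 u0 mu; rewrite /RI; under eq_integral do rewrite EFinM.
rewrite ge0_integralZl_EFin//; last exact/measurable_EFinP.
by move=> q _; rewrite lee_fin.
Qed.

Lemma mu2_point (z : C) : mu2 (toC (R:=R) @^-1` [set z]) = 0.
Proof.
rewrite (_ : _ @^-1` _ = [set complex.Re z] `*` [set complex.Im z]); last first.
  by case: z => a b; apply/seteqP; split=> -[x y] /=; rewrite /toC /= => -[-> ->].
by rewrite mu2X// lebesgue_measure_set1 mul0e.
Qed.

Lemma measurable_point (z : C) : measurable (toC (R:=R) @^-1` [set z] : set P).
Proof.
rewrite (_ : _ @^-1` _ = [set complex.Re z] `*` [set complex.Im z]); last first.
  by case: z => a b; apply/seteqP; split=> -[x y] /=; rewrite /toC /= => -[-> ->].
by apply: measurableX.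
Qed.

Lemma ae_neq (z : C) : {ae @mu2 R, forall q, toC q != z}.
Proof.
exists (toC (R:=R) @^-1` [set z]); split; first exact: measurable_point.
  exact: mu2_point.
by move=> q /= /negP; rewrite negbK => /eqP.
Qed.

(** Partial fraction identities break down at the poles, where inverses take the value 0; the
    kernels that occur have at most two poles. *)
Lemma eq_CI_off (z z' : C) g h : cmeas g -> cmeas h ->
  (forall w, w != z -> w != z' -> g w = h w) -> CI g = CI h.
Proof.
move=> mg mh gh; apply: eq_cintg_ae => //.
have F : Filter (almost_everywhere (@mu2 R)) := ae_filter_ringOfSetsType (@mu2 R).
by apply: (@filterS2 _ _ F _ _ _ _ (ae_neq z) (ae_neq z')) => q; exact: gh.
Qed.

Lemma RI_shift (a : C) u : rmeas u -> (forall z, 0 <= u z) ->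
  RI (fun z => u (a + z)) = RI u.
Proof.
move=> mu u0; rewrite [RHS](ge0_integral_affine a ltr01 mu u0) expr1n mul1e.
by apply: eq_integral => q _; rewrite mul1r.
Qed.

Lemma Rintegral_shift (a : C) u : rint u ->
  (\int[@mu2 R]_q u (a + toC q) = \int[@mu2 R]_q u (toC q))%R.
Proof.
move=> iu; have mu : rmeas u by exact: rintegrable_measurable iu.
rewrite /Rintegral; congr fine.
have h v : rmeas v -> (forall z, 0 <= v z) -> RI (fun z => v (a + z)) = RI v.
  exact: RI_shift.
rewrite [LHS]integralE [RHS]integralE; congr (_ - _)%E.
  transitivity (RI (fun z => Num.max (u (a + z)) 0)).
    by apply: eq_integral => q _; rewrite funeposE EFin_max.
  rewrite (h (fun z => Num.max (u z) 0)); last 2 first.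
  - exact: measurable_maxr.
  - by move=> z; rewrite le_max lexx orbT.
  by apply: eq_integral => q _; rewrite funeposE EFin_max.
transitivity (RI (fun z => Num.max (- u (a + z)) 0)).
  by apply: eq_integral => q _; rewrite funenegE EFin_max.
rewrite (h (fun z => Num.max (- u z) 0)); last 2 first.
- by apply: measurable_maxr => //; exact: measurable_funN.
- by move=> z; rewrite le_max lexx orbT.
by apply: eq_integral => q _; rewrite funenegE EFin_max.
Qed.

Lemma CI_shift (a : C) g : cint g -> CI (fun z => g (a + z)) = CI g.
Proof.
move=> [i1 i2]; apply: complex_ext => /=.
  exact: (Rintegral_shift a (u := fun z => complex.Re (g z))).
exact: (Rintegral_shift a (u := fun z => complex.Im (g z))).
Qed.

End plane_integral.

(** * The Cauchy transform *)

Section kernel.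
Variable R : realType.
Variable th : R.
Hypotheses (th0 : 0 < th) (th1 : th < 1).
Implicit Types x y r d e : R.

(** The power x^-(1 + th) for x > 0, with value 0 at x = 0. It is a little more singular than the
    Cauchy kernel; the surplus th is what later pays for continuity and smallness. *)
Definition kern x : R := x^-1 * (x `^ th)^-1.

Lemma kern_ge0 x : 0 <= x -> 0 <= kern x.
Proof. by move=> x0; rewrite mulr_ge0// invr_ge0// powR_ge0. Qed.

Lemma kern_small x r : 0 <= x -> x <= r -> x^-1 <= r `^ th * kern x.
Proof.
move=> x0 xr; have [->|xn0] := eqVneq x 0; first by rewrite /kern invr0 mul0r mulr0.
have xp : 0 < x by rewrite lt_def xn0.
rewrite /kern mulrCA ler_peMr ?invr_ge0// ler_pdivlMr ?powR_gt0// mul1r.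
by apply: ge0_ler_powR; rewrite ?nnegrE ?(ltW th0)// (le_trans x0).
Qed.

Lemma inv_le_kern x : 0 <= x -> x^-1 <= 1 + kern x.
Proof.
move=> x0; have [x1|x1] := leP x 1.
  by rewrite (le_trans (kern_small x0 x1))// powR1 mul1r lerDr.
apply: (@le_trans _ _ 1); last by rewrite lerDl kern_ge0.
by rewrite invf_le1 ?(lt_trans _ x1)// ltW.
Qed.

(** For x = |z - w|, y = |z' - w| and d = |z - z'| the left side is |1/(z-w) - 1/(z'-w)|. If x <= y,
    then d <= 2y; splitting d = d^th d^(1-th) and trading the second factor for 2 y^(1-th) leaves a
    singularity at the nearer point only. *)
Lemma kern_hoelder x y d : 0 < x -> 0 < y -> 0 <= d -> d <= x + y ->
  d / (x * y) <= 2 * d `^ th * (kern x + kern y).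
Proof.
have th2 : 0 <= 1 - th by rewrite subr_ge0 ltW.
wlog xy : x y / x <= y => [H x0 y0 d0 dxy|x0 y0 d0 dxy].
  have [xy|yx] := leP x y; first exact: H.
  by rewrite [x * y]mulrC [kern x + _]addrC; apply: H; rewrite ?(ltW yx)// addrC.
have [->|dn0] := eqVneq d 0; first by rewrite mul0r !mulr_ge0 ?powR_ge0 ?addr_ge0 ?kern_ge0 ?ltW.
have dp : 0 < d by rewrite lt_def dn0.
have split1 z : 0 < z -> z = z `^ th * z `^ (1 - th).
  by move=> z0; rewrite -powRD ?subrKC ?powRr1 ?ltW// gt_eqF ?implybT.
have h1 : d `^ (1 - th) <= 2 * y `^ (1 - th).
  apply: (@le_trans _ _ ((2 * y) `^ (1 - th))).
    by apply: ge0_ler_powR; rewrite ?nnegrE ?mulr_ge0// ?(ltW y0)//; lra.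
  rewrite powRM ?(ltW y0)// ler_wpM2r ?powR_ge0//.
  by apply: ler1_powR; rewrite ?ler1n// gerBl ltW.
apply: (@le_trans _ _ (2 * d `^ th * kern x)); last first.
  by rewrite ler_wpM2l ?mulr_ge0 ?powR_ge0// lerDl kern_ge0// ltW.
rewrite ler_pdivrMr ?mulr_gt0// {1}(split1 d dp) /kern.
have -> : 2 * d `^ th * (x^-1 * (x `^ th)^-1) * (x * y) =
  d `^ th * (2 * (y / x `^ th)).
  by field; rewrite !gt_eqF ?powR_gt0.
rewrite ler_wpM2l ?powR_ge0// (le_trans h1)// ler_wpM2l//.
rewrite ler_pdivlMr ?powR_gt0// {2}(split1 y y0) mulrC ler_wpM2r ?powR_ge0//.
by apply: ge0_ler_powR; rewrite ?nnegrE ?(ltW th0) ?(ltW x0) ?(ltW y0).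
Qed.

(** The left side is the error of replacing 1/w, |w| = x, by its regularization at scale e. It
    behaves like 1/x for x <= e and like e^2/x^3 beyond, and in both ranges e^th x^-(1+th)
    dominates. *)
Lemma kern_regularized x e : 0 <= x -> 0 < e ->
  e ^+ 2 / (x * (x ^+ 2 + e ^+ 2)) <= e `^ th * kern x.
Proof.
move=> x0 e0; have [->|xn0] := eqVneq x 0; first by rewrite mul0r /kern !invr0 mul0r !mulr0.
have xp : 0 < x by rewrite lt_def xn0.
have q0 : 0 < x ^+ 2 + e ^+ 2 by rewrite ltr_wpDl ?sqr_ge0// exprn_gt0.
rewrite ler_pdivrMr ?mulr_gt0// /kern.
have -> : e `^ th * (x^-1 * (x `^ th)^-1) * (x * (x ^+ 2 + e ^+ 2)) =
  e `^ th * (x ^+ 2 + e ^+ 2) / x `^ th.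
  by field; rewrite !gt_eqF ?powR_gt0.
rewrite ler_pdivlMr ?powR_gt0//.
have [xe|ex] := leP x e.
  rewrite mulrC ler_pM ?powR_ge0 ?sqr_ge0//.
    by apply: ge0_ler_powR; rewrite ?nnegrE ?(ltW th0) ?(ltW e0).
  by rewrite lerDr sqr_ge0.
have [t t1 xt] : exists2 t, 1 <= t & x = e * t.
  exists (x / e); first by rewrite ler_pdivlMr// mul1r ltW.
  by rewrite mulrC divfK// gt_eqF.
have t0 : 0 <= t by rewrite (le_trans _ t1).
rewrite {1}xt powRM ?(ltW e0)// mulrCA ler_wpM2l ?powR_ge0//.
apply: (@le_trans _ _ (e ^+ 2 * t)); first by rewrite ler_wpM2l ?sqr_ge0// ler1_powR// ltW.
rewrite (le_trans (y := x ^+ 2))//; last by rewrite lerDl sqr_ge0.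
by rewrite xt exprMn ler_wpM2l ?sqr_ge0// expr2 ler_peMr.
Qed.

End kernel.

Section cauchy_transform.
Variable R : realType.
Local Notation C := R[i].
Local Notation P := (measurableTypeR R * measurableTypeR R)%type.
Variables (th : R) (B : R) (a : C -> R).
Hypotheses (th0 : 0 < th) (th1 : th < 1).

(* The value is 2 pi, but only its positivity matters. *)
Definition kappa : R := fine (RI (fun v : C => 2 / (1 + cabs v ^+ 2) ^+ 2)).

Lemma kappaV_ge0 : 0 <= kappa^-1.
Proof.
rewrite invr_ge0 fine_ge0//; apply: integral_ge0 => q _; rewrite lee_fin.
by rewrite divr_ge0// sqr_ge0.
Qed.

Definition cauchyT (u : C -> C) (z : C) : C :=
  (kappa^-1)%:C * CI (fun w => u w / (z - w)).

(** The function a is to be a common majorant of all densities. The uniform bound on its potentials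
    at the exponent 1 + th gives boundedness of the Cauchy transform, Hölder continuity of order th
    and smallness on small disks, so nothing else about a has to be remembered. *)
Definition kato := [/\ rmeas a, forall z, 0 <= a z, (RI a <= B%:E)%E &
  forall z, (RI (fun w => (a w * kern th (cabs (z - w)))%R) <= B%:E)%E].

Hypothesis ka : kato.
Implicit Types (z w : C) (u v : C -> C).

Definition adm (M : R) (u : C -> C) := cmeas u /\ forall w, cabs (u w) <= M * a w.

Lemma cmeas_id : cmeas (@id C).
Proof.
have h b : rmeas (@pcoord R b) by apply: cts_measurable => z; exact: cts_coord.
by split; [exact: (h true)|exact: (h false)].
Qed.

Lemma cmeas_sub (z : C) : cmeas (fun w => z - w).
Proof. by apply: cmfB; [exact: cmf_cst|exact: cmeas_id]. Qed.

Lemma kato_B_ge0 : 0 <= B.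
Proof.
have [_ a0 h _] := ka; rewrite -lee_fin (le_trans _ h)// integral_ge0// => q _.
by rewrite lee_fin.
Qed.

Lemma kern_measurable d (T : measurableType d) (f : T -> C) : cmf f ->
  measurable_fun setT (fun x => kern th (cabs (f x))).
Proof.
move=> mf; apply: measurable_funM; first exact/measurable_funV/measurable_cabs.
apply: measurable_funV.
exact: (measurableT_comp (@measurable_powR R th) (measurable_cabs mf)).
Qed.

Lemma rmeas_kern (z : C) : rmeas (fun w => kern th (cabs (z - w))).
Proof. exact: (kern_measurable (cmeas_sub z)). Qed.

Lemma akern_ge0 z w : 0 <= a w * kern th (cabs (z - w)).
Proof. by have [_ a0 _ _] := ka; rewrite mulr_ge0// kern_ge0// cabs_ge0. Qed.

Lemma rmeas_akern z : rmeas (fun w => a w * kern th (cabs (z - w))).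
Proof. by have [ma _ _ _] := ka; apply: measurable_funM => //; exact: rmeas_kern. Qed.

Lemma rint_a : rint a.
Proof.
have [ma a0 h _] := ka; apply: rint_ge0 => //; exact: le_lt_trans h (ltry _).
Qed.

Lemma rint_akern z : rint (fun w => a w * kern th (cabs (z - w))).
Proof.
have [_ _ _ h] := ka; apply: rint_ge0; [exact: rmeas_akern|exact: akern_ge0|].
exact: le_lt_trans (h z) (ltry _).
Qed.

(** A majorant of a(w) / |z - w| that needs no bound on the distance, from 1/x <= 1 + x^-(1+th). *)
Definition dom (z w : C) : R := a w + a w * kern th (cabs (z - w)).

Lemma dom_ge0 z w : 0 <= dom z w.
Proof. by have [_ a0 _ _] := ka; rewrite addr_ge0// akern_ge0. Qed.

Lemma RI_dom z : (RI (dom z) <= (2 * B)%:E)%E.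
Proof.
have [ma a0 h k] := ka.
rewrite RID//; [|exact: akern_ge0|exact: rmeas_akern].
by rewrite mulr2n mulrDl mul1r EFinD leeD.
Qed.

Lemma rmeas_dom z : rmeas (dom z).
Proof. by have [ma _ _ _] := ka; apply: measurable_funD => //; exact: rmeas_akern. Qed.

Lemma rint_dom z : rint (dom z).
Proof. by apply: rintegrableD; [exact: rint_a|exact: rint_akern]. Qed.

Lemma rintZ (k : R) (u : C -> R) : rint u -> rint (fun z => k * u z).
Proof. exact: rintegrableZ. Qed.

Lemma adm_dom M u z w : 0 <= M -> adm M u -> cabs (u w / (z - w)) <= M * dom z w.
Proof.
move=> M0 [_ uM]; have [_ a0 _ _] := ka; rewrite cabsM cabsV.
apply: (@le_trans _ _ (M * a w * (1 + kern th (cabs (z - w))))).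
  rewrite ler_pM ?cabs_ge0 ?invr_ge0 ?cabs_ge0//.
  exact/(inv_le_kern th0)/cabs_ge0.
by rewrite /dom -mulrA mulrDr mulr1.
Qed.

Lemma cmeas_quot u z : cmeas u -> cmeas (fun w => u w / (z - w)).
Proof. by move=> mu; apply: cmf_div => //; exact: cmeas_sub. Qed.

Lemma adm_cint M u z : 0 <= M -> adm M u -> cint (fun w => u w / (z - w)).
Proof.
move=> M0 hu; have [mu _] := hu; apply: (cintegrable_le (cmeas_quot z mu) (rintZ M (rint_dom z))).
by move=> q; exact: adm_dom.
Qed.

Lemma cauchyT_le_gen u z (v : C -> R) (K : R) : cmeas u -> rint v ->
  (forall w, cabs (u w / (z - w)) <= v w) -> (RI v <= K%:E)%E ->
  cabs (cauchyT u z) <= 2 * kappa^-1 * K.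
Proof.
move=> mu iv uv vK; rewrite cabsM cabs_real ger0_norm ?kappaV_ge0//.
rewrite -mulrA [leRHS]mulrCA ler_wpM2l ?kappaV_ge0//.
exact: (cintg_le (cmeas_quot z mu) iv (fun q => uv (toC q)) vK).
Qed.

Lemma cauchyT_bound M u z : 0 <= M -> adm M u ->
  cabs (cauchyT u z) <= 4 * kappa^-1 * B * M.
Proof.
move=> M0 hu; have [mu _] := hu.
have -> : 4 * kappa^-1 * B * M = 2 * kappa^-1 * (M * (2 * B)) by ring.
apply: (cauchyT_le_gen (v := fun w => M * dom z w)) => //.
- exact/rintZ/rint_dom.
- by move=> w; exact: adm_dom.
- rewrite RIZ//; [|exact: dom_ge0|exact: rmeas_dom].
  by rewrite EFinM lee_wpmul2l ?lee_fin// RI_dom.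
Qed.

(** On the disk of radius rho distances are at most 2 rho, so the Cauchy kernel costs a factor (2
    rho)^th against the more singular one. This factor is the source of the contraction. *)
Lemma cauchyT_small M (rho : R) u z : 0 <= M -> adm M u ->
  (forall w, rho < cabs w -> u w = 0) -> cabs z <= rho ->
  cabs (cauchyT u z) <= 2 * kappa^-1 * ((2 * rho) `^ th * B) * M.
Proof.
move=> M0 hu su zr; have [mu uM] := hu; have [_ a0 _ kB] := ka.
rewrite -mulrA [_ * M]mulrC.
apply: (cauchyT_le_gen (v := fun w => M * ((2 * rho) `^ th * (a w * kern th (cabs (z - w)))))) => //.
- exact/rintZ/rintZ/rint_akern.
- move=> w; have [wr|wr] := ltP rho (cabs w).
    by rewrite su// mul0r cabs0 mulr_ge0// mulr_ge0 ?powR_ge0// akern_ge0.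
  rewrite cabsM cabsV.
  apply: (@le_trans _ _ (M * a w * ((2 * rho) `^ th * kern th (cabs (z - w))))).
    rewrite ler_pM ?cabs_ge0 ?invr_ge0 ?cabs_ge0//.
    apply: kern_small => //; first exact: cabs_ge0.
    by rewrite (le_trans (cabsB _ _))// mulr2n mulrDl mul1r lerD.
  by rewrite le_eqVlt; apply/orP; left; apply/eqP; ring.
- rewrite RIZ//; first rewrite RIZ//; rewrite ?powR_ge0//.
  + rewrite !EFinM !lee_wpmul2l ?lee_fin ?powR_ge0//.
  + exact: akern_ge0.
  + exact: rmeas_akern.
  + by move=> w; rewrite mulr_ge0 ?powR_ge0// akern_ge0.
  + by apply: measurable_funM; [exact: measurable_cst|exact: rmeas_akern].
Qed.

Lemma cauchyT_hoelder M u z z' : 0 <= M -> adm M u ->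
  cabs (cauchyT u z - cauchyT u z') <= 8 * kappa^-1 * B * M * cabs (z - z') `^ th.
Proof.
move=> M0 hu; have [mu uM] := hu; have [_ a0 _ kB] := ka.
rewrite /cauchyT -mulrBr /CI -cintgB; last 2 first.
- exact: (adm_cint z M0 hu).
- exact: (adm_cint z' M0 hu).
rewrite cabsM cabs_real ger0_norm ?kappaV_ge0//.
have -> : 8 * kappa^-1 * B * M * cabs (z - z') `^ th =
  kappa^-1 * (2 * (M * (2 * cabs (z - z') `^ th) * (2 * B))) by ring.
rewrite ler_wpM2l ?kappaV_ge0//.
pose v w := a w * kern th (cabs (z - w)) + a w * kern th (cabs (z' - w)).
have v0 w : 0 <= v w by rewrite addr_ge0 ?akern_ge0.
have mv : rmeas v by apply: measurable_funD; exact: rmeas_akern.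
have K0 : 0 <= M * (2 * cabs (z - z') `^ th) by rewrite !mulr_ge0 ?powR_ge0.
apply: (@cintg_le _ _ R (@mu2 R) _ (fun q => M * (2 * cabs (z - z') `^ th) * v (toC q))
  (M * (2 * cabs (z - z') `^ th) * (2 * B))).
- by apply: cmfB; exact: cmeas_quot.
- by apply: rintegrableZ; apply: rintegrableD; exact: rint_akern.
- move=> q; set w := toC q; rewrite -mulrBr cabsM.
  apply: (@le_trans _ _ (M * a w * ((2 * cabs (z - z') `^ th) *
    (kern th (cabs (z - w)) + kern th (cabs (z' - w)))))); last first.
    by rewrite /v le_eqVlt; apply/orP; left; apply/eqP; ring.
  rewrite ler_pM ?cabs_ge0//.
  (* At z = w or z' = w the difference formula for the inverses fails, and the convention 0^-1 = 0
     leaves a single term; it is still controlled by the one nonzero [kern]. *)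
  have [zw|zw] := eqVneq z w; have [zw'|zw'] := eqVneq z' w.
  + by rewrite zw zw' subrr cabs0 !mulr_ge0 ?powR_ge0// addr_ge0// kern_ge0// cabs_ge0.
  + rewrite zw !subrr invr0 sub0r cabsN cabsV (cabsBC w z').
    have h : 0 <= cabs (z' - w) by exact: cabs_ge0.
    rewrite /kern cabs0 invr0 mul0r add0r mulrCA -mulrA divff ?mulr1.
      by rewrite ler_peMr ?invr_ge0// ler1n.
    by rewrite powR_eq0 cabs_eq0 subr_eq0 (negbTE zw').
  + rewrite zw' !subrr invr0 subr0 cabsV.
    have h : 0 <= cabs (z - w) by exact: cabs_ge0.
    rewrite /kern cabs0 invr0 mul0r addr0 mulrCA -mulrA divff ?mulr1.
      by rewrite ler_peMr ?invr_ge0// ler1n.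
    by rewrite powR_eq0 cabs_eq0 subr_eq0 (negbTE zw).
  + rewrite -subr_eq0 in zw; rewrite -subr_eq0 in zw'.
    have -> : (z - w)^-1 - (z' - w)^-1 = (z' - z) / ((z - w) * (z' - w)).
      by field; rewrite zw zw'.
    rewrite cabsM cabsV cabsM (cabsBC z' z); apply: kern_hoelder => //; rewrite ?cabs_gt0 ?cabs_ge0//.
    have -> : z - z' = (z - w) - (z' - w) by ring.
    exact: cabsB.
- rewrite -/(RI (fun w => M * (2 * cabs (z - z') `^ th) * v w)) RIZ//.
  rewrite [leRHS]EFinM lee_wpmul2l ?lee_fin// RID; try exact: akern_ge0; try exact: rmeas_akern.
  by rewrite mulr2n mulrDl mul1r EFinD leeD.
Qed.

Lemma powR_small (e K : R) : 0 < e -> 0 <= K -> exists2 d : R, 0 < d &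
  forall x, 0 <= x -> x < d -> K * x `^ th < e.
Proof.
move=> e0 K0; have K1 : 0 < K + 1 by rewrite ltr_wpDl.
exists ((e / (K + 1)) `^ th^-1); first by rewrite powR_gt0// divr_gt0.
move=> x x0 xd; apply: (@le_lt_trans _ _ ((K + 1) * x `^ th)).
  by rewrite ler_wpM2r ?powR_ge0// lerDl.
rewrite mulrC -ltr_pdivlMr// (lt_le_trans (gt0_ltr_powR th0 _ _ xd))//.
- by rewrite nnegrE powR_ge0.
- by rewrite -powRrM mulVf ?gt_eqF// powRr1// divr_ge0// ltW.
Qed.

Lemma cauchyT_continuous M u z : 0 <= M -> adm M u ->
  {for z, continuous (cauchyT u)}.
Proof.
move=> M0 hu; apply/cvgC_cabsP => e e0.
have K0 : 0 <= 8 * kappa^-1 * B * M.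
  by rewrite !mulr_ge0 ?kappaV_ge0 ?kato_B_ge0.
have [d d0 hd] := powR_small e0 K0.
apply/nbhs_cabsP; exists d => // w wd.
by rewrite (le_lt_trans (cauchyT_hoelder _ _ M0 hu))// hd ?cabs_ge0.
Qed.

Lemma cts_Re (g : C -> C) z : {for z, continuous g} ->
  {for z, continuous (fun w => complex.Re (g w))}.
Proof.
move=> /cvgC_cabsP h; apply/cts_cabsP => e /h/nbhs_cabsP[d d0 hd]; exists d => // w /hd.
by apply: le_lt_trans; rewrite -cReN -cReD Re_le_cabs.
Qed.

Lemma cts_Im (g : C -> C) z : {for z, continuous g} ->
  {for z, continuous (fun w => complex.Im (g w))}.
Proof.
move=> /cvgC_cabsP h; apply/cts_cabsP => e /h/nbhs_cabsP[d d0 hd]; exists d => // w /hd.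
by apply: le_lt_trans; rewrite -cImN -cImD Im_le_cabs.
Qed.

Lemma cmeas_cts (g : C -> C) : (forall z, {for z, continuous g}) -> cmeas g.
Proof.
move=> cg; split.
  by apply: (@cts_measurable R (fun z => complex.Re (g z))) => z; exact: cts_Re.
by apply: (@cts_measurable R (fun z => complex.Im (g z))) => z; exact: cts_Im.
Qed.

Lemma cmeas_cauchyT M u : 0 <= M -> adm M u -> cmeas (cauchyT u).
Proof. by move=> M0 hu; apply: cmeas_cts => z; exact: cauchyT_continuous hu. Qed.

Lemma cauchyTD M N u v z : 0 <= M -> 0 <= N -> adm M u -> adm N v ->
  cauchyT (fun w => u w + v w) z = cauchyT u z + cauchyT v z.
Proof.
move=> M0 N0 hu hv; rewrite /cauchyT -mulrDr; congr (_ * _); rewrite /CI -cintgD.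
- by apply: eq_cintg => q; rewrite mulrDl.
- exact: (adm_cint z M0 hu).
- exact: (adm_cint z N0 hv).
Qed.

Lemma cauchyTN M u z : 0 <= M -> adm M u ->
  cauchyT (fun w => - u w) z = - cauchyT u z.
Proof.
move=> M0 hu; rewrite /cauchyT -mulrN; congr (_ * _); rewrite /CI -cintgN.
- by apply: eq_cintg => q; rewrite mulNr.
- exact: (adm_cint z M0 hu).
Qed.

Lemma eq_cauchyT u v z : (forall w, u w = v w) -> cauchyT u z = cauchyT v z.
Proof. by move=> uv; congr (_ * _); apply: eq_cintg => q; rewrite uv. Qed.

Lemma cauchyT0 z : cauchyT (fun=> 0) z = 0.
Proof.
have -> : cauchyT (fun=> 0) z = (kappa^-1)%:C * CI (fun=> 0).
  by congr (_ * _); apply: eq_cintg => q; rewrite mul0r.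
rewrite (_ : CI _ = 0) ?mulr0//; apply: complex_ext => /=;
by rewrite Rintegral_cst ?mul0r.
Qed.

Lemma admD M N u v : adm M u -> adm N v -> adm (M + N) (fun w => u w + v w).
Proof.
move=> [mu hu] [mv hv]; split=> [|w]; first exact: cmfD.
by rewrite mulrDl (le_trans (cabsD _ _))// lerD.
Qed.

Lemma admN M u : adm M u -> adm M (fun w => - u w).
Proof. by move=> [mu hu]; split=> [|w]; [exact: cmfN|rewrite cabsN]. Qed.

Lemma admM M K u (b : C -> C) : 0 <= K -> adm M u -> cmeas b -> (forall w, cabs (b w) <= K) ->
  adm (K * M) (fun w => b w * u w).
Proof.
move=> K0 [mu hu] mb hb; split=> [|w]; first exact: cmfM.
by rewrite cabsM -mulrA ler_pM ?cabs_ge0.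
Qed.

Lemma adm_sum (n : nat) (M : R) (F : 'I_n -> C -> C) : (forall i, adm M (F i)) ->
  adm (n%:R * M) (fun w => \sum_i F i w).
Proof.
move=> hF; split; first by apply: cmf_sum => i; have [] := hF i.
move=> w; rewrite (le_trans (cabs_sum _ _ _))//.
rewrite (le_trans (ler_sum _ (fun i _ => (hF i).2 w)))//.
by rewrite sumr_const card_ord mulr_natl mulrnAl.
Qed.

Lemma cauchyT_sum (n : nat) (M : R) (F : 'I_n -> C -> C) z : 0 <= M ->
  (forall i, adm M (F i)) ->
  cauchyT (fun w => \sum_i F i w) z = \sum_i cauchyT (F i) z.
Proof.
move=> M0; elim: n F => [|n IH] F hF.
  by rewrite big_ord0 -[RHS](cauchyT0 z); apply: eq_cauchyT => w; rewrite big_ord0.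
rewrite big_ord_recl -IH; last by move=> i; exact: hF.
rewrite -(cauchyTD z M0 (N := n%:R * M)) ?mulr_ge0//.
- by apply: eq_cauchyT => w; rewrite big_ord_recl.
- by apply: adm_sum => i; exact: hF.
Qed.

End cauchy_transform.

(** * The product of two Cauchy transforms *)

Section product_formula.
Variable R : realType.
Local Notation C := R[i].
Local Notation P := (measurableTypeR R * measurableTypeR R)%type.
Variables (th : R) (B : R) (a : C -> R).
Hypotheses (th0 : 0 < th) (th1 : th < 1) (ka : kato th B a).
Implicit Types (z w : C) (u v m : C -> C).

(* Partial fractions: 1/((z-w)(z-v)) = 1/((z-w)(w-v)) + 1/((z-v)(v-w)). *)
Lemma cauchyT_cauchyT_mul M N u m z : 0 <= M -> 0 <= N -> adm a M u -> adm a N m ->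
  cauchyT u z * cauchyT m z =
  cauchyT (fun w => u w * cauchyT m w + cauchyT u w * m w) z.
Proof.
move=> M0 N0 hu hm.
have [mu uM] := hu; have [mm mN] := hm; have [ma a0 aB kB] := ka.
pose I v x := CI (fun w => v w / (x - w)).
have TI v x : cauchyT v x = (kappa R)^-1%:C * I v x by [].
pose k : C := (kappa R)^-1%:C.
(* This kernel is integrated in both orders: over x first it gives the difference of the values of T
   m at z and w, over w first it gives T u. The factor (z - w) / (z - w) is 1 except at w = z, where
   it is 0 and makes the first evaluation true at the pole as well. *)
pose K w x := k * (u w * m x * ((z - w) / (z - w)) / ((z - x) * (x - w))).
have bT (v : C -> C) L : 0 <= L -> adm a L v -> exists L', 0 <= L' /\ forall x, cabs (cauchyT v x) <= L'.
  move=> L0 hv; exists (4 * (kappa R)^-1 * B * L).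
  split; first by rewrite !mulr_ge0 ?kappaV_ge0 ?(kato_B_ge0 ka).
  by move=> x; apply: (cauchyT_bound th0 ka).
have [Lu [Lu0 hLu]] := bT u M M0 hu; have [Lm [Lm0 hLm]] := bT m N N0 hm.
have mTu := cmeas_cauchyT th0 th1 ka M0 hu.
have mTm := cmeas_cauchyT th0 th1 ka N0 hm.
have adm1 : adm a (Lm * M) (fun w => u w * cauchyT m w).
  have [h1 h2] := admM Lm0 hu mTm hLm.
  by split=> [|w]; [exact: cmfM|rewrite mulrC].
have adm2 : adm a (Lu * N) (fun w => cauchyT u w * m w) by exact: admM.
have F1 w : CI (K w) = u w / (z - w) * (cauchyT m z - cauchyT m w).
  rewrite !TI -/k -mulrBr mulrCA mulrA.
  have [zw|zw] := eqVneq w z.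
    rewrite zw subrr invr0 !mulr0 mul0r -[RHS](mul0r (CI (fun=> 0 : C))) /CI -cintgZ.
      by apply: eq_cintg => q; rewrite /K subrr invr0 !(mulr0, mul0r).
    by split; exact: integrable0.
  rewrite /I /CI -cintgB; last 2 first.
  - exact: (adm_cint th0 ka z N0 hm).
  - exact: (adm_cint th0 ka w N0 hm).
  rewrite -cintgZ; last first.
    apply: cintegrableB; [exact: (adm_cint th0 ka z N0 hm)|exact: (adm_cint th0 ka w N0 hm)].
  apply: (@eq_CI_off R z w (K w) (fun x => k * (u w / (z - w)) * (m x / (z - x) - m x / (w - x)))).
  - apply: cmfM; first exact: cmf_cst.
    apply: cmf_div; last by apply: cmfM; [exact: cmeas_sub|
      apply: cmfB; [exact: cmeas_id|exact: cmf_cst]].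
    apply: cmfM; last exact: cmf_cst.
    by apply: cmfM => //; exact: cmf_cst.
  - apply: cmfM; first exact: cmf_cst.
    by apply: cmfB; apply: cmeas_quot.
  - move=> x xz xw; rewrite /K; move: (k) => k'; field.
    by rewrite !subr_eq0 (eq_sym z x) xz (eq_sym z w) zw (eq_sym w x) xw.
have F2 x : CI (K^~ x) = cauchyT u x * m x / (z - x).
  have E : CI (fun w => k * (m x / (z - x)) * (u w / (x - w))) = k * (m x / (z - x)) * I u x.
    by apply: cintgZ; exact: (adm_cint th0 ka x M0 hu).
  have -> : cauchyT u x * m x / (z - x) = k * (m x / (z - x)) * I u x by rewrite TI -/k; ring.
  rewrite -E; apply: (@eq_CI_off R z x).
  - apply: cmfM; first exact: cmf_cst.
    apply: cmf_div; last by apply: cmfM; [exact: cmf_cst|exact: cmeas_sub].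
    apply: cmfM; last by apply: cmf_div; exact: cmeas_sub.
    by apply: cmfM => //; exact: cmf_cst.
  - apply: cmfM; [exact: cmf_cst|exact: cmeas_quot].
  - move=> w wz wx; rewrite /K divff ?mulr1; last by rewrite subr_eq0 eq_sym.
    by rewrite invfM; ring.
pose L := (kappa R)^-1 * M * N.
have F3 : CI (fun w => CI (K w)) = CI (fun x => CI (K^~ x)).
  (* Two successive kernels, from z to x and from x to w, each dominated by [dom]: the integral over
     w is at most 2 B uniformly in x, and the remaining one over x is finite. *)
  pose b w x := L * dom th a z x * dom th a x w.
  have L0 : 0 <= L by rewrite !mulr_ge0 ?kappaV_ge0.
  apply: (@complex_fubini _ _ _ _ R (@mu2 R) (@mu2 R) (fun p q : P => K (toC p) (toC q))
    (fun p q : P => b (toC p) (toC q))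
    (fun q : P => L * (2 * B) * dom th a z (toC q))).
  - have m1 := cmeas_id R; have e1 := cmf_cst.
    have fst1 (v : C -> C) : cmeas v -> cmf (fun r : P * P => v (toC r.1)).
      by move=> [v1 v2]; split; [exact: (measurableT_comp v1 measurable_fst)|
         exact: (measurableT_comp v2 measurable_fst)].
    have snd1 (v : C -> C) : cmeas v -> cmf (fun r : P * P => v (toC r.2)).
      by move=> [v1 v2]; split; [exact: (measurableT_comp v1 measurable_snd)|
         exact: (measurableT_comp v2 measurable_snd)].
    apply: cmfM; first exact: cmf_cst.
    apply: cmf_div.
      apply: cmfM; first by apply: cmfM; [exact: fst1|exact: snd1].
      exact: (fst1 (fun w => (z - w) / (z - w)) (cmeas_quot z (cmeas_sub z))).
    apply: cmfM; first exact: (snd1 (fun x => z - x) (cmeas_sub z)).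
    by apply: cmfB; [exact: (snd1 id)|exact: (fst1 id)].
  - have mdz : measurable_fun setT (fun r : P * P => dom th a z (toC r.2)).
      exact: (measurableT_comp (rmeas_dom ka z) measurable_snd).
    have ma1 : measurable_fun setT (fun r : P * P => a (toC r.1)).
      exact: (measurableT_comp ma measurable_fst).
    apply: measurable_funM; first by apply: measurable_funM => //; exact: measurable_cst.
    apply: measurable_funD => //; apply: measurable_funM => //.
    apply: kern_measurable; apply: cmfB.
      have [v1 v2] := cmeas_id R.
      by split; [exact: (measurableT_comp v1 measurable_snd)|exact: (measurableT_comp v2 measurable_snd)].
    have [v1 v2] := cmeas_id R.
    by split; [exact: (measurableT_comp v1 measurable_fst)|exact: (measurableT_comp v2 measurable_fst)].
  - move=> p q; set w := toC p; set x := toC q.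
    have -> : K w x = k * ((m x / (z - x)) * (u w / (x - w)) * ((z - w) / (z - w))).
      by rewrite /K invfM; ring.
    have -> : b w x = (kappa R)^-1 * ((N * dom th a z x) * (M * dom th a x w) * 1) by rewrite /b /L; ring.
    rewrite cabsM {1}/k cabs_real ger0_norm ?kappaV_ge0// ler_wpM2l ?kappaV_ge0//.
    rewrite cabsM ler_pM ?cabs_ge0//; last first.
      have [->|zw] := eqVneq (z - w) 0; first by rewrite mul0r cabs0.
      by rewrite divff ?cabs1.
    rewrite cabsM ler_pM ?cabs_ge0//; exact: (adm_dom th0 ka).
  - by apply: measurable_funM; [exact: measurable_cst|exact: (rmeas_dom ka z)].
  - move=> q; set x := toC q.
    have := @RIZ R (L * dom th a z x) (dom th a x).
    rewrite /RI => -> //.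
    + rewrite (_ : L * (2 * B) * dom th a z x = L * dom th a z x * (2 * B)); last by ring.
      rewrite [leRHS]EFinM lee_wpmul2l//; last exact: (RI_dom ka x).
      by rewrite lee_fin mulr_ge0// (dom_ge0 ka).
    + by rewrite mulr_ge0// (dom_ge0 ka).
    + by move=> w; exact: (dom_ge0 ka).
    + exact: (rmeas_dom ka).
  - rewrite -/(RI (fun x => L * (2 * B) * dom th a z x)) RIZ.
    + apply: (@le_lt_trans _ _ ((L * (2 * B))%:E * (2 * B)%:E)%E).
        apply: lee_wpmul2l; last exact: (RI_dom ka z).
        by rewrite lee_fin; apply: mulr_ge0 => //; apply: mulr_ge0 => //; exact: (kato_B_ge0 ka).
      by rewrite -EFinM ltry.
    + by apply: mulr_ge0 => //; apply: mulr_ge0 => //; exact: (kato_B_ge0 ka).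
    + by move=> x; exact: (dom_ge0 ka).
    + exact: (rmeas_dom ka).
rewrite (cauchyTD th0 ka z (mulr_ge0 Lm0 M0) (mulr_ge0 Lu0 N0) adm1 adm2).
rewrite (TI u) (TI (fun w => u w * _)) (TI (fun w => _ * m w)) -/k -mulrDr -mulrA.
congr (_ * _).
have -> : I (fun w => cauchyT u w * m w) z = CI (fun w => CI (K w)).
  by rewrite F3; apply: eq_cintg => q; rewrite F2.
have -> : CI (fun w => CI (K w)) =
    CI (fun w => cauchyT m z * (u w / (z - w)) - u w * cauchyT m w / (z - w)).
  by apply: eq_cintg => q; rewrite F1; ring.
rewrite /CI cintgB; last 2 first.
- by apply: cintegrableZ; exact: (adm_cint th0 ka z M0 hu).
- by apply: (adm_cint th0 ka z _ adm1); rewrite mulr_ge0.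
rewrite cintgZ; last exact: (adm_cint th0 ka z M0 hu).
by rewrite -/(CI (fun w => u w * cauchyT m w / (z - w))) -/(CI (fun w => u w / (z - w))) -/(I u z) /I; ring.
Qed.

End product_formula.

(** * Complex differentiability off the support of the density *)

Section holomorphic_off_support.
Variable R : realType.
Local Notation C := R[i].
Variables (th : R) (B : R) (a : C -> R).
Hypotheses (th0 : 0 < th) (th1 : th < 1) (ka : kato th B a).
Implicit Types (z w : C) (u v m : C -> C).

(** The remainder of the kernel has to be quadratic in h uniformly in w, but only at those w where
    the density does not vanish. *)
Lemma CI_cderiv M u z (d K : R) (phi : C -> C -> C) (psi : C -> C) :
  0 <= M -> adm a M u -> 0 < d -> 0 <= K -> (forall x, cmeas (phi x)) -> cmeas psi ->
  (forall h w, cabs h < d -> u w != 0 -> [/\ cabs (phi (z + h) w) <= K,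
     cabs (psi w) <= K & cabs (phi (z + h) w - phi z w - psi w * h) <= K * cabs h ^+ 2]) ->
  cderiv (fun x => CI (fun w => u w * phi x w)) z (CI (fun w => u w * psi w)).
Proof.
move=> M0 hu d0 K0 mphi mpsi H; have [mu uM] := hu; have [ma a0 aB _] := ka.
have mc (g : C -> C) : cmeas g -> cmeas (fun w => u w * g w) by move=> mg; exact: cmfM.
have ci (g : C -> C) : cmeas g -> (forall w, u w != 0 -> cabs (g w) <= K) ->
    cint (fun w => u w * g w).
  move=> mg gK; apply: (@cintegrable_le _ _ R (@mu2 R) (fun q => u (toC q) * g (toC q))
    (fun q => K * (M * a (toC q)))).
  - exact: cmfM.
  - exact/rintegrableZ/rintegrableZ/(rint_a ka).
  - move=> q; set w := toC q; rewrite cabsM.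
    have [->|uw] := eqVneq (u w) 0; first by rewrite cabs0 mul0r !mulr_ge0.
    by rewrite mulrC ler_pM ?cabs_ge0 ?gK.
have iphi h : cabs h < d -> cint (fun w => u w * phi (z + h) w).
  by move=> hd; apply: ci => // w uw; have [] := H h w hd uw.
have ipsi : cint (fun w => u w * psi w).
  by apply: ci => // w uw; have [] := H 0 w ltac:(by rewrite cabs0) uw.
have iphi0 : cint (fun w => u w * phi z w).
  by have := iphi 0; rewrite addr0 cabs0; exact.
apply: (@cderivM_bound R _ _ _ (2 * (M * K * B)) d) => // h hd.
have -> : CI (fun w => u w * phi (z + h) w) - CI (fun w => u w * phi z w) -
    CI (fun w => u w * psi w) * h =
    CI (fun w => u w * phi (z + h) w - u w * phi z w - h * (u w * psi w)).
  have i1 := iphi h hd.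
  rewrite /CI cintgB; last 2 first.
  - exact: cintegrableB.
  - exact: cintegrableZ.
  by rewrite cintgB// cintgZ// [h * _]mulrC.
have -> : 2 * (M * K * B) * cabs h ^+ 2 = 2 * (M * (K * cabs h ^+ 2) * B) by ring.
have K2 : 0 <= M * (K * cabs h ^+ 2) by rewrite mulr_ge0// mulr_ge0// sqr_ge0.
apply: (@cintg_le _ _ R (@mu2 R) _ (fun q => M * (K * cabs h ^+ 2) * a (toC q))).
- apply: cmfB; last by apply: cmfM; [exact: cmf_cst|exact: (mc psi)].
  by apply: cmfB; [exact: (mc (phi (z + h)))|exact: (mc (phi z))].
- exact/rintegrableZ/(rint_a ka).
- move=> q; set w := toC q.
  have -> : u w * phi (z + h) w - u w * phi z w - h * (u w * psi w) =
    u w * (phi (z + h) w - phi z w - psi w * h) by ring.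
  have [->|uw] := eqVneq (u w) 0; first by rewrite mul0r cabs0 mulr_ge0.
  have [_ _ h3] := H h w hd uw.
  rewrite cabsM mulrAC ler_pM ?cabs_ge0//.
- rewrite -/(RI (fun w => M * (K * cabs h ^+ 2) * a w)) RIZ//.
  by rewrite [leRHS]EFinM lee_wpmul2l ?lee_fin.
Qed.

(** The kernel 1/(z - w) is holomorphic in z away from w. Two derivatives are extracted, because the
    second one will show that derivatives of holomorphic functions are again holomorphic. *)
Lemma cauchyT_off_support M u (V : set C) : 0 <= M -> adm a M u -> open V ->
  (forall w, V w -> u w = 0) ->
  exists g, forall z, V z -> cderiv (cauchyT u) z (g z) /\ exists l, cderiv g z l.
Proof.
move=> M0 hu oV uV; have [mu _] := hu.
have cZ (c : C) (f : C -> C) z l : cderiv f z l -> cderiv (fun x => c * f x) z (c * l).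
  move=> hf e e0; have c1 : 0 < cabs c + 1 by rewrite ltr_wpDl ?cabs_ge0.
  have [d d0 hd] := hf _ (divr_gt0 e0 c1); exists d => // h /hd.
  have -> : c * f (z + h) - c * f z - c * l * h = c * (f (z + h) - f z - l * h) by ring.
  rewrite cabsM => h1; apply: (@le_trans _ _ ((cabs c + 1) * (e / (cabs c + 1) * cabs h))).
    by rewrite ler_pM ?cabs_ge0// lerDl.
  by rewrite mulrA mulrCA divff ?mulr1 ?gt_eqF.
exists (fun z => (kappa R)^-1%:C * CI (fun w => u w * - (z - w)^-1 ^+ 2)) => z Vz.
have /openP_cabs/(_ _ Vz)[d' d'0 hd'] := oV.
(* Half of the distance to the complement of V, so that z + h with |h| < d stays at distance at
   least d from the support. *)
pose d := d' / 2; have d0 : 0 < d by rewrite divr_gt0.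
have far w : u w != 0 -> 2 * d <= cabs (z - w).
  move=> uw; rewrite leNgt; apply/negP => h; move/eqP: uw; apply; apply/uV/hd'.
  by rewrite cabsBC (lt_le_trans h)// /d mulrC divfK.
have far' w h : cabs h < d -> u w != 0 ->
    [/\ z - w != 0, z + h - w != 0, (cabs (z - w))^-1 <= d^-1 & (cabs (z + h - w))^-1 <= d^-1].
  move=> hd uw; have f1 := far w uw.
  have f2 : d <= cabs (z + h - w).
    have : cabs (z - w) <= cabs (z + h - w) + cabs h.
      by rewrite (_ : z - w = (z + h - w) - h) ?cabsB//; ring.
    lra.
  have f3 : d <= cabs (z - w) by lra.
  by split; rewrite -?cabs_gt0 ?lef_pV2 ?posrE// (lt_le_trans d0).
have D0 : 0 <= d^-1 by rewrite invr_ge0 ltW.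
split.
  apply: cZ; apply: (@CI_cderiv M u z d (d^-1 + d^-1 ^+ 2 + d^-1 ^+ 3)
    (fun x w => (x - w)^-1) (fun w => - (z - w)^-1 ^+ 2)) => //.
  - by rewrite !addr_ge0 ?exprn_ge0.
  - by move=> x; apply/cmfV/cmeas_sub.
  - by apply: cmfN; apply: cmfM; apply/cmfV/cmeas_sub.
  move=> h w hd uw; have [n1 n2 c1 c2] := far' w h hd uw.
  have s2 : d^-1 <= d^-1 + d^-1 ^+ 2 + d^-1 ^+ 3 by rewrite -addrA lerDl addr_ge0 ?exprn_ge0.
  have s3 : d^-1 ^+ 2 <= d^-1 + d^-1 ^+ 2 + d^-1 ^+ 3.
    by rewrite addrAC lerDr addr_ge0 ?exprn_ge0.
  have s4 : d^-1 ^+ 3 <= d^-1 + d^-1 ^+ 2 + d^-1 ^+ 3 by rewrite lerDr addr_ge0 ?exprn_ge0.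
  split.
  - by rewrite cabsV (le_trans c2).
  - rewrite cabsN expr2 cabsM cabsV (le_trans _ s3)// expr2 ler_pM ?invr_ge0 ?cabs_ge0//.
  - have -> : (z + h - w)^-1 - (z - w)^-1 - - (z - w)^-1 ^+ 2 * h =
       (z + h - w)^-1 * ((z - w)^-1 * (z - w)^-1) * (h * h).
      by field; rewrite n1 n2.
    rewrite !cabsM !cabsV -[cabs h * cabs h]expr2 ler_wpM2r ?sqr_ge0// (le_trans _ s4)//.
    by rewrite !exprS expr0 mulr1 !ler_pM ?mulr_ge0 ?invr_ge0 ?cabs_ge0.
(* The constant is a sum in order that each bound to be checked is one of its terms; 5 = 3 + 2
   arises from |3 + 2 h / (z - w)| with |h| <= |z - w|. *)
eexists; apply: cZ; apply: (@CI_cderiv M u z d (d^-1 ^+ 2 + 2 * d^-1 ^+ 3 + 5 * d^-1 ^+ 4)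
    (fun x w => - (x - w)^-1 ^+ 2) (fun w => 2 * (z - w)^-1 ^+ 3)) => //.
- by rewrite !addr_ge0 ?mulr_ge0 ?exprn_ge0.
- by move=> x; apply: cmfN; apply: cmfM; apply/cmfV/cmeas_sub.
- apply: cmfM; first exact: cmf_cst.
  by apply: cmfM; [|apply: cmfM]; apply/cmfV/cmeas_sub.
move=> h w hd uw; have [n1 n2 c1 c2] := far' w h hd uw.
set K := d^-1 ^+ 2 + 2 * d^-1 ^+ 3 + 5 * d^-1 ^+ 4.
have s2 : d^-1 ^+ 2 <= K by rewrite /K -addrA lerDl addr_ge0 ?mulr_ge0 ?exprn_ge0.
have s3 : 2 * d^-1 ^+ 3 <= K by rewrite /K addrAC lerDr addr_ge0 ?mulr_ge0 ?exprn_ge0.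
have s4 : 5 * d^-1 ^+ 4 <= K by rewrite /K lerDr addr_ge0 ?mulr_ge0 ?exprn_ge0.
have c20 : cabs (2 : C) = 2 by rewrite -(rmorph_nat (real_complex R) 2) cabs_real ger0_norm.
split.
- by rewrite cabsN expr2 cabsM cabsV (le_trans _ s2)// expr2 ler_pM ?invr_ge0 ?cabs_ge0.
- rewrite cabsM c20 (le_trans _ s3)// ler_wpM2l// !exprS expr0 !mulr1 !cabsM !cabsV.
  by rewrite !ler_pM ?mulr_ge0 ?invr_ge0 ?cabs_ge0.
- have -> : - (z + h - w)^-1 ^+ 2 - - (z - w)^-1 ^+ 2 - 2 * (z - w)^-1 ^+ 3 * h =
     - ((z + h - w)^-1 * ((z + h - w)^-1 * ((z - w)^-1 * (z - w)^-1)) * (3 + 2 * (h * (z - w)^-1)) * (h * h)).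
    by field; rewrite n1 n2.
  rewrite cabsN !cabsM !cabsV -[cabs h * cabs h]expr2 ler_wpM2r ?sqr_ge0// (le_trans _ s4)// mulrC.
  rewrite ler_pM ?cabs_ge0 ?mulr_ge0 ?invr_ge0 ?cabs_ge0//.
    rewrite (le_trans (cabsD _ _))// !cabsM c20 cabsV.
    have -> : cabs (3 : C) = 3 by rewrite -(rmorph_nat (real_complex R) 3) cabs_real ger0_norm.
    have : cabs h * (cabs (z - w))^-1 <= 1.
      apply: (@le_trans _ _ (d * d^-1)); last by rewrite divff ?gt_eqF.
      by apply: ler_pM => //; rewrite ?cabs_ge0 ?invr_ge0 ?cabs_ge0// (ltW hd).
    lra.
  by rewrite !exprS expr0 mulr1 !ler_pM ?mulr_ge0 ?invr_ge0 ?cabs_ge0.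
Qed.

End holomorphic_off_support.

(** * Integrability of L^p functions against the Cauchy kernel *)

Section dyadic.
Variable R : realType.
Local Notation C := R[i].
Local Notation P := (measurableTypeR R * measurableTypeR R)%type.

Definition ballf (z : C) (r : R) (w : C) : R := if cabs (w - z) <= r then 1 else 0.

Lemma ballf_ge0 z r w : 0 <= ballf z r w. Proof. by rewrite /ballf; case: ifP. Qed.

Lemma rmeas_ballf z r : rmeas (ballf z r).
Proof.
have mc : measurable_fun setT (fun q : P => cabs (toC q - z)).
  by apply: measurable_cabs; apply: cmfB; [exact: cmeas_id|exact: cmf_cst].
have mb : measurable_fun setT (fun q : P => cabs (toC q - z) <= r).
  by apply: measurable_fun_ler => //; exact: measurable_cst.
by apply: measurable_fun_ifT => //; exact: measurable_cst.
Qed.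

Lemma integral_indicX (A B : set (measurableTypeR R)) : measurable A -> measurable B ->
  (\int[@mu2 R]_q (\1_(A `*` B) q)%:E = lebesgue_measure A * lebesgue_measure B)%E.
Proof.
move=> mA mB; rewrite integral_indic//; last exact: measurableX.
by rewrite setIT; exact: mu2X.
Qed.

Lemma RI_ballf z r : 0 <= r -> (RI (ballf z r) <= ((2 * r) ^+ 2)%:E)%E.
Proof.
move=> r0.
pose S : set P := `[complex.Re z - r, complex.Re z + r]%classic `*`
  `[complex.Im z - r, complex.Im z + r]%classic.
have mS : measurable S by apply: measurableX; exact: measurable_itv.
apply: (@le_trans _ _ (\int[@mu2 R]_q (\1_S q)%:E)%E).
  have m1 : measurable_fun setT (fun q : P => (ballf z r (toC q))%:E).
    by apply/measurable_EFinP; exact: rmeas_ballf.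
  have m2 : measurable_fun setT (fun q : P => (\1_S q)%:E : \bar R).
    by apply/measurable_EFinP; exact: measurable_indic.
  apply: ge0_le_integral => //.
    by move=> q _; rewrite lee_fin ballf_ge0.
  move=> [x y] _; rewrite lee_fin /ballf indicE.
  case: ifPn => h; last by rewrite ler0n.
  have -> : (x, y) \in S; last by [].
  rewrite inE /S /=; move: h.
    move=> h; have := le_trans (Re_le_cabs _) h; have := le_trans (Im_le_cabs _) h.
    rewrite !reimE /= !ler_norml !in_itv /= => /andP[h1 h2] /andP[h3 h4].
    by split; apply/andP; split; lra.
rewrite integral_indicX; try exact: measurable_itv.
rewrite !lebesgue_measure_itv /= !lte_fin.
have [->|rn0] := eqVneq r 0; first by rewrite subr0 addr0 ltxx mul0e mulr0 expr0n.
have rp : 0 < r by rewrite lt_def rn0.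
have h (x : R) : x - r < x + r by lra.
rewrite !h -!EFinB -EFinM lee_fin le_eqVlt; apply/orP; left; apply/eqP; ring.
Qed.

(** A radial integral without polar coordinates: f is at most the sum over k of c k times the
    indicator of the disk of radius r k, and the integrals of the terms are dominated by a geometric
    series. *)
Lemma dyadic_integral (z : C) (f : C -> R) (c r : nat -> R) (A q : R) :
  rmeas f -> (forall w, 0 <= f w) -> (forall k, 0 <= c k) -> (forall k, 0 <= r k) ->
  0 <= A -> 0 <= q -> q < 1 -> (forall k, c k * (2 * r k) ^+ 2 <= A * q ^+ k) ->
  (forall w, f w = 0 \/ exists k, f w <= c k /\ cabs (w - z) <= r k) ->
  (RI f <= (A / (1 - q))%:E)%E.
Proof.
move=> mf f0 c0 r0 A0 q0 q1 cr fc.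
pose t k (p : P) : \bar R := (c k * ballf z (r k) (toC p))%:E.
have t0 k p : (0 <= t k p)%E by rewrite lee_fin mulr_ge0// ballf_ge0.
have mt k : measurable_fun setT (t k).
  by apply/measurable_EFinP/measurable_funM; [exact: measurable_cst|exact: rmeas_ballf].
apply: (@le_trans _ _ (\int[@mu2 R]_p (\sum_(k <oo) t k p))%E).
  apply: ge0_le_integral => //.
  - by move=> p _; rewrite lee_fin.
  - exact/measurable_EFinP.
  - exact: ge0_emeasurable_sum.
  - move=> p _; have [->|[k [h1 h2]]] := fc (toC p).
      by apply: nneseries_ge0 => n _ _; exact: t0.
    apply: (@le_trans _ _ (t k p)).
      by rewrite /t /ballf h2 mulr1 lee_fin.
    by rewrite (@nneseriesD1 _ _ k)// leeDl// nneseries_ge0.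
rewrite integral_nneseries//.
apply: lime_le; first by apply: is_cvg_nneseries => n _ _; exact: integral_ge0.
apply: nearW => n.
apply: (@le_trans _ _ (\sum_(0 <= k < n) (A * q ^+ k)%:E)%E).
  apply: lee_sum => k _; apply: (@le_trans _ _ ((c k)%:E * ((2 * r k) ^+ 2)%:E)%E).
    have := @RIZ R (c k) (ballf z (r k)) (c0 k) (ballf_ge0 z (r k)) (rmeas_ballf z (r k)).
    by rewrite /RI => ->; rewrite lee_wpmul2l ?lee_fin// RI_ballf.
  by rewrite -EFinM lee_fin.
rewrite sumEFin lee_fin -mulr_sumr ler_wpM2l//.
have qn1 : 0 < 1 - q by rewrite subr_gt0.
rewrite -[leRHS]mul1r ler_pdivlMr// mulrC big_mkord.
have : (1 - q) * (\sum_(k < n) q ^+ k) = 1 - q ^+ n by rewrite -opprB mulNr -subrX1 opprB.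
by move=> ->; rewrite gerBl exprn_ge0.
Qed.

Lemma pow2_gt (x : R) : exists k : nat, x < 2 ^+ k.
Proof. by exists (Num.bound x); exact: upper_nthrootP. Qed.

Lemma pow2_bracket_small (x : R) : 0 < x -> x <= 1 ->
  exists k : nat, 2^-1 ^+ k.+1 < x <= 2^-1 ^+ k.
Proof.
move=> x0 x1.
have ex : exists k, 2^-1 ^+ k.+1 < x.
  have [k hk] := pow2_gt x^-1; exists k; rewrite exprVn invf_plt ?posrE ?exprn_gt0//.
  by rewrite (lt_le_trans hk)// ler_eXn2l ?ltr1n.
have [k hk mk] := ex_minnP ex; exists k; rewrite hk/=.
case: k hk mk => [|k] hk mk; first by rewrite expr0.
by rewrite leNgt; apply/negP => /mk; rewrite ltnn.
Qed.

Lemma pow2_bracket_large (x : R) : exists k : nat, x <= 2 ^+ k /\ (k = 0%N \/ 2 ^+ k <= 2 * x).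
Proof.
have ex : exists k, x <= 2 ^+ k by have [k hk] := pow2_gt x; exists k; exact: ltW.
have [k hk mk] := ex_minnP ex; exists k; split=> //.
case: k hk mk => [|k] hk mk; [by left|right].
rewrite exprS ler_pM2l// leNgt; apply/negP => /ltW/mk; by rewrite ltnn.
Qed.

Lemma ball_power_integral (s : R) : 0 < s -> s < 2 -> exists2 K : R, 0 <= K &
  forall z, (RI (fun w => (ballf z 1 w * (cabs (w - z) `^ s)^-1)%R) <= K%:E)%E.
Proof.
move=> s0 s2; pose t : R := 2 `^ s.
have t0 : 0 < t by rewrite powR_gt0.
have t4 : t < 4.
  have -> : 4 = 2 `^ 2 :> R by rewrite powR_mulrn// expr2; ring.
  by rewrite /t /powR pnatr_eq0 /= ltr_expR ltr_pM2r// ln_gt0// ltr1n.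
exists (4 * t / (1 - t / 4)).
  by rewrite divr_ge0 ?mulr_ge0 ?(ltW t0)// subr_ge0 ltW// ltr_pdivrMr// mul1r.
(* On the shell 2^-(k+1) < |w - z| <= 2^-k the function is at most 2^(s (k+1)), and the enclosing
   square has area 4 * 4^-k. The ratio 2^s / 4 is below 1 because s < 2. *)
move=> z; apply: (@dyadic_integral z _ (fun k => t ^+ k.+1) (fun k => 2^-1 ^+ k)).
- apply: measurable_funM; first exact: rmeas_ballf.
  apply: measurable_funV; apply: (measurableT_comp (@measurable_powR R s)).
  by apply: measurable_cabs; apply: cmfB; [exact: cmeas_id|exact: cmf_cst].
- by move=> w; rewrite mulr_ge0 ?ballf_ge0 ?invr_ge0 ?powR_ge0.
- by move=> k; rewrite exprn_ge0 ?ltW.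
- by move=> k; rewrite exprn_ge0// invr_ge0.
- by rewrite mulr_ge0// ltW.
- by rewrite divr_ge0// ltW.
- by rewrite ltr_pdivrMr// mul1r.
- move=> k; rewrite le_eqVlt; apply/orP; left; apply/eqP.
  have E : (2^-1 ^+ k) ^+ 2 = 4^-1 ^+ k :> R.
    by rewrite -exprM mulnC exprM; congr (_ ^+ _); field.
  by rewrite exprMn E (exprS t) [(t / 4) ^+ k]exprMn; ring.
- move=> w; rewrite /ballf; case: (leP (cabs _) 1) => x1; last by left; rewrite mul0r.
  have [->|xn0] := eqVneq (cabs (w - z)) 0.
    by left; rewrite powR0 ?gt_eqF// invr0 mulr0.
  right; have x0 : 0 < cabs (w - z) by rewrite lt_def xn0 cabs_ge0.
  have [k /andP[k1 k2]] := pow2_bracket_small x0 x1; exists k; split=> //.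
  have ti : 2^-1 `^ s = t^-1 by rewrite -powR_inv1// powRAC powR_inv1 ?powR_ge0.
  rewrite mul1r -[t ^+ _]invrK lef_pV2 ?posrE ?powR_gt0 ?invr_gt0 ?exprn_gt0//.
  rewrite -exprVn -ti -powR_mulrn ?powR_ge0// powRAC powR_mulrn ?invr_ge0//.
  by apply: ge0_ler_powR; rewrite ?nnegrE ?(ltW s0) ?exprn_ge0 ?invr_ge0 ?cabs_ge0// ltW.
Qed.

(** Up to a constant, the area density of the round sphere in stereographic projection, as a
    function of the radius. The approximate identity consists of its rescalings. *)
Definition poisson (x : R) : R := 2 / (1 + x ^+ 2) ^+ 2.

Lemma poisson_gt0 x : 0 < poisson x.
Proof. by rewrite divr_gt0// exprn_gt0// ltr_pwDl// sqr_ge0. Qed.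

Lemma measurable_poisson d (T : measurableType d) (g : T -> R) : measurable_fun setT g ->
  measurable_fun setT (fun x => poisson (g x)).
Proof.
move=> mg; apply: measurable_funM; first exact: measurable_cst.
apply: measurable_funV; apply: measurable_funX.
by apply: measurable_funD; [exact: measurable_cst|exact: measurable_funX].
Qed.

(** The density decays like 2 / x^4, and x >= 2^(k-1) on the k-th shell; 32 = 2 * 2^4. *)
Lemma poisson_le (x : R) k : 0 <= x -> k = 0%N \/ 2 ^+ k <= 2 * x ->
  poisson x <= 32 * 16^-1 ^+ k.
Proof.
move=> x0 H; have x2 : 0 <= x ^+ 2 by rewrite sqr_ge0.
have d0 : 0 < (1 + x ^+ 2) ^+ 2 by rewrite exprn_gt0// ltr_pwDl.
rewrite /poisson ler_pdivrMr//; case: H => [->|H].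
  rewrite expr0 mulr1 (le_trans (y := 32 * 1))//; first by rewrite mulr1 ler_nat.
  by rewrite ler_wpM2l// exprn_ege1// lerDl.
have k16 : (16 : R) ^+ k = (2 ^+ k) ^+ 4.
  by rewrite -exprM mulnC exprM; congr (_ ^+ _); ring.
have h : (16 : R) ^+ k <= 16 * (1 + x ^+ 2) ^+ 2.
  rewrite k16 (le_trans (y := (2 * x) ^+ 4))//.
    by rewrite lerXn2r ?nnegrE ?mulr_ge0 ?exprn_ge0.
  have -> : (2 * x) ^+ 4 = 16 * (x ^+ 2) ^+ 2 by ring.
  by rewrite ler_wpM2l// lerXn2r ?nnegrE ?addr_ge0// lerDr.
have p0 : (0 : R) < 16 ^+ k by rewrite exprn_gt0.
rewrite exprVn mulrAC ler_pdivlMr//; lra.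
Qed.

Lemma poisson_integrable : exists2 K : R, 0 <= K &
  (RI (fun v : C => poisson (cabs v)) <= K%:E)%E /\
  (RI (fun v : C => (cabs v * poisson (cabs v))%R) <= K%:E)%E.
Proof.
have mc : measurable_fun setT (fun q : P => cabs (toC q)) by apply/measurable_cabs/cmeas_id.
(* The zeroth shell contributes 128 = 32 * 4 to the bound. The ratios are 1/4 for the mass and 1/2
   for the first moment, and 128 / (1 - 1/2) = 256 covers both. *)
exists 256; first by rewrite ler0n.
split.
  apply: (@le_trans _ _ (128 / (1 - 4^-1))%:E); last first.
    by rewrite lee_fin ler_pdivrMr; lra.
  apply: (@dyadic_integral 0 _ (fun k => 32 * 16^-1 ^+ k) (fun k => 2 ^+ k)).
  - exact: measurable_poisson.
  - by move=> w; exact/ltW/poisson_gt0.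
  - by move=> k; rewrite mulr_ge0// exprn_ge0// invr_ge0.
  - by move=> k; rewrite exprn_ge0.
  - by rewrite ler0n.
  - by rewrite invr_ge0.
  - by rewrite invf_lt1// ltr1n.
  - move=> k.
    have E : (2 ^+ k) ^+ 2 = 4 ^+ k :> R by rewrite -exprM mulnC exprM; congr (_ ^+ _); ring.
    rewrite exprMn E !exprVn.
    have -> : (16 : R) ^+ k = 4 ^+ k * 4 ^+ k by rewrite -exprMn; congr (_ ^+ _); ring.
    rewrite invfM le_eqVlt; apply/orP; left; apply/eqP; field.
    by rewrite expf_neq0.
  - move=> w; right; have [k [h1 h2]] := pow2_bracket_large (cabs w); exists k.
    by rewrite subr0; split=> //; apply: poisson_le => //; exact: cabs_ge0.
apply: (@le_trans _ _ (128 / (1 - 2^-1))%:E); last by rewrite lee_fin ler_pdivrMr; lra.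
apply: (@dyadic_integral 0 _ (fun k => 2 ^+ k * (32 * 16^-1 ^+ k)) (fun k => 2 ^+ k)).
- by apply: measurable_funM => //; exact: measurable_poisson.
- by move=> w; rewrite mulr_ge0 ?cabs_ge0//; exact/ltW/poisson_gt0.
- by move=> k; rewrite mulr_ge0 ?exprn_ge0// mulr_ge0// exprn_ge0// invr_ge0.
- by move=> k; rewrite exprn_ge0.
- by rewrite ler0n.
- by rewrite invr_ge0.
- by rewrite invf_lt1// ltr1n.
- move=> k.
  have E : (2 ^+ k) ^+ 2 = 4 ^+ k :> R by rewrite -exprM mulnC exprM; congr (_ ^+ _); ring.
  rewrite exprMn E !exprVn.
  have -> : (16 : R) ^+ k = 4 ^+ k * (2 ^+ k * 2 ^+ k) by rewrite -!exprMn; congr (_ ^+ _); ring.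
  rewrite invfM le_eqVlt; apply/orP; left; apply/eqP; field.
  by rewrite !expf_neq0.
- move=> w; right; have [k [h1 h2]] := pow2_bracket_large (cabs w); exists k.
  rewrite subr0; split=> //; rewrite ler_pM ?cabs_ge0//; first exact/ltW/poisson_gt0.
  by apply: poisson_le => //; exact: cabs_ge0.
Qed.

Lemma kappaE : kappa R = fine (RI (fun v : C => poisson (cabs v))).
Proof. by []. Qed.

Lemma RI_poisson : RI (fun v : C => poisson (cabs v)) = (kappa R)%:E.
Proof.
rewrite kappaE fineK// ge0_fin_numE.
  by have [K _ [h _]] := poisson_integrable; exact: le_lt_trans h (ltry _).
by apply: integral_ge0 => q _; rewrite lee_fin; exact/ltW/poisson_gt0.
Qed.

Lemma kappa_gt0 : 0 < kappa R.
Proof.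
rewrite -lte_fin -RI_poisson.
(* On this square |v| <= 1, so the density is at least 2 / (1 + 1)^2 = 1/2. *)
pose S : set P := `[0, 2^-1]%classic `*` `[0, 2^-1]%classic.
have mS : measurable S by apply: measurableX; exact: measurable_itv.
have m1 : measurable_fun setT (fun q : P => (2^-1 * \1_S q)%:E : \bar R).
  by apply/measurable_EFinP/measurable_funM; [exact: measurable_cst|exact: measurable_indic].
have m2 : measurable_fun setT (fun q : P => (poisson (cabs (toC q)))%:E).
  apply/measurable_EFinP/measurable_poisson; exact/measurable_cabs/cmeas_id.
apply: (@lt_le_trans _ _ (\int[@mu2 R]_q (2^-1 * \1_S q)%:E)%E); last first.
  apply: ge0_le_integral => //.
  - move=> [x y] _; rewrite lee_fin indicE.
    have [|_] := boolP ((x, y) \in S); last by rewrite mulr0; exact/ltW/poisson_gt0.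
    rewrite inE /S /= !in_itv/= mulr1 => -[/andP[x0 x1] /andP[y0 y1]].
    have h : cabs (x +i* y) ^+ 2 <= 1.
      rewrite sqr_cabs /=; have : x ^+ 2 <= 2^-1 ^+ 2 by rewrite lerXn2r ?nnegrE ?invr_ge0.
      have : y ^+ 2 <= 2^-1 ^+ 2 by rewrite lerXn2r ?nnegrE ?invr_ge0.
      have -> : (2^-1 : R) ^+ 2 = 4^-1 by field.
      lra.
    have h0 : 0 <= cabs (x +i* y) ^+ 2 by rewrite sqr_ge0.
    rewrite /poisson -[toC _]/(x +i* y) ler_pdivlMr; last by rewrite exprn_gt0// ltr_pwDl.
    have : (1 + cabs (x +i* y) ^+ 2) ^+ 2 <= 2 ^+ 2 by rewrite lerXn2r ?nnegrE ?addr_ge0//; lra.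
    have -> : (2 : R) ^+ 2 = 4 by ring.
    lra.
under eq_integral do rewrite EFinM.
rewrite ge0_integralZl_EFin//; first last.
- by apply/measurable_EFinP; exact: measurable_indic.
rewrite integral_indicX; try exact: measurable_itv.
rewrite !lebesgue_measure_itv /= !lte_fin invr_gt0 ltr0n /= -!EFinB -!EFinM lte_fin subr0.
by rewrite !mulr_gt0 ?invr_gt0.
Qed.

End dyadic.

Section kato_class.
Variable R : realType.
Local Notation C := R[i].
Local Notation P := (measurableTypeR R * measurableTypeR R)%type.

(* Halfway to the bound th < 1 - 2 / p, which puts |w|^-(1 + th) locally in the dual of L^p. *)
Definition kato_exponent (p : R) : R := (1 - 2 / p) / 2.

Lemma kato_exponent_itv (p : R) : 2 < p -> 0 < kato_exponent p < 1.
Proof.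
move=> p2; have p0 : 0 < p by lra.
rewrite /kato_exponent; have h1 : 2 / p < 1 by rewrite ltr_pdivrMr// mul1r.
have h2 : 0 < 2 / p by rewrite divr_gt0.
by apply/andP; split; lra.
Qed.

Lemma powRVl (x s : R) : 0 <= x -> x^-1 `^ s = (x `^ s)^-1.
Proof.
by move=> x0; rewrite -powR_inv1// powRAC powR_inv1// powR_ge0.
Qed.

Lemma kernE (th x : R) : 0 < th -> 0 <= x -> kern th x = (x `^ (1 + th))^-1.
Proof.
move=> th0 x0; rewrite /kern powRD ?powRr1 ?invfM//.
by apply/implyP => /eqP h; lra.
Qed.

(** Instead of Hölder's inequality for integrals, Young's inequality is applied pointwise: a times
    the kernel is at most a^p plus the q-th power of the kernel, q being the dual exponent. *)
Lemma kato_of_power (p r A : R) (a : C -> R) : 2 < p -> 0 <= r -> rmeas a ->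
  (forall w, 0 <= a w) -> (forall w, r < cabs w -> a w = 0) ->
  (RI (fun w => (a w `^ p)%R) <= A%:E)%E ->
  exists B : R, kato (kato_exponent p) B a.
Proof.
move=> p2 r0 ma a0 asupp aA.
have /andP[th0 th1] := kato_exponent_itv p2; set th := kato_exponent p in th0 th1 *.
have p0 : 0 < p by lra.
pose q := p / (p - 1); have p1 : 0 < p - 1 by lra.
have q0 : 0 < q by rewrite divr_gt0.
have pq : p^-1 + q^-1 = 1 by rewrite /q; field; rewrite !gt_eqF.
have pV1 : p^-1 <= 1 by rewrite invf_le1//; lra.
have qV1 : q^-1 <= 1 by rewrite -pq lerDr invr_ge0 ltW.
have young x y : 0 <= x -> 0 <= y -> x * y <= x `^ p + y `^ q.
  move=> x0 y0; apply: (le_trans (conjugate_powR x0 y0 p0 q0 pq)).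
  by rewrite lerD// ler_piMr ?powR_ge0.
(* The singularity of the q-th power of the kernel. It is integrable in the plane because s < 2,
   that is 3p/2 - 1 < 2 (p - 1), which is p > 2. *)
pose s := (1 + th) * q.
have s0 : 0 < s by rewrite mulr_gt0// addr_gt0.
have s2 : s < 2.
  rewrite /s /q mulrA ltr_pdivrMr// /th /kato_exponent.
  have -> : (1 + (1 - 2 / p) / 2) * p = 3 / 2 * p - 1 by field; rewrite gt_eqF.
  lra.
have [K K0 hK] := ball_power_integral s0 s2.
have mb := rmeas_ballf (0 : C) r.
have map : rmeas (fun w => a w `^ p) by exact: (measurableT_comp (@measurable_powR R p) ma).
have ap0 w : 0 <= a w `^ p by rewrite powR_ge0.
have b0 := @ballf_ge0 R 0 r.
have bA := RI_ballf (0 : C) r0.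
have A0 : 0 <= A.
  by rewrite -lee_fin (le_trans _ aA)// integral_ge0// => t _; rewrite lee_fin.
exists (A + (2 * r) ^+ 2 + K); split=> //.
  apply: (@le_trans _ _ (RI (fun w => a w `^ p + ballf 0 r w)%R)).
    apply: RI_le => //; first exact: measurable_funD.
    move=> w; have [wr|wr] := ltP r (cabs w).
      by rewrite asupp// addr_ge0 ?powR_ge0// b0.
    rewrite /ballf subr0 wr; have := young (a w) 1 (a0 w) ler01.
    by rewrite powR1 mulr1.
  rewrite RID// (le_trans (leeD aA bA))// -EFinD lee_fin lerDl//.
move=> z; pose t w : R := ballf z 1 w * (cabs (w - z) `^ s)^-1.
have t0 w : 0 <= t w by rewrite mulr_ge0 ?ballf_ge0 ?invr_ge0 ?powR_ge0.
have mt : rmeas t.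
  apply: measurable_funM; first exact: rmeas_ballf.
  apply: measurable_funV; apply: (measurableT_comp (@measurable_powR R s)).
  by apply: measurable_cabs; apply: cmfB; [exact: cmeas_id|exact: cmf_cst].
have ab0 w : 0 <= a w `^ p + ballf 0 r w by rewrite addr_ge0 ?b0.
have mab : rmeas (fun w => a w `^ p + ballf 0 r w) by exact: measurable_funD.
apply: (@le_trans _ _ (RI (fun w => a w `^ p + ballf 0 r w + t w)%R)).
  apply: RI_le => //.
  - by move=> w; rewrite mulr_ge0// kern_ge0// cabs_ge0.
  - by apply: measurable_funM => //; exact: rmeas_kern.
  - exact: measurable_funD.
  move=> w; have [wr|wr] := ltP r (cabs w).
    by rewrite asupp// mul0r addr_ge0// addr_ge0 ?powR_ge0.
  have x0 : 0 <= cabs (z - w) by rewrite cabs_ge0.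
  have k0 := @kern_ge0 R th _ x0.
  apply: (le_trans (young _ _ (a0 w) k0)); rewrite -addrA lerD2l.
  have -> : kern th (cabs (z - w)) `^ q = (cabs (z - w) `^ s)^-1.
    by rewrite kernE// powRVl ?powR_ge0// -powRrM.
  rewrite /t /ballf subr0 wr (cabsBC w z).
  (* Beyond distance 1 the q-th power of the kernel is at most 1, and the indicator of the disk
     carrying a absorbs it. *)
  case: (leP (cabs (z - w)) 1) => x1; first by rewrite mul1r lerDr.
  rewrite mul0r addr0 invf_le1 ?powR_gt0 ?(lt_trans _ x1)//.
  apply: (@le_trans _ _ (1 `^ s)); first by rewrite powR1.
  by apply: ge0_ler_powR; rewrite ?nnegrE// ?(ltW s0)// ltW.
rewrite RID// RID// (le_trans (leeD (leeD aA bA) (hK z)))//.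
Qed.

Lemma katoD (th B1 B2 : R) (a1 a2 : C -> R) : 0 < th -> kato th B1 a1 -> kato th B2 a2 ->
  kato th (B1 + B2) (fun w => a1 w + a2 w).
Proof.
move=> th0 h1 h2; have [m1 p1 i1 k1] := h1; have [m2 p2 i2 k2] := h2.
split.
- exact: measurable_funD.
- by move=> z; rewrite addr_ge0.
- by rewrite RID// EFinD leeD.
- move=> z; rewrite (_ : (fun w => _) = (fun w => a1 w * kern th (cabs (z - w)) +
    a2 w * kern th (cabs (z - w)))); last by apply/funext => w; rewrite mulrDl.
  rewrite RID ?EFinD ?leeD//; try exact: (akern_ge0 h1); try exact: (akern_ge0 h2).
    exact: (rmeas_akern h1).
  exact: (rmeas_akern h2).
Qed.

Lemma kato_ball (p r : R) : 2 < p -> 0 <= r ->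
  exists B : R, kato (kato_exponent p) B (ballf (0 : C) r).
Proof.
move=> p2 r0; apply: (@kato_of_power p r ((2 * r) ^+ 2)) => //.
- exact: rmeas_ballf.
- exact: ballf_ge0.
- by move=> w wr; rewrite /ballf subr0 leNgt wr.
- rewrite (_ : (fun w => _) = ballf (0 : C) r); first exact: RI_ballf.
  by apply/funext => w; rewrite /ballf; case: ifP => _; rewrite ?powR1 ?powR0// gt_eqF//; lra.
Qed.

(** On a bounded set L^oo lies in every L^r, so p = +oo may be replaced by some finite exponent
    above 2; 3 is one. *)
Definition finite_exponent (p : \bar R) : R := if p is r%:E then r else 3.

Lemma finite_exponent_gt2 (p : \bar R) : (2%:E < p)%E -> 2 < finite_exponent p.
Proof. by case: p => [r||]//=; rewrite ?lte_fin// ltr_nat. Qed.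

Lemma mu2_setT_gt0 : (0 < @mu2 R setT)%E.
Proof.
pose S : set P := `[0, 1]%classic `*` `[0, 1]%classic.
have mS : measurable S by apply: measurableX; exact: measurable_itv.
apply: (@lt_le_trans _ _ (@mu2 R S)); last by apply: le_measure; rewrite ?inE.
have -> : mu2 S = (lebesgue_measure (`[0%R, 1%R]%classic : set R) *
   lebesgue_measure (`[0%R, 1%R]%classic : set R))%E by exact: mu2X.
by rewrite !lebesgue_measure_itv /= !lte_fin ltr01 -EFinB -EFinM lte_fin subr0 mulr1.
Qed.

Lemma Lp_disk_power (p : \bar R) (u : C -> R) : (2%:E < p)%E -> Lp_disk p u ->
  rmeas (fun w => ballf 0 1 w * u w) /\
  exists A : R, (RI (fun w => (ballf 0 1 w * `|u w|) `^ finite_exponent p)%R <= A%:E)%E.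
Proof.
move=> p2; rewrite /Lp_disk; set f := _ \_ _ => hf.
have fE q : f q = ballf 0 1 (toC q) * u (toC q).
  rewrite /f /patch /ballf subr0; case: ifPn => [|/negP] h.
    by move: h; rewrite inE => /disk_cabs ->; rewrite mul1r.
  by case: ifPn => [h'|_]; rewrite ?mul0r//; case: h; rewrite inE; apply/disk_cabs.
have nE q : `|f q| = ballf 0 1 (toC q) * `|u (toC q)|.
  by rewrite fE normrM ger0_norm ?ballf_ge0.
have mf : measurable_fun setT f.
  by move: hf; rewrite inE => /andP[]; rewrite inE.
split; first by rewrite /rmeas (_ : (fun q => _) = f)//; apply/funext => q; rewrite fE.
case: p p2 hf => [r||]//= r2 hf.
  rewrite lte_fin in r2.
  have := Lfun_integrable (ltW (lt_trans (ltr1n _ 2) r2)) hf.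
  move=> /integrableP[_].
  rewrite (_ : (\int[_]_(x in _) _)%E = RI (fun w => (ballf 0 1 w * `|u w|) `^ r)%R); last first.
    by apply: eq_integral => q _; rewrite nE gee0_abs// lee_fin powR_ge0.
  move=> h; exists (fine (RI (fun w => (ballf 0 1 w * `|u w|) `^ r)%R)).
  rewrite fineK// ge0_fin_numE//; apply: integral_ge0 => q _; rewrite lee_fin powR_ge0//.
(* The case p = +oo: the essential supremum is finite and bounds |f| almost everywhere. *)
have [M hM] : exists M : R, {ae @mu2 R, forall q, `|f q| <= M}.
  move: hf; rewrite inE => /andP[_]; rewrite inE /= /finite_norm unlock /=.
  rewrite (_ : (0 < lebesgue2 R setT)%E); last exact: mu2_setT_gt0.
  set e := ess_sup _ _ => eoo; exists (fine e).
  have := ess_sup_ge (lebesgue2 R) (abse \o (EFin \o f)); rewrite -/e.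
  apply: filterS => q /=; case: e eoo => [x||]//=.
exists (`|M| `^ 3 * (2 * 1) ^+ 2).
have m1 : rmeas (fun w => (ballf 0 1 w * `|u w|) `^ 3).
  rewrite /rmeas; under eq_fun do rewrite -nE.
  by apply: (measurableT_comp (@measurable_powR R 3)); exact: measurableT_comp.
apply: (@le_trans _ _ (RI (fun w => `|M| `^ 3 * ballf 0 1 w)%R)).
  apply: ae_ge0_le_integral => //.
  - by move=> q _; rewrite lee_fin powR_ge0.
  - exact/measurable_EFinP.
  - by move=> q _; rewrite lee_fin mulr_ge0 ?powR_ge0 ?ballf_ge0.
  - by apply/measurable_EFinP/measurable_funM; [exact: measurable_cst|exact: rmeas_ballf].
  - apply: (@filterS _ _ (ae_filter_ringOfSetsType (@mu2 R)) _ _ _ hM) => q; rewrite nE => hq _; rewrite lee_fin.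
    move: hq; rewrite /ballf; case: ifP => _ hq; last by rewrite mul0r powR0// mulr0.
    rewrite mulr1; apply: ge0_ler_powR; rewrite ?nnegrE ?mulr_ge0//.
    by rewrite (le_trans hq)// ler_norm.
rewrite RIZ ?powR_ge0//; [|exact: ballf_ge0|exact: rmeas_ballf].
by rewrite EFinM lee_wpmul2l ?lee_fin ?powR_ge0// RI_ballf.
Qed.

Lemma Lp_disk_kato (p : \bar R) (u : C -> R) : (2%:E < p)%E -> Lp_disk p u ->
  exists B : R, kato (kato_exponent (finite_exponent p)) B (fun w => ballf 0 1 w * `|u w|).
Proof.
move=> p2 hu; have [mu [A hA]] := Lp_disk_power p2 hu.
apply: (@kato_of_power _ 1 A) => //; first exact: finite_exponent_gt2.
- rewrite (_ : (fun w => _) = (fun w => `|ballf 0 1 w * u w|)).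
    exact: measurableT_comp.
  by apply/funext => w; rewrite normrM (ger0_norm (ballf_ge0 _ _ _)).
- by move=> w; rewrite mulr_ge0// ballf_ge0.
- by move=> w wr; rewrite /ballf subr0 leNgt wr mul0r.
Qed.

End kato_class.

(** * Weyl's lemma *)

Section weyl.
Variable R : realType.
Local Notation C := R[i].
Local Notation P := (measurableTypeR R * measurableTypeR R)%type.
Implicit Types (z w : C) (e : R).

(** The function conj(w) / (|w|^2 + e^2), a smooth approximation of 1/w. *)
Definition regk e w : C :=
  (complex.Re w * (cabs w ^+ 2 + e ^+ 2)^-1) +i* (- complex.Im w * (cabs w ^+ 2 + e ^+ 2)^-1).
(* The d_s + i d_t derivative of [regk e], an approximate identity of total mass kappa. *)
Definition pois e (x : R) : R := 2 * e ^+ 2 * ((x ^+ 2 + e ^+ 2)^-1 * (x ^+ 2 + e ^+ 2)^-1).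

Lemma regkE e w : 0 < e ->
  regk e w = w^-1 * (cabs w ^+ 2 / (cabs w ^+ 2 + e ^+ 2))%:C.
Proof.
move=> e0; have [->|w0] := eqVneq w 0.
  rewrite invr0 mul0r /regk /= ; apply: complex_ext => /=. by rewrite mul0r.
  by rewrite oppr0 mul0r.
have h : cabs w ^+ 2 != 0 by rewrite expf_neq0// cabs_eq0.
have h2 : cabs w ^+ 2 + e ^+ 2 != 0.
  by rewrite gt_eqF// ltr_wpDl ?sqr_ge0// exprn_gt0.
move: h h2; rewrite /regk; set X := cabs w ^+ 2; set Y := e ^+ 2 => h h2.
by apply: complex_ext; rewrite !reimE /= ?cReV ?cImV -/X; field; rewrite ?h ?h2.
Qed.

Lemma regk_approx (th : R) e w : 0 < th -> th < 1 -> 0 < e ->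
  cabs (regk e w - w^-1) <= e `^ th * kern th (cabs w).
Proof.
move=> th0 th1 e0; apply: le_trans (kern_regularized th0 th1 (cabs_ge0 w) e0).
have h2 : cabs w ^+ 2 + e ^+ 2 != 0.
  by rewrite gt_eqF// ltr_wpDl ?sqr_ge0// exprn_gt0.
have -> : regk e w - w^-1 = w^-1 * (- (e ^+ 2 / (cabs w ^+ 2 + e ^+ 2)))%:C.
  rewrite regkE// -[X in _ - X]mulr1 -mulrBr; congr (_ * _).
  move: h2; set X := cabs w ^+ 2; set Y := e ^+ 2 => h2.
  by rewrite -(rmorph1 (real_complex R)) -rmorphB; congr (_%:C); field.
rewrite cabsM cabsV cabs_real normrN ger0_norm; last first.
  by rewrite divr_ge0 ?addr_ge0 ?sqr_ge0.
by rewrite invfM mulrCA.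
Qed.

Lemma cmeas_regk e z : cmeas (fun w => regk e (w - z)).
Proof.
have ms : cmeas (fun w => w - z) by apply: cmfB; [exact: cmeas_id|exact: cmf_cst].
have mq : measurable_fun setT (fun q : P => (cabs (toC q - z) ^+ 2 + e ^+ 2)^-1).
  apply: measurable_funV; apply: measurable_funD; last exact: measurable_cst.
  exact: measurable_sqr_cabs.
case: ms => m1 m2; split; first exact: measurable_funM.
by apply: measurable_funM => //; exact: measurable_funN.
Qed.

Lemma pois_ge0 e x : 0 <= pois e x.
Proof.
have h : 0 <= (x ^+ 2 + e ^+ 2)^-1 by rewrite invr_ge0 addr_ge0// sqr_ge0.
apply: mulr_ge0; last exact: mulr_ge0.
by apply: mulr_ge0; rewrite ?sqr_ge0.
Qed.

Lemma rmeas_dist z : rmeas (fun w => cabs (w - z)).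
Proof. by apply: measurable_cabs; apply: cmfB; [exact: cmeas_id|exact: cmf_cst]. Qed.

Lemma rmeas_pois e z : rmeas (fun w => pois e (cabs (w - z))).
Proof.
have h : measurable_fun setT (fun q : P => (cabs (toC q - z) ^+ 2 + e ^+ 2)^-1).
  apply: measurable_funV; apply: measurable_funD; last exact: measurable_cst.
  by apply: measurable_funX; exact: rmeas_dist.
by apply: measurable_funM; [exact: measurable_cst|exact: measurable_funM].
Qed.

Lemma pois_scale e v : 0 < e -> e ^+ 2 * pois e (e * v) = poisson v.
Proof.
move=> e0; rewrite /pois /poisson; field.
have h : 1 + v ^+ 2 != 0 by rewrite gt_eqF// ltr_pwDl// sqr_ge0.
rewrite h /=; have -> : (e * v) ^+ 2 + e ^+ 2 = e ^+ 2 * (1 + v ^+ 2) by ring.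
by rewrite mulf_neq0// expf_neq0// gt_eqF.
Qed.

Lemma RI_pois e z : 0 < e -> RI (fun w => pois e (cabs (w - z))) = (kappa R)%:E.
Proof.
move=> e0; rewrite /RI (@ge0_integral_affine _ z e (fun w => pois e (cabs (w - z))))//; first last.
- by move=> w; exact: pois_ge0.
- exact: rmeas_pois.
rewrite -RI_poisson /RI -ge0_integralZl_EFin ?sqr_ge0//.
- apply: eq_integral => q _; rewrite -EFinM [z + _]addrC addrK cabsM cabs_real gtr0_norm//.
  by rewrite pois_scale.
- by move=> q _; rewrite lee_fin pois_ge0.
- apply/measurable_EFinP; have := @rmeas_pois e z.
  by move=> /measurableT_comp/(_ (measurable_affine z e)); apply: eq_measurable_fun => q _ /=; rewrite toC_affine.
Qed.

(** Serves as a tail estimate: the mass at distance at least d from z is at most e K / d. *)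
Lemma RI_pois_moment : exists2 K : R, 0 <= K & forall e z, 0 < e ->
  (RI (fun w => (cabs (w - z) * pois e (cabs (w - z)))%R) <= (e * K)%:E)%E.
Proof.
have [K K0 [_ hK]] := poisson_integrable R; exists K => // e z e0.
have mm : rmeas (fun w => cabs (w - z) * pois e (cabs (w - z))).
  by apply: measurable_funM; [exact: rmeas_dist|exact: rmeas_pois].
have nn w : 0 <= cabs (w - z) * pois e (cabs (w - z)) by rewrite mulr_ge0 ?cabs_ge0 ?pois_ge0.
rewrite /RI (@ge0_integral_affine _ z e (fun w => cabs (w - z) * pois e (cabs (w - z))))//.
rewrite -ge0_integralZl_EFin ?sqr_ge0//.
- rewrite [leRHS]EFinM; have e00 : (0 <= e%:E)%E by rewrite lee_fin ltW.
  apply: le_trans (lee_wpmul2l e00 hK).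
  have nn' (v : C) : 0 <= cabs v * poisson (cabs v).
    by rewrite mulr_ge0 ?cabs_ge0//; exact/ltW/poisson_gt0.
  have mm' : rmeas (fun v : C => cabs v * poisson (cabs v)).
    apply: measurable_funM; first exact/measurable_cabs/cmeas_id.
    exact/measurable_poisson/measurable_cabs/cmeas_id.
  rewrite -(RIZ (ltW e0) nn' mm') le_eqVlt; apply/orP; left; apply/eqP.
  apply: eq_integral => q _.
  rewrite -!EFinM [z + _]addrC addrK cabsM cabs_real gtr0_norm// mulrCA pois_scale//.
  by rewrite mulrA.
- by move=> q _; rewrite lee_fin.
- apply/measurable_EFinP.
  by have := measurableT_comp mm (measurable_affine z e); apply: eq_measurable_fun => q _ /=; rewrite toC_affine.
Qed.

Lemma le0_small (x K : R) : 0 <= K -> (forall t : R, 0 < t -> x <= K * t) -> x <= 0.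
Proof.
move=> K0 H; rewrite leNgt; apply/negP => x0.
have K1 : 0 < K + 1 by rewrite ltr_wpDl.
have := H (x / (K + 1)) (divr_gt0 x0 K1); apply/negP; rewrite -ltNge.
by rewrite mulrA ltr_pdivrMr// mulrC ltr_pM2l// ltrDl.
Qed.

(** As e tends to 0, [pois e] concentrates at z with mass kappa and [regk e] tends to 1/w, so the
    hypothesis becomes kappa F(z) = int m(w) / (z - w) dw. Both errors are explicit, and no limit
    theorem for integrals is needed. *)
Lemma weyl (th B : R) (a : C -> R) (F m : C -> C) (M N : R) z :
  0 < th -> th < 1 -> kato th B a ->
  cmeas F -> 0 <= M -> (forall w, cabs (F w) <= M) -> {for z, continuous F} ->
  0 <= N -> adm a N m ->
  (forall e, 0 < e ->
    CI (fun w => F w * (pois e (cabs (w - z)))%:C + m w * regk e (w - z)) = 0) ->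
  F z = cauchyT m z.
Proof.
move=> th0 th1 ka mF M0 FM cF N0 hm H; have [mm mN] := hm; have [ma a0 aB kB] := ka.
have B0 := kato_B_ge0 ka; have kp := kappa_gt0 R; have [K K0 hK] := RI_pois_moment.
have ipois e : 0 < e -> rint (fun w => pois e (cabs (w - z))).
  move=> e0; apply: rint_ge0; [exact: rmeas_pois|by move=> w; exact: pois_ge0|].
  by rewrite RI_pois// ltry.
have imom e : 0 < e -> rint (fun w => cabs (w - z) * pois e (cabs (w - z))).
  move=> e0; apply: rint_ge0.
  - by apply: measurable_funM; [exact: rmeas_dist|exact: rmeas_pois].
  - by move=> w; rewrite mulr_ge0 ?cabs_ge0 ?pois_ge0.
  - exact: le_lt_trans (hK e z e0) (ltry _).
have mpC e : cmeas (fun w => (pois e (cabs (w - z)))%:C).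
  by apply: cmf_real; exact: rmeas_pois.
have ipC e : 0 < e -> cint (fun w => (pois e (cabs (w - z)))%:C).
  move=> e0; apply: (@cintegrable_le _ _ R (@mu2 R) _ (fun q => pois e (cabs (toC q - z)))) => //.
  - exact: mpC.
  - exact: ipois.
  - by move=> q; rewrite cabs_real ger0_norm ?pois_ge0.
have iFp e : 0 < e -> cint (fun w => F w * (pois e (cabs (w - z)))%:C).
  move=> e0; apply: (@cintegrable_le _ _ R (@mu2 R) _ (fun q => M * pois e (cabs (toC q - z)))).
  - by apply: cmfM => //; exact: mpC.
  - by apply: rintegrableZ; exact: ipois.
  - move=> q; rewrite cabsM cabs_real ger0_norm ?pois_ge0//.
    by rewrite ler_wpM2r ?pois_ge0.
pose J := CI (fun w => m w / (z - w)).
have iJ : cint (fun w => m w / (z - w)) by exact: (adm_cint th0 ka z N0 hm).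
have D2 e : 0 < e -> cint (fun w => m w * regk e (w - z)) /\
    cabs (CI (fun w => m w * regk e (w - z)) + J) <= 2 * (N * e `^ th * B).
  move=> e0.
  have db (q : P) : cabs (m (toC q) * regk e (toC q - z) + m (toC q) / (z - toC q)) <=
      N * e `^ th * (a (toC q) * kern th (cabs (z - toC q))).
    set w := toC q; have -> : m w * regk e (w - z) + m w / (z - w) =
      m w * (regk e (w - z) - (w - z)^-1) by rewrite -(opprB w z) invrN; ring.
    rewrite cabsM (cabsBC z w) mulrACA; apply: ler_pM; rewrite ?cabs_ge0//.
    exact: regk_approx.
  have md : cmeas (fun w => m w * regk e (w - z) + m w / (z - w)).
    by apply: cmfD; [apply: cmfM => //; exact: cmeas_regk|exact: cmeas_quot].
  have ib : rintegrable (@mu2 R) (fun q => N * e `^ th * (a (toC q) * kern th (cabs (z - toC q)))).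
    by apply: rintegrableZ; exact: (rint_akern ka).
  have id := cintegrable_le md ib db.
  have im : cint (fun w => m w * regk e (w - z)).
    have := cintegrableB id iJ; congr cintegrable; apply/funext => q.
    by rewrite addrK.
  split=> //; rewrite /J /CI -cintgD//; apply: (cintg_le md ib db).
  have Ne : 0 <= N * e `^ th by rewrite mulr_ge0 ?powR_ge0.
  rewrite -/(RI (fun w => (N * e `^ th * (a w * kern th (cabs (z - w))))%R)) RIZ//.
  + by rewrite [leRHS]EFinM; apply: lee_wpmul2l => //; rewrite lee_fin.
  + by move=> w; exact: (akern_ge0 ka).
  + exact: (rmeas_akern ka).
suff E : (kappa R)%:C * F z = J.
  rewrite /cauchyT -/J -E mulrA -rmorphM mulVf ?mul1r//; by rewrite gt_eqF.
apply/eqP; rewrite -subr_eq0 -cabs_eq0 eq_le cabs_ge0 andbT.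
(* The coefficient adds up three errors, each doubled by the crude bound on complex integrals: t
   kappa from the continuity of F, t from the tail and t from the kernel. *)
apply: (@le0_small _ (2 * kappa R + 4)) => [|t t0]; first by rewrite addr_ge0// mulr_ge0// ltW.
have /cvgC_cabsP/(_ _ t0)/nbhs_cabsP[d d0 hd] := cF.
have [c c0 hc] := powR_small th0 (K := N * B) t0 ltac:(by rewrite mulr_ge0).
have MK0 : 0 < 2 * M * K / d + 1.
  by rewrite ltr_wpDl// divr_ge0 ?mulr_ge0// ltW.
(* The first entry makes the kernel error N B e^th less than t, the second makes the tail 2 M e K /
   d at most t. *)
pose e := Num.min (c / 2) (t / (2 * M * K / d + 1)).
have e0 : 0 < e by rewrite lt_min !divr_gt0.
have ec : e < c.
  by rewrite (le_lt_trans (y := c / 2)) ?ge_min ?lexx// ltr_pdivrMr// mulr2n mulrDr mulr1 ltrDl.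
have et : (2 * M * K / d) * e <= t.
  have : (2 * M * K / d + 1) * e <= t by rewrite mulrC -ler_pdivlMr// ge_min lexx orbT.
  apply: le_trans; by rewrite ler_wpM2r ?(ltW e0)// lerDl.
have [im hD2] := D2 e e0.
have := H e e0; rewrite /CI cintgD//; last exact: iFp.
rewrite -/(CI (fun w => F w * _)) -/(CI (fun w => m w * _)) => HE.
have D1 : cabs (CI (fun w => F w * (pois e (cabs (w - z)))%:C) - (kappa R)%:C * F z) <=
    2 * (t * kappa R + 2 * M / d * (e * K)).
  have kI : CI (fun w => (pois e (cabs (w - z)))%:C) = (kappa R)%:C.
    rewrite /CI /cintg /= Rintegral_cst// mul0r.
    by rewrite /Rintegral (_ : (\int[_]_(x in _) _)%E = RI (fun w => pois e (cabs (w - z))))// RI_pois.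
  have -> : CI (fun w => F w * (pois e (cabs (w - z)))%:C) - (kappa R)%:C * F z =
      CI (fun w => F w * (pois e (cabs (w - z)))%:C - F z * (pois e (cabs (w - z)))%:C).
    rewrite -kI mulrC /CI cintgB ?cintgZ//; first exact: ipC.
    + exact: iFp.
    + by apply: cintegrableZ; exact: ipC.
  have d20 : 0 <= 2 * M / d by rewrite divr_ge0 ?mulr_ge0// ltW.
  (* Within distance d of z continuity gives t; beyond it the difference is at most 2 M, hence at
     most 2 M |w - z| / d. *)
  apply: (@cintg_le _ _ R (@mu2 R) _ (fun q => t * pois e (cabs (toC q - z)) +
      2 * M / d * (cabs (toC q - z) * pois e (cabs (toC q - z))))).
  - apply: cmfB; first by apply: cmfM => //; exact: mpC.
    by apply: cmfM; [exact: cmf_cst|exact: mpC].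
  - by apply: rintegrableD; apply: rintegrableZ; [exact: ipois|exact: imom].
  - move=> q; set w := toC q; rewrite -mulrBl cabsM cabs_real ger0_norm ?pois_ge0//.
    rewrite mulrA -mulrDl ler_wpM2r ?pois_ge0//.
    have [wd|dw] := ltP (cabs (w - z)) d.
      by rewrite ltW// (lt_le_trans (hd _ wd))// lerDl mulr_ge0 ?cabs_ge0.
    rewrite (le_trans (cabsB _ _))//; apply: (@le_trans _ _ (2 * M)).
      by rewrite mulr2n mulrDl mul1r lerD.
    apply: (@le_trans _ _ (2 * M / d * cabs (w - z))); last by rewrite lerDr ltW.
    by rewrite mulrAC ler_pdivlMr// ler_wpM2l// mulr_ge0.
  - rewrite -/(RI (fun w => (t * pois e (cabs (w - z)) +
      2 * M / d * (cabs (w - z) * pois e (cabs (w - z))))%R)) RID.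
    + rewrite EFinD leeD//.
        rewrite RIZ ?(ltW t0)// ?RI_pois//; first by move=> w; exact: pois_ge0.
        exact: rmeas_pois.
      rewrite RIZ//.
      * by rewrite [leRHS]EFinM; apply: lee_wpmul2l; [rewrite lee_fin|exact: hK].
      * by move=> w; rewrite mulr_ge0 ?cabs_ge0 ?pois_ge0.
      * by apply: measurable_funM; [exact: rmeas_dist|exact: rmeas_pois].
    + by move=> w; rewrite mulr_ge0 ?(ltW t0) ?pois_ge0.
    + by move=> w; apply: mulr_ge0 => //; rewrite mulr_ge0 ?cabs_ge0 ?pois_ge0.
    + by apply: measurable_funM; [exact: measurable_cst|exact: rmeas_pois].
    + apply: measurable_funM; first exact: measurable_cst.
      by apply: measurable_funM; [exact: rmeas_dist|exact: rmeas_pois].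
set A1 := CI _ in HE D1; set A2 := CI _ in HE hD2.
have -> : (kappa R)%:C * F z - J = (A1 + A2) - (A1 - (kappa R)%:C * F z) - (A2 + J) by ring.
rewrite HE sub0r (le_trans (cabsB _ _))// cabsN.
have := hc e (ltW e0) ec => h3.
have h4 : 2 * M / d * (e * K) <= t by rewrite (le_trans _ et)// le_eqVlt; apply/orP; left; apply/eqP; ring.
have h5 : N * e `^ th * B <= t by rewrite mulrAC ltW.
apply: (le_trans (lerD D1 hD2)); lra.
Qed.

End weyl.

(** * Holomorphic functions are smooth *)

Section plane_compactness.
Variable R : realType.
Local Notation C := R[i].

Lemma compact_box (L : R) : compact [set z : C | `|complex.Re z| <= L /\ `|complex.Im z| <= L].
Proof.
pose f (v : 'rV[R]_2) : C := v 0 0 +i* v 0 1.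
have cA : compact [set v : 'rV[R]_2 | forall i, `[- L, L]%classic (v ord0 i)].
  exact: (@rV_compact _ _ (fun=> `[- L, L]%classic) (fun=> @segment_compact R _ _)).
have -> : [set z : C | `|complex.Re z| <= L /\ `|complex.Im z| <= L] =
    f @` [set v : 'rV[R]_2 | forall i, `[- L, L]%classic (v ord0 i)].
  apply/seteqP; split=> [z /= [h1 h2]|z [v /= hv <-]].
    exists (\row_(i < 2) if i == 0 then complex.Re z else complex.Im z).
      by move=> i /=; rewrite mxE in_itv /= -ler_norml; case: ifP.
    by rewrite /f !mxE /= ReIm.
  by have := hv 0; have := hv 1; rewrite /= !in_itv /= -!ler_norml.
apply: continuous_compact cA; apply: continuous_subspaceT => v.
have c (i : 'I_2) : {for v, continuous (fun w : 'rV[R]_2 => w 0 i)} by exact: coord_continuous.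
apply/cvgC_cabsP => e e0.
have /cvgrPdist_lt/(_ _ (divr_gt0 e0 (ltr0Sn _ 1))) c1 := c 0.
have /cvgrPdist_lt/(_ _ (divr_gt0 e0 (ltr0Sn _ 1))) c2 := c 1.
apply: filterS2 c1 c2 => w h1 h2; apply: (le_lt_trans (cabs_le _)).
by rewrite /f !reimE /= [ltRHS]splitr ltrD// distrC.
Qed.

Lemma cts_bounded (u : C -> R) (L : R) : (forall z, {for z, continuous u}) ->
  exists2 M : R, 0 <= M & forall z, cabs z <= L -> `|u z| <= M.
Proof.
move=> cu; have [L0|L0] := ltP L 0.
  by exists 0 => // z /le_lt_trans/(_ L0); rewrite ltNge cabs_ge0.
pose A := [set z : C | `|complex.Re z| <= L /\ `|complex.Im z| <= L].
have cn : {within A, continuous (fun z => `|u z|)}.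
  apply: continuous_subspaceT => z; apply/cts_cabsP => e e0.
  have /cts_cabsP/(_ _ e0)[d d0 hd] := cu z; exists d => // w /hd; apply: le_lt_trans.
  exact: ler_dist_dist.
have A0 : A !=set0 by exists 0; rewrite /A /= normr0.
have [c Ac hc] := compact_EVT_max A0 (@compact_box L) cn.
exists `|u c| => // z zL; apply: hc; rewrite inE; split.
  exact: le_trans (Re_le_cabs _) zL.
exact: le_trans (Im_le_cabs _) zL.
Qed.

End plane_compactness.

(** * The divergence theorem for differentiable vector fields *)

Section divergence_theorem.
Variable R : realType.
Local Notation C := R[i].
Local Notation P := (measurableTypeR R * measurableTypeR R)%type.
Local Notation lam := (@lebesgue_measure R).

Lemma Rintegral_near d (T : measurableType d) (mu : {measure set T -> \bar R}) (D : set T)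
    (f : T -> R) (k K m : R) : measurable D -> mu D = m%:E ->
  mu.-integrable D (EFin \o f) -> (forall x, D x -> `|f x - k| <= K) ->
  `|\int[mu]_(x in D) f x - k * m| <= K * m.
Proof.
move=> mD muD fi fk.
have ic (c : R) : mu.-integrable D (EFin \o (fun=> c)).
  apply: (@measurable_bounded_integrable _ _ _ mu (fun=> c) D mD).
  - by rewrite muD ltry.
  - exact: measurable_cst.
  - by exists `|c|; split; [exact: num_real|move=> x cx y _; exact: ltW].
have ib : mu.-integrable D (EFin \o (fun x => f x - k)).
  by have := integrableB mD fi (ic k).
have -> : \int[mu]_(x in D) f x - k * m = \int[mu]_(x in D) (f x - k).
  by rewrite RintegralB// Rintegral_cst// muD.
apply: (le_trans (le_normr_Rintegral mD ib)).
have -> : K * m = \int[mu]_(x in D) K by rewrite Rintegral_cst// muD.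
apply: le_Rintegral => //.
exact: integrable_norm ib.
Qed.

Lemma cts_integrable (h : R -> R) (a b : R) : continuous h ->
  lam.-integrable `]a, b]%classic (EFin \o h).
Proof.
move=> ch; have := @continuous_compact_integrable R h `[a, b]%classic (@segment_compact R a b).
move=> /(_ (continuous_subspaceT ch)); apply: integrableS; try exact: measurable_itv.
exact: subset_itv_oc_cc.
Qed.

Lemma lam_itv (a b : R) : a <= b -> lam `]a, b]%classic = (b - a)%:E.
Proof.
move=> ab; rewrite lebesgue_measure_itv /= lte_fin.
by case: ltgtP ab => // -> _; rewrite subrr.
Qed.

Lemma Rintegral_oc_split (h : R -> R) (a b c : R) : continuous h -> a <= b -> b <= c ->
  \int[lam]_(t in `]a, c]) h t = \int[lam]_(t in `]a, b]) h t + \int[lam]_(t in `]b, c]) h t.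
Proof.
move=> ch ab bc.
have E : `]a, c]%classic = `]a, b]%classic `|` `]b, c]%classic :> set R.
  by rewrite -itv_bndbnd_setU ?bnd_simp.
rewrite E Rintegral_setU//; try exact: measurable_itv.
- by rewrite -E; exact: cts_integrable.
- apply/disj_setPS => t /= []; rewrite !in_itv/= => /andP[_ tb] /andP[bt _].
  by have := lt_le_trans bt tb; rewrite ltxx.
Qed.

(** Half-open sides, so that bisection partitions a rectangle exactly. *)
Definition box (x y r s : R) : set P := `]x, x + r]%classic `*` `]y, y + s]%classic.

Lemma measurable_box x y r s : measurable (box x y r s).
Proof. by apply: measurableX; exact: measurable_itv. Qed.

Lemma mu2_box x y r s : 0 <= r -> 0 <= s -> @mu2 R (box x y r s) = (r * s)%:E.
Proof.
move=> r0 s0.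
have -> : @mu2 R (box x y r s) = (lam `]x, (x + r)%R]%classic * lam `]y, (y + s)%R]%classic)%E.
  by apply: mu2X; exact: measurable_itv.
by rewrite !lam_itv ?lerDl// -EFinM; congr EFin; ring.
Qed.

Variables (p q ps pt qs qt g : C -> R) (L M : R).
Hypotheses (fp : forall z, frechet p z (ps z) (pt z))
  (fq : forall z, frechet q z (qs z) (qt z))
  (gE : forall z, g z = ps z + qt z) (cg : forall z, {for z, continuous g})
  (gM : forall z, `|g z| <= M) (L0 : 0 < L)
  (pL : forall z, L <= cabs z -> p z = 0) (qL : forall z, L <= cabs z -> q z = 0)
  (gL : forall z, L <= cabs z -> g z = 0).

Lemma frechet_cts (u : C -> R) z a b : frechet u z a b -> {for z, continuous u}.
Proof.
move=> fu; apply/cts_cabsP => e e0; have [d d0 hd] := fu 1 ltr01.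
pose K := `|a| + `|b| + 1; have K0 : 0 < K by rewrite ltr_wpDl// addr_ge0.
exists (Num.min d (e / K)); first by rewrite lt_min d0 divr_gt0.
move=> w; rewrite lt_min => /andP[wd]; rewrite ltr_pdivlMr// => we.
have := hd _ wd; rewrite subrKC mul1r; set h := w - z => h1.
have h2 : `|a * complex.Re h + b * complex.Im h| <= (`|a| + `|b|) * cabs h.
  rewrite (le_trans (ler_normD _ _))// !normrM mulrDl lerD// ler_wpM2l//.
    exact: Re_le_cabs.
  exact: Im_le_cabs.
have -> : u w - u z = (u w - u z - (a * complex.Re h + b * complex.Im h)) +
  (a * complex.Re h + b * complex.Im h) by ring.
rewrite (le_lt_trans (ler_normD _ _))// (le_lt_trans _ we)//.
have -> : cabs h * K = cabs h + (`|a| + `|b|) * cabs h by rewrite /K; ring.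
exact: lerD h1 h2.
Qed.

Lemma cts_vline (u : C -> R) (x : R) : (forall z, {for z, continuous u}) ->
  continuous (fun t => u (x +i* t)).
Proof.
move=> cu t; apply/cvgrPdist_lt => e e0.
have /cts_cabsP/(_ _ e0)[d d0 hd] := cu (x +i* t).
apply/nbhs_ballP; exists d => //= s; rewrite /ball /= => ts; rewrite distrC; apply: hd.
apply: (le_lt_trans (cabs_le _)); rewrite !reimE /= subrr normr0 add0r distrC//.
Qed.

Lemma cts_hline (u : C -> R) (y : R) : (forall z, {for z, continuous u}) ->
  continuous (fun s => u (s +i* y)).
Proof.
move=> cu t; apply/cvgrPdist_lt => e e0.
have /cts_cabsP/(_ _ e0)[d d0 hd] := cu (t +i* y).
apply/nbhs_ballP; exists d => //= s; rewrite /ball /= => ts; rewrite distrC; apply: hd.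
apply: (le_lt_trans (cabs_le _)); rewrite !reimE /= subrr normr0 addr0 distrC//.
Qed.

Let cp z : {for z, continuous p}. Proof. exact: frechet_cts (fp z). Qed.
Let cq z : {for z, continuous q}. Proof. exact: frechet_cts (fq z). Qed.

Let dp (x r t : R) := p ((x + r) +i* t) - p (x +i* t).
Let dq (y r s : R) := q (s +i* (y + r)) - q (s +i* y).

Let cdp x r : continuous (dp x r).
Proof. by move=> t; apply: (@cvgB R R^o R^o); exact: cts_vline. Qed.
Let cdq y r : continuous (dq y r).
Proof. by move=> t; apply: (@cvgB R R^o R^o); exact: cts_hline. Qed.

Let mg : rmeas g. Proof. exact: cts_measurable. Qed.

Let ig D : measurable D -> (@mu2 R D < +oo)%E -> (@mu2 R).-integrable D (EFin \o (fun w => g (toC w))).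
Proof.
move=> mD Dfin; apply: (@measurable_bounded_integrable _ _ _ (@mu2 R) _ D mD) => //.
  exact: measurable_funTS mg.
exists M; split; first exact: num_real.
by move=> x Mx y _; exact: le_trans (gM (toC y)) (ltW Mx).
Qed.

(** The outward flux of (p, q) through the boundary of a square minus the integral of the divergence
    over it. It is additive under subdivision, since inner sides cancel. *)
Definition flux (x y r : R) : R :=
  \int[lam]_(t in `]y, y + r]) dp x r t + \int[lam]_(s in `]x, x + r]) dq y r s -
  \int[@mu2 R]_(w in box x y r r) g (toC w).

Lemma box_split (x y r s : R) : 0 <= r -> 0 <= s ->
  \int[@mu2 R]_(w in box x y (r + r) s) g (toC w) =
  \int[@mu2 R]_(w in box x y r s) g (toC w) + \int[@mu2 R]_(w in box (x + r) y r s) g (toC w).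
Proof.
move=> r0 s0.
have E : box x y (r + r) s = box x y r s `|` box (x + r) y r s.
  have e : `]x, x + (r + r)]%classic = `]x, x + r]%classic `|` `]x + r, x + r + r]%classic :> set R.
    by rewrite addrA -itv_bndbnd_setU ?bnd_simp ?lerDl.
  by rewrite /box e; apply/seteqP; split=> -[u v] /=; tauto.
have rr : 0 <= r + r by rewrite addr_ge0.
rewrite E Rintegral_setU//; try exact: measurable_box.
- rewrite -E; apply: ig; first exact: measurable_box.
  by rewrite (_ : @mu2 R _ = ((r + r) * s)%:E) ?ltry//; exact: mu2_box.
- apply/disj_setPS => -[a b] /= [[/= + _] [/= + _]]; rewrite !in_itv/= => /andP[_ tb] /andP[bt _].
  by have := lt_le_trans bt tb; rewrite ltxx.
Qed.

Lemma box_split' (x y r s : R) : 0 <= r -> 0 <= s ->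
  \int[@mu2 R]_(w in box x y r (s + s)) g (toC w) =
  \int[@mu2 R]_(w in box x y r s) g (toC w) + \int[@mu2 R]_(w in box x (y + s) r s) g (toC w).
Proof.
move=> r0 s0.
have E : box x y r (s + s) = box x y r s `|` box x (y + s) r s.
  have e : `]y, y + (s + s)]%classic = `]y, y + s]%classic `|` `]y + s, y + s + s]%classic :> set R.
    by rewrite addrA -itv_bndbnd_setU ?bnd_simp ?lerDl.
  by rewrite /box e; apply/seteqP; split=> -[u v] /=; tauto.
have ss : 0 <= s + s by rewrite addr_ge0.
rewrite E Rintegral_setU//; try exact: measurable_box.
- rewrite -E; apply: ig; first exact: measurable_box.
  by rewrite (_ : @mu2 R _ = (r * (s + s))%:E) ?ltry//; exact: mu2_box.
- apply/disj_setPS => -[a b] /= [[/= _ +] [/= _ +]]; rewrite !in_itv/= => /andP[_ tb] /andP[bt _].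
  by have := lt_le_trans bt tb; rewrite ltxx.
Qed.

Lemma flux_split x y r : 0 <= r -> flux x y (r + r) =
  flux x y r + flux (x + r) y r + flux x (y + r) r + flux (x + r) (y + r) r.
Proof.
move=> r0; have rr : 0 <= r + r by rewrite addr_ge0.
have dpE t : dp x (r + r) t = dp x r t + dp (x + r) r t by rewrite /dp addrA; ring.
have dqE s : dq y (r + r) s = dq y r s + dq (y + r) r s by rewrite /dq addrA; ring.
rewrite /flux.
have -> : \int[lam]_(t in `]y, y + (r + r)]) dp x (r + r) t =
    \int[lam]_(t in `]y, y + r]) dp x r t + \int[lam]_(t in `]y, y + r]) dp (x + r) r t +
    (\int[lam]_(t in `]y + r, y + r + r]) dp x r t + \int[lam]_(t in `]y + r, y + r + r]) dp (x + r) r t).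
  rewrite (@Rintegral_oc_split _ y (y + r)) ?lerDl ?lerD2l ?lerDl// addrA.
  by congr (_ + _); rewrite -RintegralD; try exact: cts_integrable; try exact: measurable_itv;
    apply: eq_Rintegral => t _; rewrite dpE.
have -> : \int[lam]_(t in `]x, x + (r + r)]) dq y (r + r) t =
    \int[lam]_(t in `]x, x + r]) dq y r t + \int[lam]_(t in `]x, x + r]) dq (y + r) r t +
    (\int[lam]_(t in `]x + r, x + r + r]) dq y r t + \int[lam]_(t in `]x + r, x + r + r]) dq (y + r) r t).
  rewrite (@Rintegral_oc_split _ x (x + r)) ?lerDl ?lerD2l ?lerDl// addrA.
  by congr (_ + _); rewrite -RintegralD; try exact: cts_integrable; try exact: measurable_itv;
    apply: eq_Rintegral => t _; rewrite dqE.
rewrite box_split// !box_split'//; ring.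
Qed.

(** The differential at the point accounts for the main terms of the three integrals, and these
    cancel because g = ps + qt. Each pair of opposite sides leaves 4 e r^2, since points of the
    square are within 2 r of a + ib, and the area integral leaves e r^2. *)
Lemma flux_small (a b e : R) : 0 < e -> exists2 d : R, 0 < d &
  forall x y r, 0 <= r -> r < d -> x <= a <= x + r -> y <= b <= y + r ->
  `|flux x y r| <= 9 * e * (r * r).
Proof.
move=> e0; pose z := a +i* b.
have [d1 d10 h1] := fp z e0; have [d2 d20 h2] := fq z e0.
have /cts_cabsP/(_ _ e0)[d3 d30 h3] := @cg z.
exists (Num.min d1 (Num.min d2 d3) / 3); first by rewrite divr_gt0// !lt_min d10 d20 d30.
move=> x y r r0; rewrite ltr_pdivlMr// => rd /andP[xa ax] /andP[yb by'].
have close s t : x <= s <= x + r -> y <= t <= y + r -> cabs ((s +i* t) - z) <= 2 * r /\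
    cabs ((s +i* t) - z) < Num.min d1 (Num.min d2 d3).
  move=> /andP[s1 s2] /andP[t1 t2].
  have h : cabs ((s +i* t) - z) <= 2 * r.
    rewrite (le_trans (cabs_le _))// !reimE /=.
    have : `|s - a| <= r by rewrite ler_norml; apply/andP; split; lra.
    have : `|t - b| <= r by rewrite ler_norml; apply/andP; split; lra.
    lra.
  by split=> //; rewrite (le_lt_trans h)//; move: (Num.min _ _) rd => m; lra.
have D1 : `|\int[lam]_(t in `]y, y + r]) dp x r t - (ps z * r) * r| <= (4 * e * r) * r.
  apply: (@Rintegral_near _ _ lam); first exact: measurable_itv.
  - by rewrite [LHS]lam_itv ?lerDl//; congr EFin; ring.
  - exact: cts_integrable.
  - move=> t /=; rewrite in_itv/= => /andP[yt ty].
    have [c1 c2] := close (x + r) t ltac:(by rewrite lerDl r0 lexx) ltac:(by rewrite (ltW yt)).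
    have [c3 c4] := close x t ltac:(by rewrite lexx lerDl) ltac:(by rewrite (ltW yt)).
    move: c2 c4; rewrite !lt_min => /andP[c2 _] /andP[c4 _].
    have := h1 _ c2; have := h1 _ c4; rewrite !subrKC !reimE /= => k1 k2.
    rewrite /dp; set A := p _ in k2 *; set A' := p (x +i* t) in k1 *.
    have -> : A - A' - ps z * r = (A - p z - (ps z * (x + r - a) + pt z * (t - b))) -
      (A' - p z - (ps z * (x - a) + pt z * (t - b))) by ring.
    rewrite (le_trans (ler_normB _ _))//.
    have := ler_wpM2l (ltW e0) c1; have := ler_wpM2l (ltW e0) c3; lra.
have D2 : `|\int[lam]_(s in `]x, x + r]) dq y r s - (qt z * r) * r| <= (4 * e * r) * r.
  apply: (@Rintegral_near _ _ lam); first exact: measurable_itv.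
  - by rewrite [LHS]lam_itv ?lerDl//; congr EFin; ring.
  - exact: cts_integrable.
  - move=> s /=; rewrite in_itv/= => /andP[xs sx].
    have [c1 c2] := close s (y + r) ltac:(by rewrite (ltW xs)) ltac:(by rewrite lerDl r0 lexx).
    have [c3 c4] := close s y ltac:(by rewrite (ltW xs)) ltac:(by rewrite lexx lerDl).
    move: c2 c4; rewrite !lt_min => /andP[_ /andP[c2 _]] /andP[_ /andP[c4 _]].
    have := h2 _ c2; have := h2 _ c4; rewrite !subrKC !reimE /= => k1 k2.
    rewrite /dq; set A := q _ in k2 *; set A' := q (s +i* y) in k1 *.
    have -> : A - A' - qt z * r = (A - q z - (qs z * (s - a) + qt z * (y + r - b))) -
      (A' - q z - (qs z * (s - a) + qt z * (y - b))) by ring.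
    rewrite (le_trans (ler_normB _ _))//.
    have := ler_wpM2l (ltW e0) c1; have := ler_wpM2l (ltW e0) c3; lra.
have D3 : `|\int[@mu2 R]_(w in box x y r r) g (toC w) - g z * (r * r)| <= e * (r * r).
  apply: (@Rintegral_near _ _ (@mu2 R)); first exact: measurable_box.
  - exact: mu2_box.
  - apply: ig; first exact: measurable_box.
    by rewrite (_ : @mu2 R _ = (r * r)%:E) ?ltry//; exact: mu2_box.
  - move=> [s t] [/=]; rewrite !in_itv/= => /andP[s1 s2] /andP[t1 t2].
    rewrite ltW// h3//; have [_] := close s t ltac:(by rewrite (ltW s1)) ltac:(by rewrite (ltW t1)).
    by rewrite !lt_min => /andP[_ /andP[_]].
rewrite /flux; set I1 := \int[lam]_(t in _) _ in D1 *.
set I2 := \int[lam]_(t in _) _ in D2 *; set I3 := Rintegral _ _ _ in D3 *.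
have -> : I1 + I2 - I3 = (I1 - ps z * r * r) + (I2 - qt z * r * r) - (I3 - g z * (r * r)).
  by rewrite gE; ring.
rewrite (le_trans (ler_normB _ _))//.
have := ler_normD (I1 - ps z * r * r) (I2 - qt z * r * r).
rewrite -!mulrA in D1 D2 *; lra.
Qed.

(* Goursat's bisection: p and q are only assumed to be pointwise differentiable. *)
Lemma flux0 x y r : 0 <= r -> flux x y r = 0.
Proof.
move=> r0; apply/eqP; rewrite -normr_eq0 eq_le normr_ge0 andbT leNgt; apply/negP => c0.
set c := `|flux x y r| in c0.
pose st := (R * R * R)%type.
(* The condition on the side stands inside the existential, so that [choice] provides a map defined
   on all states, which can be iterated. *)
have step (s : st) : exists s' : st, 0 <= s.2 -> [/\ s'.2 = s.2 / 2,
    s.1.1 <= s'.1.1 /\ s'.1.1 + s'.2 <= s.1.1 + s.2,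
    s.1.2 <= s'.1.2 /\ s'.1.2 + s'.2 <= s.1.2 + s.2 &
    `|flux s.1.1 s.1.2 s.2| <= 4 * `|flux s'.1.1 s'.1.2 s'.2|].
  case: s => -[u v] t /=; have [t0|tn] : 0 <= t \/ t < 0 by case: (lerP 0 t); [left|right].
    2: by exists (u, v, t) => /= t0; have := le_lt_trans t0 tn; rewrite ltxx.
  pose h := t / 2; have h0 : 0 <= h by rewrite divr_ge0.
  have th : t = h + h by rewrite /h; field.
  have := flux_split u v h0; rewrite -th => E.
  have lem (u' v' : R) : u <= u' -> u' + h <= u + t -> v <= v' -> v' + h <= v + t ->
     `|flux u v t| <= 4 * `|flux u' v' h| -> exists s' : st, 0 <= t -> [/\ s'.2 = h,
    u <= s'.1.1 /\ s'.1.1 + s'.2 <= u + t,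
    v <= s'.1.2 /\ s'.1.2 + s'.2 <= v + t &
    `|flux u v t| <= 4 * `|flux s'.1.1 s'.1.2 s'.2|].
    by move=> *; exists (u', v', h).
  have le1 x' : x' <= x' + h by rewrite lerDl.
  have le2 x' : x' + h <= x' + t by rewrite th addrA lerDl.
  have le3 x' : x' + h + h <= x' + t by rewrite th addrA.
  have [k1|k1] := leP (`|flux u v t|) (4 * `|flux u v h|); first exact: lem k1.
  have [k2|k2] := leP (`|flux u v t|) (4 * `|flux (u + h) v h|); first exact: lem k2.
  have [k3|k3] := leP (`|flux u v t|) (4 * `|flux u (v + h) h|); first exact: lem k3.
  apply: (lem (u + h) (v + h)) => //.
  have := ler_normD (flux u v h + flux (u + h) v h + flux u (v + h) h) (flux (u + h) (v + h) h).
  have := ler_normD (flux u v h + flux (u + h) v h) (flux u (v + h) h).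
  have := ler_normD (flux u v h) (flux (u + h) v h).
  rewrite -E; move: k1 k2 k3.
  move: (flux u v t) (flux u v h) (flux (u + h) v h) (flux u (v + h) h) (flux (u + h) (v + h) h) => *; lra.
have [next hn] := choice step.
pose sq n := iter n next (x, y, r).
have sqP n : (sq n).2 = r / 2 ^+ n /\ c <= 4 ^+ n * `|flux (sq n).1.1 (sq n).1.2 (sq n).2|.
  elim: n => [|n [IH1 IH2]]; first by rewrite /sq /= !expr0 divr1 mul1r.
  have t0 : 0 <= (sq n).2 by rewrite IH1 divr_ge0// exprn_ge0.
  have [e1 _ _ e4] := hn (sq n) t0; rewrite /sq iterS -/(sq n); split.
    by rewrite e1 IH1 exprS invfM; field; rewrite expf_neq0.
  apply: (le_trans IH2); rewrite exprSr -mulrA ler_wpM2l// exprn_ge0//.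
have sq0 n : 0 <= (sq n).2 by have [-> _] := sqP n; rewrite divr_ge0// exprn_ge0.
have mono m n : (m <= n)%N -> (sq m).1.1 <= (sq n).1.1 /\
    (sq n).1.1 + (sq n).2 <= (sq m).1.1 + (sq m).2 /\ (sq m).1.2 <= (sq n).1.2 /\
    (sq n).1.2 + (sq n).2 <= (sq m).1.2 + (sq m).2.
  move=> /subnK <-; elim: (n - m)%N => [|k [i1 [i2 [i3 i4]]]]; first by rewrite add0n.
  have [_ [e1 e2] [e3 e4] _] := hn (sq (k + m)) (sq0 _).
  rewrite addSn /sq iterS -/(sq _); split; first exact: le_trans i1 e1.
  split; first exact: le_trans e2 i2.
  by split; [exact: le_trans i3 e3|exact: le_trans e4 i4].
(* For nested intervals the supremum of the left ends lies in each of them; applied to both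
   coordinates, it gives a point common to all closed squares. *)
have lim (f : nat -> R) : (forall m n, f m <= f n + (sq n).2) ->
    exists l, forall n, f n <= l <= f n + (sq n).2.
  move=> H; exists (sup [set f n | n in setT]) => n.
  have ne : [set f n | n in setT] !=set0 by exists (f 0%N), 0%N.
  have ub k : ubound [set f n | n in setT] (f k + (sq k).2) by move=> _ [m _ <-].
  apply/andP; split; first by apply: ub_le_sup; [exists (f 0%N + (sq 0%N).2); exact: ub|exists n].
  exact: ge_sup.
have key (f : nat -> R) : (forall m n, (m <= n)%N -> f m <= f n /\ f n + (sq n).2 <= f m + (sq m).2) ->
    forall m n, f m <= f n + (sq n).2.
  move=> H m n; have [mn|nm] := leqP m n.
    by have [h _] := H _ _ mn; rewrite (le_trans h)// lerDl.
  by have [_ h] := H _ _ (ltnW nm); rewrite (le_trans _ h)// lerDl.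
have [a ha] := lim (fun n => (sq n).1.1) (key _ (fun m n mn => conj (mono m n mn).1 (mono m n mn).2.1)).
have [b hb] := lim (fun n => (sq n).1.2) (key _ (fun m n mn => conj (mono m n mn).2.2.1 (mono m n mn).2.2.2)).
(* With X = 9 r^2 + 1 the final bound 4^n * 9 e (r / 2^n)^2 equals c (X - 1) / (2 X), which is less
   than c for every n. *)
have e0 : 0 < c / (9 * (r * r) + 1) / 2.
  by rewrite !divr_gt0// ltr_wpDl// mulr_ge0// mulr_ge0.
have [d d0 hd] := flux_small a b e0.
have [n hnn] := pow2_gt (r / d).
have rd : (sq n).2 < d.
  have [-> _] := sqP n; rewrite ltr_pdivrMr ?exprn_gt0//.
  by rewrite mulrC -ltr_pdivrMr.
have := hd _ _ _ (sq0 n) rd (ha n) (hb n).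
have [en cn] := sqP n; rewrite en in cn *.
move=> hf; have : c < c; last by rewrite ltxx.
apply: (le_lt_trans cn).
have p4 : (0 : R) < 4 ^+ n by rewrite exprn_gt0.
apply: (le_lt_trans (ler_wpM2l (ltW p4) hf)).
have -> : 4 ^+ n = 2 ^+ n * 2 ^+ n :> R by rewrite -exprMn; congr (_ ^+ _); ring.
have p2 : (0 : R) < 2 ^+ n by rewrite exprn_gt0.
set X := 9 * (r * r) + 1; have X0 : 0 < X by rewrite /X ltr_wpDl// mulr_ge0// mulr_ge0.
have -> : 2 ^+ n * 2 ^+ n * (9 * (c / X / 2) * (r / 2 ^+ n * (r / 2 ^+ n))) =
   c * ((X - 1) / X / 2).
  by rewrite /X; field; rewrite -/X !gt_eqF.
rewrite -[ltRHS]mulr1 ltr_pM2l// ltr_pdivrMr// mul1r ltr_pdivrMr//; lra.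
Qed.

Lemma divergence_zero : \int[@mu2 R]_w g (toC w) = 0.
Proof.
have r0 : 0 <= L + L by rewrite addr_ge0// ltW.
have := flux0 (- L) (- L) r0.
rewrite /flux.
have E1 (t : R) : dp (- L) (L + L) t = 0.
  rewrite /dp !pL ?subrr//; apply: le_trans (Re_le_cabs _) => /=.
    by rewrite normrN gtr0_norm.
  by rewrite addKr gtr0_norm.
have E2 (t : R) : dq (- L) (L + L) t = 0.
  rewrite /dq !qL ?subrr//; apply: le_trans (Im_le_cabs _) => /=.
    by rewrite normrN gtr0_norm.
  by rewrite addKr gtr0_norm.
have Z (D : set R) (h : R -> R) : (forall t, h t = 0) -> \int[lam]_(t in D) h t = 0.
  by move=> h0; rewrite /Rintegral integral0_eq// => t _; rewrite h0.
rewrite (Z _ (dp (- L) (L + L)))// (Z _ (dq (- L) (L + L)))//.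
rewrite addr0 sub0r => /eqP; rewrite oppr_eq0 => /eqP E.
rewrite -[RHS]E [RHS]Rintegral_mkcond; apply: eq_Rintegral => -[s t] _.
rewrite /patch; case: ifPn => // /negP; rewrite inE => nb; apply: gL.
rewrite leNgt; apply/negP => lt1; apply: nb; split=> /=; rewrite in_itv/= addKr.
  have := le_lt_trans (Re_le_cabs _) lt1; rewrite /= ltr_norml => /andP[h1 h2].
  by rewrite h1 ltW.
have := le_lt_trans (Im_le_cabs _) lt1; rewrite /= ltr_norml => /andP[h1 h2].
by rewrite h1 ltW.
Qed.

End divergence_theorem.

Section test_functions.
Variable R : realType.
Local Notation C := R[i].
Implicit Types (z w c : C) (e r : R) (f g F : C -> C) (chi : C -> R).

Lemma ctsC_reim f z : {for z, continuous (fun w => complex.Re (f w))} ->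
  {for z, continuous (fun w => complex.Im (f w))} -> {for z, continuous f}.
Proof.
move=> /cts_cabsP h1 /cts_cabsP h2; apply/cvgC_cabsP => e e0.
have e2 : 0 < e / 2 by rewrite divr_gt0.
have [d1 d10 k1] := h1 _ e2; have [d2 d20 k2] := h2 _ e2.
apply/nbhs_cabsP; exists (Num.min d1 d2); first by rewrite lt_min d10.
move=> w; rewrite lt_min => /andP[w1 w2]; rewrite (le_lt_trans (cabs_le _))// !reimE.
by have := k1 _ w1; have := k2 _ w2; lra.
Qed.

Lemma ctsCM f g z : {for z, continuous f} -> {for z, continuous g} ->
  {for z, continuous (fun w => f w * g w)}.
Proof.
move=> hf hg; have [f1 f2 g1 g2] := And4 (cts_Re hf) (cts_Im hf) (cts_Re hg) (cts_Im hg).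
have N u : {for z, continuous u} -> {for z, continuous (fun w => - u w : R)}.
  by move=> hu; have := ctsM (@cts_cst R (-1) z) hu; apply: near_cts; near=> w; rewrite mulN1r.
apply: ctsC_reim.
  apply: (@near_cts R (fun w => complex.Re (f w) * complex.Re (g w) + - (complex.Im (f w) * complex.Im (g w)))).
    by near=> w; rewrite cReM.
  by apply: ctsD; [exact: ctsM|apply: N; exact: ctsM].
apply: (@near_cts R (fun w => complex.Re (f w) * complex.Im (g w) + complex.Im (f w) * complex.Re (g w))).
  by near=> w; rewrite cImM.
by apply: ctsD; exact: ctsM.
Unshelve. all: by end_near.
Qed.

Lemma near_ctsC f g z : (\forall w \near z, f w = g w) ->
  {for z, continuous f} -> {for z, continuous g}.
Proof.
move=> fg hf; apply: ctsC_reim; [apply: near_cts (cts_Re hf)|apply: near_cts (cts_Im hf)].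
  by near=> w; congr complex.Re; near: w.
by near=> w; congr complex.Im; near: w.
Unshelve. all: by end_near.
Qed.

Lemma cts_bounded_complex f (L : R) : (forall z, {for z, continuous f}) ->
  exists2 M : R, 0 <= M & forall z, cabs z <= L -> cabs (f z) <= M.
Proof.
move=> cf; have [M1 M10 h1] := cts_bounded L (fun z => cts_Re (@cf z)).
have [M2 M20 h2] := cts_bounded L (fun z => cts_Im (@cf z)).
exists (M1 + M2); first exact: addr_ge0.
by move=> z zL; rewrite (le_trans (cabs_le _))// lerD ?h1 ?h2.
Qed.

Lemma CkC_on_cts k O f z : CkC_on k O f -> O z -> {for z, continuous f}.
Proof.
case: k => [k|] [h1 h2] Oz; apply: ctsC_reim.
- exact: Cn_on_cts h1 Oz.
- exact: Cn_on_cts h2 Oz.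
- exact: Cn_on_cts (h1 0%N) Oz.
- exact: Cn_on_cts (h2 0%N) Oz.
Qed.

Definition dchi chi w : C := pd true chi w +i* pd false chi w.
Definition testf chi e z w : C := (chi w)%:C * regk e (w - z).

Lemma dbarE f z : dbar f z = (pd true (fun w => complex.Re (f w)) z - pd false (fun w => complex.Im (f w)) z)
  +i* (pd true (fun w => complex.Im (f w)) z + pd false (fun w => complex.Re (f w)) z).
Proof. by apply: complex_ext; rewrite /dbar !reimE /= /pds /pdt /pd /=; ring. Qed.

Let den e z w : R := cabs (w - z) ^+ 2 + e ^+ 2.
Let den_neq0 e z w : 0 < e -> den e z w != 0.
Proof. by move=> e0; rewrite gt_eqF// ltr_wpDl ?sqr_ge0// exprn_gt0. Qed.

Lemma testf_smooth chi e z : 0 < e -> (forall m, Cn_on m setT chi) -> CkC_on None setT (testf chi e z).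
Proof.
move=> e0 hchi.
have hV m : Cn_on m setT (fun w => (den e z w)^-1).
  apply: Cn_onV; [exact: openT|by move=> w _; exact: den_neq0|].
  by apply: Cn_onD; [exact: openT|apply: Cn_on_sqdist; exact: openT|apply: Cn_on_cst; exact: openT].
have hX m b : Cn_on m setT (fun w => pcoord b w - pcoord b z).
  by apply: Cn_onB; [exact: openT|apply: Cn_on_coord; exact: openT|apply: Cn_on_cst; exact: openT].
split=> m.
  apply: (@Cn_on_eq R m setT (fun w => chi w * ((pcoord true w - pcoord true z) * (den e z w)^-1))).
  - exact: openT.
  - by move=> w _; rewrite /testf /regk /den !reimE /=; ring.
  - by do 2!(apply: Cn_onM; [exact: openT| |]) => //; exact: hchi.
apply: (@Cn_on_eq R m setT (fun w => chi w * (- (pcoord false w - pcoord false z) * (den e z w)^-1))).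
- exact: openT.
- by move=> w _; rewrite /testf /regk /den !reimE /=; ring.
- apply: Cn_onM; [exact: openT|exact: hchi|apply: Cn_onM; [exact: openT| |exact: hV]].
  by apply: Cn_onN; [exact: openT|exact: hX].
Qed.

Lemma dbar_testf chi e z w : 0 < e -> Cn_on 1 setT chi ->
  dbar (testf chi e z) w = dchi chi w * regk e (w - z) + (chi w * pois e (cabs (w - z)))%:C.
Proof.
move=> e0 hchi; pose q w := den e z w.
pose X b w := pcoord b w - pcoord b z.
have q0 v : q v != 0 := den_neq0 _ _ e0.
have iX b (c : bool) : isd b (X c) w (b == c)%:R.
  by have := isdD (isd_coord b c w) (isd_cst b (- pcoord c z) w); rewrite addr0.
have qE v : X true v * X true v + X false v * X false v + e ^+ 2 = q v.
  by rewrite /q /den sqr_cabs /X !reimE /= !expr2.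
have iq b : isd b q w (2 * X b w).
  have := isdD (isdD (isdM (iX b true) (iX b true)) (isdM (iX b false) (iX b false))) (isd_cst b (e ^+ 2) w).
  rewrite (_ : (fun _ => _) = q); last by apply/funext => v; exact: qE.
  by case: b => /=; congr isd; ring.
have iV b := isdV (q0 w) (iq b).
have ichi b := Cn_on_isd b hchi (I : setT w).
have iR b (c : bool) := isdM (ichi b) (isdM (iX b c) (iV b)).
have E1 : (fun v => complex.Re (testf chi e z v)) = (fun v => chi v * (X true v * (q v)^-1)).
  by apply/funext => v; rewrite /testf /regk /q /den /X !reimE /=; ring.
have E2 : (fun v => complex.Im (testf chi e z v)) = (fun v => - (chi v * (X false v * (q v)^-1))).
  by apply/funext => v; rewrite /testf /regk /q /den /X !reimE /=; ring.
rewrite dbarE E1 E2 !(isd_pd (iR _ _)) !(isd_pd (isdN (iR _ _))).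
have Ex : complex.Re (w - z) = X true w by rewrite !reimE.
have Ey : complex.Im (w - z) = X false w by rewrite !reimE.
rewrite /dchi /regk /pois -/(den e z w) -/(q w) Ex Ey.
have := qE w; have := q0 w; move: (X true w) (X false w) (q w) (chi w) (pd true chi w) (pd false chi w).
move=> x y k h h1 h2 k0 kE; apply: complex_ext; rewrite !reimE /=.
  have -> : e ^+ 2 = k - (x * x + y * y) by rewrite -kE; ring.
  by field.
by field.
Qed.

Lemma dchi_cts chi z : Cn_on 1 setT chi -> {for z, continuous (dchi chi)}.
Proof.
by move=> h; apply: ctsC_reim => /=; exact: Cn_on_cts (Cn_on_pd _ h) I.
Qed.

Lemma pd_near0 b (u : C -> R) z k : (\forall w \near z, u w = k) -> pd b u z = 0.
Proof.
move=> h; apply: isd_pd; apply: (isd_near _ (isd_cst b k z)).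
by near=> w; rewrite (near h w).
Unshelve. all: by end_near.
Qed.

Lemma dchi0 chi z k : (\forall w \near z, chi w = k) -> dchi chi z = 0.
Proof. by move=> h; rewrite /dchi !(pd_near0 _ h). Qed.

(* Applied with a cut-off function chi, so that F and m only matter on its support. *)
Lemma weyl_local (th B : R) (a chi : C -> R) F m (M N : R) :
  0 < th -> th < 1 -> kato th B a -> (forall k, Cn_on k setT chi) ->
  0 <= M -> (forall w, cabs ((chi w)%:C * F w) <= M) ->
  (forall z, {for z, continuous (fun w => (chi w)%:C * F w)}) ->
  0 <= N -> adm a N (fun w => dchi chi w * F w - (chi w)%:C * m w) ->
  (forall e z, 0 < e ->
     CI (fun w => dbar (testf chi e z) w * F w - testf chi e z w * m w) = 0) ->
  forall z, (chi z)%:C * F z = cauchyT (fun w => dchi chi w * F w - (chi w)%:C * m w) z.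
Proof.
move=> th0 th1 ka hchi M0 FM cF N0 hm H z.
apply: (weyl th0 th1 ka _ M0 FM (@cF z) N0 hm); first exact: cmeas_cts.
move=> e e0; rewrite -(H e z e0); apply: eq_cintg => q.
rewrite dbar_testf//.
rewrite /testf; move: (toC q) => w; rewrite [(chi w * _)%:C]rmorphM /=.
by move: (dchi _ _) (regk _ _) (pois _ _)%:C (chi w)%:C => x1 x2 x3 x4; ring.
Qed.
End test_functions.

(** * The weak equation for complex differentiable functions *)

Section goursat.
Variable R : realType.
Local Notation C := R[i].
Implicit Types (z w c : C) (e r : R) (f g F : C -> C) (chi : C -> R).

Definition cfrechet g z (a b : C) := forall e : R, 0 < e ->
  exists2 d : R, 0 < d & forall h, cabs h < d ->
    cabs (g (z + h) - g z - (a * (complex.Re h)%:C + b * (complex.Im h)%:C)) <= e * cabs h.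

Lemma cfrechet_reim g z a b :
  frechet (fun w => complex.Re (g w)) z (complex.Re a) (complex.Re b) ->
  frechet (fun w => complex.Im (g w)) z (complex.Im a) (complex.Im b) -> cfrechet g z a b.
Proof.
move=> h1 h2 e e0; have e2 : 0 < e / 2 by rewrite divr_gt0.
have [d1 d10 k1] := h1 _ e2; have [d2 d20 k2] := h2 _ e2.
exists (Num.min d1 d2); first by rewrite lt_min d10.
move=> h; rewrite lt_min => /andP[w1 w2]; rewrite (le_trans (cabs_le _))// !reimE /= !(mulr0, subr0, addr0, add0r).
by have := k1 _ w1; have := k2 _ w2; lra.
Qed.

Lemma frechet_Re g z a b : cfrechet g z a b ->
  frechet (fun w => complex.Re (g w)) z (complex.Re a) (complex.Re b).
Proof.
move=> hg e /hg[d d0 h]; exists d => // k /h; apply: le_trans.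
by apply: le_trans (Re_le_cabs _); rewrite !reimE /= !(mulr0, subr0, addr0, add0r).
Qed.

Lemma frechet_Im g z a b : cfrechet g z a b ->
  frechet (fun w => complex.Im (g w)) z (complex.Im a) (complex.Im b).
Proof.
move=> hg e /hg[d d0 h]; exists d => // k /h; apply: le_trans.
by apply: le_trans (Im_le_cabs _); rewrite !reimE /= !(mulr0, subr0, addr0, add0r).
Qed.

Lemma frechetN (u : C -> R) z (a b : R) : frechet u z a b -> frechet (fun w => - u w) z (- a) (- b).
Proof.
move=> hu e /hu[d d0 h]; exists d => // k /h; apply: le_trans.
by rewrite -normrN le_eqVlt; apply/orP; left; apply/eqP; congr `|_|; ring.
Qed.

Lemma cderiv_cfrechet f z l : cderiv f z l -> cfrechet f z l ('i * l).
Proof.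
move=> hf e /hf[d d0 h]; exists d => // k /h; apply: le_trans.
rewrite (_ : l * k = l * (complex.Re k)%:C + 'i * l * (complex.Im k)%:C)//.
by apply: complex_ext; rewrite !reimE /=; ring.
Qed.

Lemma cfrechet_lip f z a b : cfrechet f z a b -> exists2 d : R, 0 < d &
  forall h, cabs h < d -> cabs (f (z + h) - f z) <= (1 + cabs a + cabs b) * cabs h.
Proof.
move=> /(_ _ ltr01)[d d0 h]; exists d => // k /h hk.
set X := a * _ + _ in hk.
have hX : cabs X <= cabs a * cabs k + cabs b * cabs k.
  rewrite (le_trans (cabsD _ _))// !cabsM !cabs_real lerD// ler_wpM2l ?cabs_ge0//.
    exact: Re_le_cabs.
  exact: Im_le_cabs.
have := cabsD (f (z + k) - f z - X) X; rewrite subrK => h1.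
apply: (le_trans h1).
have -> : (1 + cabs a + cabs b) * cabs k = 1 * cabs k + (cabs a * cabs k + cabs b * cabs k) by ring.
exact: lerD hk hX.
Qed.

Lemma cfrechetM f g z a b a' b' : cfrechet f z a b -> cfrechet g z a' b' ->
  cfrechet (fun w => f w * g w) z (a * g z + f z * a') (b * g z + f z * b').
Proof.
move=> hf hg e e0.
have [d1 d10 k1] := cfrechet_lip hf; have [d2 d20 k2] := cfrechet_lip hg.
pose K1 := 1 + cabs a + cabs b; pose K2 := 1 + cabs a' + cabs b'.
have K10 : 0 < K1 by rewrite /K1 -addrA ltr_pwDl// addr_ge0 ?cabs_ge0.
have K20 : 0 < K2 by rewrite /K2 -addrA ltr_pwDl// addr_ge0 ?cabs_ge0.
have F0 : 0 < 1 + cabs (f z) by rewrite ltr_pwDl ?cabs_ge0.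
have G0 : 0 < 1 + cabs (g z) by rewrite ltr_pwDl ?cabs_ge0.
have [d3 d30 k3] := hf (e / 3 / (1 + cabs (g z))) (divr_gt0 (divr_gt0 e0 (ltr0Sn _ 2)) G0).
have [d4 d40 k4] := hg (e / 3 / (1 + cabs (f z))) (divr_gt0 (divr_gt0 e0 (ltr0Sn _ 2)) F0).
exists (Num.min (Num.min d1 d2) (Num.min (Num.min d3 d4) (e / 3 / (K1 * K2)))).
  by rewrite !lt_min d10 d20 d30 d40 !divr_gt0// mulr_gt0.
move=> h; rewrite !lt_min => /andP[/andP[h1 h2] /andP[/andP[h3 h4]]].
rewrite ltr_pdivlMr ?mulr_gt0// => h5.
have := k1 _ h1; have := k2 _ h2; have := k3 _ h3; have := k4 _ h4.
rewrite -/K1 -/K2; set Lf := a * _ + b * _; set Lg := a' * _ + b' * _ => e4 e3 e2 e1.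
have -> : f (z + h) * g (z + h) - f z * g z - ((a * g z + f z * a') * (complex.Re h)%:C +
    (b * g z + f z * b') * (complex.Im h)%:C) =
  (f (z + h) - f z) * (g (z + h) - g z) + ((f (z + h) - f z - Lf) * g z +
   f z * (g (z + h) - g z - Lg)) by rewrite /Lf /Lg; ring.
rewrite (le_trans (cabsD _ _))//; have := cabsD ((f (z + h) - f z - Lf) * g z) (f z * (g (z + h) - g z - Lg)).
rewrite !cabsM => e5.
have c0 := cabs_ge0 h.
have b1 : cabs (f (z + h) - f z) * cabs (g (z + h) - g z) <= e / 3 * cabs h.
  rewrite (le_trans (ler_pM (cabs_ge0 _) (cabs_ge0 _) e1 e2))//.
  by rewrite mulrACA mulrCA mulrC ler_wpM2r// mulrC ltW// mulrC.
have b2 : cabs (f (z + h) - f z - Lf) * cabs (g z) <= e / 3 * cabs h.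
  have G1 : cabs (g z) <= 1 + cabs (g z) by rewrite lerDr.
  rewrite (le_trans (ler_pM (cabs_ge0 _) (cabs_ge0 _) e3 G1))//.
  by rewrite mulrAC divfK ?gt_eqF.
have b3 : cabs (f z) * cabs (g (z + h) - g z - Lg) <= e / 3 * cabs h.
  have G1 : cabs (f z) <= 1 + cabs (f z) by rewrite lerDr.
  rewrite (le_trans (ler_pM (cabs_ge0 _) (cabs_ge0 _) G1 e4))//.
  by rewrite mulrA [X in X * _ <= _]mulrC divfK ?gt_eqF.
have -> : e * cabs h = e / 3 * cabs h + (e / 3 * cabs h + e / 3 * cabs h) by field.
apply: lerD b1 _; apply: le_trans e5 _; exact: lerD b2 b3.
Qed.

Lemma cfrechet0 g z : (\forall w \near z, g w = 0) -> cfrechet g z 0 0.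
Proof.
move=> /nbhs_cabsP[d d0 h] e e0; exists d => // k kd; rewrite !h ?subrr ?cabs0//; last by rewrite addrC addKr.
by rewrite !mul0r addr0 subr0 cabs0 mulr_ge0 ?cabs_ge0// ltW.
Qed.

Lemma CkC_on_cfrechet m O g z : open O -> O z -> CkC_on (Some m.+1) O g ->
  cfrechet g z (pd true (fun w => complex.Re (g w)) z +i* pd true (fun w => complex.Im (g w)) z)
    (pd false (fun w => complex.Re (g w)) z +i* pd false (fun w => complex.Im (g w)) z).
Proof.
by move=> oO Oz [h1 h2]; apply: cfrechet_reim => /=; apply: Cn_on_frechet; eauto.
Qed.

Lemma near_out c (r : R) z : r < cabs (z - c) -> \forall w \near z, r < cabs (w - c).
Proof.
move=> rz; apply/nbhs_cabsP; exists (cabs (z - c) - r); first by rewrite subr_gt0.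
move=> w hw; have := cabsD (z - w) (w - c); rewrite addrA subrK => h.
by move: hw; rewrite cabsBC; lra.
Qed.

Lemma near_in c (r : R) z : cabs (z - c) < r -> \forall w \near z, cabs (w - c) < r.
Proof. exact: open_near (@open_cball R c r). Qed.

(** Stokes' theorem for phi f, where the derivative of f is not known to be continuous. It drops out
    of d_s + i d_t applied to phi f, which leaves the continuous function (dbar phi) f; this is why
    the divergence theorem asks for continuity of the divergence alone. *)
Lemma dbar_cderiv_zero phi f c (r r' : R) : 0 <= r -> r < r' ->
  CkC_on None setT phi -> (forall w, r <= cabs (w - c) -> phi w = 0) ->
  (forall w, cabs (w - c) < r' -> exists l, cderiv f w l) ->
  CI (fun w => dbar phi w * f w) = 0.
Proof.
move=> r0 rr' hphi phi0 hf; pose g w := phi w * f w.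
pose D w := 'D_1 f w.
have hD w : cabs (w - c) < r' -> cderiv f w (D w).
  by move=> /hf h; apply: derivable_cderiv; apply/cderivP.
have near0 w : r' <= cabs (w - c) -> \forall v \near w, phi v = 0.
  by move=> h; apply: filterS (near_out (lt_le_trans rr' h)) => v hv; apply: phi0; exact: ltW.
pose ps w := pd true (fun w => complex.Re (phi w)) w +i* pd true (fun w => complex.Im (phi w)) w.
pose pt w := pd false (fun w => complex.Re (phi w)) w +i* pd false (fun w => complex.Im (phi w)) w.
have ps0 w : r' <= cabs (w - c) -> ps w = 0 /\ pt w = 0.
  move=> /near0 h; rewrite /ps /pt.
  have h1 : \forall v \near w, complex.Re (phi v) = 0 by apply: filterS h => v ->.
  have h2 : \forall v \near w, complex.Im (phi v) = 0 by apply: filterS h => v ->.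
  by rewrite !(pd_near0 _ h1) !(pd_near0 _ h2).
have dE w : dbar phi w = ps w + 'i * pt w by rewrite dbarE; apply: complex_ext; rewrite /ps /pt !reimE /=; ring.
have hphi1 m : CkC_on (Some m) setT phi by case: hphi => h1 h2; split; [exact: h1|exact: h2].
have gF w : cfrechet g w (ps w * f w + phi w * D w) (pt w * f w + phi w * ('i * D w)).
  have [wr|rw] := ltP (cabs (w - c)) r'.
    apply: cfrechetM; first exact: (CkC_on_cfrechet openT I (hphi1 1%N)).
    exact: cderiv_cfrechet (hD w wr).
  have h := near0 w rw; have [-> ->] := ps0 w rw; rewrite phi0 ?(le_trans (ltW rr'))// !mul0r !addr0.
  by apply: cfrechet0; apply: filterS h => v; rewrite /g => ->; rewrite mul0r.
pose G w := dbar phi w * f w.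
have G0 w : r' <= cabs (w - c) -> G w = 0.
  by move=> rw; have [h1 h2] := ps0 w rw; rewrite /G dE h1 h2 mulr0 addr0 mul0r.
have cdb w : {for w, continuous (dbar phi)}.
  have [h1 h2] := hphi1 1%N.
  apply: near_ctsC (_ : {for w, continuous (fun v => ps v * 1 + 'i * pt v)}); last first.
    apply: ctsC_reim.
      apply: (@near_cts R (fun v => pd true (fun w => complex.Re (phi w)) v + -1 * pd false (fun w => complex.Im (phi w)) v)).
        by near=> v; rewrite /ps /pt !reimE /=; ring.
      by apply: ctsD; [|apply: ctsM; first exact: cts_cst]; apply: Cn_on_cts (Cn_on_pd _ _) I; eassumption.
    apply: (@near_cts R (fun v => pd true (fun w => complex.Im (phi w)) v + pd false (fun w => complex.Re (phi w)) v)).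
      by near=> v; rewrite /ps /pt !reimE /=; ring.
    by apply: ctsD; apply: Cn_on_cts (Cn_on_pd _ _) I; eassumption.
  by near=> v; rewrite dE mulr1.
have cG w : {for w, continuous G}.
  have [wr|rw] := ltP (cabs (w - c)) r'.
    by apply: ctsCM; [exact: cdb|exact: cderiv_continuous (hD w wr)].
  have h : \forall v \near w, 0 = G v.
    apply: filterS (near_out (lt_le_trans rr' rw)) => v hv.
    have h : \forall u \near v, phi u = 0.
      by apply: filterS (near_out hv) => u hu; apply: phi0; exact: ltW.
    have h1 : \forall u \near v, complex.Re (phi u) = 0 by apply: filterS h => u ->.
    have h2 : \forall u \near v, complex.Im (phi u) = 0 by apply: filterS h => u ->.
    by rewrite /G dbarE !(pd_near0 _ h1) !(pd_near0 _ h2) subr0 addr0 mul0r.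
  by apply: near_ctsC h _; apply: ctsC_reim; exact: cts_cst.
pose L := cabs c + r'; have L0 : 0 < L by rewrite ltr_wpDl ?cabs_ge0// (le_lt_trans r0).
have out w : L <= cabs w -> r' <= cabs (w - c).
  by have := cabsD (w - c) c; rewrite subrK /L; lra.
have [M M0 hM] := cts_bounded_complex L cG.
have GM w : cabs (G w) <= M.
  by have [/ltW/hM//|/out/G0 ->] := ltP (cabs w) L; rewrite cabs0.
have g0 w : L <= cabs w -> g w = 0.
  by move=> /out h; rewrite /g phi0 ?mul0r// (le_trans (ltW rr')).
(* The terms containing the derivative of f carry the factor i^2 + 1 = 0. *)
have AE w : (ps w * f w + phi w * D w) + 'i * (pt w * f w + phi w * ('i * D w)) = G w.
  have -> : (ps w * f w + phi w * D w) + 'i * (pt w * f w + phi w * ('i * D w)) =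
    G w + ('i * 'i + 1) * (phi w * D w) by rewrite /G dE; ring.
  by rewrite -expr2 sqr_i addNr mul0r addr0.
apply: complex_ext => /=.
  apply: (@divergence_zero R (fun w => complex.Re (g w)) (fun w => - complex.Im (g w))
    _ _ _ _ (fun w => complex.Re (G w)) L M (fun w => frechet_Re (gF w)) (fun w => frechetN (frechet_Im (gF w)))) => //.
  - by move=> w; rewrite -[LHS]/(complex.Re (G w)) -AE !reimE /=; ring.
  - by move=> w; exact: cts_Re (@cG w).
  - by move=> w; exact: le_trans (Re_le_cabs _) (GM w).
  - by move=> w /g0 ->.
  - by move=> w /g0 -> /=; rewrite oppr0.
  - by move=> w /out/G0; rewrite /G => ->.
apply: (@divergence_zero R (fun w => complex.Im (g w)) (fun w => complex.Re (g w))
    _ _ _ _ (fun w => complex.Im (G w)) L M (fun w => frechet_Im (gF w)) (fun w => frechet_Re (gF w))) => //.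
- by move=> w; rewrite -[LHS]/(complex.Im (G w)) -AE !reimE /=; ring.
- by move=> w; exact: cts_Im (@cG w).
- by move=> w; exact: le_trans (Im_le_cabs _) (GM w).
- by move=> w /g0 ->.
- by move=> w /g0 ->.
- by move=> w /out/G0; rewrite /G => ->.
Unshelve. all: by end_near.
Qed.
End goursat.

Section holomorphic_regularity.
Variable R : realType.
Local Notation C := R[i].
Implicit Types (z w c : C) (e r : R) (f g F : C -> C) (chi : C -> R).

Lemma adm_ballf (L N : R) (m : C -> C) : cmeas m -> (forall w, cabs (m w) <= N) ->
  (forall w, L < cabs w -> m w = 0) -> adm (ballf 0 L) N m.
Proof.
move=> mm mN m0; split=> // w; rewrite /ballf subr0; case: ifPn => [_|]; first by rewrite mulr1.
by rewrite -ltNge => /m0 ->; rewrite cabs0 mulr0.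
Qed.

Lemma cut_continuous chi F c r r' : r < r' -> (forall z, {for z, continuous chi}) ->
  (forall w, r <= cabs (w - c) -> chi w = 0) ->
  (forall w, cabs (w - c) < r' -> {for w, continuous F}) ->
  forall z, {for z, continuous (fun w => (chi w)%:C * F w)}.
Proof.
move=> rr' cchi chi0 cF z; have [zr|rz] := ltP (cabs (z - c)) r'.
  by apply: ctsCM; [apply: ctsC_reim => /=; [exact: cchi|exact: cts_cst]|exact: cF].
apply: (@near_ctsC R (fun=> 0)).
  by apply: filterS (near_out (lt_le_trans rr' rz)) => w /ltW/chi0 ->; rewrite mul0r.
by apply: ctsC_reim; exact: cts_cst.
Qed.

Lemma dchi_cut_continuous chi F c r r' : r < r' -> Cn_on 1 setT chi ->
  (forall w, r <= cabs (w - c) -> chi w = 0) ->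
  (forall w, cabs (w - c) < r' -> {for w, continuous F}) ->
  forall z, {for z, continuous (fun w => dchi chi w * F w)}.
Proof.
move=> rr' hchi chi0 cF z; have [zr|rz] := ltP (cabs (z - c)) r'.
  by apply: ctsCM; [exact: dchi_cts|exact: cF].
apply: (@near_ctsC R (fun=> 0)); last by apply: ctsC_reim; exact: cts_cst.
apply: filterS (near_out (lt_le_trans rr' rz)) => w hw.
rewrite (@dchi0 _ _ _ 0) ?mul0r//.
by apply: filterS (near_out hw) => v /ltW/chi0.
Qed.

Lemma cabs_out c (r : R) w : cabs c + r < cabs w -> r < cabs (w - c).
Proof. by have := cabsD (w - c) c; rewrite subrK; lra. Qed.

(** By Goursat f solves the weak equation with m = 0, so chi f is the Cauchy transform of (dchi) f.
    That density vanishes where chi is constant, in particular near c, and there the transform is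
    twice differentiable. *)
Lemma derive_cderiv_ball f c (r : R) : 0 < r ->
  (forall w, cabs (w - c) < r -> exists l, cderiv f w l) ->
  exists l, cderiv (fun w => 'D_1 f w) c l.
Proof.
move=> r0 hf; have r30 : 0 < r / 3 by rewrite divr_gt0.
have [chi [hchi chi1 chi0 _]] := @bump_exists R c (r / 3) (r / 2) (ltW r30) ltac:(lra).
have r2r : r / 2 < r by lra.
have cf w : cabs (w - c) < r -> {for w, continuous f} by move=> /hf[l]; exact: cderiv_continuous.
have cchi z : {for z, continuous chi} := Cn_on_cts (hchi 0%N) I.
have c1 := cut_continuous r2r cchi chi0 cf.
have c2 := dchi_cut_continuous r2r (hchi 1%N) chi0 cf.
have dchi_out w : r / 2 < cabs (w - c) -> dchi chi w = 0.
  by move=> hw; apply: (@dchi0 _ _ _ 0); apply: filterS (near_out hw) => v /ltW/chi0.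
pose L := cabs c + r.
have out w : L < cabs w -> r / 2 < cabs (w - c).
  by move=> /cabs_out; exact: lt_trans.
have [M M0 hM] := cts_bounded_complex L c1; have [N N0 hN] := cts_bounded_complex L c2.
(* The density is bounded with bounded support, so the indicator of a large disk is a majorant; 3 is
   just an exponent above 2. *)
have [B kB] := @kato_ball R 3 L ltac:(lra) ltac:(by rewrite addr_ge0 ?cabs_ge0 ?ltW).
have /andP[th0 th1] := @kato_exponent_itv R 3 ltac:(lra).
pose m w := dchi chi w * f w - (chi w)%:C * 0.
have mE : m = (fun w => dchi chi w * f w) by apply/funext => w; rewrite /m mulr0 subr0.
have hm : adm (ballf 0 L) N m.
  rewrite mE; apply: adm_ballf; first exact: cmeas_cts.
    move=> w; have [/hN//|/out/dchi_out ->] := leP (cabs w) L.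
    by rewrite mul0r cabs0.
  by move=> w /out/dchi_out ->; rewrite mul0r.
have rep z : (chi z)%:C * f z = cauchyT m z.
  apply: (weyl_local th0 th1 kB hchi M0 _ c1 N0 hm) => [w|e v e0].
    have [/hM//|/out/ltW/chi0 ->] := leP (cabs w) L.
    by rewrite mul0r cabs0.
  rewrite -[RHS](@dbar_cderiv_zero R (testf chi e v) f c (r / 2) r)//; last 2 first.
  - exact: testf_smooth.
  - by move=> w /chi0; rewrite /testf => ->; rewrite mul0r.
  - by apply: eq_cintg => q; rewrite mulr0 subr0.
  - by rewrite divr_ge0// ltW.
pose V := [set w | cabs (w - c) < r / 3].
have oV : open V by exact: open_cball.
have nearV z : V z -> \forall w \near z, V w by exact: open_near.
have [|g hg] := cauchyT_off_support kB N0 hm oV.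
  move=> w Vw; rewrite mE (@dchi0 _ _ _ 1) ?mul0r//.
  by apply: filterS (nearV w Vw) => v /ltW/chi1.
have fE w : V w -> f w = cauchyT m w by move=> /ltW/chi1 h; rewrite -rep h mul1r.
have Vc : V c by rewrite /V /= subrr cabs0.
have [_ [l hl]] := hg c Vc; exists l.
apply: cderiv_near hl; apply: filterS (nearV c Vc) => w Vw; apply/esym/derive_cderiv.
apply: cderiv_near (hg w Vw).1.
by apply: filterS (nearV w Vw) => v /fE.
Qed.

Lemma frechet_isd_dir b (u : C -> R) z (l m : R) : frechet u z l m -> isd b u z (if b then l else m).
Proof.
move=> hu; apply/isdP => e /hu[d d0 h]; exists d => // t td.
have := h (t%:C * pdir R b); rewrite cabs_pdir => /(_ td); apply: le_trans.
have [-> ->] : complex.Re (t%:C * pdir R b) = (if b then t else 0) /\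
    complex.Im (t%:C * pdir R b) = (if b then 0 else t).
  by case: b => /=; split; ring.
by case: b; rewrite mulr0 ?addr0 ?add0r.
Qed.

(** Needed for coordinate changes. The partial derivatives are D and i D with D the complex
    derivative, which is again complex differentiable, so induction applies. *)
Lemma cderiv_CkC_on (O : set C) f : open O -> (forall z, O z -> exists l, cderiv f z l) ->
  CkC_on None O f.
Proof.
move=> oO; suff H m : forall f, (forall z, O z -> exists l, cderiv f z l) ->
    Cn_on m O (fun z => complex.Re (f z)) /\ Cn_on m O (fun z => complex.Im (f z)).
  by move=> hf; split=> m; [have [] := H m f hf|have [] := H m f hf].
elim: m => [|m IH] {}f hf.
  split; split=> // z /hf[l /cderiv_continuous cf]; [exact: cts_Re|exact: cts_Im].
pose D w := 'D_1 f w.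
have fD z : O z -> cderiv f z (D z).
  by move=> /hf h; apply: derivable_cderiv; apply/cderivP.
have [D1 D2] : Cn_on m O (fun z => complex.Re (D z)) /\ Cn_on m O (fun z => complex.Im (D z)).
  apply: IH => z Oz; have /openP_cabs/(_ z Oz)[r r0 hr] := oO.
  by apply: (derive_cderiv_ball r0) => w /hr; exact: hf.
have key (u : C -> R) (a b : C -> R) : (forall z, O z -> {for z, continuous u}) ->
    (forall z, O z -> frechet u z (a z) (b z)) ->
    Cn_on m O a -> Cn_on m O b -> Cn_on m.+1 O u.
  move=> cu hu ha hb; apply/Cn_onS; split=> // c.
  have E z : O z -> isd c u z (if c then a z else b z) by move=> Oz; exact: frechet_isd_dir (hu z Oz).
  split=> [z Oz|]; first by rewrite (isd_pd (E z Oz)); exact: E.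
  by case: c E => E; [apply: Cn_on_eq ha|apply: Cn_on_eq hb] => // z Oz; rewrite (isd_pd (E z Oz)).
split.
  apply: (key _ (fun z => complex.Re (D z)) (fun z => complex.Re ('i * D z))).
  - by move=> z /hf[l /cderiv_continuous cf]; exact: cts_Re.
  - by move=> z Oz; exact: frechet_Re (cderiv_cfrechet (fD z Oz)).
  - exact: D1.
  - by apply: Cn_on_eq (Cn_onN oO D2) => // z _; rewrite !reimE /=; ring.
apply: (key _ (fun z => complex.Im (D z)) (fun z => complex.Im ('i * D z))).
- by move=> z /hf[l /cderiv_continuous cf]; exact: cts_Im.
- by move=> z Oz; exact: frechet_Im (cderiv_cfrechet (fD z Oz)).
- exact: D2.
- by apply: Cn_on_eq D1 => // z _; rewrite !reimE /=; ring.
Qed.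

Lemma test_function_testf chi e z (r : R) : 0 < e -> r < 1 -> (forall m, Cn_on m setT chi) ->
  (forall w, r <= cabs w -> chi w = 0) -> test_function (testf chi e z).
Proof.
move=> e0 r1 hchi chi0; split; first exact: testf_smooth.
move=> w cw; apply/open_disk_cabs; rewrite ltNge; apply/negP => w1.
have rw : r < cabs (w - 0) by rewrite subr0 (lt_le_trans r1).
have [v [/= v0]] := cw _ (near_out rw); rewrite subr0 => /ltW/chi0 h.
by move: v0; rewrite /testf h mul0r eqxx.
Qed.

Lemma Cintegral_disk (g : C -> C) : (forall w, 1 < cabs w -> g w = 0) -> Cintegral (@disk R) g = CI g.
Proof.
move=> g0; rewrite /Cintegral.
have out (h : C -> R) : (forall w, 1 < cabs w -> h w = 0) ->
    ((fun q => h (toC q)) \_ ((@toC R) @^-1` @disk R)) = (fun q => h (toC q)).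
  move=> h0; apply/funext => q; rewrite /patch; case: ifPn => // /negP nq.
  rewrite h0// ltNge; apply/negP => h1; apply: nq; rewrite inE; exact/disk_cabs.
by apply: complex_ext => /=; rewrite Rintegral_mkcond; congr Rintegral;
  [apply: (out (fun w => complex.Re (g w)))|apply: (out (fun w => complex.Im (g w)))] => w /g0 ->.
Qed.

(** The cut-off carries the equation from the disk to the whole plane at the price of the density
    (dchi) F. This term is bounded on the disk and becomes admissible because a dominates the
    indicator of the disk. *)
Lemma weak_representation (th B : R) (a chi : C -> R) F m (O : set C) (N r : R) :
  0 < th -> th < 1 -> kato th B a -> (forall k, Cn_on k setT chi) -> r < 1 ->
  (forall w, r <= cabs w -> chi w = 0) -> (forall w, ballf 0 1 w <= a w) ->
  open O -> @disk R `<=` O -> (forall w, O w -> {for w, continuous F}) ->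
  0 <= N -> adm a N (fun w => (ballf 0 1 w)%:C * m w) ->
  (forall phi, test_function phi ->
     Cintegral (@disk R) (fun w => - dbar phi w * F w + phi w * m w) = 0) ->
  exists2 M, 0 <= M & adm a M (fun w => dchi chi w * F w - (chi w)%:C * m w) /\
  forall z, (chi z)%:C * F z = cauchyT (fun w => dchi chi w * F w - (chi w)%:C * m w) z.
Proof.
move=> th0 th1 ka hchi r1 chi0 aball oO dO cF N0 hm H.
have cF1 w : cabs (w - 0) < 1 -> {for w, continuous F}.
  by rewrite subr0 => /ltW h; apply: cF; apply: dO; apply/disk_cabs.
have cchi z : {for z, continuous chi} := Cn_on_cts (hchi 0%N) I.
have chi0' w : r <= cabs (w - 0) -> chi w = 0 by rewrite subr0; exact: chi0.
have c1 := cut_continuous r1 cchi chi0' cF1.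
have c2 := dchi_cut_continuous r1 (hchi 1%N) chi0' cF1.
have c3 z : {for z, continuous (fun w => (chi w)%:C : C)}.
  by apply: ctsC_reim => /=; [exact: cchi|exact: cts_cst].
have dchi_out w : r < cabs w -> dchi chi w = 0.
  rewrite -[X in cabs X]subr0 => hw; apply: (@dchi0 _ _ _ 0).
  by apply: filterS (near_out hw) => v /ltW/chi0'.
have [M M0 hM] := cts_bounded_complex 1 c1; have [K K0 hK] := cts_bounded_complex 1 c2.
have [L L0 hL] := cts_bounded_complex 1 c3.
have admK : adm a K (fun w => dchi chi w * F w).
  split=> [|w]; first exact: cmeas_cts.
  have a0 := le_trans (ballf_ge0 0 1 w) (aball w).
  have [w1|w1] := leP (cabs w) 1; last first.
    by rewrite dchi_out ?(lt_trans r1)// mul0r cabs0 mulr_ge0.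
  rewrite (le_trans (hK w w1))// ler_peMr//; apply: le_trans (aball w).
  by rewrite /ballf subr0 w1.
have chiL w : cabs ((chi w)%:C : C) <= L.
  by have [/hL//|w1] := leP (cabs w) 1; rewrite chi0 ?cabs0// ltW// (lt_trans r1).
have hm' : adm a (L * N) (fun w => (chi w)%:C * m w).
  have <- : (fun w => (chi w)%:C * ((ballf 0 1 w)%:C * m w)) = (fun w => (chi w)%:C * m w).
    apply/funext => w; rewrite /ballf subr0; case: ifPn => [_|]; first by rewrite mul1r.
    by rewrite -ltNge => h; rewrite chi0 ?mul0r// ltW// (lt_trans r1).
  exact: admM L0 hm (cmeas_cts c3) chiL.
have hd := admD admK (admN hm'); have KN0 : 0 <= K + L * N by rewrite addr_ge0// mulr_ge0.
exists (K + L * N) => //; split=> // z.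
apply: (weyl_local th0 th1 ka hchi M0 _ c1 KN0 hd) => [w|e v e0].
  by have [/hM//|w1] := leP (cabs w) 1; rewrite chi0 ?mul0r ?cabs0// ltW// (lt_trans r1).
(* The weak equation contains -dbar phi; testing it with the negative cut-off restores the signs
   that [weyl_local] expects. *)
pose nchi w := - chi w.
have hn k : Cn_on k setT nchi by apply: Cn_onN; [exact: openT|exact: hchi].
have n0 w : r <= cabs w -> nchi w = 0 by move=> /chi0; rewrite /nchi => ->; rewrite oppr0.
have tn := test_function_testf v e0 r1 hn n0.
have dn w : dchi nchi w = - dchi chi w.
  rewrite /dchi /nchi; have h b := isdN (Cn_on_isd b (hchi 1%N) (I : setT w)).
  by rewrite !(isd_pd (h _)).
have tE w : testf nchi e v w = - testf chi e v w.
  by rewrite /testf /nchi raddfN mulNr.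
have dE w : dbar (testf nchi e v) w = - dbar (testf chi e v) w.
  rewrite !dbar_testf// dn /nchi; have -> (x y : R) : (- x * y)%:C = - (x * y)%:C :> C.
    by rewrite -raddfN mulNr.
  by rewrite mulNr opprD.
rewrite -(H _ tn) Cintegral_disk.
  by apply: eq_cintg => q; rewrite dE tE opprK mulNr.
move=> w w1; rewrite dE tE opprK dbar_testf// dchi_out ?(lt_trans r1)//.
by rewrite /testf chi0 ?(ltW (lt_trans r1 w1))// !(mul0r, oppr0, addr0).
Qed.

End holomorphic_regularity.

(** * The gauge transformation on a small disk *)

Section picard.
Variable R : realType.
Local Notation C := R[i].

(** The intervals around u m of radius 2 G 2^-m are nested, because the radius drops by G 2^-m at
    each step; the supremum of their left ends is the limit, with the stated rate. *)
Lemma geom_limit (u : nat -> R) (G : R) : (forall m, `|u m.+1 - u m| <= G * 2^-1 ^+ m) ->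
  exists l, forall m, `|u m - l| <= 2 * G * 2^-1 ^+ m.
Proof.
move=> hu; pose d m := 2 * G * 2^-1 ^+ m.
have dS m : d m.+1 = d m - G * 2^-1 ^+ m by rewrite /d exprS; field.
have G0 : 0 <= G by have := hu 0%N; rewrite expr0 mulr1; exact: le_trans.
have d0 m : 0 <= d m by rewrite /d !mulr_ge0// exprn_ge0.
have mono m n : (m <= n)%N -> u m - d m <= u n - d n /\ u n + d n <= u m + d m.
  move=> /subnK <-; elim: (n - m)%N => [|k [h1 h2]]; first by rewrite add0n.
  have := hu (k + m)%N; rewrite ler_norml => /andP[k1 k2].
  by move: h1 h2; rewrite addSn !dS; lra.
have key m n : u m - d m <= u n + d n.
  have [mn|/ltnW nm] := leqP m n.
    by have [h _] := mono _ _ mn; have := d0 n; lra.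
  by have [_ h] := mono _ _ nm; have := d0 m; lra.
exists (sup [set u n - d n | n in setT]) => m.
have ne : [set u n - d n | n in setT] !=set0 by exists (u 0%N - d 0%N), 0%N.
have ub : ubound [set u n - d n | n in setT] (u m + d m) by move=> _ [k _ <-].
have h1 : u m - d m <= sup [set u n - d n | n in setT].
  by apply: ub_le_sup; [exists (u m + d m)|exists m].
have h2 : sup [set u n - d n | n in setT] <= u m + d m by exact: ge_sup.
by rewrite -/(d m) ler_norml; apply/andP; split; lra.
Qed.

Lemma geom_limit_complex (u : nat -> C) (G : R) : (forall m, cabs (u m.+1 - u m) <= G * 2^-1 ^+ m) ->
  exists l, forall m, cabs (u m - l) <= 4 * G * 2^-1 ^+ m.
Proof.
move=> hu.
have h b m : `|pcoord b (u m.+1) - pcoord b (u m)| <= G * 2^-1 ^+ m.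
  apply: le_trans (hu m); case: b; rewrite /= -?cReN -?cReD -?cImN -?cImD.
    exact: Re_le_cabs.
  exact: Im_le_cabs.
have [l1 h1] := geom_limit (h true); have [l2 h2] := geom_limit (h false).
exists (l1 +i* l2) => m; rewrite (le_trans (cabs_le _))// !reimE /=.
by have := h1 m; have := h2 m; rewrite /=; lra.
Qed.

Lemma geom_null (x G : R) : (forall m, x <= G * 2^-1 ^+ m) -> x <= 0.
Proof.
move=> h; rewrite leNgt; apply/negP => x0.
have [k hk] := pow2_gt (G / x).
have p2 : (0 : R) < 2 ^+ k by rewrite exprn_gt0.
have := h k; rewrite exprVn ler_pdivlMr//; move: hk; rewrite ltr_pdivrMr// => hk.
by rewrite leNgt mulrC hk.
Qed.

Lemma pow2_cvg0 (G : R) : (fun m => G * 2^-1 ^+ m) @ \oo --> (0 : R).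
Proof.
rewrite -[X in _ --> X](mulr0 G); apply: (@cvgM R); first exact: cvg_cst.
by apply: cvg_expr; rewrite gtr0_norm ?invr_gt0// invf_lt1// ltr1n.
Qed.

Lemma cmf_limit d (T : measurableType d) (u : nat -> T -> C) (v : T -> C) (G : R) :
  (forall m, cmf (u m)) -> (forall m x, cabs (u m x - v x) <= G * 2^-1 ^+ m) -> cmf v.
Proof.
move=> mu hu.
have key (f : nat -> T -> R) (g : T -> R) : (forall m, measurable_fun setT (f m)) ->
    (forall m x, `|f m x - g x| <= G * 2^-1 ^+ m) -> measurable_fun setT g.
  move=> mf hf; apply: (measurable_fun_cvg mf) => x _.
  apply/cvgrPdist_lt => e e0; have /cvgrPdist_lt/(_ _ e0) := pow2_cvg0 G.
  apply: filterS => m; rewrite sub0r normrN; apply: le_lt_trans; rewrite distrC.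
  exact: le_trans (hf m x) (ler_norm _).
split; [apply: (key (fun m x => complex.Re (u m x)))|apply: (key (fun m x => complex.Im (u m x)))].
- by move=> m; case: (mu m).
- by move=> m x; apply: le_trans (hu m x); rewrite -cReN -cReD; exact: Re_le_cabs.
- by move=> m; case: (mu m).
- by move=> m x; apply: le_trans (hu m x); rewrite -cImN -cImD; exact: Im_le_cabs.
Qed.

Variables (th B rho Kb : R) (a : C -> R) (n : nat) (b : 'I_n -> 'I_n -> C -> C).
Hypotheses (th0 : 0 < th) (th1 : th < 1) (ka : kato th B a).
Hypotheses (Kb0 : 0 <= Kb) (hb : forall j k, adm a Kb (b j k))
  (b0 : forall j k w, rho < cabs w -> b j k w = 0).

(** The gauge multiplies f from the left and the coefficient from the right, so the rows of the
    equation Psi = 1 + T (Psi b) decouple; this is its operator on a single row. *)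
Definition rowT (y : 'I_n -> C -> C) k z := cauchyT (fun w => \sum_j y j w * b j k w) z.
Definition contraction := 2 * (kappa R)^-1 * ((2 * rho) `^ th * B) * (n%:R * Kb).

Lemma row_adm (y : 'I_n -> C -> C) M k : (forall j, cmeas (y j)) -> 0 <= M ->
  (forall j w, cabs w <= rho -> cabs (y j w) <= M) ->
  adm a (n%:R * (M * Kb)) (fun w => \sum_j y j w * b j k w).
Proof.
move=> my M0 hy; apply: adm_sum => j; have [mb bK] := hb j k.
split=> [|w]; first exact: cmfM (my j) mb.
rewrite cabsM; have [wr|/b0 ->] := leP (cabs w) rho; last first.
  by rewrite cabs0 mulr0 mulr_ge0 ?mulr_ge0//; case: ka => _ + _ _.
by rewrite -mulrA ler_pM ?cabs_ge0 ?hy.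
Qed.

Lemma rowT_small y M k z : (forall j, cmeas (y j)) -> 0 <= M ->
  (forall j w, cabs w <= rho -> cabs (y j w) <= M) -> cabs z <= rho ->
  cabs (rowT y k z) <= contraction * M.
Proof.
move=> my M0 hy zr; have nM : 0 <= n%:R * (M * Kb) by rewrite !mulr_ge0.
have := cauchyT_small th0 ka nM (row_adm k my M0 hy) _ zr.
rewrite /contraction => h; apply: le_trans (h _) _.
  by move=> w wr; rewrite big1// => j _; rewrite b0// mulr0.
by rewrite le_eqVlt; apply/orP; left; apply/eqP; ring.
Qed.

Lemma rowT_continuous y M k z : (forall j, cmeas (y j)) -> 0 <= M ->
  (forall j w, cabs w <= rho -> cabs (y j w) <= M) -> {for z, continuous (rowT y k)}.
Proof.
move=> my M0 hy; have nM : 0 <= n%:R * (M * Kb) by rewrite !mulr_ge0.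
exact: (@cauchyT_continuous R th B a th0 th1 ka _ _ z nM (row_adm k my M0 hy)).
Qed.

Lemma rowTB y y' M M' k z : (forall j, cmeas (y j)) -> (forall j, cmeas (y' j)) ->
  0 <= M -> 0 <= M' -> (forall j w, cabs w <= rho -> cabs (y j w) <= M) ->
  (forall j w, cabs w <= rho -> cabs (y' j w) <= M') ->
  rowT (fun j w => y j w - y' j w) k z = rowT y k z - rowT y' k z.
Proof.
move=> my my' M0 M'0 hy hy'; rewrite /rowT.
have nM : 0 <= n%:R * (M * Kb) by rewrite !mulr_ge0.
have nM' : 0 <= n%:R * (M' * Kb) by rewrite !mulr_ge0.
rewrite -(cauchyTN th0 ka _ nM' (row_adm k my' M'0 hy')).
rewrite -(cauchyTD th0 ka _ nM nM' (row_adm k my M0 hy) (admN (row_adm k my' M'0 hy'))).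
apply: eq_cauchyT => w; rewrite -sumrN -big_split /=; apply: eq_bigr => j _.
by rewrite mulrBl.
Qed.

Lemma eq_rowT y y' k z : (forall j w, cabs w <= rho -> y j w = y' j w) -> rowT y k z = rowT y' k z.
Proof.
move=> E; apply: eq_cauchyT => w; apply: eq_bigr => j _.
by have [/E ->//|/b0 ->] := leP (cabs w) rho; rewrite !mulr0.
Qed.

Hypothesis small : contraction <= 2^-1.

(** The iteration contracts in the sup norm over the disk of radius rho. As b vanishes outside, the
    limit on that disk already determines T (y b) everywhere, and the equation itself extends the
    solution to the plane. *)
Lemma rowT_solution (g : 'I_n -> C -> C) (G : R) : 0 <= G ->
  (forall k z, {for z, continuous (g k)}) -> (forall k z, cabs z <= rho -> cabs (g k z) <= G) ->
  exists x, [/\ forall k z, {for z, continuous (x k)},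
    forall k z, cabs z <= rho -> cabs (x k z) <= 2 * G &
    forall k z, x k z = g k z + rowT x k z].
Proof.
move=> G0 cg hg.
pose it := fix it (m : nat) : 'I_n -> C -> C :=
  if m is m'.+1 then fun k z => g k z + rowT (it m') k z else g.
have half M : 0 <= M -> contraction * M <= 2^-1 * M by move=> M0; rewrite ler_wpM2r.
have G20 : 0 <= 2 * G by rewrite mulr_ge0.
have [cit bit] : (forall m k z, {for z, continuous (it m k)}) /\
    forall m k z, cabs z <= rho -> cabs (it m k z) <= 2 * G.
  apply: all_and2; elim=> [|m [IH1 IH2]]; first by split=> // k z /hg h; rewrite (le_trans (h k))//; lra.
  have mi j := cmeas_cts (IH1 j); split=> k z.
    have c := @rowT_continuous (it m) (2 * G) k z mi G20 IH2.
    by apply: ctsC_reim; [apply: near_cts (ctsD (cts_Re (@cg k z)) (cts_Re c))|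
      apply: near_cts (ctsD (cts_Im (@cg k z)) (cts_Im c))]; near=> w; rewrite /= reimE.
  move=> zr; rewrite /= (le_trans (cabsD _ _))//.
  have := rowT_small k mi G20 IH2 zr; have := half _ G20; have := hg k z zr; lra.
have mit m j := cmeas_cts (cit m j).
have dit m k z : cabs z <= rho -> cabs (it m.+1 k z - it m k z) <= G * 2^-1 ^+ m.
  elim: m k z => [|m IH] k z zr.
    rewrite /= addrAC subrr add0r expr0 mulr1.
    have := rowT_small k (fun j => cmeas_cts (cg j)) G0 hg zr; have := half _ G0; lra.
  have M0 : 0 <= G * 2^-1 ^+ m by rewrite mulr_ge0// exprn_ge0.
  have -> : it m.+2 k z - it m.+1 k z = rowT (fun j w => it m.+1 j w - it m j w) k z.
    rewrite (rowTB k z (mit m.+1) (mit m) G20 G20 (bit m.+1) (bit m)) /=; ring.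
  have md j : cmeas (fun w => it m.+1 j w - it m j w) by exact: cmfB (mit m.+1 j) (mit m j).
  rewrite (le_trans (rowT_small k md M0 IH zr))// (le_trans (half _ M0))//.
  by rewrite exprS mulrCA.
(* Outside the disk the iterates are not controlled; there they are set to 0, which [rowT] cannot
   see. *)
pose cut m j w : C := (ballf 0 rho w)%:C * it m j w.
have cutE m j w : cabs w <= rho -> cut m j w = it m j w.
  by move=> wr; rewrite /cut /ballf subr0 wr mul1r.
have lim (jw : 'I_n * C) : exists l, forall m, cabs (cut m jw.1 jw.2 - l) <= 4 * G * 2^-1 ^+ m.
  apply: geom_limit_complex => m; case: jw => j w /=.
  have [wr|wr] := leP (cabs w) rho; first by rewrite !cutE// dit.
  by rewrite /cut /ballf subr0 [cabs w <= rho]leNgt wr /= !mul0r subrr cabs0 mulr_ge0// exprn_ge0.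
have [y' hy'] := choice lim; pose y j w := y' (j, w).
have hy m j w : cabs (cut m j w - y j w) <= 4 * G * 2^-1 ^+ m by exact: (hy' (j, w)).
have my j : cmeas (y j).
  apply: (@cmf_limit _ _ (fun m q => cut m j (toC q)) _ (4 * G)) => [m|m q]; last exact: hy.
  exact: cmfM (cmf_real (rmeas_ballf 0 rho)) (mit m j).
have by_ j w : cabs w <= rho -> cabs (y j w) <= 2 * G.
  move=> wr; rewrite -subr_le0; apply: (@geom_null _ (4 * G)) => m.
  have := hy m j w; rewrite cutE// => h; have := bit m j w wr.
  by have := cabsB (it m j w) (it m j w - y j w); rewrite subKr; lra.
(* The limit y is only known to be measurable and bounded. One more application of T gives a
   function that is continuous on the plane and agrees with y on the disk. *)
pose x k z := g k z + rowT y k z.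
have xy k z : cabs z <= rho -> x k z = y k z.
  move=> zr; apply/eqP; rewrite -subr_eq0 -cabs_eq0 eq_le cabs_ge0 andbT.
  apply: (@geom_null _ (4 * G)) => m.
  have M0 : 0 <= 4 * G * 2^-1 ^+ m by rewrite !mulr_ge0// exprn_ge0.
  have h1 := hy m.+1 k z; rewrite cutE// exprS in h1.
  have E : x k z - y k z = (it m.+1 k z - y k z) - rowT (fun j w => it m j w - y j w) k z.
    by rewrite (rowTB k z (mit m) my G20 G20 (bit m) by_) /x /=; ring.
  have md j : cmeas (fun w => it m j w - y j w) by exact: cmfB (mit m j) (my j).
  have hd j w : cabs w <= rho -> cabs (it m j w - y j w) <= 4 * G * 2^-1 ^+ m.
    by move=> wr; rewrite -cutE.
  rewrite E (le_trans (cabsB _ _))//.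
  have := rowT_small k md M0 hd zr; have := half _ M0; move: h1; lra.
exists x; split=> [k z|k z zr|k z]; last 2 first.
- by rewrite xy// by_.
- by rewrite {1}/x; congr (_ + _); apply: eq_rowT => j w wr; rewrite xy.
have c := @rowT_continuous y (2 * G) k z my G20 by_.
by apply: ctsC_reim; [apply: near_cts (ctsD (cts_Re (@cg k z)) (cts_Re c))|
  apply: near_cts (ctsD (cts_Im (@cg k z)) (cts_Im c))]; near=> w; rewrite /x /= reimE.
Unshelve. all: by end_near.
Qed.

Definition gauge_solution (Psi : 'I_n -> 'I_n -> C -> C) := forall i,
  [/\ forall k z, {for z, continuous (Psi i k)},
    forall k z, cabs z <= rho -> cabs (Psi i k z) <= 2 &
    forall k z, Psi i k z = (i == k)%:R + rowT (Psi i) k z].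

Lemma gauge_exists : exists Psi, gauge_solution Psi.
Proof.
have H i : exists x, [/\ forall k z, {for z, continuous (x k)},
    forall k z, cabs z <= rho -> cabs (x k z) <= 2 * 1 &
    forall k z, x k z = (i == k)%:R + rowT x k z].
  apply: (@rowT_solution (fun k _ => (i == k)%:R) 1) => // [k z|k z _].
    by apply: ctsC_reim; exact: cts_cst.
  by case: (i == k); rewrite ?cabs1 ?cabs0.
by have [Psi hPsi] := choice H; exists Psi => i; have := hPsi i; rewrite mulr1.
Qed.

Lemma similarity_core Psi (F m : 'I_n -> C -> C) (N r : R) : gauge_solution Psi ->
  0 <= N -> (forall k, adm a N (m k)) -> (forall k z, F k z = cauchyT (m k) z) ->
  (forall j w, cabs w < r -> \sum_k b j k w * F k w + m j w = 0) ->
  forall i z, cabs z < r -> exists l, cderiv (fun w => \sum_k Psi i k w * F k w) z l.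
Proof.
move=> hPsi N0 hm FE H i z zr; have [cP bP PE] := hPsi i.
have mP j := cmeas_cts (cP j); have h2 : (0 : R) <= 2 by [].
pose u k w := \sum_j Psi i j w * b j k w.
pose K := n%:R * (2 * Kb); have K0 : 0 <= K by rewrite !mulr_ge0.
have hu k : adm a K (u k) by exact: row_adm.
pose L := 4 * (kappa R)^-1 * B * N.
have L0 : 0 <= L by rewrite mulr_ge0// !mulr_ge0// ?(kato_B_ge0 ka)// ?invr_ge0 ltW// kappa_gt0.
have FL k w : cabs (F k w) <= L by have := @cauchyT_bound R th B a th0 ka N (m k) w N0 (hm k); rewrite FE.
have cF k w : {for w, continuous (F k)}.
  have -> : F k = cauchyT (m k) by apply/funext => v; rewrite FE.
  exact: (@cauchyT_continuous R th B a th0 th1 ka _ _ w N0 (hm k)).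
pose L' := 4 * (kappa R)^-1 * B * K.
have L'0 : 0 <= L' by rewrite mulr_ge0// !mulr_ge0// ?(kato_B_ge0 ka)// ?invr_ge0 ltW// kappa_gt0.
have TL k w : cabs (rowT (Psi i) k w) <= L' by have := @cauchyT_bound R th B a th0 ka K (u k) w K0 (hu k).
have mT k : cmeas (rowT (Psi i) k) by exact: (@cmeas_cauchyT R th B a th0 th1 ka K (u k) K0 (hu k)).
have a1 k : adm a (L * K) (fun w => F k w * u k w) by apply: (admM L0 (hu k)) => //; exact: cmeas_cts.
have a2 k : adm a (L' * N) (fun w => rowT (Psi i) k w * m k w) by exact: admM.
have D0 : 0 <= L * K + L' * N by rewrite addr_ge0// mulr_ge0.
pose v k w := F k w * u k w + rowT (Psi i) k w * m k w.
have hv k : adm a (L * K + L' * N) (v k) by exact: admD.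
pose d w := \sum_k v k w + m i w.
pose M := n%:R * (L * K + L' * N) + N.
have hd : adm a M d by apply: admD (hm i); exact: adm_sum.
have M0 : 0 <= M by rewrite addr_ge0// mulr_ge0.
have key w : \sum_k Psi i k w * F k w = cauchyT d w.
  have nD0 : 0 <= n%:R * (L * K + L' * N) by rewrite mulr_ge0.
  rewrite /d (cauchyTD th0 ka w nD0 N0 (adm_sum hv) (hm i)) (cauchyT_sum th0 ka w D0 hv) -FE.
  rewrite (eq_bigr (fun k => rowT (Psi i) k w * F k w + (i == k)%:R * F k w)); last first.
    by move=> k _; rewrite PE mulrDl addrC.
  rewrite big_split /= [X in _ + X](bigD1 i)//= eqxx mul1r [X in _ + (_ + X)]big1 ?addr0; last first.
    by move=> k ki; rewrite eq_sym (negbTE ki) mul0r.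
  congr (_ + _); apply: eq_bigr => k _; rewrite FE.
  rewrite /rowT (cauchyT_cauchyT_mul th0 th1 ka w K0 N0 (hu k) (hm k)).
  by apply: eq_cauchyT => t; rewrite /v FE mulrC.
(* By the fixed point equation for Psi the density regroups as Psi applied to b F + m, hence it
   vanishes where the equation holds. *)
have d0 w : cabs w < r -> d w = 0.
  move=> wr; have -> : d w = \sum_j Psi i j w * (\sum_k b j k w * F k w + m j w).
    under eq_bigr do rewrite mulrDr.
    rewrite big_split /= /d /v big_split /= -addrA; congr (_ + _).
      under [RHS]eq_bigr do rewrite mulr_sumr.
      rewrite exchange_big /=; apply: eq_bigr => k _; rewrite /u mulr_sumr.
      by apply: eq_bigr => j _; rewrite mulrC mulrA.
    rewrite [RHS](eq_bigr (fun k => rowT (Psi i) k w * m k w + (i == k)%:R * m k w)); last first.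
      by move=> k _; rewrite [Psi i k w]PE mulrDl addrC.
    rewrite big_split /= [X in _ = _ + X](bigD1 i)//= eqxx mul1r [X in _ = _ + (_ + X)]big1 ?addr0//.
    by move=> k ki; rewrite eq_sym (negbTE ki) mul0r.
  by apply: big1 => j _; rewrite H// mulr0.
have oV := @open_cball R 0 r.
have [|g hg] := cauchyT_off_support ka M0 hd oV.
  by move=> w; rewrite /= subr0; exact: d0.
exists (g z); have -> : (fun w => \sum_k Psi i k w * F k w) = cauchyT d by apply/funext.
by have [] := hg z; rewrite /= ?subr0.
Qed.

(* Entries of Psi - 1 are so small that Psi x = 0 forces |x| <= |x| / 2 in the sup norm. *)
Lemma gauge_unit Psi z : gauge_solution Psi -> n%:R * (2 * contraction) <= 2^-1 -> cabs z <= rho ->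
  (\matrix_(i, k) Psi i k z) \in unitmx.
Proof.
move=> hPsi hn zr; rewrite -row_free_unit -kermx_eq0; apply/eqP/row_matrixP => r.
rewrite row0; set v := row r _.
have hv : v *m (\matrix_(i, k) Psi i k z) = 0 by apply/sub_kermxP; exact: row_sub.
clearbody v.
have ent i k : cabs (Psi i k z - (i == k)%:R) <= 2 * contraction.
  have [cP bP PE] := hPsi i; rewrite PE addrAC subrr add0r mulrC.
  apply: rowT_small => //; exact: (fun j => cmeas_cts (cP j)).
pose S := \sum_k cabs (v 0 k).
have S0 : 0 <= S by apply: sumr_ge0 => k _; exact: cabs_ge0.
have vk k : cabs (v 0 k) <= 2 * contraction * S.
  have E : v 0 k = - \sum_i v 0 i * (Psi i k z - (i == k)%:R).
    have := congr1 (fun M : 'rV_n => M 0 k) hv; rewrite !mxE.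
    rewrite (eq_bigr (fun i => v 0 i * Psi i k z)); last by move=> i _; rewrite [X in _ * X]mxE.
    rewrite (eq_bigr (fun i => v 0 i * (Psi i k z - (i == k)%:R) + v 0 i * (i == k)%:R)).
      2: by move=> i _; rewrite -mulrDr subrK.
    rewrite big_split /= [X in _ + X](bigD1 k)//= eqxx mulr1 [X in _ + (_ + X)]big1.
      2: by move=> i ik; rewrite (negbTE ik) mulr0.
    by rewrite addr0 addrC => /eqP; rewrite addr_eq0 => /eqP.
  rewrite E cabsN (le_trans (cabs_sum _ _ _))// mulr_sumr; apply: ler_sum => i _.
  by rewrite cabsM mulrC ler_wpM2r ?cabs_ge0.
have S_le : S <= 2^-1 * S.
  apply: (@le_trans _ _ (\sum_(k < n) 2 * contraction * S)); first by apply: ler_sum => k _; exact: vk.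
  rewrite sumr_const card_ord.
  have -> : (2 * contraction * S) *+ n = n%:R * (2 * contraction) * S by rewrite -mulr_natl; ring.
  exact: ler_wpM2r S0 _ _ hn.
have /eqP : S = 0 by lra.
rewrite psumr_eq0 => [/allP h|k _]; last exact: cabs_ge0.
apply/rowP => k; rewrite [RHS]mxE; apply/eqP; rewrite -cabs_eq0.
by have /implyP := h k (mem_index_enum k); exact.
Qed.

End picard.

(** * The gauge for a weak solution on the disk *)

Section plane_core.
Variable R : realType.
Local Notation C := R[i].

Lemma adm_le (a : C -> R) (M N : R) u : (forall w, 0 <= a w) -> M <= N -> adm a M u -> adm a N u.
Proof. by move=> a0 MN [mu h]; split=> // w; rewrite (le_trans (h w))// ler_wpM2r. Qed.

Lemma small_radius (th B Kb : R) (n : nat) : 0 < th -> 0 <= B -> 0 <= Kb ->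
  exists rho : R, [/\ 0 < rho, rho < 2^-1, contraction th B rho Kb n <= 2^-1 &
    n%:R * (2 * contraction th B rho Kb n) <= 2^-1].
Proof.
move=> th0 B0 K0; pose K := 2 * (kappa R)^-1 * B * (n%:R * Kb).
have K00 : 0 <= K by rewrite !mulr_ge0// invr_ge0 ltW// kappa_gt0.
have n1 : 0 <= 4 * n%:R + 1 :> R by rewrite addr_ge0// mulr_ge0.
have h2 : (0 : R) < 2^-1 by rewrite invr_gt0.
(* [contraction] equals K (2 rho)^th. Making 4n + 1 times it less than 1/2 yields both smallness
   conditions; below, d/4 keeps 2 rho under d and 1/4 keeps rho under 1/2. *)
have [d d0 hd] := powR_small th0 h2 (mulr_ge0 n1 K00).
have m0 : 0 < Num.min (d / 4) 4^-1 by rewrite lt_min divr_gt0//= invr_gt0.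
exists (Num.min (d / 4) 4^-1).
have x1 : Num.min (d / 4) 4^-1 <= d / 4 by rewrite ge_min lexx.
have x2 : Num.min (d / 4) 4^-1 <= 4^-1 :> R by rewrite ge_min lexx orbT.
move: (Num.min _ _) m0 x1 x2 => x x0 x1 x2.
have := hd (2 * x) ltac:(by rewrite mulr_ge0// ltW) ltac:(lra).
have -> : contraction th B x Kb n = K * (2 * x) `^ th by rewrite /contraction /K; ring.
have y0 : 0 <= (2 * x) `^ th by rewrite powR_ge0.
have t0 : 0 <= K * (2 * x) `^ th by rewrite mulr_ge0.
rewrite -mulrA; move: (K * (2 * x) `^ th) t0 => t t0 ht.
have n0 : 0 <= n%:R * t by rewrite mulr_ge0.
by split=> //; lra.
Qed.

Section core.
Variables (th B : R) (a : C -> R) (n : nat) (O : set C) (f m : 'I_n -> C -> C) (N : R).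
Hypotheses (th0 : 0 < th) (th1 : th < 1) (ka : kato th B a) (aball : forall w, ballf 0 1 w <= a w).
Hypotheses (oO : open O) (dO : @disk R `<=` O) (cf : forall k w, O w -> {for w, continuous (f k)}).
Hypotheses (N0 : 0 <= N) (hm : forall k, adm a N (fun w => (ballf 0 1 w)%:C * m k w)).
Hypothesis weak : forall k phi, test_function phi ->
  Cintegral (@disk R) (fun w => - dbar phi w * f k w + phi w * m k w) = 0.

(** The coefficient b has to reproduce m only for |w| < r. As r <= 1/2 and the cut-off is 1 up to
    radius 1/2, its derivative does not disturb the equation there. *)
Lemma plane_core (rho Kb r : R) (b : 'I_n -> 'I_n -> C -> C) Psi : 0 <= Kb ->
  (forall j k, adm a Kb (b j k)) -> (forall j k w, rho < cabs w -> b j k w = 0) ->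
  r <= 2^-1 -> gauge_solution rho b Psi ->
  (forall j w, cabs w < r -> \sum_k b j k w * f k w = m j w) ->
  forall i z, cabs z < r -> exists l, cderiv (fun w => \sum_k Psi i k w * f k w) z l.
Proof.
move=> Kb0 hb b0 r2 hPsi H i z zr.
have [chi [hchi chi1 chi0 _]] := @bump_exists R 0 (2^-1) (3 / 4) ltac:(by rewrite invr_ge0) ltac:(lra).
have {}chi0 w : 3 / 4 <= cabs w -> chi w = 0 by have := chi0 w; rewrite subr0.
have {}chi1 w : cabs w <= 2^-1 -> chi w = 1 by have := chi1 w; rewrite subr0.
have a0 w : 0 <= a w by case: ka.
pose m' k w := dchi chi w * f k w - (chi w)%:C * m k w.
have rep k : exists M : R, 0 <= M /\ adm a M (m' k) /\
    forall z, (chi z)%:C * f k z = cauchyT (m' k) z.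
  have [M M0 [h1 h2]] := weak_representation th0 th1 ka hchi (ltac:(lra) : 3 / 4 < 1 :> R) chi0 aball oO dO
    (@cf k) N0 (hm k) (weak k).
  by exists M.
have [M hM] := choice rep.
pose MM := \sum_k M k; have MM0 : 0 <= MM by apply: sumr_ge0 => k _; case: (hM k).
have hm' k : adm a MM (m' k).
  have [_ [h _]] := hM k; apply: adm_le h => //.
  by rewrite /MM (bigD1 k)//= lerDl sumr_ge0// => j _; case: (hM j).
have hrep k w : (chi w)%:C * f k w = cauchyT (m' k) w by case: (hM k) => _ [_ ->].
have half w : cabs w < r -> cabs w <= 2^-1 by move=> /ltW h; exact: le_trans r2.
have [|l hl] := similarity_core th0 th1 ka Kb0 hb b0 hPsi MM0 hm' hrep _ i zr.
  move=> j w wr; rewrite /m' chi1 ?half// (@dchi0 _ _ _ 1) ?mul0r ?mul1r ?sub0r; last first.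
    have rw : cabs (w - 0) < 2^-1 by rewrite subr0 (lt_le_trans wr).
    by apply: filterS (near_in rw) => v; rewrite subr0 => /ltW/chi1.
  by rewrite -(H j w wr) -sumrB big1// => k _; rewrite mul1r subrr.
exists l; apply: cderiv_near hl.
have rz : cabs (z - 0) < r by rewrite subr0.
apply: filterS (near_in rz) => w; rewrite subr0 => wr; apply: eq_bigr => k _.
by rewrite chi1 ?half// mul1r.
Qed.

End core.

Section real_endomorphism.
Variable n : nat.
Implicit Types (A : C -> 'cV[C]_n -> 'cV[C]_n) (v : 'cV[C]_n).

Definition ecol (l : 'I_n) (b : bool) : 'cV[C]_n := (if b then 1 else 'i) *: delta_mx l 0.

Lemma real_endo0 A z : real_endo A -> A z 0 = 0.
Proof.
move=> hA; have := hA z 1 0 0; rewrite !scaler0 !scale1r addr0 => /eqP.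
by rewrite -subr_eq subrr eq_sym => /eqP.
Qed.

Lemma real_endo_sum A z (I : Type) (s : seq I) (c : I -> R) (v : I -> 'cV[C]_n) : real_endo A ->
  A z (\sum_(i <- s) (c i)%:C *: v i) = \sum_(i <- s) (c i)%:C *: A z (v i).
Proof.
move=> hA; elim: s => [|i s IH]; first by rewrite !big_nil real_endo0.
by rewrite !big_cons hA IH.
Qed.

Lemma real_endoE A z v k : real_endo A -> A z v k 0 =
  \sum_l ((complex.Re (v l 0))%:C * A z (ecol l true) k 0 +
          (complex.Im (v l 0))%:C * A z (ecol l false) k 0).
Proof.
move=> hA; pose c (lb : 'I_n * bool) := if lb.2 then complex.Re (v lb.1 0) else complex.Im (v lb.1 0).
have {1}-> : v = \sum_lb (c lb)%:C *: ecol lb.1 lb.2.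
  apply/colP => i; rewrite summxE.
  transitivity (\sum_l \sum_b ((c (l, b))%:C *: ecol l b) i 0).
    rewrite (bigD1 i)//= [X in _ + X]big1 ?addr0; last first.
      by move=> l li; rewrite big1// => b _; rewrite !mxE eq_sym (negbTE li) andFb !mulr0.
    rewrite big_bool /= !mxE eqxx /= !mulr1.
    by apply: complex_ext; rewrite /c !reimE /=; ring.
  by rewrite pair_bigA; apply: eq_bigr => -[].
rewrite real_endo_sum// summxE (eq_bigr (fun lb : 'I_n * bool =>
  (c (lb.1, lb.2))%:C * A z (ecol lb.1 lb.2) k 0)); last by move=> [l b] _; rewrite mxE.
rewrite -(pair_bigA _ (fun l b => (c (l, b))%:C * A z (ecol l b) k 0)) /=.
by apply: eq_bigr => l _; rewrite big_bool.
Qed.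

Lemma kato0 (th : R) : kato th 0 (fun _ : C => 0).
Proof.
split=> //; first exact: measurable_cst.
  by rewrite /RI integral0.
by move=> z; rewrite /RI (eq_integral (cst 0%E)) ?integral0// => q _; rewrite mul0r.
Qed.

Lemma kato_sum (I : Type) (s : seq I) (th : R) (Bs : I -> R) (as_ : I -> C -> R) : 0 < th ->
  (forall i, kato th (Bs i) (as_ i)) ->
  kato th (\sum_(i <- s) Bs i) (fun w => \sum_(i <- s) as_ i w).
Proof.
move=> th0 H; elim: s => [|i s IH].
  rewrite big_nil; under [X in kato _ _ X]eq_fun do rewrite big_nil; exact: kato0.
rewrite big_cons; under [X in kato _ _ X]eq_fun do rewrite big_cons; exact: katoD.
Qed.

(* The indicator is added so that constants on the disk are dominated as well. *)
Definition endo_size A w : R := ballf 0 1 w + \sum_(x : 'I_n * bool * 'I_n * bool)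
  ballf 0 1 w * `|pcoord x.2 (A w (ecol x.1.1.1 x.1.1.2) x.1.2 0)|.

Lemma endo_size_kato p A : (2%:E < p)%E -> Lp_endo p A ->
  exists B : R, kato (kato_exponent (finite_exponent p)) B (endo_size A).
Proof.
move=> hp hA; have p2 := finite_exponent_gt2 hp; have /andP[th0 th1] := kato_exponent_itv p2.
have [B1 k1] := kato_ball p2 (ler01 : 0 <= 1 :> R).
have H (x : 'I_n * bool * 'I_n * bool) : exists B : R, kato (kato_exponent (finite_exponent p)) B
    (fun w => ballf 0 1 w * `|pcoord x.2 (A w (ecol x.1.1.1 x.1.1.2) x.1.2 0)|).
  have [h1 h2] := hA (ecol x.1.1.1 x.1.1.2) x.1.2.
  by case: x h1 h2 => [[[l b] k] []] /= h1 h2; exact: Lp_disk_kato.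
have [Bs hBs] := choice H.
by eexists; apply: katoD k1 (kato_sum _ th0 hBs).
Qed.

Lemma endo_size_ball A w : ballf 0 1 w <= endo_size A w.
Proof. by rewrite lerDl sumr_ge0// => x _; rewrite mulr_ge0// ballf_ge0. Qed.

Lemma endo_size_bound A w v k (M : R) : real_endo A -> 0 <= M -> cabs w <= 1 ->
  (forall l, cabs (v l 0) <= M) -> cabs (A w v k 0) <= M * endo_size A w.
Proof.
move=> hA M0 w1 hv; rewrite real_endoE// (le_trans (cabs_sum _ _ _))//.
have bE : ballf 0 1 w = 1 by rewrite /ballf subr0 w1.
apply: (@le_trans _ _ (M * \sum_l \sum_b \sum_c `|pcoord c (A w (ecol l b) k 0)|)).
  rewrite mulr_sumr; apply: ler_sum => l _.
  rewrite big_bool /= mulrDr (le_trans (cabsD _ _))// !cabsM !cabs_real.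
  have h c : cabs c <= \sum_b `|pcoord b c| by rewrite big_bool /= cabs_le.
  apply: lerD; apply: ler_pM => //; rewrite ?cabs_ge0//; try exact: h.
    exact: le_trans (Re_le_cabs _) (hv l).
  exact: le_trans (Im_le_cabs _) (hv l).
apply: ler_wpM2l => //; rewrite /endo_size bE.
apply: (@le_trans _ _ (\sum_(x : 'I_n * bool * 'I_n * bool)
  1 * `|pcoord x.2 (A w (ecol x.1.1.1 x.1.1.2) x.1.2 0)|)); last by rewrite lerDr.
rewrite !pair_bigA /=.
(* The terms with the given k form a subfamily of the nonnegative sum over all indices. *)
pose h (x : 'I_n * bool * bool) : 'I_n * bool * 'I_n * bool := (x.1.1, x.1.2, k, x.2).
pose G (y : 'I_n * bool * 'I_n * bool) := 1 * `|pcoord y.2 (A w (ecol y.1.1.1 y.1.1.2) y.1.2 0)|.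
rewrite (_ : \sum_i _ = \sum_(x : 'I_n * bool * bool) G (h x)); last first.
  by apply: eq_bigr => x _; rewrite /G /h mul1r.
rewrite -(@big_imset _ _ _ _ _ h predT G) /=; last by move=> [[? ?] ?] [[? ?] ?] _ _ [-> -> ->].
rewrite [leRHS](bigID (mem [set h x | x in predT]%SET))/= lerDl sumr_ge0// => y _.
Qed.

Lemma Lp_endo_cmeas p A v k : (2%:E < p)%E -> Lp_endo p A -> cmeas (fun w => (ballf 0 1 w)%:C * A w v k 0).
Proof.
move=> hp /(_ v k)[h1 h2]; have [m1 _] := Lp_disk_power hp h1; have [m2 _] := Lp_disk_power hp h2.
by split; [apply: eq_measurable_fun m1|apply: eq_measurable_fun m2] => q _; rewrite !reimE /=; ring.
Qed.

End real_endomorphism.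

Section continuous_gauge.
Variables (n : nat) (p : \bar R) (A : C -> 'cV[C]_n -> 'cV[C]_n) (O : set C) (f : C -> 'cV[C]_n).
Hypotheses (hp : (2%:E < p)%E) (hA : real_endo A) (lA : Lp_endo p A).
Hypotheses (oO : open O) (dO : @disk R `<=` O)
  (cf : forall k w, O w -> {for w, continuous (fun w => f w k 0)})
  (f1 : forall k w, disk w -> cabs (f w k 0) <= 1).
Hypothesis weak : forall k phi, test_function phi ->
  Cintegral (@disk R) (fun w => - dbar phi w * f w k 0 + phi w * A w (f w) k 0) = 0.

(** f is continuous on O only; the indicator makes it measurable on the whole plane. *)
Let fO l w : C := (\1_O w)%:C * f w l 0.

Lemma fOE l w : O w -> fO l w = f w l 0.
Proof. by move=> Ow; rewrite /fO indicE mem_set// mul1r. Qed.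

Lemma cmeas_fO l : cmeas (fO l).
Proof.
split; [have := cts_on_measurable oO (fun w Ow => cts_Re (@cf l w Ow))|
  have := cts_on_measurable oO (fun w Ow => cts_Im (@cf l w Ow))];
  by apply: eq_measurable_fun => q _; rewrite /fO !reimE /=; ring.
Qed.

(** [Lp_endo] gives measurability of A w v for a fixed v, but in A w (f w) the vector moves with w.
    Expanding f in the real basis reduces the second to the first. *)
Let Ap k w : C := \sum_l ((complex.Re (fO l w))%:C * ((ballf 0 1 w)%:C * A w (ecol l true) k 0) +
   (complex.Im (fO l w))%:C * ((ballf 0 1 w)%:C * A w (ecol l false) k 0)).

Lemma ApE k w : Ap k w = (ballf 0 1 w)%:C * A w (f w) k 0.
Proof.
rewrite /Ap real_endoE// mulr_sumr /ballf subr0; apply: eq_bigr => l _.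
case: ifPn => [w1|_]; last by rewrite !mul0r !mulr0 addr0.
by rewrite !mul1r fOE//; apply: dO; exact/disk_cabs.
Qed.

Lemma cmeas_Ap k : cmeas (Ap k).
Proof.
apply: cmf_sum => l; have [h1 h2] := cmeas_fO l.
apply: cmfD; apply: cmfM; try exact: cmf_real; exact: (Lp_endo_cmeas _ _ hp lA).
Qed.

Let nf w : R := \sum_l cabs (fO l w) ^+ 2.

(* P is complex linear with P f = A f: it is the rank one operator v |-> <v, f> / |f|^2 A f. *)
Let P k j w : C := Ap k w * ((complex.Re (fO j w) +i* - complex.Im (fO j w)) * ((nf w)^-1)%:C).

Lemma nf_ge l w : cabs (fO l w) <= Num.sqrt (nf w).
Proof.
rewrite -[leLHS](ger0_norm (cabs_ge0 _)) -sqrtr_sqr ler_wsqrtr// /nf (bigD1 l)//= lerDl.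
by apply: sumr_ge0 => i _; exact: sqr_ge0.
Qed.

Lemma nf_ge0 w : 0 <= nf w. Proof. by apply: sumr_ge0 => i _; exact: sqr_ge0. Qed.

(** Both A f and the covector <., f> are of order |f|, which cancels the denominator |f|^2; so the
    bound does not deteriorate near zeros of f. At a zero P is 0 by the convention 0^-1 = 0. *)
Lemma P_bound k j w : cabs (P k j w) <= endo_size A w.
Proof.
have s0 : 0 <= endo_size A w by apply: le_trans (endo_size_ball A w); exact: ballf_ge0.
rewrite /P !cabsM cabs_real ApE cabsM cabs_real /ballf subr0.
case: ifPn => [w1|_]; last by rewrite normr0 !mul0r.
rewrite normr1 mul1r; set q := Num.sqrt (nf w).
have q2 : nf w = q ^+ 2 by rewrite sqr_sqrtr ?nf_ge0.
have q0 : 0 <= q by exact: sqrtr_ge0.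
have h1 : cabs (A w (f w) k 0) <= q * endo_size A w.
  by apply: endo_size_bound => // l; rewrite -fOE ?nf_ge//; apply: dO; exact/disk_cabs.
have h2 : cabs (complex.Re (fO j w) +i* - complex.Im (fO j w)) <= q.
  by apply: le_trans (nf_ge j w); rewrite !cabsE /= sqrrN.
have [qz|qn] := eqVneq q 0; first by rewrite q2 qz expr0n /= invr0 normr0 !mulr0.
have qp : 0 < q by rewrite lt_def qn.
rewrite (le_trans (ler_pM (cabs_ge0 _) _ h1 (ler_wpM2r (normr_ge0 _) h2)))//.
  by rewrite mulr_ge0 ?cabs_ge0.
by rewrite q2 normfV ger0_norm ?sqr_ge0// le_eqVlt; apply/orP; left; apply/eqP; field.
Qed.

Lemma cmeas_P k j : cmeas (P k j).
Proof.
have [h1 h2] := cmeas_fO j; apply: cmfM; first exact: cmeas_Ap.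
apply: cmfM; first by split=> //=; exact: measurable_funN.
apply: cmf_real; apply: measurable_funV.
have : measurable_fun setT (fun q : measurableTypeR R * measurableTypeR R => \sum_l cabs (fO l (toC q)) ^+ 2).
  apply: measurable_sum => l; exact: (measurable_funX 2 (measurable_cabs (cmeas_fO l))).
by [].
Qed.

Lemma P_mul k w : cabs w <= 1 -> \sum_j P k j w * f w j 0 = A w (f w) k 0.
Proof.
move=> w1; have Ow : O w by apply: dO; exact/disk_cabs.
have [n0|nn] := eqVneq (nf w) 0.
  have fz l : f w l 0 = 0.
    apply/eqP; rewrite -fOE// -cabs_eq0 eq_le cabs_ge0 andbT.
    by have := nf_ge l w; rewrite n0 sqrtr0.
  have -> : f w = 0 by apply/colP => l; rewrite fz mxE.
  by rewrite real_endo0// mxE big1// => j _; rewrite mxE mulr0.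
have E j : P k j w * f w j 0 = A w (f w) k 0 * ((nf w)^-1 * cabs (fO j w) ^+ 2)%:C.
  have ab : (complex.Re (fO j w) +i* - complex.Im (fO j w)) * fO j w = (cabs (fO j w) ^+ 2)%:C.
    by rewrite sqr_cabs; apply: complex_ext; rewrite !reimE /=; ring.
  rewrite -fOE// rmorphM /= -ab /P ApE /ballf subr0 w1 mul1r; ring.
under eq_bigr do rewrite E.
rewrite -mulr_sumr -(raddf_sum (@real_complex R)) -mulr_sumr -/(nf w) mulVf//.
by rewrite mulr1.
Qed.

Lemma continuous_gauge : exists r : R, exists Psi : 'I_n -> 'I_n -> C -> C,
  [/\ 0 < r, r < 2^-1, forall i k z, {for z, continuous (Psi i k)},
    forall z, cabs z < r -> (\matrix_(i, k) Psi i k z) \in unitmx &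
    forall i z, cabs z < r -> exists l, cderiv (fun w => \sum_k Psi i k w * f w k 0) z l].
Proof.
have p2 := finite_exponent_gt2 hp; have /andP[th0 th1] := kato_exponent_itv p2.
have [B kB] := endo_size_kato hp lA; have B0 := kato_B_ge0 kB.
have s0 w : 0 <= endo_size A w by apply: le_trans (endo_size_ball A w); exact: ballf_ge0.
have [rho [r0 r2 c1 c2]] := small_radius n th0 B0 (ler01 : 0 <= 1 :> R).
pose b k j w : C := (ballf 0 rho w)%:C * P k j w.
have hb k j : adm (endo_size A) 1 (b k j).
  split=> [|w]; first exact: cmfM (cmf_real (rmeas_ballf 0 rho)) (cmeas_P k j).
  rewrite mul1r cabsM cabs_real; apply: le_trans (P_bound k j w).
  rewrite ler_piMl ?cabs_ge0// ger0_norm ?ballf_ge0// /ballf; by case: ifP.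
have b0 k j w : rho < cabs w -> b k j w = 0.
  by move=> h; rewrite /b /ballf subr0 leNgt h mul0r.
have [Psi hPsi] := gauge_exists th0 th1 kB ler01 hb b0 c1.
exists rho, Psi; split=> //.
- by move=> i k z; have [h _ _] := hPsi i; exact: h.
- by move=> z /ltW zr; exact: (gauge_unit th0 kB ler01 hb b0 hPsi).
apply: (plane_core th0 th1 kB (endo_size_ball A) oO dO (f := fun k w => f w k 0) (m := fun k w => A w (f w) k 0) cf ler01 _ weak ler01 hb b0 (ltW r2) hPsi).
  move=> k; split=> [|w].
    have -> : (fun w => (ballf 0 1 w)%:C * A w (f w) k 0) = Ap k by apply/funext => w; rewrite ApE.
    exact: cmeas_Ap.
  rewrite mul1r /ballf subr0; case: ifPn => [w1|_]; last by rewrite mul0r cabs0.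
  by rewrite mul1r -[endo_size A w]mul1r; apply: endo_size_bound => // l; apply: f1; exact/disk_cabs.
move=> k w wr; have w1 : cabs w <= 1 by lra.
rewrite -(P_mul k w1); apply: eq_bigr => j _.
by rewrite /b /ballf subr0 (ltW wr) mul1r.
Qed.

End continuous_gauge.
End plane_core.

(** * Smoothness of the gauge transformation *)

Section uniform_derivative.
Variable R : realType.
Local Notation C := R[i].
Implicit Types (u v f g : C -> C) (z w h t : C).

Lemma closed_cball (L : R) : closed [set z : C | cabs z <= L].
Proof.
move=> z cz; rewrite /= leNgt; apply/negP => Lz.
have Lz' : L < cabs (z - 0) by rewrite subr0.
have [w [/= w1]] := cz _ (near_out Lz'); rewrite subr0 => w2.
by have := le_lt_trans w1 w2; rewrite ltxx.
Qed.

Lemma compact_cball (L : R) : compact [set z : C | cabs z <= L].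
Proof.
apply: subclosed_compact (@closed_cball L) (@compact_box R L) _ => z /= zL.
by split; [exact: le_trans (Re_le_cabs _) zL|exact: le_trans (Im_le_cabs _) zL].
Qed.

Lemma cts_bounded_cball f (L : R) : (forall z, cabs z <= L -> {for z, continuous f}) ->
  exists2 M : R, 0 <= M & forall z, cabs z <= L -> cabs (f z) <= M.
Proof.
move=> cf; have [L0|L0] := ltP L 0.
  by exists 0 => // z /le_lt_trans/(_ L0); rewrite ltNge cabs_ge0.
have cn : {within [set z : C | cabs z <= L], continuous (fun z => cabs (f z))}.
  apply: continuous_in_subspaceT => z; rewrite inE => /cf cz.
  apply/cts_cabsP => e e0; have /cvgC_cabsP/(_ _ e0)/nbhs_cabsP[d d0 hd] := cz.
  exists d => // w /hd; apply: le_lt_trans.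
  rewrite ler_norml; have := cabsD (f z - f w) (f w); have := cabsD (f w - f z) (f z).
  by rewrite !subrK [cabs (f z - f w)]cabsBC => h1 h2; apply/andP; split; lra.
have A0 : [set z : C | cabs z <= L] !=set0 by exists 0; rewrite /= cabs0.
have [c Ac hc] := compact_EVT_max A0 (@compact_cball L) cn.
by exists (cabs (f c)) => [|z zL]; [exact: cabs_ge0|apply: hc; rewrite inE].
Qed.

Lemma heine_cantor f (L e : R) : (forall z, {for z, continuous f}) -> 0 < e ->
  exists2 d : R, 0 < d & forall z h, cabs z <= L -> cabs h < d -> cabs (f (z + h) - f z) <= e.
Proof.
move=> cf e0; have /compact_near_coveringP := @compact_cball L.
move=> /(_ R (0^'+) (fun (d : R) z => forall h, cabs h < d -> cabs (f (z + h) - f z) <= e)) H.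
have /H h1 : forall z, [set z : C | cabs z <= L] z -> \forall z' \near z & d \near 0^'+,
    forall h, cabs h < d -> cabs (f (z' + h) - f z') <= e.
  move=> z _; have e2 : 0 < e / 2 by rewrite divr_gt0.
  have /cvgC_cabsP/(_ _ e2)/nbhs_cabsP[d d0 hd] := @cf z.
  have d2 : 0 < d / 2 by rewrite divr_gt0.
  exists ([set w | cabs (w - z) < d / 2], [set x : R | x < d / 2]) => /=.
    split; last exact: nbhs_right_lt.
    by apply/nbhs_cabsP; exists (d / 2).
  move=> [w x] /= [wz xd] h hx.
  have h1 := hd w ltac:(lra).
  have h2 : cabs (f (w + h) - f z) < e / 2.
    apply: hd; have -> : w + h - z = (w - z) + h by ring.
    by have := cabsD (w - z) h; lra.
  have := cabsB (f (w + h) - f z) (f w - f z).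
  have -> : f (w + h) - f z - (f w - f z) = f (w + h) - f w by ring.
  lra.
have : \forall d \near (0 : R)^'+, 0 < d /\ forall z, cabs z <= L -> forall h, cabs h < d -> cabs (f (z + h) - f z) <= e.
  by apply: filterS2 (nbhs_right_gt (0 : R)) h1 => d ? ?; split.
by move=> /(@filter_ex _ _ _)[d [d0 hd]]; exists d => // z h /hd; exact.
Qed.

Definition pdc b u w : C := pd b (fun w => complex.Re (u w)) w +i* pd b (fun w => complex.Im (u w)) w.

(** Difference quotients that converge uniformly on disks. Uniformity lets a remainder estimate for
    a density pass to its Cauchy transform, which is bounded by the sup norm of the density. *)
Definition uds b (L : R) u v := forall e : R, 0 < e -> exists2 d : R, 0 < d &
  forall z (h : R), cabs z <= L -> `|h| < d ->
    cabs (u (z + h%:C * pdir R b) - u z - v z * h%:C) <= e * `|h|.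

Lemma CkC_on_pdc m b O u : CkC_on (Some m.+1) O u -> CkC_on (Some m) O (pdc b u).
Proof. by move=> [h1 h2]; split; exact: Cn_on_pd. Qed.

Lemma uds_C1 b L u : CkC_on (Some 1%N) setT u -> uds b L u (pdc b u).
Proof.
move=> hu e e0; have e2 : 0 < e / 2 by rewrite divr_gt0.
have [h1 h2] := hu; have hp := CkC_on_pdc b hu.
have i1 w := @Cn_on_isd R 0 setT _ b w h1 I; have i2 w := @Cn_on_isd R 0 setT _ b w h2 I.
have [d d0 hd] := @heine_cantor (pdc b u) L (e / 2) (fun z => CkC_on_cts hp I) e2.
exists d => // z h zL hh; rewrite (le_trans (cabs_le _))// !reimE /= !(mulr0, subr0, addr0, add0r).
have key (t : R) : `|t| <= `|h| -> cabs (pdc b u (z + t%:C * pdir R b) - pdc b u z) <= e / 2.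
  by move=> th; apply: hd => //; rewrite cabs_pdir; exact: le_lt_trans th hh.
have k1 := @pd_mean_value R b (fun w => complex.Re (u w)) z h (pd b (fun w => complex.Re (u w)) z) (e / 2).
have k2 := @pd_mean_value R b (fun w => complex.Im (u w)) z h (pd b (fun w => complex.Im (u w)) z) (e / 2).
rewrite [e]splitr mulrDl; apply: lerD.
  apply: k1 => t /key ht /=; split; first exact: i1.
  by apply: le_trans ht; apply: le_trans (Re_le_cabs _); rewrite !reimE.
apply: k2 => t /key ht /=; split; first exact: i2.
by apply: le_trans ht; apply: le_trans (Im_le_cabs _); rewrite !reimE.
Qed.

Lemma uds_CkC_on m u (v : bool -> C -> C) : (forall z, {for z, continuous u}) ->
  (forall b L, uds b L u (v b)) -> (forall b, CkC_on (Some m) setT (v b)) -> CkC_on (Some m.+1) setT u.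
Proof.
move=> cu hu hv.
have hR b z : isd b (fun w => complex.Re (u w)) z (complex.Re (v b z)).
  apply/isdP => e /(hu b (cabs z))[d d0 hd]; exists d => // h hh.
  apply: le_trans (hd z h (lexx _) hh); apply: le_trans (Re_le_cabs _).
  by rewrite !reimE /= mulr0 subr0.
have hI b z : isd b (fun w => complex.Im (u w)) z (complex.Im (v b z)).
  apply/isdP => e /(hu b (cabs z))[d d0 hd]; exists d => // h hh.
  apply: le_trans (hd z h (lexx _) hh); apply: le_trans (Im_le_cabs _).
  by rewrite !reimE /= mulr0 add0r.
split; apply/Cn_onS; split.
- by move=> z _; exact: cts_Re (@cu z).
- move=> b; split=> [z _|]; first by rewrite (isd_pd (hR b z)).
  by apply: Cn_on_eq (hv b).1 => [|z _]; [exact: openT|rewrite (isd_pd (hR b z))].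
- by move=> z _; exact: cts_Im (@cu z).
- move=> b; split=> [z _|]; first by rewrite (isd_pd (hI b z)).
  by apply: Cn_on_eq (hv b).2 => [|z _]; [exact: openT|rewrite (isd_pd (hI b z))].
Qed.

Lemma CkC_onD k O u v : open O -> CkC_on k O u -> CkC_on k O v -> CkC_on k O (fun w => u w + v w).
Proof.
move=> oO; case: k => [m|] [u1 u2] [v1 v2]; split => /=; try move=> m.
- by apply: Cn_on_eq (Cn_onD oO u1 v1) => // w _; rewrite reimE.
- by apply: Cn_on_eq (Cn_onD oO u2 v2) => // w _; rewrite reimE.
- by apply: Cn_on_eq (Cn_onD oO (u1 m) (v1 m)) => // w _; rewrite reimE.
- by apply: Cn_on_eq (Cn_onD oO (u2 m) (v2 m)) => // w _; rewrite reimE.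
Qed.

Lemma CkC_onM k O u v : open O -> CkC_on k O u -> CkC_on k O v -> CkC_on k O (fun w => u w * v w).
Proof.
move=> oO; case: k => [m|] [u1 u2] [v1 v2]; split => /=; try move=> m.
- by apply: Cn_on_eq (Cn_onB oO (Cn_onM oO u1 v1) (Cn_onM oO u2 v2)) => // w _; rewrite reimE.
- by apply: Cn_on_eq (Cn_onD oO (Cn_onM oO u1 v2) (Cn_onM oO u2 v1)) => // w _; rewrite reimE.
- by apply: Cn_on_eq (Cn_onB oO (Cn_onM oO (u1 m) (v1 m)) (Cn_onM oO (u2 m) (v2 m))) => // w _; rewrite reimE.
- by apply: Cn_on_eq (Cn_onD oO (Cn_onM oO (u1 m) (v2 m)) (Cn_onM oO (u2 m) (v1 m))) => // w _; rewrite reimE.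
Qed.

Lemma CkC_on_cst k O (c : C) : open O -> CkC_on k O (fun=> c).
Proof. by move=> oO; case: k => [m|]; split => /=; try move=> m; exact: Cn_on_cst. Qed.

Lemma CkC_on_sum k O (I : Type) (s : seq I) (P : pred I) (F : I -> C -> C) : open O ->
  (forall i, CkC_on k O (F i)) -> CkC_on k O (fun w => \sum_(i <- s | P i) F i w).
Proof.
move=> oO hF; elim: s => [|i s IH].
  by under eq_fun do rewrite big_nil; exact: CkC_on_cst.
by under eq_fun do rewrite big_cons; case: (P i) => //; exact: CkC_onD.
Qed.

Lemma CkC_on_eq k O u v : open O -> (forall z, O z -> u z = v z) -> CkC_on k O u -> CkC_on k O v.
Proof.
move=> oO uv; case: k => [m|] [h1 h2]; split => /=; try move=> m.
- by apply: Cn_on_eq h1 => // z /uv ->.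
- by apply: Cn_on_eq h2 => // z /uv ->.
- by apply: Cn_on_eq (h1 m) => // z /uv ->.
- by apply: Cn_on_eq (h2 m) => // z /uv ->.
Qed.

Lemma CkC_on_cts0 O u : (forall z, O z -> {for z, continuous u}) -> CkC_on (Some 0%N) O u.
Proof. by move=> cu; split; split=> // z /cu; [exact: cts_Re|exact: cts_Im]. Qed.

End uniform_derivative.

Section cauchy_transform_regularity.
Variable R : realType.
Local Notation C := R[i].
Variables (th B : R) (a : C -> R).
Hypotheses (th0 : 0 < th) (th1 : th < 1) (ka : kato th B a) (aball : forall w, ballf 0 1 w <= a w).
Implicit Types (u v : C -> C) (z w : C).

Lemma adm_unit M u : cmeas u -> 0 <= M -> (forall w, cabs (u w) <= M) ->
  (forall w, 1 < cabs w -> u w = 0) -> adm a M u.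
Proof.
move=> mu M0 uM u0; split=> // w; have [w1|/u0 ->] := leP (cabs w) 1.
  rewrite (le_trans (uM w))// ler_peMr//; apply: le_trans (aball w).
  by rewrite /ballf subr0 w1.
by rewrite cabs0 mulr_ge0//; case: ka.
Qed.

Lemma adm_cts u (L : R) : L <= 1 -> (forall w, {for w, continuous u}) -> (forall w, L < cabs w -> u w = 0) ->
  exists2 M, 0 <= M & adm a M u /\ forall w, cabs (u w) <= M.
Proof.
move=> L1 cu u0; have [M M0 hM] := cts_bounded_complex 1 cu.
have u0' w : 1 < cabs w -> u w = 0 by move=> h; apply: u0; exact: le_lt_trans h.
have uM w : cabs (u w) <= M by have [/hM//|/u0' ->] := leP (cabs w) 1; rewrite cabs0.
by exists M => //; split=> //; apply: adm_unit => //; exact: cmeas_cts.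
Qed.

Lemma cauchyT_shift M u z t : 0 <= M -> adm a M u ->
  cauchyT u (z + t) = cauchyT (fun w => u (w + t)) z.
Proof.
move=> M0 hu; rewrite /cauchyT; congr (_ * _).
rewrite -(CI_shift t (adm_cint th0 ka (z + t) M0 hu)).
by apply: eq_cintg => q; rewrite [t + _]addrC; congr (_ / _); ring.
Qed.

Let K : R := 4 * (kappa R)^-1 * B.
Let K0 : 0 <= K.
Proof. by rewrite /K !mulr_ge0 ?(kato_B_ge0 ka)// invr_ge0 ltW// kappa_gt0. Qed.

Lemma cauchyTZ M (c : C) u z : 0 <= M -> adm a M u -> cauchyT (fun w => c * u w) z = c * cauchyT u z.
Proof.
move=> M0 hu; rewrite /cauchyT mulrCA; congr (_ * _); rewrite -(cintgZ c (adm_cint th0 ka z M0 hu)).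
by apply: eq_cintg => q; rewrite mulrA.
Qed.

Lemma cauchyT_difference M N u v z (h : R) b : 0 <= M -> 0 <= N -> adm a M u -> adm a N v ->
  adm a M (fun w => u (w + h%:C * pdir R b)) ->
  cauchyT u (z + h%:C * pdir R b) - cauchyT u z - cauchyT v z * h%:C =
  cauchyT (fun w => u (w + h%:C * pdir R b) - u w - v w * h%:C) z.
Proof.
move=> M0 N0 hu hv hs; rewrite (cauchyT_shift _ _ M0 hu).
have hvh : adm a (`|h| * N) (fun w => h%:C * v w).
  by apply: (admM (normr_ge0 h) hv); [exact: cmf_cst|move=> w; rewrite cabs_real].
have hN0 : 0 <= `|h| * N by rewrite mulr_ge0.
have MM0 : 0 <= M + M by rewrite addr_ge0.
rewrite [_ * h%:C]mulrC -(cauchyTZ _ _ N0 hv) -(cauchyTN th0 ka _ M0 hu) -(cauchyTN th0 ka _ hN0 hvh).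
rewrite -(cauchyTD th0 ka _ M0 M0 hs (admN hu)) -(cauchyTD th0 ka _ MM0 hN0 (admD hs (admN hu)) (admN hvh)).
by apply: eq_cauchyT => w; rewrite [v w * _]mulrC.
Qed.

Lemma uds0 b u v (L : R) z : (forall w, L < cabs w -> u w = 0) -> (forall L', uds b L' u v) ->
  L < cabs z -> v z = 0.
Proof.
move=> u0 huv Lz; apply/eqP; rewrite -cabs_eq0 eq_le cabs_ge0 andbT.
apply/ler_addgt0Pl => e e0; rewrite addr0; have [d d0 hd] := huv (cabs z) e e0.
pose h : R := Num.min (d / 2) ((cabs z - L) / 2).
have h0 : 0 < h by rewrite lt_min !divr_gt0// subr_gt0.
have hd2 : h <= d / 2 by rewrite ge_min lexx.
have hL2 : h <= (cabs z - L) / 2 by rewrite ge_min lexx orbT.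
have := hd z h (lexx _) ltac:(by rewrite gtr0_norm//; lra).
rewrite (u0 z Lz) (u0 (z + h%:C * pdir R b)).
  by rewrite subrr sub0r cabsN cabsM cabs_real ler_pM2r ?normr_gt0 ?gt_eqF.
have := cabsB (z + h%:C * pdir R b) (h%:C * pdir R b); rewrite addrK cabs_pdir gtr0_norm//; lra.
Qed.

Lemma shift_out u (L h : R) b w : `|h| < 1 - L -> (forall w, L < cabs w -> u w = 0) -> 1 < cabs w ->
  u (w + h%:C * pdir R b) = 0.
Proof.
move=> hL u0 w1; apply: u0.
by have := cabsB (w + h%:C * pdir R b) (h%:C * pdir R b); rewrite addrK cabs_pdir; lra.
Qed.

Lemma cts_shift u t z : (forall z, {for z, continuous u}) -> {for z, continuous (fun w => u (w + t))}.
Proof.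
move=> cu; apply/cvgC_cabsP => e e0; have /cvgC_cabsP/(_ _ e0)/nbhs_cabsP[d d0 hd] := @cu (z + t).
by apply/nbhs_cabsP; exists d => // w wz; apply: hd; rewrite opprD addrACA subrr addr0.
Qed.

(** T commutes with translations, so its difference quotients are transforms of those of the
    density. The restriction |h| < 1 - rho keeps the translated density inside the unit disk, where
    a is at least 1. *)
Lemma cauchyT_uds b u v (rho : R) : rho < 1 -> (forall z, {for z, continuous u}) ->
  (forall z, {for z, continuous v}) -> (forall w, rho < cabs w -> u w = 0) ->
  (forall L, uds b L u v) -> forall L, uds b L (cauchyT u) (cauchyT v).
Proof.
move=> r1 cu cv u0 huv L e e0.
have v0 w : rho < cabs w -> v w = 0 by exact: uds0 u0 huv.
have [M M0 [hu uM]] := adm_cts (ltW r1) cu u0; have [N N0 [hv vN]] := adm_cts (ltW r1) cv v0.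
(* K bounds T on admissible densities; it may be 0, hence K + 1 in the denominator. *)
have e1 : 0 < e / (K + 1) by rewrite divr_gt0// ltr_wpDl.
have [d d0 hd] := huv 1 _ e1.
exists (Num.min d (1 - rho)); first by rewrite lt_min d0 subr_gt0.
move=> z h _; rewrite lt_min => /andP[hh h1].
have hs : adm a M (fun w => u (w + h%:C * pdir R b)).
  apply: adm_unit => //; first by apply: cmeas_cts => w; exact: cts_shift.
  by move=> w w1; exact: shift_out h1 u0 w1.
rewrite (@cauchyT_difference M N u v z h b M0 N0 hu hv hs).
have E0 : 0 <= e / (K + 1) * `|h| by rewrite mulr_ge0// ltW.
have hw : adm a (e / (K + 1) * `|h|) (fun w => u (w + h%:C * pdir R b) - u w - v w * h%:C).
  have w1 w : 1 < cabs w -> u (w + h%:C * pdir R b) - u w - v w * h%:C = 0.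
    move=> w1; rewrite (shift_out b h1 u0 w1) u0 ?(lt_trans r1)// v0 ?(lt_trans r1)//.
    by rewrite mul0r !subr0.
  apply: adm_unit => //.
    by case: hs => [ms _]; apply: cmfB; [apply: cmfB => //; exact: cmeas_cts|
      apply: cmfM; [exact: cmeas_cts|exact: cmf_cst]].
  by move=> w; have [/hd/(_ hh)//|/w1 ->] := leP (cabs w) 1; rewrite cabs0.
apply: le_trans (cauchyT_bound th0 ka z E0 hw) _; rewrite -/K mulrA.
apply: ler_wpM2r => //; rewrite mulrCA; apply: ler_piMr; first exact: ltW.
by rewrite ler_pdivrMr ?ltr_wpDl// mul1r lerDl.
Qed.

Lemma cauchyT_CkC_on m u (rho : R) : rho < 1 -> CkC_on (Some m) setT u ->
  (forall w, rho < cabs w -> u w = 0) -> CkC_on (Some m) setT (cauchyT u).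
Proof.
move=> r1; elim: m u => [|m IH] u hu u0.
  apply: CkC_on_cts0 => z _.
  have [M M0 [h _]] := adm_cts (ltW r1) (fun w => CkC_on_cts hu I) u0.
  exact: (@cauchyT_continuous R th B a th0 th1 ka _ _ z M0 h).
have cu z : {for z, continuous u} := CkC_on_cts hu I.
have [M M0 [h _]] := adm_cts (ltW r1) cu u0.
have hu1 : CkC_on (Some 1%N) setT u by case: hu => h1 h2; split; [apply: Cn_on_le h1|apply: Cn_on_le h2].
apply: (uds_CkC_on (v := fun b => cauchyT (pdc b u))).
- by move=> z; exact: (@cauchyT_continuous R th B a th0 th1 ka _ _ z M0 h).
- move=> b L; apply: (cauchyT_uds r1 cu _ u0) => [z|L']; last exact: uds_C1.
  exact: CkC_on_cts (CkC_on_pdc b hu) I.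
- move=> b; apply: IH; first exact: CkC_on_pdc.
  by move=> w; apply: (uds0 u0) => L'; exact: uds_C1.
Qed.

End cauchy_transform_regularity.

Section gauge_regularity.
Variable R : realType.
Local Notation C := R[i].

Lemma fin_radius (I : finType) (Q : I -> R -> Prop) :
  (forall i, exists2 d, 0 < d & Q i d) -> (forall i d d', d' <= d -> Q i d -> Q i d') ->
  exists2 d, 0 < d & forall i, Q i d.
Proof.
move=> hQ mQ; suff [d d0 hd] : exists2 d, 0 < d & forall i, i \in enum I -> Q i d.
  by exists d => // i; apply: hd; rewrite mem_enum.
elim: (enum I) => [|i s [d d0 hd]]; first by exists 1.
have [c c0 hc] := hQ i; exists (Num.min c d); first by rewrite lt_min c0.
by move=> j; rewrite inE => /orP[/eqP ->|/hd h]; [apply: mQ hc|apply: mQ h]; rewrite ge_min lexx ?orbT.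
Qed.

Lemma cts_bounded_family (I : finType) (F : I -> C -> C) (L : R) : (forall i z, {for z, continuous (F i)}) ->
  exists2 M : R, 0 <= M & forall i z, cabs z <= L -> cabs (F i z) <= M.
Proof.
move=> cF; have H i : exists M : R, 0 <= M /\ forall z, cabs z <= L -> cabs (F i z) <= M.
  by have [M M0 h] := cts_bounded_complex L (@cF i); exists M.
have [M hM] := choice H; exists (\sum_i M i); first by apply: sumr_ge0 => i _; case: (hM i).
move=> i z zL; apply: (le_trans ((hM i).2 z zL)); rewrite (bigD1 i)//= lerDl.
by apply: sumr_ge0 => j _; case: (hM j).
Qed.

(** Iterating E <= c + S/2 from an a priori bound S0 gives 2 c + S0 2^-m. The final bound is free of
    S0, which in the application depends on h in an unknown way. *)
Lemma le_bootstrap (T : Type) (P : T -> Prop) (E : T -> R) (c S0 : R) :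
  (forall t, P t -> E t <= S0) ->
  (forall S, 0 <= S -> (forall t, P t -> E t <= S) -> forall t, P t -> E t <= c + 2^-1 * S) ->
  0 <= c -> 0 <= S0 -> forall t, P t -> E t <= 2 * c.
Proof.
move=> h0 hS c0 S00.
have H m t : P t -> E t <= 2 * c + S0 * 2^-1 ^+ m.
  elim: m t => [|m IH] t Pt; first by rewrite expr0 mulr1 (le_trans (h0 t Pt))// lerDr mulr_ge0.
  have p0 : 0 <= S0 * 2^-1 ^+ m by rewrite mulr_ge0// exprn_ge0.
  apply: le_trans (hS (2 * c + S0 * 2^-1 ^+ m) _ IH t Pt) _; first by rewrite addr_ge0// mulr_ge0.
  by rewrite exprS; lra.
move=> t Pt; rewrite -subr_le0; apply: (@geom_null _ _ S0) => m; have := H m t Pt; lra.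
Qed.

Lemma ctsCD (f g : C -> C) z : {for z, continuous f} -> {for z, continuous g} ->
  {for z, continuous (fun w => f w + g w)}.
Proof.
move=> hf hg; apply: ctsC_reim.
  by apply: near_cts (ctsD (cts_Re hf) (cts_Re hg)); near=> w; rewrite reimE.
by apply: near_cts (ctsD (cts_Im hf) (cts_Im hg)); near=> w; rewrite reimE.
Unshelve. all: by end_near.
Qed.

Lemma ctsC_cst (c : C) z : {for z, continuous (fun _ : C => c)}.
Proof. by apply: ctsC_reim; exact: cts_cst. Qed.

Lemma ctsCB (f g : C -> C) z : {for z, continuous f} -> {for z, continuous g} ->
  {for z, continuous (fun w => f w - g w)}.
Proof.
move=> hf hg; apply: (@near_ctsC R (fun w => f w + -1 * g w)).
  by near=> w; rewrite mulN1r.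
by apply: ctsCD hf _; apply: ctsCM hg; exact: ctsC_cst.
Unshelve. all: by end_near.
Qed.

Lemma ctsC_sum (I : Type) (s : seq I) (F : I -> C -> C) z : (forall i, {for z, continuous (F i)}) ->
  {for z, continuous (fun w => \sum_(i <- s) F i w)}.
Proof.
move=> cF; elim: s => [|i s IH].
  by apply: (@near_ctsC R (fun=> 0)); [near=> w; rewrite big_nil|exact: ctsC_cst].
apply: (@near_ctsC R (fun w => F i w + \sum_(j <- s) F j w)); first by near=> w; rewrite big_cons.
by apply: ctsCD IH; exact: cF.
Unshelve. all: by end_near.
Qed.

Variables (th B rho Kb : R) (a : C -> R) (n : nat) (b : 'I_n -> 'I_n -> C -> C).
Hypotheses (th0 : 0 < th) (th1 : th < 1) (ka : kato th B a) (aball : forall w, ballf 0 1 w <= a w).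
Hypotheses (Kb0 : 0 <= Kb) (hb : forall j k, adm a Kb (b j k))
  (b0 : forall j k w, rho < cabs w -> b j k w = 0).
Hypotheses (rho0 : 0 <= rho) (rho1 : rho < 1) (sb : forall j k, CkC_on None setT (b j k))
  (small : contraction th B rho Kb n <= 2^-1).

Let sbm m j k : CkC_on (Some m) setT (b j k).
Proof. by have [h1 h2] := @sb j k; split; [exact: h1|exact: h2]. Qed.

Let K : R := 4 * (kappa R)^-1 * B.
Let K0 : 0 <= K.
Proof. by rewrite /K !mulr_ge0 ?(kato_B_ge0 ka)// invr_ge0 ltW// kappa_gt0. Qed.

(* The error E = X(. + h) - X - h Y solves E = o(h) + T (E b), and y |-> T (y b) halves sup norms
   on the disk of radius rho. *)
Lemma rowT_deriv (c : bool) (g g' X : 'I_n -> C -> C) :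
  (forall k L, uds c L (g k) (g' k)) -> (forall k z, {for z, continuous (g' k)}) ->
  (forall k z, {for z, continuous (X k)}) -> (forall k z, X k z = g k z + rowT b X k z) ->
  exists Y, [/\ forall k z, {for z, continuous (Y k)},
    forall k z, Y k z = (g' k z + cauchyT (fun w => \sum_j X j w * pdc c (b j k) w) z) + rowT b Y k z &
    forall k L, uds c L (X k) (Y k)].
Proof.
move=> hg cg' cX XE.
pose b' j k := pdc c (b j k).
have cb j k z : {for z, continuous (b j k)} := CkC_on_cts (sb j k) I.
have ub j k L : uds c L (b j k) (b' j k) by apply: uds_C1; exact: sbm.
have cb' j k z : {for z, continuous (b' j k)} := CkC_on_cts (CkC_on_pdc c (sbm 1 j k)) I.
have b'0 j k w : rho < cabs w -> b' j k w = 0 by apply: (@uds0 R c (b j k) (b' j k) rho) => //; exact: b0.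
pose W k w := \sum_j X j w * b' j k w.
have cW k z : {for z, continuous (W k)} by apply: ctsC_sum => j; apply: ctsCM; [exact: cX|exact: cb'].
have W0 k w : rho < cabs w -> W k w = 0 by move=> h; rewrite /W big1// => j _; rewrite b'0// mulr0.
have aW k := adm_cts ka aball (ltW rho1) (@cW k) (W0 k).
pose G k z := g' k z + cauchyT (W k) z.
have cG k z : {for z, continuous (G k)}.
  have [M M0 [h _]] := aW k; apply: ctsCD; first exact: cg'.
  exact: (@cauchyT_continuous R th B a th0 th1 ka _ _ z M0 h).
have [G0 G00 hG] := cts_bounded_family rho cG.
(* Y solves the formally differentiated equation; that it is the derivative of X is shown
   afterwards. *)
have [Y [cY bY YE]] := rowT_solution th0 th1 ka Kb0 hb b0 small G00 cG hG.
exists Y; split=> //.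
pose p h : C := h%:C * pdir R c.
pose E k (h : R) z := X k (z + p h) - X k z - Y k z * h%:C.
(* What remains of the difference quotient of X b once E b is taken out: the remainder of b, and the
   increment of X times h b'. Both are o(h). *)
pose Q k (h : R) w := \sum_j (X j (w + p h) * (b j k (w + p h) - b j k w - b' j k w * h%:C) +
  (X j (w + p h) - X j w) * b' j k w * h%:C).
have cE k h z : {for z, continuous (E k h)}.
  apply: ctsCB; last by apply: ctsCM; [exact: cY|exact: ctsC_cst].
  by apply: ctsCB; [exact: cts_shift|exact: cX].
have cQ k h z : {for z, continuous (Q k h)}.
  apply: ctsC_sum => j; apply: ctsCD; apply: ctsCM.
  - exact: cts_shift.
  - apply: ctsCB; last by apply: ctsCM; [exact: cb'|exact: ctsC_cst].
    by apply: ctsCB; [apply: cts_shift|]; exact: cb.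
  - by apply: ctsCM; [apply: ctsCB; [exact: cts_shift|exact: cX]|exact: cb'].
  - exact: ctsC_cst.
have Q0 k h w : `|h| < 1 - rho -> 1 < cabs w -> Q k h w = 0.
  move=> h1 w1; rewrite /Q big1// => j _.
  rewrite (shift_out c h1 (b0 j k) w1) b0 ?(lt_trans rho1)// b'0 ?(lt_trans rho1)//.
  by rewrite mul0r !subr0 !mulr0 mul0r addr0.
pose U k w := \sum_j X j w * b j k w.
pose V k w := \sum_j (Y j w * b j k w) + W k w.
have cU k z : {for z, continuous (U k)} by apply: ctsC_sum => j; apply: ctsCM; [exact: cX|exact: cb].
have cYb k z : {for z, continuous (fun w => \sum_j (Y j w * b j k w))}.
  by apply: ctsC_sum => j; apply: ctsCM; [exact: cY|exact: cb].
have cV k z : {for z, continuous (V k)} by apply: ctsCD; [exact: cYb|exact: cW].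
have U0 k w : rho < cabs w -> U k w = 0 by move=> h; rewrite /U big1// => j _; rewrite b0// mulr0.
have Yb0 k w : rho < cabs w -> \sum_j (Y j w * b j k w) = 0 by move=> h; rewrite big1// => j _; rewrite b0// mulr0.
have V0 k w : rho < cabs w -> V k w = 0 by move=> h; rewrite /V W0// addr0 Yb0.
have split k h z : `|h| < 1 - rho ->
    E k h z = (g k (z + p h) - g k z - g' k z * h%:C) + cauchyT (Q k h) z + rowT b (fun j => E j h) k z.
  move=> h1.
  have [MU MU0 [aU Ub]] := adm_cts ka aball (ltW rho1) (@cU k) (U0 k).
  have [MV MV0 [aV _]] := adm_cts ka aball (ltW rho1) (@cV k) (V0 k).
  have [MW MW0 [aW' _]] := aW k.
  have [MY MY0 [aY _]] := adm_cts ka aball (ltW rho1) (@cYb k) (Yb0 k).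
  have aUs : adm a MU (fun w => U k (w + p h)).
    apply: (adm_unit ka aball) => //; first by apply: cmeas_cts => w; apply: cts_shift; exact: cU.
    by move=> w w1; exact: shift_out h1 (U0 k) w1.
  have r1 : 1 <= 1 :> R by [].
  have [MQ MQ0 [aQ _]] := adm_cts ka aball r1 (@cQ k h) (fun w => Q0 k h w h1).
  have cEb w : {for w, continuous (fun w => \sum_j E j h w * b j k w)}.
    by apply: ctsC_sum => j; apply: ctsCM; [exact: cE|exact: cb].
  have Eb0 w : rho < cabs w -> \sum_j E j h w * b j k w = 0 by move=> hw; rewrite big1// => j _; rewrite b0// mulr0.
  have [ME ME0 [aE _]] := adm_cts ka aball (ltW rho1) cEb Eb0.
  have TV : Y k z = g' k z + cauchyT (V k) z.
    by rewrite YE /G -addrA; congr (_ + _); rewrite addrC /V (cauchyTD th0 ka z MY0 MW0 aY aW').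
  have E1 : E k h z = (g k (z + p h) + cauchyT (U k) (z + p h)) - (g k z + cauchyT (U k) z) -
    (g' k z + cauchyT (V k) z) * h%:C by rewrite /E (XE k (z + p h)) (XE k z) TV.
  have Hd := @cauchyT_difference R th B a th0 ka MU MV (U k) (V k) z h c MU0 MV0 aU aV aUs.
  have Eq w : U k (w + p h) - U k w - V k w * h%:C = Q k h w + \sum_j E j h w * b j k w.
    rewrite /U /V /W /Q mulrDl !mulr_suml -sumrB -big_split -sumrB -big_split /=.
    by apply: eq_bigr => j _; rewrite /E; ring.
  rewrite (eq_cauchyT z Eq) (cauchyTD th0 ka z MQ0 ME0 aQ aE) -/(p h) in Hd.
  rewrite E1 -[rowT b _ k z]/(cauchyT (fun w => \sum_j E j h w * b j k w) z) -(canLR (addrK _) Hd); ring.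
move=> k0 L e e0.
(* If the errors of g and Q are at most de |h|, then |E| <= c0 + K n (2 c0 Kb) with c0 = (1 + K) de
   |h|, which is D de |h|; hence de = e / D. *)
pose D := (1 + K) * (1 + 2 * K * (n%:R * Kb)).
have KK0 : 0 <= 2 * K * (n%:R * Kb) by apply: mulr_ge0; apply: mulr_ge0.
have D0 : 0 < D by rewrite mulr_gt0// ltr_pwDl.
pose de := e / D; have de0 : 0 < de by rewrite divr_gt0.
have [MX MX0 hMX] := cts_bounded_family 2 cX.
have [Mb Mb0 hMb] := cts_bounded_family 1 (fun jk : 'I_n * 'I_n => @cb' jk.1 jk.2).
have n0 : (0 : R) <= n%:R by [].
(* Chosen so that n MX e1 and n Mb e2 are each at most de / 2. *)
have e10 : 0 < de / (2 * n%:R * MX + 1) by rewrite divr_gt0// ltr_wpDl// !mulr_ge0.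
have e20 : 0 < de / (2 * n%:R * Mb + 1) by rewrite divr_gt0// ltr_wpDl// !mulr_ge0.
set e1 := _ / _ in e10; set e2 := _ / _ in e20.
have [d1 d10 h1] : exists2 d, 0 < d & forall k, forall z (h : R), cabs z <= Num.max L 1 -> `|h| < d ->
    cabs (g k (z + p h) - g k z - g' k z * h%:C) <= de * `|h|.
  apply: (@fin_radius _ (fun k d => forall z (h : R), cabs z <= Num.max L 1 -> `|h| < d -> _)) => [k|k d d' dd H z h zL hd].
    by have [d d0 hd] := hg k (Num.max L 1) de de0; exists d.
  by apply: H => //; exact: lt_le_trans dd.
have [d2 d20 h2] : exists2 d, 0 < d & forall jk : 'I_n * 'I_n, forall z (h : R), cabs z <= 1 -> `|h| < d ->
    cabs (b jk.1 jk.2 (z + p h) - b jk.1 jk.2 z - b' jk.1 jk.2 z * h%:C) <= e1 * `|h|.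
  apply: (@fin_radius _ (fun jk d => forall z (h : R), cabs z <= 1 -> `|h| < d -> _)) => [[j k]|k d d' dd H z h zL hd].
    by have [d d0 hd] := ub j k 1 e1 e10; exists d.
  by apply: H => //; exact: lt_le_trans dd.
have [d3 d30 h3] : exists2 d, 0 < d & forall j, forall z (h : C), cabs z <= 1 -> cabs h < d ->
    cabs (X j (z + h) - X j z) <= e2.
  apply: (@fin_radius _ (fun j d => forall z (h : C), cabs z <= 1 -> cabs h < d -> _)) => [j|k d d' dd H z h zL hd].
    exact: heine_cantor (cX j) e20.
  by apply: H => //; exact: lt_le_trans dd.
exists (Num.min (Num.min d1 d2) (Num.min d3 (1 - rho))).
  by rewrite !lt_min d10 d20 d30 subr_gt0.
move=> z h zL; rewrite !lt_min => /andP[/andP[hh1 hh2] /andP[hh3 hh4]].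
have ph : cabs (p h) = `|h| by rewrite cabs_pdir.
have h1le : `|h| <= 1 by apply: ltW (lt_le_trans hh4 _); rewrite gerBl.
have hq k w : cabs (Q k h w) <= de * `|h|.
  have [w1|w1] := leP (cabs w) 1; last by rewrite Q0// cabs0 mulr_ge0// ltW.
  have bd : cabs (Q k h w) <= \sum_(j < n) (MX * e1 + e2 * Mb) * `|h|.
    rewrite (le_trans (cabs_sum _ _ _))//; apply: ler_sum => j _.
    rewrite (le_trans (cabsD _ _))// !cabsM cabs_real mulrDl; apply: lerD; last first.
      rewrite ler_wpM2r// ler_pM ?cabs_ge0// ?(hMb (j, k))//.
      by apply: h3 => //; rewrite ph.
    rewrite -mulrA ler_pM ?cabs_ge0//; last exact: (h2 (j, k)).
    apply: hMX; apply: (le_trans (cabsD w (p h))); rewrite ph.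
    exact: lerD w1 h1le.
  apply: (le_trans bd); rewrite sumr_const card_ord -mulr_natl mulrA ler_wpM2r//.
  have -> : n%:R * (MX * e1 + e2 * Mb) = de * 2^-1 * (2 * n%:R * MX / (2 * n%:R * MX + 1)) +
     de * 2^-1 * (2 * n%:R * Mb / (2 * n%:R * Mb + 1)).
    by rewrite /e1 /e2; field; rewrite !gt_eqF ?ltr_wpDl// ?mulr_ge0.
  have fr x : 0 <= x -> x / (x + 1) <= 1 :> R.
    by move=> x0; rewrite ler_pdivrMr ?ltr_wpDl// mul1r lerDl.
  have hd2 : 0 <= de * 2^-1 by rewrite mulr_ge0// ltW.
  have := ler_wpM2l hd2 (fr _ (_ : 0 <= 2 * n%:R * MX)); have := ler_wpM2l hd2 (fr _ (_ : 0 <= 2 * n%:R * Mb)).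
  by rewrite !mulr1 => /(_ ltac:(by rewrite !mulr_ge0)) k1 /(_ ltac:(by rewrite !mulr_ge0)) k2; lra.
have dh0 : 0 <= de * `|h| by rewrite mulr_ge0// ltW.
have TQ k w : cabs (cauchyT (Q k h) w) <= K * (de * `|h|).
  have aQ : adm a (de * `|h|) (Q k h).
    by apply: (adm_unit ka aball) (hq k) _ => // [|v]; [exact: cmeas_cts|exact: Q0].
  exact: (@cauchyT_bound R th B a th0 ka _ (Q k h) w dh0 aQ).
have mE j : cmeas (E j h) by exact: cmeas_cts.
have [S0 S00 hS0] := cts_bounded_family rho (fun k => @cE k h).
pose c0 := (1 + K) * (de * `|h|).
have c00 : 0 <= c0 by rewrite mulr_ge0// addr_ge0.
have base k w : cabs w <= Num.max L 1 -> cabs (E k h w) <= c0 + cabs (rowT b (fun j => E j h) k w).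
  move=> wL; rewrite split// (le_trans (cabsD _ _))// lerD2r (le_trans (cabsD _ _))//.
  by rewrite /c0 mulrDl mul1r lerD// h1.
(* On the disk of radius rho the term [rowT] costs at most half the bound and is absorbed. Elsewhere
   it is then estimated from these values alone, since b vanishes off the disk. *)
have small' : forall t : 'I_n * C, cabs t.2 <= rho -> cabs (E t.1 h t.2) <= 2 * c0.
  apply: (@le_bootstrap _ (fun t : 'I_n * C => cabs t.2 <= rho) (fun t => cabs (E t.1 h t.2)) c0 S0) => //.
    by move=> [k w] /=; exact: hS0.
  move=> S SS0 hS [k w] /= wr; apply: (le_trans (base k w _)); first by rewrite le_max (le_trans wr (ltW rho1)) orbT.
  rewrite lerD2l; apply: le_trans (rowT_small th0 ka Kb0 hb b0 k mE SS0 _ wr) _.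
    by move=> j v vr; exact: (hS (j, v)).
  by rewrite ler_wpM2r.
have c20 : 0 <= 2 * c0 by rewrite mulr_ge0.
apply: (le_trans (base k0 z _)); first by rewrite le_max zL.
have aR := row_adm ka Kb0 hb b0 k0 mE c20 (fun j w wr => small' (j, w) wr).
have nn0 : 0 <= n%:R * (2 * c0 * Kb) by apply: mulr_ge0 => //; exact: mulr_ge0.
have := @cauchyT_bound R th B a th0 ka _ _ z nn0 aR; rewrite -/K -/(rowT b (fun j => E j h) k0 z) => hR.
have -> : e * `|h| = c0 + K * (n%:R * (2 * c0 * Kb)).
  rewrite /c0 /de; have Dn : D != 0 by rewrite gt_eqF.
  transitivity (D * (e / D * `|h|)); first by field.
  by rewrite {1}/D; ring.
by rewrite lerD2l.
Qed.

(** The induction keeps the inhomogeneity general: the derivative of X solves the equation with g' +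
    T (X b') in place of g, and this is C^m because X is C^m by induction. *)
Lemma rowT_CkC_on m (g X : 'I_n -> C -> C) : (forall k, CkC_on (Some m) setT (g k)) ->
  (forall k z, {for z, continuous (X k)}) -> (forall k z, X k z = g k z + rowT b X k z) ->
  forall k, CkC_on (Some m) setT (X k).
Proof.
elim: m g X => [|m IH] g X hg cX XE k; first by apply: CkC_on_cts0 => z _; exact: cX.
have hg1 j : CkC_on (Some 1%N) setT (g j).
  by have [h1 h2] := hg j; split; [apply: Cn_on_le h1|apply: Cn_on_le h2].
have hgm j : CkC_on (Some m) setT (g j).
  by have [h1 h2] := hg j; split; [apply: Cn_on_le h1|apply: Cn_on_le h2].
have hX := IH g X hgm cX XE.
have H c : exists Y, (forall j L, uds c L (X j) (Y j)) /\ forall j, CkC_on (Some m) setT (Y j).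
  have [||Y [cY YE uY]] := @rowT_deriv c g (fun j => pdc c (g j)) X _ _ cX XE.
  - by move=> j L; exact: uds_C1.
  - by move=> j z; exact: CkC_on_cts (CkC_on_pdc c (hg j)) I.
  exists Y; split=> //; apply: IH cY YE => j.
  apply: CkC_onD; [exact: openT|exact: CkC_on_pdc|].
  apply: (cauchyT_CkC_on th0 th1 ka aball rho1).
    apply: CkC_on_sum => [|i]; first exact: openT.
    by apply: CkC_onM; [exact: openT|exact: hX|apply: CkC_on_pdc; exact: sbm].
  move=> w wr; rewrite big1// => i _.
  rewrite (@uds0 R c (b i j) (pdc c (b i j)) rho w) ?mulr0//; first exact: b0.
  by move=> L; apply: uds_C1; exact: sbm.
have [Y hY] := choice H.
apply: (uds_CkC_on (v := fun c => Y c k)) => [z|c L|c]; first exact: cX.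
  exact: (hY c).1.
exact: (hY c).2.
Qed.

Lemma gauge_CkC_on Psi : gauge_solution rho b Psi -> forall i k, CkC_on None setT (Psi i k).
Proof.
move=> hPsi i k; have [cP _ PE] := hPsi i.
have H m : CkC_on (Some m) setT (Psi i k).
  apply: (@rowT_CkC_on m (fun k _ => (i == k)%:R)) cP PE k => j.
  by apply: CkC_on_cst; exact: openT.
by split=> m; case: (H m).
Qed.

End gauge_regularity.

(** * The smooth, complex-linear case *)

Section smooth_gauge.
Variable R : realType.
Local Notation C := R[i].

Lemma bounded_Lp_disk (p : \bar R) (u : C -> R) (M : R) : (2%:E < p)%E ->
  rmeas (fun w => ballf 0 1 w * u w) -> (forall w, cabs w <= 1 -> `|u w| <= M) -> Lp_disk p u.
Proof.
move=> hp mu uM; rewrite /Lp_disk; set f := _ \_ _.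
have fE q : f q = ballf 0 1 (toC q) * u (toC q).
  rewrite /f /patch /ballf subr0; case: ifPn => [|/negP] h.
    by move: h; rewrite inE => /disk_cabs ->; rewrite mul1r.
  by case: ifPn => [h'|_]; rewrite ?mul0r//; case: h; rewrite inE; apply/disk_cabs.
have mf : measurable_fun setT f by rewrite (_ : f = (fun q => ballf 0 1 (toC q) * u (toC q)))//; apply/funext.
have fM q : `|f q| <= `|M| * ballf 0 1 (toC q).
  rewrite fE /ballf subr0; case: ifP => [h|_]; last by rewrite mul0r normr0 mulr0.
  by rewrite mul1r mulr1 (le_trans (uM _ h))// ler_norm.
rewrite inE; apply/andP; split; first by rewrite inE.
rewrite inE /= /finite_norm unlock.
case: p hp => [r||]//= hr; last first.
  rewrite (_ : (0 < lebesgue2 R setT)%E = true); last exact: mu2_setT_gt0.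
  apply: (@le_lt_trans _ _ `|M|%:E); last exact: ltry.
  apply/ess_supP; apply: nearW => q /=; rewrite lee_fin (le_trans (fM q))//.
  by rewrite ler_piMr// /ballf; case: ifP.
apply: poweR_lty; apply: (@le_lt_trans _ _ (RI (fun w => `|M| `^ r * ballf 0 1 w)%R)).
  have m1 : measurable_fun setT (fun q : measurableTypeR R * measurableTypeR R => (`|f q| `^ r)%:E).
    by apply/measurable_EFinP; apply: (measurableT_comp (@measurable_powR R r)); exact: measurableT_comp.
  have m2 : measurable_fun setT (fun q : measurableTypeR R * measurableTypeR R => (`|M| `^ r * ballf 0 1 (toC q))%:E).
    by apply/measurable_EFinP/measurable_funM; [exact: measurable_cst|exact: rmeas_ballf].
  rewrite (_ : (\int[_]_x _)%E = (\int[@mu2 R]_q (`|f q| `^ r)%:E)%E)//.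
  apply: ge0_le_integral => // q _; rewrite lee_fin ?powR_ge0//.
  have r0 : 0 < r by move: hr; rewrite lte_fin => hr; apply: lt_trans hr.
  apply: (@le_trans _ _ ((`|M| * ballf 0 1 (toC q)) `^ r)).
    by apply: ge0_ler_powR; rewrite ?nnegrE ?(ltW r0)// mulr_ge0// ballf_ge0.
  rewrite /ballf; case: ifP => _; first by rewrite !mulr1.
  by rewrite !mulr0 powR0// gt_eqF.
rewrite RIZ ?powR_ge0//; [|exact: ballf_ge0|exact: rmeas_ballf].
apply: (@le_lt_trans _ _ ((`|M| `^ r)%:E * ((2 * 1) ^+ 2)%:E)%E); last by rewrite -EFinM ltry.
by apply: lee_wpmul2l; [rewrite lee_fin powR_ge0|exact: RI_ballf].
Qed.

Lemma smooth_endo_Lp (p : \bar R) (n : nat) (A : C -> 'cV[C]_n -> 'cV[C]_n) : (2%:E < p)%E ->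
  smooth_endo A -> Lp_endo p A.
Proof.
move=> hp [U [oO dO hA]] v k; have [h1 h2] := hA v k 0.
have key (u : C -> R) : (forall m, Cn_on m U u) -> Lp_disk p u.
  move=> hu; have cu w : U w -> {for w, continuous u} := fun Ow => Cn_on_cts (hu 0%N) Ow.
  have [M M0 hM] : exists2 M : R, 0 <= M & forall z, cabs z <= 1 -> cabs ((u z)%:C : C) <= M.
    apply: cts_bounded_cball => z /disk_cabs/dO/cu cz.
    by apply: ctsC_reim => //=; exact: cts_cst.
  apply: (@bounded_Lp_disk p u M hp); last by move=> w /hM; rewrite cabs_real.
  have := measurable_funM (rmeas_ballf (0 : C) 1) (cts_on_measurable oO cu).
  apply: eq_measurable_fun => q _ /=; rewrite /ballf subr0; case: ifPn => [w1|_]; last by rewrite !mul0r.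
  by rewrite indicE mem_set ?mul1r//; apply: dO; apply/disk_cabs.
by split; [exact: key h1|exact: key h2].
Qed.

(** A small square near z has positive measure, so it cannot lie in the exceptional null set. *)
Lemma ae_dense (Q : C -> Prop) (z : C) (e : R) : {ae @lebesgue2 R, forall q, Q (toC q)} -> 0 < e ->
  exists2 w, cabs (w - z) < e & Q w.
Proof.
move=> [N [mN N0 QN]] e0; apply: contrapT => H.
pose d := e / 4; have d0 : 0 < d by rewrite divr_gt0.
have sub : box (complex.Re z) (complex.Im z) d d `<=` N.
  move=> [s t] [/=]; rewrite !in_itv/= => /andP[s1 s2] /andP[t1 t2]; apply: QN => /= Qst; apply: H.
  exists (s +i* t) => //; rewrite (le_lt_trans (cabs_le _))// !reimE /= !gtr0_norm ?subr_gt0//.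
  by rewrite /d in s2 t2; lra.
have h : (@mu2 R (box (complex.Re z) (complex.Im z) d d) <= @mu2 R N)%E.
  by apply: le_measure; rewrite ?inE//; exact: measurable_box.
have h1 := @mu2_box R (complex.Re z) (complex.Im z) d d (ltW d0) (ltW d0).
have h2 : @mu2 R N = 0%E by exact: N0.
by move: h; rewrite h1 h2 lee_fin leNgt mulr_gt0.
Qed.

Lemma cut_CkC_on (chi : C -> R) (F : C -> C) (O : set C) (r r' : R) : r < r' -> open O ->
  (forall m, Cn_on m setT chi) -> (forall w, r <= cabs w -> chi w = 0) ->
  (forall w, cabs w < r' -> O w) -> CkC_on None O F -> CkC_on None setT (fun w => (chi w)%:C * F w).
Proof.
move=> rr' oO hchi chi0 sub hF.
have hc : CkC_on None setT (fun w => (chi w)%:C : C).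
  by split=> m /=; [exact: hchi|apply: Cn_on_cst; exact: openT].
have hcO : CkC_on None O (fun w => (chi w)%:C : C).
  by have [h1 h2] := hc; split=> m; [apply: Cn_on_sub (h1 m)|apply: Cn_on_sub (h2 m)].
have [p1 p2] := CkC_onM oO hcO hF.
have out : CkC_on None [set w : C | r < cabs w] (fun w => (chi w)%:C * F w).
  have oU : open [set w : C | r < cabs w].
    apply/openP_cabs => z /= rz; exists (cabs z - r); first by rewrite subr_gt0.
    by move=> w; have := cabsD (z - w) w; rewrite subrK [cabs (z - w)]cabsBC; lra.
  apply: CkC_on_eq (CkC_on_cst None 0 oU) => // w /= /ltW/chi0 ->; by rewrite mul0r.
have [q1 q2] := out.
have oU : open [set w : C | r < cabs w].
  apply/openP_cabs => z /= rz; exists (cabs z - r); first by rewrite subr_gt0.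
  by move=> w; have := cabsD (z - w) w; rewrite subrK [cabs (z - w)]cabsBC; lra.
split=> m; apply: Cn_on_local => z _; have [zr|rz] := ltP (cabs z) r'.
- by exists O; split=> //; exact: sub.
- by exists [set w : C | r < cabs w]; split=> //=; exact: lt_le_trans rz.
- by exists O; split=> //; exact: sub.
- by exists [set w : C | r < cabs w]; split=> //=; exact: lt_le_trans rz.
Qed.

Lemma cabs_ecol (n : nat) (l : 'I_n) c (k : 'I_n) : cabs (ecol R l c k 0) <= 1.
Proof.
rewrite /ecol !mxE eqxx andbT cabsM -[leRHS]mulr1 ler_pM ?cabs_ge0//.
  by have := @cabs_pdir R 1 c; rewrite cabsM cabs_real normr1 mul1r /pdir => ->.
by case: (k == l); rewrite ?cabs1 ?cabs0.
Qed.

Section smooth.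
Variables (n : nat) (p : \bar R) (A : C -> 'cV[C]_n -> 'cV[C]_n) (O : set C) (f : C -> 'cV[C]_n).
Hypotheses (hp : (2%:E < p)%E) (hA : real_endo A) (sA : smooth_endo A).
Hypothesis cA : forall w l k, cabs w < 1 -> A w (ecol R l false) k 0 = 'i * A w (ecol R l true) k 0.
Hypotheses (oO : open O) (dO : @disk R `<=` O)
  (cf : forall k w, O w -> {for w, continuous (fun w => f w k 0)})
  (f1 : forall k w, disk w -> cabs (f w k 0) <= 1).
Hypothesis weak : forall k phi, test_function phi ->
  Cintegral (@disk R) (fun w => - dbar phi w * f w k 0 + phi w * A w (f w) k 0) = 0.

Lemma smooth_gauge : exists r : R, exists Psi : 'I_n -> 'I_n -> C -> C,
  [/\ 0 < r, r < 2^-1, forall i k, CkC_on None setT (Psi i k),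
    forall z, cabs z < r -> (\matrix_(i, k) Psi i k z) \in unitmx &
    forall i z, cabs z < r -> exists l, cderiv (fun w => \sum_k Psi i k w * f w k 0) z l].
Proof.
have lA := smooth_endo_Lp hp sA.
have p2 := finite_exponent_gt2 hp; have /andP[th0 th1] := kato_exponent_itv p2.
have [B kB] := endo_size_kato hp lA; have B0 := kato_B_ge0 kB.
have s0 w : 0 <= endo_size A w by apply: le_trans (endo_size_ball A w); exact: ballf_ge0.
have [rho [r0 r2 c1 c2]] := small_radius n th0 B0 (ler01 : 0 <= 1 :> R).
have [U [oU dU hU]] := sA.
have rho2 : 0 < rho / 2 by rewrite divr_gt0.
(* A sharp cut-off would destroy the smoothness of b. A smooth one needs a transition region, so b
   agrees with A only on the disk of radius rho / 2. *)
have [chi [hchi chi1 chi0 chi01]] := @bump_exists R 0 (rho / 2) rho (ltW rho2) ltac:(lra).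
have {}chi0 w : rho <= cabs w -> chi w = 0 by have := chi0 w; rewrite subr0.
have {}chi1 w : cabs w <= rho / 2 -> chi w = 1 by have := chi1 w; rewrite subr0.
pose b k j w : C := (chi w)%:C * A w (ecol R j true) k 0.
have sb k j : CkC_on None setT (b k j).
  have r1 : rho < 1 by lra.
  apply: (cut_CkC_on r1 oU hchi chi0) (hU _ k 0) => w /ltW w1.
  by apply: dU; apply/disk_cabs.
have cb k j z : {for z, continuous (b k j)} := CkC_on_cts (sb k j) I.
have b0 k j w : rho < cabs w -> b k j w = 0 by move=> /ltW/chi0 h; rewrite /b h mul0r.
have hb k j : adm (endo_size A) 1 (b k j).
  split=> [|w]; first exact: cmeas_cts.
  have [w1|w1] := leP (cabs w) 1; last by rewrite b0 ?cabs0 ?mul1r//; lra.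
  rewrite /b cabsM cabs_real -[leRHS]mul1r; apply: ler_pM; rewrite ?cabs_ge0//.
    by have /andP[? ?] := chi01 w; rewrite ger0_norm.
  by apply: endo_size_bound => // l; exact: cabs_ecol.
have [Psi hPsi] := gauge_exists th0 th1 kB ler01 hb b0 c1.
exists (rho / 2), Psi; split=> //.
- lra.
- apply: (@gauge_CkC_on R _ B rho 1 (endo_size A) n b th0 th1 kB (endo_size_ball A) ler01 hb b0 (ltW r0) _ sb c1 Psi hPsi).
  lra.
- move=> z zr; apply: (gauge_unit th0 kB ler01 hb b0 hPsi) => //; lra.
apply: (plane_core th0 th1 kB (endo_size_ball A) oO dO (f := fun k w => f w k 0) (m := fun k w => A w (f w) k 0)
    cf ler01 _ weak ler01 hb b0 _ hPsi).
- move=> k; split=> [|w].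
    have mA v : cmeas (fun w => (ballf 0 1 w)%:C * A w v k 0) by exact: (Lp_endo_cmeas v k hp lA).
    pose g w : C := \sum_l ((complex.Re ((\1_O w)%:C * f w l 0))%:C * ((ballf 0 1 w)%:C * A w (ecol R l true) k 0) +
      (complex.Im ((\1_O w)%:C * f w l 0))%:C * ((ballf 0 1 w)%:C * A w (ecol R l false) k 0)).
    have -> : (fun w => (ballf 0 1 w)%:C * A w (f w) k 0) = g.
      apply/funext => w; rewrite /g real_endoE// mulr_sumr /ballf subr0; apply: eq_bigr => l _.
      case: ifPn => [w1|_]; last by rewrite !mul0r !mulr0 addr0.
      by rewrite !mul1r indicE mem_set ?mul1r//; apply: dO; apply/disk_cabs.
    apply: cmf_sum => l; have [m1 m2] := cmeas_fO oO cf l.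
    by apply: cmfD; apply: cmfM; try exact: cmf_real; exact: mA.
  rewrite mul1r /ballf subr0; case: ifPn => [w1|_]; last by rewrite mul0r cabs0.
  by rewrite mul1r -[endo_size A w]mul1r; apply: endo_size_bound => // l; apply: f1; exact/disk_cabs.
- lra.
move=> k w wr; have w1 : cabs w < 1 by lra.
rewrite (real_endoE w (f w) k hA); apply: eq_bigr => j _.
rewrite cA// /b chi1 ?ltW// mul1r [RHS](_ : _ = (complex.Re (f w j 0) +i* complex.Im (f w j 0)) * A w (ecol R j true) k 0).
  by rewrite ReIm mulrC.
by apply: complex_ext; rewrite !reimE /=; ring.
Qed.

End smooth.

Section matrix_regularity.
Variables (k : option nat) (O : set C).
Hypothesis oO : open O.

Lemma CkC_on_prod (I : Type) (s : seq I) (F : I -> C -> C) :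
  (forall i, CkC_on k O (F i)) -> CkC_on k O (fun w => \prod_(i <- s) F i w).
Proof.
move=> hF; elim: s => [|i s IH].
  by under eq_fun do rewrite big_nil; exact: CkC_on_cst.
by under eq_fun do rewrite big_cons; exact: CkC_onM.
Qed.

Lemma CkC_onV u : (forall z, O z -> u z != 0) -> CkC_on k O u -> CkC_on k O (fun w => (u w)^-1).
Proof.
move=> u0.
have key m : CkC_on (Some m) O u -> CkC_on (Some m) O (fun w => (u w)^-1).
  move=> [h1 h2].
  have q0 z : O z -> complex.Re (u z) * complex.Re (u z) + complex.Im (u z) * complex.Im (u z) != 0.
    by move=> /u0; rewrite -!expr2 -sqr_cabs sqrf_eq0 cabs_eq0.
  have hq := Cn_onV oO q0 (Cn_onD oO (Cn_onM oO h1 h1) (Cn_onM oO h2 h2)).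
  split.
    by apply: Cn_on_eq (Cn_onM oO h1 hq) => // z _; rewrite cReV sqr_cabs !expr2.
  by apply: Cn_on_eq (Cn_onM oO (Cn_onN oO h2) hq) => // z _; rewrite cImV sqr_cabs !expr2.
case: k => [m|]; first exact: key.
move=> [h1 h2]; have H m : CkC_on (Some m) O (fun w => (u w)^-1) by apply: key; split; [exact: h1|exact: h2].
by split=> m; case: (H m).
Qed.

Lemma CkC_on_det m (g : C -> 'M[C]_m) : Ckmx_on k O g -> CkC_on k O (fun z => \det (g z)).
Proof.
move=> hg; apply: CkC_on_sum => // s; apply: CkC_onM => //; first exact: CkC_on_cst.
by apply: CkC_on_prod => i; exact: hg.
Qed.

Lemma Ckmx_on_mul m n l (g : C -> 'M[C]_(m, n)) (h : C -> 'M[C]_(n, l)) :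
  Ckmx_on k O g -> Ckmx_on k O h -> Ckmx_on k O (fun z => g z *m h z).
Proof.
move=> hg hh i j; under eq_fun do rewrite mxE.
by apply: CkC_on_sum => // x; exact: CkC_onM.
Qed.

(** By Cramer's rule the entries are polynomials in those of g divided by the determinant. *)
Lemma Ckmx_on_inv m (g : C -> 'M[C]_m) : Ckmx_on k O g -> (forall z, O z -> g z \in unitmx) ->
  Ckmx_on k O (fun z => invmx (g z)).
Proof.
move=> hg ug i j.
apply: (@CkC_on_eq R k O (fun z => (\det (g z))^-1 * ((-1) ^+ (j + i) * \det (row' j (col' i (g z)))))) => //.
  by move=> z /ug uz; rewrite /invmx uz !mxE.
apply: CkC_onM => //.
  by apply: CkC_onV; [move=> z /ug; rewrite unitmxE unitfE|exact: CkC_on_det].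
apply: CkC_onM => //; first exact: CkC_on_cst.
by apply: CkC_on_det => x y; under eq_fun do rewrite !mxE; exact: hg.
Qed.

End matrix_regularity.
End smooth_gauge.

(** * Charts and trivializations *)

Section charts.
Variable R : realType.
Local Notation C := R[i].

Lemma cderiv_affine (a k z : C) : cderiv (fun w => a + k * w) z k.
Proof.
move=> e e0; exists 1 => // h _; rewrite (_ : _ - _ - _ = 0); last by ring.
by rewrite cabs0 mulr_ge0 ?cabs_ge0// ltW.
Qed.

Lemma holomorphic_onP (O : set C) f :
  holomorphic_on O f <-> forall z, O z -> exists l, cderiv f z l.
Proof. by split=> h z /h/cderivP. Qed.

Lemma open_chart_pre (T : topologicalType) (c : chart R T) (U : set T) : open U ->
  open (ccod c `&` cbwd c @^-1` U).
Proof.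
move=> oU; rewrite openE => z [cz Uz]; apply: filterI.
  by apply: open_nbhs_nbhs; split=> //; exact: open_ccod.
by apply: (cbwd_continuous cz); apply: open_nbhs_nbhs.
Qed.

Section rescale.
Variables (T : topologicalType) (c : chart R T) (a : C) (r : R).
Hypothesis r0 : 0 < r.
Let aff w : C := a + r%:C * w.
Let affV w : C := r%:C^-1 * (w - a).

Let rC : r%:C != 0 :> C.
Proof. by apply/eqP => /(congr1 (@complex.Re R)) /= /eqP; rewrite gt_eqF. Qed.
Let affK w : affV (aff w) = w. Proof. by rewrite /affV /aff addrC addKr mulKf. Qed.
Let affVK w : aff (affV w) = w. Proof. by rewrite /affV /aff mulVKf// subrKC. Qed.

Let caff w : {for w, continuous aff}.
Proof. exact: cderiv_continuous (cderiv_affine a r%:C w). Qed.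

Let rescale_open : open [set w | ccod c (aff w)].
Proof.
rewrite openE => w cw; apply: (@caff w); apply: open_nbhs_nbhs; split=> //.
exact: open_ccod.
Qed.

Let rescale_fwd_continuous x : cdom c x -> {for x, continuous (fun y => affV (cfwd c y))}.
Proof.
move=> cx; apply/cvgC_cabsP => e e0.
have /cvgC_cabsP/(_ _ (mulr_gt0 r0 e0)) := cfwd_continuous cx.
apply: filterS => y; rewrite /affV -mulrBr opprB addrA subrK cabsM cabsV cabs_real gtr0_norm//.
by rewrite ltr_pdivrMl.
Qed.

(** Moves the disk of radius r about a onto the unit disk, where local forms of D live. It is
    transparent, because later proofs compute with its components. *)
Definition rescale_chart : chart R T.
Proof.
refine (@Chart R T (cdom c) [set w | ccod c (aff w)] (fun x => affV (cfwd c x)) (fun w => cbwd c (aff w))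
  (open_cdom c) rescale_open _ _ _ _ rescale_fwd_continuous _).
- by move=> x /cfwd_cod; rewrite /= affVK.
- by move=> w /= /cbwd_dom.
- by move=> x /cfwdK; rewrite affVK.
- by move=> w /= /cbwdK ->; rewrite affK.
- move=> w /= cw; apply: (@continuous_comp _ _ _ aff (cbwd c) w); first exact: caff.
  exact: cbwd_continuous.
Defined.

End rescale.

Section surface.
Variable X : riemann_surface R.

Lemma surf_atlas_hol_coord (c : chart R X) : surf_atlas c -> hol_coord c.
Proof. by move=> hc d hd; split; exact: surf_compat. Qed.

Lemma rescale_hol_coord (c : chart R X) (a : C) (r : R) (r0 : 0 < r) : surf_atlas c ->
  hol_coord (rescale_chart c a r0).
Proof.
move=> hc d hd; split; apply/holomorphic_onP => z [/= cz dz].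
  have /holomorphic_onP/(_ (a + r%:C * z))[|l hl] := surf_compat hc hd; first by split.
  by eexists; exact: cderiv_comp (cderiv_affine a r%:C z) hl.
have /holomorphic_onP/(_ z)[|l hl] := surf_compat hd hc; first by split.
eexists; have := cderiv_comp hl (cderiv_affine (- (r%:C^-1 * a)) r%:C^-1 _).
by apply: cderiv_near; near=> w; rewrite /= mulrBr addrC.
Unshelve. all: by end_near.
Qed.

(** By definition a holomorphic coordinate is compatible with the atlas only; two of them are
    compared by passing through a chart of the atlas around the point. *)
Lemma hol_coord_trans (c d : chart R X) z : hol_coord c -> hol_coord d ->
  ccod c z -> cdom d (cbwd c z) -> exists l, cderiv (cfwd d \o cbwd c) z l.
Proof.
move=> hc hd cz dz; have [e he ex] := surf_cover (cbwd c z).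
have /holomorphic_onP/(_ z)[|l hl] := (hc e he).1; first by split.
have /holomorphic_onP/(_ (cfwd e (cbwd c z)))[|m hm] := (hd e he).2.
  by split; [exact: cfwd_cod|rewrite /= cfwdK].
exists (m * l); have := cderiv_comp hl hm; apply: cderiv_near.
have oU := @open_chart_pre _ c _ (open_cdom e).
apply: filterS (open_near oU (conj cz ex)) => w [_ ew] /=.
by rewrite cfwdK.
Qed.

Lemma hol_coord_trans_CkC_on (c d : chart R X) : hol_coord c -> hol_coord d ->
  CkC_on None (ccod c `&` cbwd c @^-1` cdom d) (cfwd d \o cbwd c).
Proof.
move=> hc hd; apply: cderiv_CkC_on; first by apply: open_chart_pre; exact: open_cdom.
by move=> z [cz dz]; exact: hol_coord_trans.
Qed.

(** The coordinate vector d/dz, whose other components are the derivatives of the coordinate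
    changes; the chain rule makes it a tangent vector. Evaluating D on it frees the local form of
    the factor conj(dz(v)). *)
Lemma tangent_exists (c : chart R X) (x : X) : hol_coord_at x c -> exists v : tangent x, v c = 1.
Proof.
move=> [hc cx].
pose v (d : chart R X) : C := if `[< hol_coord_at x d >] then 'D_1 (cfwd d \o cbwd c) (cfwd c x) else 0.
have cz : ccod c (cfwd c x) by exact: cfwd_cod.
have vT : v \in is_tangent x.
  apply/asboolP; split=> [d nd|d d' hd hd']; first by rewrite /v asboolF.
  rewrite /v !asboolT//; have [hd1 dx] := hd; have [hd1' dx'] := hd'.
  have [|l hl] := @hol_coord_trans c d (cfwd c x) hc hd1 cz; first by rewrite cfwdK.
  have [|m hm] := @hol_coord_trans d d' (cfwd d x) hd1 hd1' (cfwd_cod dx); first by rewrite cfwdK.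
  rewrite (derive_cderiv hl) (derive_cderiv hm); apply: derive_cderiv.
  have := cderiv_comp hl (_ : cderiv (cfwd d' \o cbwd d) ((cfwd d \o cbwd c) (cfwd c x)) m).
  rewrite /= (cfwdK cx) => /(_ hm); apply: cderiv_near.
  have oU := @open_chart_pre _ c _ (open_cdom d).
  have h : (ccod c `&` cbwd c @^-1` cdom d) (cfwd c x) by split=> //=; rewrite cfwdK.
  by apply: filterS (open_near oU h) => w [_ ew] /=; rewrite cfwdK.
have nn : \forall w \near cfwd c x, 0 + 1 * w = (cfwd c \o cbwd c) w.
  have h := @open_near R (ccod c) _ (@open_ccod _ _ c) cz.
  by apply: filterS h => w cw; rewrite /= cbwdK// add0r mul1r.
exists (Tangent vT); rewrite /= /v asboolT//; apply: derive_cderiv.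
exact: cderiv_near nn (cderiv_affine 0 1 (cfwd c x)).
Qed.

End surface.

Lemma CkC_on_sub k (O O' : set C) f : O' `<=` O -> CkC_on k O f -> CkC_on k O' f.
Proof.
by move=> s; case: k => [m|] [h1 h2]; split=> /=; try move=> m; apply: Cn_on_sub s _; try exact: h1; exact: h2.
Qed.

Lemma CkC_on_comp k (O U : set C) (F h : C -> C) : open O -> open U -> (forall z, O z -> U (h z)) ->
  CkC_on None O h -> CkC_on k U F -> CkC_on k O (fun z => F (h z)).
Proof.
move=> oO oU OU [h1 h2].
have hh m : CkC_on (Some m) O h by split; [exact: h1|exact: h2].
case: k => [m|] [F1 F2]; split=> /=; try move=> m.
- exact: Cn_on_comp oO oU OU (hh m) F1.
- exact: Cn_on_comp oO oU OU (hh m) F2.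
- exact: Cn_on_comp oO oU OU (hh m) (F1 m).
- exact: Cn_on_comp oO oU OU (hh m) (F2 m).
Qed.

Lemma CkC_on_local m (O : set C) f : (forall z, O z -> exists U, [/\ open U, U z & CkC_on (Some m) U f]) ->
  CkC_on (Some m) O f.
Proof.
move=> H; split; apply: Cn_on_local => z /H[U [oU Uz [h1 h2]]]; exists U; split=> //.
Qed.

End charts.

Section trivializations.
Variables (R : realType) (X : riemann_surface R) (n : nat) (E : vbundle X n).
Local Notation C := R[i].

Section assemble.
Variables (c : chart R X) (tau : local_triv n E) (r : R) (k : option nat) (M : C -> 'M[C]_n).
Hypotheses (hc : hol_coord c)
  (sub : forall z, cabs z < r -> ccod c z /\ tdom tau (cbwd c z))
  (hM : Ckmx_on k setT M) (uM : forall z, cabs z < r -> M z \in unitmx)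
  (trans : forall sigma, triv_atlas sigma -> transition_class k tau sigma /\ transition_class k sigma tau).

Let V : set X := [set x | cdom c x /\ cabs (cfwd c x) < r].

Let oV : open V.
Proof.
rewrite openE => x [cx xr]; apply: filterI.
  by apply: open_nbhs_nbhs; split=> //; exact: open_cdom.
have xr0 : cabs (cfwd c x - 0) < r by rewrite subr0.
have h : nbhs (cfwd c x) [set w | cabs (w - 0) < r] by exact: open_near (@open_cball R 0 r) xr0.
have h' : nbhs x (cfwd c @^-1` [set w | cabs (w - 0) < r]) := @cfwd_continuous R X c x cx _ h.
apply: (@filterS _ (nbhs x) _ _ _ _ h') => y; rewrite /preimage /= subr0//.
Qed.

Let Vtau x : V x -> tdom tau x.
Proof. by move=> [cx /sub[_]]; rewrite cfwdK. Qed.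

Let phi x : {linear E x -> 'cV[C]_n} := (mulmx (M (cfwd c x)) \o tmap tau x).

Let phi_bij x : V x -> bijective (phi x).
Proof.
move=> Vx; have u := uM Vx.2.
have b : bijective (mulmx (M (cfwd c x)) : 'cV[C]_n -> 'cV[C]_n).
  by exists (mulmx (invmx (M (cfwd c x)))) => v; [exact: mulKmx|exact: mulKVmx].
exact: bij_comp b (tmap_bij (Vtau Vx)).
Qed.

Definition gauged_triv : local_triv n E := @LocalTriv R X n E V phi oV phi_bij.

Let V_chart (d : chart R X) (W : set X) : surf_atlas d -> open W -> W `<=` V ->
  open (ccod d `&` cbwd d @^-1` W) /\ CkC_on None (ccod d `&` cbwd d @^-1` W) (cfwd c \o cbwd d).
Proof.
move=> hd oW WV; split; first exact: open_chart_pre.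
apply: CkC_on_sub (hol_coord_trans_CkC_on (surf_atlas_hol_coord hd) hc).
by move=> z [dz /WV[]].
Qed.

Lemma gauged_triv_class : triv_class k gauged_triv.
Proof.
move=> sigma hs; have [[g2 [g2E g2C]] [g1 [g1E g1C]]] := trans hs.
have oB : open [set w : C | cabs w < r].
  have -> : [set w : C | cabs w < r] = [set w | cabs (w - 0) < r] by apply/funext => w; rewrite /= subr0.
  exact: open_cball.
split.
  exists (fun x => M (cfwd c x) *m g1 x); split=> [x v sx Vx|d hd].
    by rewrite /= (g1E x v sx (Vtau Vx)) mulmxA.
  have [oW cW] := V_chart hd (openI (open_tdom sigma) oV) (@subIsetr _ _ _).
  apply: Ckmx_on_mul => // [i j|i j].
    by apply: (CkC_on_comp oW openT _ cW (hM i j)).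
  apply: CkC_on_sub (g1C d hd i j) => z [dz [sz Vz]]; split=> //; split=> //; exact: Vtau.
exists (fun x => g2 x *m invmx (M (cfwd c x))); split=> [x v Vx sx|d hd].
  by rewrite /= -mulmxA mulKmx ?(uM Vx.2)// (g2E x v (Vtau Vx) sx).
have [oW cW] := V_chart hd (openI oV (open_tdom sigma)) (@subIsetl _ _ _).
apply: Ckmx_on_mul => // [i j|].
  apply: CkC_on_sub (g2C d hd i j) => z [dz [Vz sz]]; split=> //; split=> //; exact: Vtau.
have hinv : Ckmx_on k [set w : C | cabs w < r] (fun z => invmx (M z)).
  by apply: Ckmx_on_inv => // i j; apply: CkC_on_sub (hM i j).
move=> i j; apply: (CkC_on_comp oW oB _ cW (hinv i j)).
by move=> z [dz [[_ h] _]].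
Qed.

Lemma gauged_holomorphic_in (eta : section E) :
  (forall i z, cabs z < r -> exists l, cderiv (fun w => (M w *m local_rep c tau eta w) i 0) z l) ->
  holomorphic_in gauged_triv eta.
Proof.
move=> hol d hd i; apply/holomorphic_onP => z [dz Vz].
have [l hl] := hol i _ Vz.2.
have [m hm] := hol_coord_trans (surf_atlas_hol_coord hd) hc dz Vz.1.
exists (l * m); have := cderiv_comp hm hl; apply: cderiv_near.
have oU := open_chart_pre (c := d) oV.
apply: filterS (open_near oU (conj dz Vz)) => w [dw [cw _]].
rewrite /local_rep /=; congr ((_ *m _) i 0).
exact: (congr1 (fun x => tmap tau x (eta x)) (cfwdK cw)).
Qed.

End assemble.

Section adapted.
Variables (c : chart R X) (tau : local_triv n E).
Hypotheses (hc : hol_coord c) (ht : triv_atlas tau).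

Let dom : set X := cdom c `&` tdom tau.

(** D acts on global C^1 sections, so a constant vector must be cut off and extended by 0. The
    surface being Hausdorff, the image K of the closed disk is closed, and the extension vanishes on
    the open complement of K. *)
Lemma local_section (w0 : C) (r1 r2 : R) (e : 'cV[C]_n) : bundle_class (Some 1%N) E ->
  0 <= r1 -> r1 < r2 -> (forall w, cabs (w - w0) <= r2 -> ccod c w /\ tdom tau (cbwd c w)) ->
  exists s : section E, section_class (Some 1%N) s /\
    forall w, cabs (w - w0) <= r1 -> tmap tau (cbwd c w) (s (cbwd c w)) = e.
Proof.
move=> hE r10 r12 sub; have [chi [hchi chi1 chi0 _]] := bump_exists w0 r10 r12.
have H x : exists v : E x, (dom x -> tmap tau x v = (chi (cfwd c x))%:C *: e) /\ (~ dom x -> v = 0).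
  have [dx|dx] := pselect (dom x); last by exists 0; split.
  have [h _ hK] := tmap_bij dx.2.
  by exists (h ((chi (cfwd c x))%:C *: e)); split=> // _; rewrite hK.
pose s x := projT1 (cid (H x)).
have sE x : dom x -> tmap tau x (s x) = (chi (cfwd c x))%:C *: e by move=> dx; exact: (projT2 (cid (H x))).1.
have s0 x : ~ dom x -> s x = 0 by move=> dx; exact: (projT2 (cid (H x))).2.
pose K : set X := (fun w => cbwd c (w0 + w)) @` [set w : C | cabs w <= r2].
have Kdom x : K x -> dom x.
  move=> [w /= wr <-]; have [|cw tw] := sub (w0 + w); first by rewrite addrC addKr.
  by split=> //; exact: cbwd_dom.
have cK : closed K.
  apply: compact_closed; first exact: surf_hausdorff.
  apply: continuous_compact; last exact: compact_cball.
  apply: continuous_in_subspaceT => w; rewrite inE /= => wr.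
  have [|cw _] := sub (w0 + w); first by rewrite addrC addKr.
  apply: (@continuous_comp _ _ _ (fun w => w0 + w) (cbwd c) w); last exact: cbwd_continuous.
  have -> : (fun w => w0 + w) = (fun w => w0 + 1 * w) by apply/funext => v; rewrite mul1r.
  exact: cderiv_continuous (cderiv_affine w0 1 w).
have sK x : ~ K x -> s x = 0.
  move=> nK; have [dx|/s0//] := pselect (dom x).
  apply: (bij_inj (tmap_bij dx.2)); rewrite linear0 sE// chi0 ?scale0r//.
  rewrite leNgt; apply/negP => lt2; apply: nK; exists (cfwd c x - w0); first exact: ltW.
  by rewrite subrKC cfwdK//; case: dx.
exists s; split; last first.
  move=> w wr; have [|cw tw] := sub w; first exact: le_trans wr (ltW r12).
  by rewrite sE ?cbwdK// ?chi1// ?scale1r//; split=> //; exact: cbwd_dom.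
move=> sigma hs d hd i j; apply: CkC_on_local => z [dz sz].
have [dx|dx] := pselect (dom (cbwd d z)).
  have [g [gE gC]] := hE tau sigma ht hs.
  have oD : open (dom `&` tdom sigma) by apply: openI; [apply: openI; [exact: open_cdom|exact: open_tdom]|exact: open_tdom].
  have oU := open_chart_pre (c := d) oD; exists (ccod d `&` cbwd d @^-1` (dom `&` tdom sigma)); split=> //.
  have ch : CkC_on None (ccod d `&` cbwd d @^-1` (dom `&` tdom sigma)) (cfwd c \o cbwd d).
    by apply: CkC_on_sub (hol_coord_trans_CkC_on (surf_atlas_hol_coord hd) hc) => w [? [[? ?] ?]].
  have cchi : CkC_on (Some 1%N) setT (fun w => (chi w)%:C : C).
    by split; [exact: hchi|apply: Cn_on_cst; exact: openT].
  have h1 : Ckmx_on (Some 1%N) (ccod d `&` cbwd d @^-1` (dom `&` tdom sigma))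
      (fun w => g (cbwd d w) *m ((chi (cfwd c (cbwd d w)))%:C *: e)).
    apply: Ckmx_on_mul => // [a b|a b].
      by apply: CkC_on_sub (gC d hd a b) => w [? [[? ?] ?]].
    have h2 := CkC_on_comp oU openT (fun _ _ => I) ch cchi.
    have h3 := CkC_onM oU h2 (CkC_on_cst (Some 1%N) (e a b) oU).
    by apply: CkC_on_eq h3 => // w _; rewrite mxE.
  apply: CkC_on_eq (h1 i j) => // w [dw [wdom ws]] /=.
  by rewrite (gE _ _ wdom.2 ws) sE.
have oK : open (~` K) by exact: closed_openC.
have oU := open_chart_pre (c := d) oK.
exists (ccod d `&` cbwd d @^-1` (~` K)); split=> //; first by split=> //= /Kdom.
apply: CkC_on_eq (CkC_on_cst (Some 1%N) 0 oU) => // w [dw /sK /= ->].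
by rewrite linear0 mxE.
Qed.

Lemma section_classZD k (a : C) (s t : section E) : section_class k s -> section_class k t ->
  section_class k (fun x => a *: s x + t x).
Proof.
move=> hs htt sigma hsig d hd i j.
have oU := open_chart_pre (c := d) (open_tdom sigma).
apply: (CkC_on_eq (u := fun w => a * (tmap sigma (cbwd d w) (s (cbwd d w))) i j + (tmap sigma (cbwd d w) (t (cbwd d w))) i j)) => //.
  by move=> w _ /=; rewrite linearP !mxE.
by apply: CkC_onD => //; [apply: CkC_onM => //; [exact: CkC_on_cst|exact: hs]|exact: htt].
Qed.

Lemma dbarv_near_cst (f : C -> 'cV[C]_n) z e : (\forall w \near z, f w = e) -> dbarv f z = 0.
Proof.
move=> h; apply/colP => k; rewrite !mxE dbarE.
have h1 : \forall w \near z, complex.Re (f w k 0) = complex.Re (e k 0) by apply: filterS h => w ->.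
have h2 : \forall w \near z, complex.Im (f w k 0) = complex.Im (e k 0) by apply: filterS h => w ->.
by rewrite !(pd_near0 _ h1) !(pd_near0 _ h2) subrr addr0.
Qed.

(* Apply D to sections that are constant near a given point. *)
Lemma complex_linear_endo (D : operator E) A : bundle_class (Some 1%N) E -> disk_coord c tau ->
  complex_linear_op D -> local_form D c tau A -> smooth_endo A ->
  forall w l k, cabs w < 1 -> A w (ecol R l false) k 0 = 'i * A w (ecol R l true) k 0.
Proof.
move=> hE [_ _ dc dt] hD hA [U [oU dU sA]] w0 l k w01; pose e := ecol R l true.
have e'E : ecol R l false = 'i *: e by rewrite /e /ecol scalerA mulr1.
pose r2 := (1 - cabs w0) / 2; pose r1 := r2 / 2.
have r20 : 0 < r2 by rewrite divr_gt0// subr_gt0.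
have r10 : 0 < r1 by rewrite divr_gt0.
have in_disk w : cabs (w - w0) <= r2 -> disk w.
  by move=> wr; apply/disk_cabs; have := cabsD (w - w0) w0; rewrite subrK; move: wr; rewrite /r2; lra.
have r12 : r1 < r2 by rewrite /r1; lra.
have [s [sC sE]] := @local_section w0 r1 r2 e hE (ltW r10) r12
  (fun w wr => conj (dc _ (in_disk w wr)) (dt _ (in_disk w wr))).
(* Linearity is stated for a s + t. Taking t = s and a = i - 1 turns this into i s, without a zero
   section. *)
pose a : C := 'i - 1.
pose s' : section E := fun x => a *: s x + s x.
have s'C : section_class (Some 1%N) s' by exact: section_classZD.
have h1 := hD a s s sC sC c hc.
have h2 := hA s sC; have h3 := hA s' s'C.
have near_e w : cabs (w - w0) < r1 -> \forall v \near w, local_rep c tau s v = e.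
  by move=> wr; apply: filterS (near_in wr) => v vr; apply: sE; exact: ltW.
have rep' v : local_rep c tau s' v = a *: local_rep c tau s v + local_rep c tau s v.
  by rewrite /local_rep /s' linearP.
have near_e' w : cabs (w - w0) < r1 -> \forall v \near w, local_rep c tau s' v = 'i *: e.
  move=> /near_e; apply: filterS => v ve; rewrite rep' ve /a scalerBl scale1r subrK//.
pose Q w := cabs (w - w0) < r1 -> A w (ecol R l false) k 0 = 'i * A w e k 0.
have aeQ : {ae @lebesgue2 R, forall q, Q (toC q)}.
  have F : Filter (almost_everywhere (@lebesgue2 R)) := ae_filter_ringOfSetsType (@lebesgue2 R).
  apply: filterS3 h1 h2 h3 => q; move: (toC q) => w H1 H2 H3 wr.
  have wd : disk w by apply: in_disk; apply: ltW; exact: lt_trans wr r12.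
  have cw := dc w wd.
  have [v vc] := @tangent_exists R X c (cbwd c w) (conj hc (cbwd_dom cw)).
  have := H1 cw v => /(congr1 (tmap tau (cbwd c w))); rewrite linearP.
  have := H2 wd v; have := H3 wd v; rewrite vc conjC1 !scale1r => -> ->.
  rewrite (dbarv_near_cst (near_e w wr)) (dbarv_near_cst (near_e' w wr)) !add0r.
  rewrite (nbhs_singleton (near_e w wr)) (nbhs_singleton (near_e' w wr)) -e'E => ->.
  by rewrite !mxE /a -/e; ring.
(* The identity holds almost everywhere near w0, hence at points arbitrarily close to w0; as A is
   smooth, G is continuous and vanishes at w0. *)
pose G w := A w (ecol R l false) k 0 - 'i * A w e k 0.
have Uw0 : U w0 by apply: dU; apply/disk_cabs; exact: ltW.
have cG : {for w0, continuous G}.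
  apply: ctsCB; first exact: CkC_on_cts (sA _ k 0) Uw0.
  by apply: ctsCM; [exact: ctsC_cst|exact: CkC_on_cts (sA _ k 0) Uw0].
apply/eqP; rewrite -subr_eq0 -/(G w0) -cabs_eq0 eq_le cabs_ge0 andbT leNgt; apply/negP => G0.
have /cvgC_cabsP/(_ _ G0)/nbhs_cabsP[d d0 hd] := cG.
have m0 : 0 < Num.min d r1 by rewrite lt_min d0.
have [w] := ae_dense w0 aeQ m0; rewrite lt_min => /andP[wd wr] /(_ wr) Gw.
by have := hd w wd; rewrite /G Gw subrr sub0r cabsN ltxx.
Qed.

End adapted.
End trivializations.

(** * From the gauge to a trivialization of the bundle *)

Section similarity.
Variables (R : realType) (X : riemann_surface R) (n : nat) (E : vbundle X n).
Local Notation C := R[i].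

Lemma adapted_coord (eta : section E) (z0 : X) : section_class (Some 0%N) eta -> eta z0 = 0 ->
  exists (c : chart R X) (tau : local_triv n E) (O : set C),
    [/\ disk_coord c tau, cdom c z0 /\ cfwd c z0 = 0, open O /\ @disk R `<=` O,
      forall k w, O w -> {for w, continuous (fun w => local_rep c tau eta w k 0)} &
      forall k w, disk w -> cabs (local_rep c tau eta w k 0) <= 1].
Proof.
move=> heta hz0; have [tau ht tz] := triv_cover E z0; have [c0 hc0 cz] := surf_cover z0.
pose a := cfwd c0 z0; pose W := ccod c0 `&` cbwd c0 @^-1` tdom tau.
have oW : open W by apply: open_chart_pre; exact: open_tdom.
have Wa : W a by split; [exact: cfwd_cod|rewrite /= cfwdK].
have cf k w : W w -> {for w, continuous (fun w => local_rep c0 tau eta w k 0)}.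
  by move=> Ww; exact: CkC_on_cts (heta tau ht c0 hc0 k 0) Ww.
have fa : local_rep c0 tau eta a = 0.
  rewrite /local_rep (congr1 (fun x => tmap tau x (eta x)) (cfwdK cz)) hz0; exact: linear0.
(* d1 keeps the disk inside the domain; d2 uses that eta vanishes at z0 and is continuous, so that
   its components stay at most 1. *)
have /openP_cabs/(_ a Wa)[d1 d10 hd1] := oW.
have [d2 d20 hd2] : exists2 d : R, 0 < d & forall k w, cabs (w - a) < d -> cabs (local_rep c0 tau eta w k 0) <= 1.
  apply: (@fin_radius R _ (fun k d => forall w, cabs (w - a) < d -> cabs (local_rep c0 tau eta w k 0) <= 1)).
    move=> k; have /cvgC_cabsP/(_ _ ltr01)/nbhs_cabsP[d d0 hd] := cf k a Wa.
    by exists d => // w /hd; rewrite fa mxE subr0 => /ltW.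
  by move=> k d d' dd H w wd; apply: H; exact: lt_le_trans dd.
(* Halved, because the closed unit disk has to land in an open disk. *)
pose r := Num.min d1 d2 / 2; have m0 : 0 < Num.min d1 d2 by rewrite lt_min d10.
have r0 : 0 < r by rewrite divr_gt0.
have rm : r < Num.min d1 d2 by rewrite /r; lra.
have aff w : disk w -> cabs (a + r%:C * w - a) < d1 /\ cabs (a + r%:C * w - a) < d2.
  move=> /disk_cabs w1; have h : cabs (a + r%:C * w - a) < Num.min d1 d2.
    rewrite addrC addKr cabsM cabs_real gtr0_norm//; apply: le_lt_trans rm.
    by rewrite ler_piMr// ltW.
  by move: h; rewrite lt_min => /andP.
pose c := rescale_chart c0 a r0.
exists c, tau, (ccod c `&` cbwd c @^-1` tdom tau).
have dW w : disk w -> W (a + r%:C * w) by move=> /aff[h _]; exact: hd1.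
split.
- split=> //; first exact: rescale_hol_coord.
    by move=> w /dW[].
  by move=> w /dW[].
- by split=> //=; rewrite -/a subrr mulr0.
- split; first by apply: open_chart_pre; exact: open_tdom.
  by move=> w /dW[].
- move=> k w Ow; apply: (@continuous_comp _ _ _ (fun w => a + r%:C * w) (fun w => local_rep c0 tau eta w k 0) w).
    exact: cderiv_continuous (cderiv_affine a r%:C w).
  exact: cf.
- by move=> k w /aff[_]; exact: hd2.
Qed.

(** The class k is left open, so that the continuous and the smooth half share the construction. *)
Lemma gauge_trivialization (k : option nat) (c : chart R X) (tau : local_triv n E) (eta : section E)
    (z0 : X) (r : R) (Psi : 'I_n -> 'I_n -> C -> C) :
  disk_coord c tau -> cdom c z0 -> cfwd c z0 = 0 ->
  (forall sigma, triv_atlas sigma -> transition_class k tau sigma /\ transition_class k sigma tau) ->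
  0 < r -> r < 2^-1 -> (forall i j, CkC_on k setT (Psi i j)) ->
  (forall z, cabs z < r -> (\matrix_(i, j) Psi i j z) \in unitmx) ->
  (forall i z, cabs z < r ->
     exists l, cderiv (fun w => \sum_j Psi i j w * local_rep c tau eta w j 0) z l) ->
  exists Phi : local_triv n E,
    [/\ tdom Phi z0, triv_class k Phi & holomorphic_in Phi eta].
Proof.
move=> [hc ht dc dt] cz z00 trans r0 r2 hPsi uPsi hol.
pose M z : 'M[C]_n := \matrix_(i, j) Psi i j z.
have sub z : cabs z < r -> ccod c z /\ tdom tau (cbwd c z).
  by move=> zr; have zd : disk z by [apply/disk_cabs; lra]; split; [exact: dc|exact: dt].
have hM : Ckmx_on k setT M by move=> i j; under eq_fun do rewrite mxE; exact: hPsi.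
exists (gauged_triv (M := M) sub uPsi); split.
- by split=> //; rewrite z00 cabs0.
- exact: gauged_triv_class.
- apply: gauged_holomorphic_in => // i z zr; have [l hl] := hol i z zr.
  exists l; apply: cderiv_near hl; near=> w; rewrite mxE.
  by apply: eq_bigr => j _; rewrite mxE.
Unshelve. all: by end_near.
Qed.

End similarity.

Local Close Scope complex_scope.
Theorem theoremB20 (R : realType) (X : riemann_surface R) (n : nat)
    (E : vbundle X n) (hE : bundle_class (Some 1%N) E)
    (p : \bar R) (hp : (2%:E < p)%E)
    (D : operator E) (hD : CR_operator p D)
    (eta : section E) (heta : section_class (Some 0%N) eta)
    (hweak : weak_solution p D eta)
    (z0 : X) (hz0 : eta z0 = 0) :
  (exists Phi : local_triv n E,
     [/\ tdom Phi z0, triv_class (Some 0%N) Phi & holomorphic_in Phi eta]) /\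
  (smooth_CR_operator D -> complex_linear_op D ->
   exists Phi : local_triv n E,
     [/\ tdom Phi z0, triv_class None Phi & holomorphic_in Phi eta]).
Proof.
have [c [tau [U [hct [cz z00] [oO dO] cf f1]]]] := adapted_coord heta hz0.
have [hc ht dc dt] := hct.
split.
  have [A [rA lA fA]] := hD.2 c tau hct.
  have weak k phi hphi := hweak c tau A hct rA lA fA phi hphi k.
  have [r [Psi [r0 r2 cPsi uPsi hol]]] := continuous_gauge hp rA lA oO dO cf f1 weak.
  apply: (gauge_trivialization hct cz z00 _ r0 r2 _ uPsi hol) => [sigma hs|i j].
    by split; exact: triv_compat.
  by apply: CkC_on_cts0 => z _; exact: cPsi.
move=> [bE hA] cD; have [A [rA sA fA]] := hA c tau hct.
(* [weak_solution] speaks about coefficients of class L^p; the smooth coefficient is one of them. *)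
have lA := smooth_endo_Lp hp sA.
have weak k phi hphi := hweak c tau A hct rA lA fA phi hphi k.
have cA := complex_linear_endo hc ht hE hct cD fA sA.
have [r [Psi [r0 r2 cPsi uPsi hol]]] := smooth_gauge hp rA sA cA oO dO cf f1 weak.
apply: (gauge_trivialization hct cz z00 _ r0 r2 cPsi uPsi hol) => sigma hs.
by split; exact: bE.
Qed.
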